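(* Let $\mathbf k$ be a field of characteristic $0$. For every $n\ge 0$ there is an equivalence of ($\mathbf k$-linear) categories $$\mathfrak{SB}_n\;\simeq\;\mathcal Q_n\rtimes\mathfrak S_n ,$$ where $\mathfrak{SB}_n$ is the degree $n$ block of the PROB $\mathfrak{SB}$ of set bialgebras, $\mathcal Q_n$ is the double incidence category of $GL_n$ and $\mathfrak S_n$ is the symmetric group.
   Context: ''Braided category'' means $\mathbf k$-linear braided monoidal category; braiding $R_{V,W}:V\otimes W\to W\otimes V$, unit $\mathbf 1$. **Set bialgebras.** A set bialgebra $U$ in a braided category $\mathcal V$ consists of a functor $I\mapsto U_I$ from the groupoid of finite sets and bijections to $\mathcal V$ with $U_\emptyset=\mathbf 1$, and morphisms $\mu_{I,J}:U_I\otimes U_J\to U_{I\sqcup J}$, $\Delta_{I,J}:U_{I\sqcup J}\to U_I\otimes U_J$ natural in bijections of $I,J$, such that: (SB0) $\mu$ is associative and $\Delta$ coassociative; (SB1-2) $\mu_{I,\emptyset},\mu_{\emptyset,I},\Delta_{I,\emptyset},\Delta_{\emptyset,I}$ are the unit isomorphisms or their inverses; (SB3) if $I=J_1\sqcup J_2=L_1\sqcup L_2$ and $K_{ij}=J_i\cap L_j$, then $\Delta_{L_1,L_2}\circ\mu_{J_1,J_2}=(\mu_{K_{11},K_{21}}\otimes\mu_{K_{12},K_{22}})\circ(\mathrm{Id}\otimes R_{U_{K_{12}},U_{K_{21}}}\otimes\mathrm{Id})\circ(\Delta_{K_{11},K_{12}}\otimes\Delta_{K_{21},K_{22}})$. **The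 PROB $\mathfrak{SB}$.** It is the braided category generated by a universal set bialgebra $\mathbf u$: generated, as a braided category, by formal objects $\mathbf u_I$ ($I$ a finite set, $\mathbf u_\emptyset=\mathbf 1$) and morphisms $\gamma_\sigma:\mathbf u_I\to\mathbf u_J$ (for bijections $\sigma:I\to J$), $\mu_{I,J}$, $\Delta_{I,J}$, subject only to functoriality of $\gamma$, naturality of $\mu,\Delta$ and (SB0)–(SB3). It is characterized up to braided equivalence by the natural equivalence between set bialgebras in $\mathcal V$ and $\mathbf k$-linear braided monoidal functors $\mathfrak{SB}\to\mathcal V$. Its objects are $\mathbf u_{I_1}\otimes\cdots\otimes\mathbf u_{I_k}$; $\mathfrak{SB}_n$ is the full subcategory on those with $\sum|I_\nu|=n$, and $\mathfrak{SB}=\coprod_n\mathfrak{SB}_n$ (zero Homs between different blocks). **$\mathcal Q_n$.** An ordered set partition of $\{1,\dots,n\}$ is a sequence $\mathbf I=(I_1,\dots,I_k)$ of nonempty disjoint subsets with union $\{1,\dots,n\}$. It labels the parabolic subalgebra $\mathfrak p_{\mathbf I}\subset\mathfrak{gl}_n$ stabilizing the flag of coordinate subspaces $V_\nu=\bigoplus_{i\in I_1\sqcup\dots\sqcup I_\nu}\mathbb C e_i$; all parabolic subalgebras containing the diagonal matrices arise so. Its cell is $C_{\mathbf I}\subset\mathbb R^n$, the set of $t$ with $t_i=t_j$ if $i,j$ are in the same part and $t_i<t_j$ if the part of $i$ precedes the part of $j$. One has $\mathfrak p_{\mathbf I}\subset\mathfrak p_{\mathbf I'}$ iff $C_{\mathbf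 I'}\subset\overline{C_{\mathbf I}}$ iff $\mathbf I$ refines $\mathbf I'$ (each part of $\mathbf I'$ is split into consecutive parts of $\mathbf I$). $(\mathbf I,\mathbf I',\mathbf I'')$ is collinear if there are $a\in C_{\mathbf I},b\in C_{\mathbf I'},c\in C_{\mathbf I''}$ with $b\in[a,c]$. $\mathcal Q_n$ is the $\mathbf k$-linear category with objects the $\mathfrak p_{\mathbf I}$ and generating morphisms $\mathrm{Ind}_{\mathfrak p}^{\mathfrak p'}:\mathfrak p\to\mathfrak p'$, $\mathrm{Res}_{\mathfrak p'}^{\mathfrak p}:\mathfrak p'\to\mathfrak p$ for $\mathfrak p\subset\mathfrak p'$, with relations: (2a) $\mathrm{Ind}_{\mathfrak p}^{\mathfrak p}=\mathrm{Res}_{\mathfrak p}^{\mathfrak p}=\mathrm{Id}$; (2b) for $\mathfrak p\subset\mathfrak p'\subset\mathfrak p''$, $\mathrm{Ind}_{\mathfrak p'}^{\mathfrak p''}\mathrm{Ind}_{\mathfrak p}^{\mathfrak p'}=\mathrm{Ind}_{\mathfrak p}^{\mathfrak p''}$, $\mathrm{Res}_{\mathfrak p'}^{\mathfrak p}\mathrm{Res}_{\mathfrak p''}^{\mathfrak p'}=\mathrm{Res}_{\mathfrak p''}^{\mathfrak p}$; (2c) $\mathrm{Res}_{\mathfrak p'}^{\mathfrak p}\mathrm{Ind}_{\mathfrak p}^{\mathfrak p'}=\mathrm{Id}$; and, with $\tau_{\mathfrak p}^{\mathfrak p'}:=\mathrm{Res}_{\mathfrak{gl}_n}^{\mathfrak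 p'}\mathrm{Ind}_{\mathfrak p}^{\mathfrak{gl}_n}$, (2d) $\tau_{\mathfrak p}^{\mathfrak p''}=\tau_{\mathfrak p'}^{\mathfrak p''}\tau_{\mathfrak p}^{\mathfrak p'}$ for collinear triples; (2e) $\tau_{\mathfrak p'}^{\mathfrak p''}$ is invertible whenever the cells of $\mathfrak p',\mathfrak p''$ have the same linear span and lie in it on opposite sides of a common codimension $1$ face (i.e. the ordered set partitions differ by exchanging two adjacent parts). **Semidirect product.** $\mathfrak S_n$ acts strictly on $\mathcal Q_n$ by permuting $\{1,\dots,n\}$. $\mathcal Q_n\rtimes\mathfrak S_n$ has the same objects as $\mathcal Q_n$; $\mathrm{Hom}(V,V')=\bigoplus_{g\in\mathfrak S_n}\mathrm{Hom}_{\mathcal Q_n}(gV,V')$, the element $\xi$ of the $g$-th summand being written $(\xi,g)$, with composition $(\xi,g)\circ(\zeta,h)=(\xi\circ g(\zeta),gh)$. *)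

(* Defs.v *)
From Stdlib Require Import Setoid Morphisms.
From HB Require Import structures.
From mathcomp Require Import all_boot all_order all_algebra all_fingroup.
From mathcomp Require Import reals complex.

Set Implicit Arguments.
Unset Strict Implicit.
Unset Printing Implicit Defensive.

Import GRing.Theory Num.Theory.
Local Open Scope ring_scope.

(* Hom-modules are setoids: [heq] plays the role of equality of morphisms.
   Categories presented by generators and relations then have formal
   expressions as morphisms and the generated congruence as [heq].  (The
   objects below range over all finite types, so that a quotient with an
   [lmodType] structure would not fit in the universe of [choiceType].) *)
Record linCat (k : fieldType) := LinCat {
  ob :> Type;
  hom : ob -> ob -> Type;
  heq : forall a b, hom a b -> hom a b -> Prop;
  idm : forall a, hom a a;
  comp : forall a b c, hom b c -> hom a b -> hom a c;
  hzero : forall a b, hom a b;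
  hadd : forall a b, hom a b -> hom a b -> hom a b;
  hscale : forall a b, k -> hom a b -> hom a b;
  heq_refl : forall a b (f : hom a b), heq f f;
  heq_sym : forall a b (f g : hom a b), heq f g -> heq g f;
  heq_trans : forall a b (f g h : hom a b), heq f g -> heq g h -> heq f h;
  comp_heq : forall a b c (f f' : hom b c) (g g' : hom a b),
    heq f f' -> heq g g' -> heq (comp f g) (comp f' g');
  hadd_heq : forall a b (f f' g g' : hom a b),
    heq f f' -> heq g g' -> heq (hadd f g) (hadd f' g');
  hscale_heq : forall a b x (f f' : hom a b),
    heq f f' -> heq (hscale x f) (hscale x f');
  compA : forall a b c d (f : hom c d) (g : hom b c) (h : hom a b),
    heq (comp f (comp g h)) (comp (comp f g) h);
  comp1m : forall a b (f : hom a b), heq (comp (idm b) f) f;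
  compm1 : forall a b (f : hom a b), heq (comp f (idm a)) f;
  haddA : forall a b (f g h : hom a b),
    heq (hadd f (hadd g h)) (hadd (hadd f g) h);
  haddC : forall a b (f g : hom a b), heq (hadd f g) (hadd g f);
  hadd0 : forall a b (f : hom a b), heq (hadd (hzero a b) f) f;
  haddN : forall a b (f : hom a b), heq (hadd (hscale (-1) f) f) (hzero a b);
  hscaleA : forall a b x y (f : hom a b),
    heq (hscale x (hscale y f)) (hscale (x * y) f);
  hscale1 : forall a b (f : hom a b), heq (hscale 1 f) f;
  hscaleDr : forall a b x (f g : hom a b),
    heq (hscale x (hadd f g)) (hadd (hscale x f) (hscale x g));
  hscaleDl : forall a b x y (f : hom a b),
    heq (hscale (x + y) f) (hadd (hscale x f) (hscale y f));
  compDl : forall a b c (f f' : hom b c) (g : hom a b),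
    heq (comp (hadd f f') g) (hadd (comp f g) (comp f' g));
  compDr : forall a b c (f : hom b c) (g g' : hom a b),
    heq (comp f (hadd g g')) (hadd (comp f g) (comp f g'));
  compZl : forall a b c x (f : hom b c) (g : hom a b),
    heq (comp (hscale x f) g) (hscale x (comp f g));
  compZr : forall a b c x (f : hom b c) (g : hom a b),
    heq (comp f (hscale x g)) (hscale x (comp f g))
}.

Arguments hom {k} _ _ _.
Arguments heq {k _ a b} _ _.
Arguments idm {k _} a.
Arguments comp {k _ a b c} _ _.
Arguments hzero {k _} a b.
Arguments hadd {k _ a b} _ _.
Arguments hscale {k _ a b} _ _.

Declare Scope lincat_scope.
Delimit Scope lincat_scope with LC.
Notation "f =~ g" := (heq f g) (at level 70, no associativity) : lincat_scope.
Notation "f \c g" := (comp f g)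
  (at level 40, left associativity) : lincat_scope.
Local Open Scope lincat_scope.

Record linFunctor (k : fieldType) (C D : linCat k) := LinFunctor {
  fob :> C -> D;
  fmap : forall a b, hom C a b -> hom D (fob a) (fob b);
  fmap_heq : forall a b (f g : hom C a b), f =~ g -> fmap f =~ fmap g;
  fmap1 : forall a, fmap (idm a) =~ idm (fob a);
  fmapM : forall a b c (f : hom C b c) (g : hom C a b),
    fmap (f \c g) =~ fmap f \c fmap g;
  fmapD : forall a b (f g : hom C a b),
    fmap (hadd f g) =~ hadd (fmap f) (fmap g);
  fmapZ : forall a b x (f : hom C a b), fmap (hscale x f) =~ hscale x (fmap f)
}.

Section FunctorOps.
Variable k : fieldType.

Definition idFunctor (C : linCat k) : linFunctor C C.
Proof.
apply: (@LinFunctor k C C (fun a => a) (fun a b f => f)) => *;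
  by [ | apply: heq_refl].
Defined.

Definition compFunctor (C D E : linCat k)
  (G : linFunctor D E) (F : linFunctor C D) : linFunctor C E.
Proof.
apply: (@LinFunctor k C E (fun a => G (F a)) (fun a b f => fmap G (fmap F f))).
- by move=> a b f g fg; do 2!apply: fmap_heq.
- by move=> a; apply: heq_trans (fmap_heq G (fmap1 F a)) (fmap1 G _).
- move=> a b c f g.
  by apply: heq_trans (fmap_heq G (fmapM F f g)) (fmapM G _ _).
- by move=> a b f g; apply: heq_trans (fmap_heq G (fmapD F f g)) (fmapD G _ _).
- by move=> a b x f; apply: heq_trans (fmap_heq G (fmapZ F x f)) (fmapZ G _ _).
Defined.

End FunctorOps.

Record natIso (k : fieldType) (C D : linCat k) (F G : linFunctor C D) := NatIso {
  nt : forall a, hom D (F a) (G a);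
  ntV : forall a, hom D (G a) (F a);
  ntK : forall a, ntV a \c nt a =~ idm (F a);
  ntVK : forall a, nt a \c ntV a =~ idm (G a);
  nt_natural : forall a b (f : hom C a b), nt b \c fmap F f =~ fmap G f \c nt a
}.

Definition lin_equivalent (k : fieldType) (C D : linCat k) : Prop :=
  exists (F : linFunctor C D) (G : linFunctor D C),
    inhabited (natIso (compFunctor G F) (idFunctor C)) /\
    inhabited (natIso (compFunctor F G) (idFunctor D)).

Definition fullSub (k : fieldType) (C : linCat k) (P : C -> Prop) : linCat k.
Proof.
apply: (@LinCat k {a : C | P a} (fun a b => hom C (sval a) (sval b))
  (fun a b => @heq k C _ _) (fun a => idm (sval a))
  (fun a b c => @comp k C _ _ _) (fun a b => hzero _ _)
  (fun a b => @hadd k C _ _) (fun a b => @hscale k C _ _)) => *.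
- exact: heq_refl.
- exact: heq_sym.
- apply: heq_trans; eassumption.
- exact: comp_heq.
- exact: hadd_heq.
- exact: hscale_heq.
- exact: compA.
- exact: comp1m.
- exact: compm1.
- exact: haddA.
- exact: haddC.
- exact: hadd0.
- exact: haddN.
- exact: hscaleA.
- exact: hscale1.
- exact: hscaleDr.
- exact: hscaleDl.
- exact: compDl.
- exact: compDr.
- exact: compZl.
- exact: compZr.
Defined.

Definition eqhom (k : fieldType) (C : linCat k) (a b : C) (e : a = b) :
    hom C a b :=
  match e in _ = b' return hom C a b' with erefl => idm a end.

(* [U_{I \sqcup J}] is indexed by the sum type [I + J]; identities between
   iterated disjoint unions become the evident bijections below. *)
Section SumBijections.

Definition sum_map (I I' J J' : Type) (s : I -> I') (t : J -> J')
    (x : I + J) : I' + J' :=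
  match x with inl i => inl (s i) | inr j => inr (t j) end.

Lemma sum_map_bij (I I' J J' : Type) (s : I -> I') (t : J -> J') :
  bijective s -> bijective t -> bijective (sum_map s t).
Proof.
case=> s' sK s'K [t' tK t'K]; exists (sum_map s' t').
  by case=> x /=; rewrite ?sK ?tK.
by case=> x /=; rewrite ?s'K ?t'K.
Qed.

Definition sum_assoc (I J K : Type) (x : (I + J) + K) : I + (J + K) :=
  match x with
  | inl (inl i) => inl i | inl (inr j) => inr (inl j) | inr l => inr (inr l)
  end.

Lemma sum_assoc_bij (I J K : Type) : bijective (@sum_assoc I J K).
Proof.
exists (fun x => match x with
  | inl i => inl (inl i) | inr (inl j) => inl (inr j) | inr (inr l) => inr l
  end).
  by case=> [[]|].
by case=> [|[]].
Qed.

Definition sum_void_r (I : Type) (x : I + void) : I :=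
  match x with inl i => i | inr v => of_void I v end.

Lemma sum_void_r_bij (I : Type) : bijective (@sum_void_r I).
Proof. by exists inl => // -[|[]]. Qed.

Definition sum_void_l (I : Type) (x : void + I) : I :=
  match x with inl v => of_void I v | inr i => i end.

Lemma sum_void_l_bij (I : Type) : bijective (@sum_void_l I).
Proof. by exists inr => // -[[]|]. Qed.

Definition sum_mid (K11 K12 K21 K22 : Type) (x : (K11 + K12) + (K21 + K22)) :
    (K11 + K21) + (K12 + K22) :=
  match x with
  | inl (inl y) => inl (inl y) | inl (inr y) => inr (inl y)
  | inr (inl y) => inl (inr y) | inr (inr y) => inr (inr y)
  end.

Lemma sum_mid_bij (K11 K12 K21 K22 : Type) :
  bijective (@sum_mid K11 K12 K21 K22).
Proof. by exists (@sum_mid K11 K21 K12 K22) => -[] []. Qed.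

End SumBijections.

(* The unit object is by definition [u_\emptyset].  Strictness of the tensor
   product is not imposed: objects are parenthesized tensor products. *)
Inductive sbOb : Type :=
  | sbU (I : finType)
  | sbTens (a b : sbOb).

Definition sb1 : sbOb := sbU void.

Notation "a \ox b" := (sbTens a b)
  (at level 40, left associativity) : lincat_scope.

Fixpoint sb_deg (a : sbOb) : nat :=
  match a with
  | sbU J => #|J|
  | sbTens a b => (sb_deg a + sb_deg b)%N
  end.

Section PROB.
Variable k : fieldType.

Inductive sbHom : sbOb -> sbOb -> Type :=
  | sb_id a : sbHom a a
  | sb_comp a b c : sbHom b c -> sbHom a b -> sbHom a c
  | sb_zero a b : sbHom a b
  | sb_add a b : sbHom a b -> sbHom a b -> sbHom a b
  | sb_scale a b : k -> sbHom a b -> sbHom a b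
  | sb_tens a a' b b' : sbHom a a' -> sbHom b b' -> sbHom (a \ox b) (a' \ox b')
  | sb_assoc a b c : sbHom ((a \ox b) \ox c) (a \ox (b \ox c))
  | sb_assocV a b c : sbHom (a \ox (b \ox c)) ((a \ox b) \ox c)
  | sb_lunit a : sbHom (sb1 \ox a) a
  | sb_lunitV a : sbHom a (sb1 \ox a)
  | sb_runit a : sbHom (a \ox sb1) a
  | sb_runitV a : sbHom a (a \ox sb1)
  | sb_braid a b : sbHom (a \ox b) (b \ox a)
  | sb_braidV a b : sbHom (b \ox a) (a \ox b)
  | sb_gamma (I J : finType) (s : I -> J) : bijective s ->
      sbHom (sbU I) (sbU J)
  | sb_mu (I J : finType) : sbHom (sbU I \ox sbU J) (sbU (I + J)%type)
  | sb_delta (I J : finType) : sbHom (sbU (I + J)%type) (sbU I \ox sbU J).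

Local Notation "f \c g" := (sb_comp f g) : lincat_scope.
Local Notation "f \ot g" := (sb_tens f g) (at level 35) : lincat_scope.
Local Notation id_ a := (sb_id a).

(* [Id \ox R_{b,c} \ox Id], up to associativity constraints. *)
Definition sb_braid_mid (a b c d : sbOb) :
    sbHom ((a \ox b) \ox (c \ox d)) ((a \ox c) \ox (b \ox d)) :=
  sb_assocV a c (b \ox d) \c
  (id_ a \ot (sb_assoc c b d \c (sb_braid b c \ot id_ d) \c sb_assocV b c d)) \c
  sb_assoc a b (c \ox d).

Reserved Notation "f =b g" (at level 70, no associativity).

Inductive sbEq : forall a b, sbHom a b -> sbHom a b -> Prop :=
  | sbe_refl a b (f : sbHom a b) : f =b f
  | sbe_sym a b (f g : sbHom a b) : f =b g -> g =b f
  | sbe_trans a b (f g h : sbHom a b) : f =b g -> g =b h -> f =b h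
  | sbe_comp a b c (f f' : sbHom b c) (g g' : sbHom a b) :
      f =b f' -> g =b g' -> f \c g =b f' \c g'
  | sbe_add a b (f f' g g' : sbHom a b) :
      f =b f' -> g =b g' -> sb_add f g =b sb_add f' g'
  | sbe_scale a b x (f f' : sbHom a b) :
      f =b f' -> sb_scale x f =b sb_scale x f'
  | sbe_tens a a' b b' (f f' : sbHom a a') (g g' : sbHom b b') :
      f =b f' -> g =b g' -> f \ot g =b f' \ot g'
  | sbe_compA a b c d (f : sbHom c d) (g : sbHom b c) (h : sbHom a b) :
      f \c (g \c h) =b f \c g \c h
  | sbe_comp1m a b (f : sbHom a b) : id_ b \c f =b f
  | sbe_compm1 a b (f : sbHom a b) : f \c id_ a =b f
  | sbe_addA a b (f g h : sbHom a b) :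
      sb_add f (sb_add g h) =b sb_add (sb_add f g) h
  | sbe_addC a b (f g : sbHom a b) : sb_add f g =b sb_add g f
  | sbe_add0 a b (f : sbHom a b) : sb_add (sb_zero a b) f =b f
  | sbe_addN a b (f : sbHom a b) : sb_add (sb_scale (-1) f) f =b sb_zero a b
  | sbe_scaleA a b x y (f : sbHom a b) :
      sb_scale x (sb_scale y f) =b sb_scale (x * y) f
  | sbe_scale1 a b (f : sbHom a b) : sb_scale 1 f =b f
  | sbe_scaleDr a b x (f g : sbHom a b) :
      sb_scale x (sb_add f g) =b sb_add (sb_scale x f) (sb_scale x g)
  | sbe_scaleDl a b x y (f : sbHom a b) :
      sb_scale (x + y) f =b sb_add (sb_scale x f) (sb_scale y f)
  | sbe_compDl a b c (f f' : sbHom b c) (g : sbHom a b) :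
      sb_add f f' \c g =b sb_add (f \c g) (f' \c g)
  | sbe_compDr a b c (f : sbHom b c) (g g' : sbHom a b) :
      f \c sb_add g g' =b sb_add (f \c g) (f \c g')
  | sbe_compZl a b c x (f : sbHom b c) (g : sbHom a b) :
      sb_scale x f \c g =b sb_scale x (f \c g)
  | sbe_compZr a b c x (f : sbHom b c) (g : sbHom a b) :
      f \c sb_scale x g =b sb_scale x (f \c g)
  | sbe_tens1 a b : id_ a \ot id_ b =b id_ (a \ox b)
  | sbe_tensM a a' a'' b b' b'' (f' : sbHom a' a'') (f : sbHom a a')
        (g' : sbHom b' b'') (g : sbHom b b') :
      (f' \c f) \ot (g' \c g) =b (f' \ot g') \c (f \ot g)
  | sbe_tensDl a a' b b' (f f' : sbHom a a') (g : sbHom b b') :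
      sb_add f f' \ot g =b sb_add (f \ot g) (f' \ot g)
  | sbe_tensDr a a' b b' (f : sbHom a a') (g g' : sbHom b b') :
      f \ot sb_add g g' =b sb_add (f \ot g) (f \ot g')
  | sbe_tensZl a a' b b' x (f : sbHom a a') (g : sbHom b b') :
      sb_scale x f \ot g =b sb_scale x (f \ot g)
  | sbe_tensZr a a' b b' x (f : sbHom a a') (g : sbHom b b') :
      f \ot sb_scale x g =b sb_scale x (f \ot g)
  | sbe_assocK a b c : sb_assocV a b c \c sb_assoc a b c =b id_ _
  | sbe_assocVK a b c : sb_assoc a b c \c sb_assocV a b c =b id_ _
  | sbe_assoc_nat a a' b b' c c'
        (f : sbHom a a') (g : sbHom b b') (h : sbHom c c') :
      sb_assoc a' b' c' \c ((f \ot g) \ot h) =b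
      (f \ot (g \ot h)) \c sb_assoc a b c
  | sbe_lunitK a : sb_lunitV a \c sb_lunit a =b id_ _
  | sbe_lunitVK a : sb_lunit a \c sb_lunitV a =b id_ _
  | sbe_lunit_nat a b (f : sbHom a b) :
      sb_lunit b \c (id_ sb1 \ot f) =b f \c sb_lunit a
  | sbe_runitK a : sb_runitV a \c sb_runit a =b id_ _
  | sbe_runitVK a : sb_runit a \c sb_runitV a =b id_ _
  | sbe_runit_nat a b (f : sbHom a b) :
      sb_runit b \c (f \ot id_ sb1) =b f \c sb_runit a
  | sbe_pentagon a b c d :
      sb_assoc a b (c \ox d) \c sb_assoc (a \ox b) c d =b
      (id_ a \ot sb_assoc b c d) \c sb_assoc a (b \ox c) d \c
        (sb_assoc a b c \ot id_ d)
  | sbe_triangle a b :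
      (id_ a \ot sb_lunit b) \c sb_assoc a sb1 b =b sb_runit a \ot id_ b
  | sbe_braidK a b : sb_braidV a b \c sb_braid a b =b id_ _
  | sbe_braidVK a b : sb_braid a b \c sb_braidV a b =b id_ _
  | sbe_braid_nat a a' b b' (f : sbHom a a') (g : sbHom b b') :
      sb_braid a' b' \c (f \ot g) =b (g \ot f) \c sb_braid a b
  | sbe_hexagon1 a b c :
      sb_assoc b c a \c sb_braid a (b \ox c) \c sb_assoc a b c =b
      (id_ b \ot sb_braid a c) \c sb_assoc b a c \c (sb_braid a b \ot id_ c)
  | sbe_hexagon2 a b c :
      sb_assocV c a b \c sb_braid (a \ox b) c \c sb_assocV a b c =b
      (sb_braid a c \ot id_ b) \c sb_assocV a c b \c (id_ a \ot sb_braid b c)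
  (* Bijections are identified when they agree pointwise. *)
  | sbe_gamma_ext (I J : finType) (s t : I -> J)
        (sP : bijective s) (tP : bijective t) :
      s =1 t -> sb_gamma sP =b sb_gamma tP
  | sbe_gamma1 (I : finType) (iP : bijective (@id I)) :
      sb_gamma iP =b id_ (sbU I)
  | sbe_gammaM (I J K : finType) (s : I -> J) (t : J -> K)
        (sP : bijective s) (tP : bijective t) :
      sb_gamma (bij_comp tP sP) =b sb_gamma tP \c sb_gamma sP
  | sbe_mu_nat (I I' J J' : finType) (s : I -> I') (t : J -> J')
        (sP : bijective s) (tP : bijective t) :
      sb_gamma (sum_map_bij sP tP) \c sb_mu I J =b
      sb_mu I' J' \c (sb_gamma sP \ot sb_gamma tP)
  | sbe_delta_nat (I I' J J' : finType) (s : I -> I') (t : J -> J')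
        (sP : bijective s) (tP : bijective t) :
      sb_delta I' J' \c sb_gamma (sum_map_bij sP tP) =b
      (sb_gamma sP \ot sb_gamma tP) \c sb_delta I J
  | sbe_muA (I J K : finType) :
      sb_gamma (@sum_assoc_bij I J K) \c sb_mu (I + J)%type K \c
        (sb_mu I J \ot id_ (sbU K)) =b
      sb_mu I (J + K)%type \c (id_ (sbU I) \ot sb_mu J K) \c
        sb_assoc (sbU I) (sbU J) (sbU K)
  | sbe_deltaA (I J K : finType) :
      sb_assoc (sbU I) (sbU J) (sbU K) \c (sb_delta I J \ot id_ (sbU K)) \c
        sb_delta (I + J)%type K =b
      (id_ (sbU I) \ot sb_delta J K) \c sb_delta I (J + K)%type \c
        sb_gamma (@sum_assoc_bij I J K)
  | sbe_mu_r (I : finType) :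
      sb_gamma (@sum_void_r_bij I) \c sb_mu I void =b sb_runit (sbU I)
  | sbe_mu_l (I : finType) :
      sb_gamma (@sum_void_l_bij I) \c sb_mu void I =b sb_lunit (sbU I)
  | sbe_delta_r (I : finType) :
      sb_delta I void =b sb_runitV (sbU I) \c sb_gamma (@sum_void_r_bij I)
  | sbe_delta_l (I : finType) :
      sb_delta void I =b sb_lunitV (sbU I) \c sb_gamma (@sum_void_l_bij I)
  (* The compatibility square for I = J_1 + J_2 = L_1 + L_2, written with
     J_i = K_{i1} + K_{i2} and L_j = K_{1j} + K_{2j}. *)
  | sbe_SB3 (K11 K12 K21 K22 : finType) :
      sb_delta (K11 + K21)%type (K12 + K22)%type \c
        sb_gamma (@sum_mid_bij K11 K12 K21 K22) \c
        sb_mu (K11 + K12)%type (K21 + K22)%type =b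
      (sb_mu K11 K21 \ot sb_mu K12 K22) \c
        sb_braid_mid (sbU K11) (sbU K12) (sbU K21) (sbU K22) \c
        (sb_delta K11 K12 \ot sb_delta K21 K22)
where "f =b g" := (sbEq f g).

Definition SB : linCat k :=
  LinCat sbe_refl sbe_sym sbe_trans sbe_comp sbe_add sbe_scale sbe_compA
    sbe_comp1m sbe_compm1 sbe_addA sbe_addC sbe_add0 sbe_addN sbe_scaleA
    sbe_scale1 sbe_scaleDr sbe_scaleDl sbe_compDl sbe_compDr sbe_compZl
    sbe_compZr.

Definition SBn (n : nat) : linCat k :=
  fullSub (C := SB) (fun a : sbOb => sb_deg a = n).

End PROB.

Section Parabolic.
Variable n : nat.

Definition is_osp (I : seq {set 'I_n}) : bool :=
  [&& all (fun A => A != set0) I,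
      pairwise (fun A B : {set 'I_n} => [disjoint A & B]) I
    & \bigcup_(A <- I) A == [set: 'I_n]].

Definition osp : Type := {I : seq {set 'I_n} | is_osp I}.

(* The label of gl_n: the one-part partition, or the empty one when [n = 0]. *)
Definition osp_top_seq : seq {set 'I_n} :=
  [seq A <- [:: [set: 'I_n]] | A != set0].

Lemma osp_top_subproof : is_osp osp_top_seq.
Proof.
rewrite /is_osp /osp_top_seq /=; case: eqP => [E|/eqP E] /=.
  by rewrite big_nil E eqxx.
by rewrite E big_cons big_nil setU0 eqxx.
Qed.

Definition osp_top : osp := exist _ osp_top_seq osp_top_subproof.

(* Index of the part containing [i]. *)
Definition part_of (I : osp) (i : 'I_n) : nat :=
  find (fun A : {set 'I_n} => i \in A) (sval I).

(* The cells of [I] and [J] have the same linear span and lie in it on opposite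
   sides of a common face of codimension 1: the one of the partition where [A]
   and [B] are merged. *)
Definition exch (I J : osp) : Prop :=
  exists s A B t, sval I = s ++ A :: B :: t /\ sval J = s ++ B :: A :: t.

Section OverReals.
Variable R : realType.

(* The coordinate subspace V_nu of C^n, where C = R[i] and V_0 = 0. *)
Definition flag (I : osp) (nu : nat) (v : 'cV[R[i]]_n) : Prop :=
  forall i, v i 0 != 0 -> has (fun A : {set 'I_n} => i \in A) (take nu (sval I)).

Definition parabolic (I : osp) (X : 'M[R[i]]_n) : Prop :=
  forall nu v, flag I nu v -> flag I nu (X *m v).

Definition psub (I J : osp) : Prop :=
  forall X, parabolic I X -> parabolic J X.

Definition cell (I : osp) (t : 'rV[R]_n) : Prop :=
  forall i j,
    (part_of I i = part_of I j -> t 0 i = t 0 j) /\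
    ((part_of I i < part_of I j)%N -> t 0 i < t 0 j).

Definition collinear (I J K : osp) : Prop :=
  exists a b c, [/\ cell I a, cell J b, cell K c &
    exists2 s : R, 0 <= s <= 1 & b = (1 - s) *: a + s *: c].

Lemma psub_top (I : osp) : psub I osp_top.
Proof.
move=> X _ nu v; rewrite /flag /= /osp_top_seq /=; case: eqP => [E|/eqP E] /=.
  by move=> _ i; have := in_set0 i; rewrite -E in_setT.
case: nu => [|nu] /= vP i; last by rewrite in_setT.
rewrite mxE big1 ?eqxx // => j _.
by case: (altP (v j 0 =P 0)) => [->|/vP //]; rewrite mulr0.
Qed.

End OverReals.

Section Action.
Implicit Types g h : 'S_n.

Definition osp_act_seq g (I : seq {set 'I_n}) : seq {set 'I_n} :=
  [seq g @: A | A : {set 'I_n} <- I].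

Lemma osp_act_subproof g (I : osp) : is_osp (osp_act_seq g (sval I)).
Proof.
case: I => I /= /and3P[I0 Id /eqP IU]; apply/and3P; split.
- by rewrite all_map; apply: sub_all I0 => A /=; rewrite imset_eq0.
- rewrite pairwise_map; apply: sub_pairwise Id => A B /=.
  by rewrite !disjoint_subset => /subsetP AB; apply/subsetP=> _ /imsetP[x xA ->];
    rewrite inE (mem_imset _ _ perm_inj); apply: AB.
- apply/eqP/setP=> x; rewrite in_setT big_map.
  have : (g^-1)%g x \in \bigcup_(A <- I) A by rewrite IU in_setT.
  elim: I {I0 Id IU} => [|A I IH]; first by rewrite big_nil in_set0.
  rewrite !big_cons !in_setU => /orP[xA|/IH->]; last by rewrite orbT.
  by apply/orP; left; apply/imsetP; exists ((g^-1)%g x); rewrite ?permKV.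
Qed.

Definition osp_act g (I : osp) : osp :=
  exist _ (osp_act_seq g (sval I)) (osp_act_subproof g I).

Lemma osp_eq (I J : osp) : sval I = sval J -> I = J.
Proof. by move=> e; apply: val_inj. Qed.

Lemma osp_act1 (I : osp) : osp_act 1%g I = I.
Proof.
apply: osp_eq => /=; rewrite /osp_act_seq -[RHS]map_id; apply: eq_map => A.
by apply/setP=> x; rewrite -[x in LHS](perm1 x) (mem_imset _ _ perm_inj).
Qed.

(* Permutations compose diagrammatically: [(h * g) x = g (h x)], so that
   the product written gh in left-action notation is [h * g]. *)
Lemma osp_actM g h (I : osp) : osp_act g (osp_act h I) = osp_act (h * g)%g I.
Proof.
apply: osp_eq => /=; rewrite /osp_act_seq -map_comp; apply: eq_map => A /=.
by rewrite -imset_comp; apply: eq_imset => x /=; rewrite permM.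
Qed.

Lemma osp_act_top g : osp_act g osp_top = osp_top.
Proof.
apply: osp_eq => /=; rewrite /osp_act_seq /osp_top_seq /=.
case: ifP => //= _; congr [:: _]; apply/setP=> x; rewrite in_setT.
by apply/imsetP; exists ((g^-1)%g x); rewrite ?permKV ?in_setT.
Qed.

Lemma mem_act g (A : {set 'I_n}) i : (g i \in g @: A) = (i \in A).
Proof. exact: mem_imset perm_inj. Qed.

Lemma part_of_act g I i : part_of (osp_act g I) (g i) = part_of I i.
Proof.
rewrite /part_of /= /osp_act_seq find_map; apply: eq_find => A /=.
exact: mem_act.
Qed.

Lemma exch_act g I J : exch I J -> exch (osp_act g I) (osp_act g J).
Proof.
move=> [s [A [B [t [eI eJ]]]]].
exists (osp_act_seq g s), (g @: A), (g @: B), (osp_act_seq g t).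
by rewrite /= eI eJ /osp_act_seq !map_cat.
Qed.

Variable R : realType.

Lemma flag_act g I nu (v : 'cV[R[i]]_n) :
  flag (osp_act g I) nu v <-> flag I nu (\col_i v (g i) 0).
Proof.
have hasE i : has (fun A : {set 'I_n} => g i \in A)
    (take nu (osp_act_seq g (sval I))) =
    has (fun A : {set 'I_n} => i \in A) (take nu (sval I)).
  by rewrite /osp_act_seq -map_take has_map; apply: eq_has => A /=;
    rewrite mem_act.
split=> vP i; first by rewrite mxE => /vP; rewrite hasE.
by rewrite -{1 2}(permKV g i) => vi; rewrite hasE; apply: vP; rewrite mxE.
Qed.

Lemma parabolic_act g I (X : 'M[R[i]]_n) :
  parabolic (osp_act g I) X <-> parabolic I (\matrix_(i, j) X (g i) (g j)).
Proof.
have mulE (v : 'cV[R[i]]_n) : \col_i (X *m v) (g i) 0 =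
    (\matrix_(i, j) X (g i) (g j)) *m (\col_i v (g i) 0).
  apply/matrixP=> i j; rewrite !mxE (reindex_inj (@perm_inj _ g)) /=.
  by apply: eq_bigr => l _; rewrite !mxE.
split=> XP nu v vP; last first.
  by apply/flag_act; rewrite mulE; apply: XP; apply/flag_act.
have vE : v = \col_i (\col_j v ((g^-1)%g j) 0) (g i) 0.
  by apply/matrixP=> i j; rewrite !mxE permK ord1.
by rewrite vE -mulE; apply/flag_act/XP/flag_act; rewrite -vE.
Qed.

Lemma psub_act g I J : psub R I J -> psub R (osp_act g I) (osp_act g J).
Proof. by move=> IJ X /parabolic_act XP; apply/parabolic_act/IJ. Qed.

Lemma cell_act g I (t : 'rV[R]_n) :
  cell I t -> cell (osp_act g I) (\row_i t 0 ((g^-1)%g i)).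
Proof.
move=> tP i j; rewrite !mxE -{1 3}(permKV g i) -{1 3}(permKV g j).
by rewrite !part_of_act; apply: tP.
Qed.

Lemma collinear_act g I J K : collinear R I J K ->
  collinear R (osp_act g I) (osp_act g J) (osp_act g K).
Proof.
move=> [a [b [c [aP bP cP [s sP e]]]]].
exists (\row_i a 0 ((g^-1)%g i)), (\row_i b 0 ((g^-1)%g i)),
  (\row_i c 0 ((g^-1)%g i)).
split; [exact: cell_act..|exists s => //].
by apply/matrixP=> i j; rewrite e !mxE.
Qed.

End Action.
End Parabolic.

Section DoubleIncidence.
Variables (k : fieldType) (R : realType) (n : nat).
Local Notation osp := (osp n).
Local Notation psub := (@psub n R).
Local Notation top := (osp_top n).

(* Invertibility of [q_tau p' p''] for partitions differing by an adjacent
   exchange is imposed through a formal inverse [q_tauV]. *)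
Inductive qHom : osp -> osp -> Type :=
  | q_id p : qHom p p
  | q_comp p q r : qHom q r -> qHom p q -> qHom p r
  | q_zero p q : qHom p q
  | q_add p q : qHom p q -> qHom p q -> qHom p q
  | q_scale p q : k -> qHom p q -> qHom p q
  | q_Ind p p' : psub p p' -> qHom p p'
  | q_Res p' p : psub p p' -> qHom p' p
  | q_tauV p' p'' : exch p' p'' -> qHom p'' p'.

Local Notation "f \c g" := (q_comp f g) : lincat_scope.

Definition q_tau (p p' : osp) : qHom p p' :=
  q_Res (psub_top (R := R) (I := p')) \c q_Ind (psub_top (R := R) (I := p)).

Reserved Notation "f =q g" (at level 70, no associativity).

Inductive qEq : forall p q, qHom p q -> qHom p q -> Prop :=
  | qe_refl p q (f : qHom p q) : f =q f
  | qe_sym p q (f g : qHom p q) : f =q g -> g =q f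
  | qe_trans p q (f g h : qHom p q) : f =q g -> g =q h -> f =q h
  | qe_comp p q r (f f' : qHom q r) (g g' : qHom p q) :
      f =q f' -> g =q g' -> f \c g =q f' \c g'
  | qe_add p q (f f' g g' : qHom p q) :
      f =q f' -> g =q g' -> q_add f g =q q_add f' g'
  | qe_scale p q x (f f' : qHom p q) :
      f =q f' -> q_scale x f =q q_scale x f'
  | qe_compA p q r s (f : qHom r s) (g : qHom q r) (h : qHom p q) :
      f \c (g \c h) =q f \c g \c h
  | qe_comp1m p q (f : qHom p q) : q_id q \c f =q f
  | qe_compm1 p q (f : qHom p q) : f \c q_id p =q f
  | qe_addA p q (f g h : qHom p q) :
      q_add f (q_add g h) =q q_add (q_add f g) h
  | qe_addC p q (f g : qHom p q) : q_add f g =q q_add g f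
  | qe_add0 p q (f : qHom p q) : q_add (q_zero p q) f =q f
  | qe_addN p q (f : qHom p q) : q_add (q_scale (-1) f) f =q q_zero p q
  | qe_scaleA p q x y (f : qHom p q) :
      q_scale x (q_scale y f) =q q_scale (x * y) f
  | qe_scale1 p q (f : qHom p q) : q_scale 1 f =q f
  | qe_scaleDr p q x (f g : qHom p q) :
      q_scale x (q_add f g) =q q_add (q_scale x f) (q_scale x g)
  | qe_scaleDl p q x y (f : qHom p q) :
      q_scale (x + y) f =q q_add (q_scale x f) (q_scale y f)
  | qe_compDl p q r (f f' : qHom q r) (g : qHom p q) :
      q_add f f' \c g =q q_add (f \c g) (f' \c g)
  | qe_compDr p q r (f : qHom q r) (g g' : qHom p q) :
      f \c q_add g g' =q q_add (f \c g) (f \c g')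
  | qe_compZl p q r x (f : qHom q r) (g : qHom p q) :
      q_scale x f \c g =q q_scale x (f \c g)
  | qe_compZr p q r x (f : qHom q r) (g : qHom p q) :
      f \c q_scale x g =q q_scale x (f \c g)
  | qe_Ind1 p (h : psub p p) : q_Ind h =q q_id p
  | qe_Res1 p (h : psub p p) : q_Res h =q q_id p
  | qe_IndM p p' p'' (h1 : psub p p') (h2 : psub p' p'') (h3 : psub p p'') :
      q_Ind h2 \c q_Ind h1 =q q_Ind h3
  | qe_ResM p p' p'' (h1 : psub p p') (h2 : psub p' p'') (h3 : psub p p'') :
      q_Res h1 \c q_Res h2 =q q_Res h3
  | qe_ResInd p p' (h : psub p p') : q_Res h \c q_Ind h =q q_id p
  | qe_tauM p p' p'' : collinear R p p' p'' ->
      q_tau p p'' =q q_tau p' p'' \c q_tau p p'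
  | qe_tauK p' p'' (h : exch p' p'') : q_tauV h \c q_tau p' p'' =q q_id p'
  | qe_tauVK p' p'' (h : exch p' p'') : q_tau p' p'' \c q_tauV h =q q_id p''
where "f =q g" := (qEq f g).

Definition Q : linCat k :=
  LinCat qe_refl qe_sym qe_trans qe_comp qe_add qe_scale qe_compA
    qe_comp1m qe_compm1 qe_addA qe_addC qe_add0 qe_addN qe_scaleA
    qe_scale1 qe_scaleDr qe_scaleDl qe_compDl qe_compDr qe_compZl
    qe_compZr.

Fixpoint q_act (g : 'S_n) p q (f : qHom p q) :
    qHom (osp_act g p) (osp_act g q) :=
  match f with
  | q_id p => q_id _
  | q_comp _ _ _ f1 f2 => q_comp (q_act g f1) (q_act g f2)
  | q_zero p q => q_zero _ _
  | q_add _ _ f1 f2 => q_add (q_act g f1) (q_act g f2)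
  | q_scale _ _ x f1 => q_scale x (q_act g f1)
  | q_Ind _ _ h => q_Ind (psub_act (g := g) h)
  | q_Res _ _ h => q_Res (psub_act (g := g) h)
  | q_tauV _ _ h => q_tauV (exch_act g h)
  end.

End DoubleIncidence.

#[global] Hint Resolve heq_refl : core.

Section LinCatTheory.
Variables (k : fieldType) (C : linCat k).

#[global] Instance heq_equivalence (a b : C) : Equivalence (@heq k C a b).
Proof.
split; [exact: heq_refl|exact: heq_sym|move=> f g h; exact: heq_trans].
Qed.

#[global] Instance comp_proper (a b c : C) :
  Proper (@heq k C b c ==> @heq k C a b ==> @heq k C a c) comp.
Proof. by move=> f f' ff' g g' gg'; apply: comp_heq. Qed.

#[global] Instance hadd_proper (a b : C) :
  Proper (@heq k C a b ==> @heq k C a b ==> @heq k C a b) hadd.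
Proof. by move=> f f' ff' g g' gg'; apply: hadd_heq. Qed.

#[global] Instance hscale_proper (a b : C) (x : k) :
  Proper (@heq k C a b ==> @heq k C a b) (hscale x).
Proof. by move=> f f' ff'; apply: hscale_heq. Qed.

Lemma haddr0 (a b : C) (f : hom C a b) : hadd f (hzero a b) =~ f.
Proof. by rewrite haddC hadd0. Qed.

Lemma hadd_cancel (a b : C) (f g h : hom C a b) :
  hadd f g =~ hadd f h -> g =~ h.
Proof.
move=> fgh; by rewrite -(hadd0 g) -(haddN f) -haddA fgh haddA haddN hadd0.
Qed.

Lemma hscale0 (a b : C) x : hscale x (hzero a b) =~ (hzero a b : hom C a b).
Proof.
apply: (@hadd_cancel _ _ (hscale x (hzero a b))).
by rewrite -hscaleDr !haddr0.
Qed.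

Lemma comp0l (a b c : C) (g : hom C a b) : hzero b c \c g =~ hzero a c.
Proof.
apply: (@hadd_cancel _ _ (hzero b c \c g)).
by rewrite -compDl !haddr0.
Qed.

Lemma comp0r (a b c : C) (f : hom C b c) : f \c hzero a b =~ hzero a c.
Proof.
apply: (@hadd_cancel _ _ (f \c hzero a b)).
by rewrite -compDr !haddr0.
Qed.

Definition hsum (T : Type) (a b : C) (r : seq T) (F : T -> hom C a b) :
    hom C a b :=
  \big[hadd/hzero a b]_(i <- r) F i.

Section Sums.
Variable (T : eqType).
Implicit Type r : seq T.

Lemma hsum_heq (a b : C) r (F G : T -> hom C a b) :
  (forall i, F i =~ G i) -> hsum r F =~ hsum r G.
Proof.
move=> FG; rewrite /hsum; elim: r => [|i r IH].
  by rewrite !big_nil; apply: heq_refl.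
by rewrite !big_cons; apply: hadd_heq.
Qed.

Lemma hsum_compl (a b c : C) r (F : T -> hom C b c) (g : hom C a b) :
  hsum r F \c g =~ hsum r (fun i => F i \c g).
Proof.
rewrite /hsum; elim: r => [|i r IH]; first by rewrite !big_nil; apply: comp0l.
by rewrite !big_cons compDl; apply: hadd_heq => //; apply: heq_refl.
Qed.

Lemma hsum_compr (a b c : C) r (f : hom C b c) (F : T -> hom C a b) :
  f \c hsum r F =~ hsum r (fun i => f \c F i).
Proof.
rewrite /hsum; elim: r => [|i r IH]; first by rewrite !big_nil; apply: comp0r.
by rewrite !big_cons compDr; apply: hadd_heq => //; apply: heq_refl.
Qed.

Lemma haddACA (a b : C) (f g h l : hom C a b) :
  hadd (hadd f g) (hadd h l) =~ hadd (hadd f h) (hadd g l).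
Proof.
rewrite -haddA -(haddA f h); apply: hadd_heq; first exact: heq_refl.
rewrite (haddC h l) haddA; exact: haddC.
Qed.

Lemma hsumD (a b : C) r (F G : T -> hom C a b) :
  hsum r (fun i => hadd (F i) (G i)) =~ hadd (hsum r F) (hsum r G).
Proof.
rewrite /hsum; elim: r => [|i r IH].
  by rewrite !big_nil; apply: heq_sym; apply: hadd0.
rewrite !big_cons; apply: heq_trans (haddACA _ _ _ _).
by apply: hadd_heq => //; apply: heq_refl.
Qed.

Lemma hsumZ (a b : C) r x (F : T -> hom C a b) :
  hsum r (fun i => hscale x (F i)) =~ hscale x (hsum r F).
Proof.
rewrite /hsum; elim: r => [|i r IH].
  by rewrite !big_nil; apply: heq_sym; apply: hscale0.
rewrite !big_cons hscaleDr.
by apply: hadd_heq => //; apply: heq_refl.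
Qed.

Lemma hsum0 (a b : C) r (F : T -> hom C a b) :
  (forall i, i \in r -> F i =~ hzero a b) -> hsum r F =~ hzero a b.
Proof.
rewrite /hsum; elim: r => [|i r IH] F0; first by rewrite big_nil.
rewrite big_cons F0 ?mem_head // hadd0; apply: IH => j jr.
by apply: F0; rewrite inE jr orbT.
Qed.

Lemma hsum_cat (a b : C) r s (F : T -> hom C a b) :
  hsum (r ++ s) F =~ hadd (hsum r F) (hsum s F).
Proof.
rewrite /hsum; elim: r => [|i r IH] /=.
  by rewrite big_nil; apply: heq_sym; apply: hadd0.
rewrite !big_cons; apply: heq_trans (haddA _ _ _).
by apply: hadd_heq => //; apply: heq_refl.
Qed.

Lemma hsum_perm (a b : C) r s (F : T -> hom C a b) :
  perm_eq r s -> hsum r F =~ hsum s F.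
Proof.
move=> rs; move: (heq_refl (hsum r F)).
apply: (catCA_perm_ind (P := fun s => hsum r F =~ hsum s F)) rs => s1 s2 s3 ->.
by rewrite !hsum_cat !haddA (haddC (hsum s1 F)); apply: heq_refl.
Qed.

Lemma hsum_single (a b : C) r (F : T -> hom C a b) i0 :
  uniq r -> i0 \in r -> (forall i, i != i0 -> F i =~ hzero a b) ->
  hsum r F =~ F i0.
Proof.
move=> ru ri F0; rewrite (hsum_perm F (perm_to_rem ri)) /hsum big_cons.
rewrite -[X in heq _ X]haddr0; apply: hadd_heq; first exact: heq_refl.
by apply: hsum0 => i; rewrite mem_rem_uniq // inE => /andP[ii _]; apply: F0.
Qed.

End Sums.

Lemma hsum_exchange (T S : eqType) (a b : C) (r : seq T) (s : seq S)
    (F : T -> S -> hom C a b) :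
  hsum r (fun i => hsum s (F i)) =~ hsum s (fun j => hsum r (F^~ j)).
Proof.
elim: r => [|i r IH].
  rewrite /hsum big_nil; apply: heq_sym; apply: hsum0 => j _.
  by rewrite big_nil; apply: heq_refl.
rewrite {1}/hsum big_cons -/(hsum r _) IH.
rewrite -hsumD; apply: hsum_heq => j.
by rewrite {2}/hsum big_cons; apply: heq_refl.
Qed.

Lemma hsum_map (T S : Type) (a b : C) (r : seq T) (h : T -> S)
    (F : S -> hom C a b) :
  hsum (map h r) F = hsum r (fun i => F (h i)).
Proof. by rewrite /hsum big_map. Qed.

Lemma eqhom_comp (a b c : C) (e : a = b) (e' : b = c) :
  eqhom e' \c eqhom e =~ eqhom (etrans e e').
Proof. by case: _ / e'; case: _ / e; apply: comp1m. Qed.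

End LinCatTheory.

Section Semidirect.
Variables (k : fieldType) (R : realType) (n : nat).
Local Notation Q := (Q k R n).
Local Notation osp := (osp n).
Implicit Types (g h m : 'S_n) (p q : osp).

Lemma q_Ind_irr p q (h1 h2 : psub R p q) :
  (q_Ind k h1 : hom Q p q) =~ q_Ind k h2.
Proof.
have id_p : psub R p p by [].
have e : (q_Ind k id_p : hom Q p p) =~ @idm k Q p := qe_Ind1 k id_p.
apply: (@heq_trans k Q) (heq_sym (compm1 (q_Ind k h1 : hom Q p q))) _.
by rewrite -e; apply: qe_IndM.
Qed.

Lemma q_Res_irr p q (h1 h2 : psub R p q) :
  (q_Res k h1 : hom Q q p) =~ q_Res k h2.
Proof.
have id_p : psub R p p by [].
have e : (q_Res k id_p : hom Q p p) =~ @idm k Q p := qe_Res1 k id_p.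
apply: (@heq_trans k Q) (heq_sym (comp1m (q_Res k h1 : hom Q q p))) _.
by rewrite -e; apply: qe_ResM.
Qed.

Lemma q_act_tau g p q :
  (q_act g (q_tau k R p q) : hom Q _ _) =~ q_tau k R (osp_act g p) (osp_act g q).
Proof.
rewrite /q_tau /=.
move: (psub_act _) (psub_act _); rewrite osp_act_top => h1 h2.
by apply: (@comp_heq k Q); [exact: q_Res_irr|exact: q_Ind_irr].
Qed.

Lemma q_act_heq g p q (f f' : hom Q p q) :
  f =~ f' -> (q_act g f : hom Q _ _) =~ q_act g f'.
Proof.
elim=> {p q f f'} /=; try by [constructor|econstructor; eassumption].
- move=> p p' p'' c.
  apply: (@heq_trans k Q) (q_act_tau _ _ _) _.
  apply: (@heq_trans k Q) (qe_tauM k (collinear_act g c)) _.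
  by apply: (@heq_sym k Q); apply: (@comp_heq k Q); apply: q_act_tau.
- move=> p p' h; apply: (@heq_trans k Q) (qe_tauK k R (exch_act g h)).
  by apply: (@comp_heq k Q); [apply: heq_refl|apply: q_act_tau].
- move=> p p' h; apply: (@heq_trans k Q) (qe_tauVK k R (exch_act g h)).
  by apply: (@comp_heq k Q); [apply: q_act_tau|apply: heq_refl].
Qed.

Definition act_hom g p q (f : hom Q p q) : hom Q (osp_act g p) (osp_act g q) :=
  q_act g f.

#[local] Instance act_hom_proper g p q :
  Proper (@heq k Q p q ==> @heq k Q _ _) (@act_hom g p q).
Proof. by move=> f f' ff'; apply: q_act_heq. Qed.

Definition qcast p q (e : p = q) : hom Q p q := eqhom (C := Q) e.

Lemma qcast_irr p q (e e' : p = q) : qcast e =~ qcast e'.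
Proof. by rewrite (eq_irrelevance e e'). Qed.

Lemma qcast_id p (e : p = p) : qcast e =~ @idm k Q p.
Proof. exact: (qcast_irr e erefl). Qed.

Lemma qcastM p q r (e : p = q) (e' : q = r) (e'' : p = r) :
  qcast e' \c qcast e =~ qcast e''.
Proof. by case: _ / e' e'' => e''; rewrite !qcast_id comp1m (qcast_irr e e''). Qed.

Lemma act_hom_cast g p q (e : p = q) (e' : osp_act g p = osp_act g q) :
  act_hom g (qcast e) =~ qcast e'.
Proof. case: _ / e e' => e'; rewrite !qcast_id; exact: heq_refl. Qed.

Lemma act_homM g p q r (f : hom Q q r) (f' : hom Q p q) :
  act_hom g (f \c f') =~ act_hom g f \c act_hom g f'.
Proof. exact: heq_refl. Qed.

Lemma act_hom_sum (T : Type) g p q (r : seq T) (F : T -> hom Q p q) :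
  act_hom g (hsum r F) =~ hsum r (fun i => act_hom g (F i)).
Proof.
rewrite /hsum; elim: r => [|i r IH]; first by rewrite !big_nil; apply: heq_refl.
by rewrite !big_cons; apply: (@hadd_heq k Q).
Qed.

Lemma act_hom0 g p q : act_hom g (@hzero k Q p q) = @hzero k Q _ _.
Proof. by []. Qed.

Lemma q_tauV_irr p q (h1 h2 : exch p q) :
  (q_tauV k R h1 : hom Q q p) =~ q_tauV k R h2.
Proof.
have e1 : (q_tau k R p q : hom Q p q) \c q_tauV k R h1 =~ @idm k Q q
  := qe_tauVK k R h1.
have e2 : (q_tauV k R h2 : hom Q q p) \c q_tau k R p q =~ @idm k Q p
  := qe_tauK k R h2.
apply: (@heq_trans k Q) (heq_sym (comp1m (q_tauV k R h1 : hom Q q p))) _.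
by rewrite -e2 -compA e1 compm1.
Qed.

Lemma cast_sq p q (f f' : hom Q p q) (e : p = p) (e' : q = q) :
  f =~ f' -> f \c qcast e =~ qcast e' \c f'.
Proof. by move=> ff'; rewrite !qcast_id comp1m compm1. Qed.

Lemma act_hom_act g h m p q (f : hom Q p q)
    (e : osp_act m p = osp_act g (osp_act h p))
    (e' : osp_act m q = osp_act g (osp_act h q)) : (h * g)%g = m ->
  act_hom g (act_hom h f) \c qcast e =~ qcast e' \c act_hom m f.
Proof.
move=> em; case: _ / em e e'.
elim: f => {p q} /=.
- move=> p e e'.
  apply: (@heq_trans k Q) (comp1m (qcast e)) _.
  apply: (@heq_trans k Q) (qcast_irr e e') _.
  exact: (heq_sym (compm1 (qcast e'))).
- move=> p q r f IHf f' IHf' e e'.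
  have e1 := esym (osp_actM g h q).
  suff : act_hom g (act_hom h f) \c act_hom g (act_hom h f') \c qcast e =~
      qcast e' \c (act_hom (h * g)%g f \c act_hom (h * g)%g f') by [].
  have {}IHf : act_hom g (act_hom h f) \c qcast e1 =~
      qcast e' \c act_hom (h * g)%g f := IHf e1 e'.
  have {}IHf' : act_hom g (act_hom h f') \c qcast e =~
      qcast e1 \c act_hom (h * g)%g f' := IHf' e e1.
  by rewrite -compA IHf' compA IHf compA.
- move=> p q e e'.
  exact: (@heq_trans k Q _ _ _ _ _ (comp0l _ _) (heq_sym (comp0r _ _))).
- move=> p q f IHf f' IHf' e e'.
  apply: (@heq_trans k Q) (compDl _ _ _) _.
  apply: (@heq_trans k Q) (heq_sym (compDr _ _ _)).
  by apply: (@hadd_heq k Q); [apply: IHf|apply: IHf'].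
- move=> p q x f IHf e e'.
  apply: (@heq_trans k Q) (compZl _ _ _) _.
  apply: (@heq_trans k Q) (heq_sym (compZr _ _ _)).
  by apply: (@hscale_heq k Q); apply: IHf.
- move=> p q i e e'; rewrite /act_hom /=.
  move: (psub_act _) (psub_act _); case: _ / e; case: _ / e' => h1 h2.
  apply: cast_sq; exact: q_Ind_irr.
- move=> p q i e e'; rewrite /act_hom /=.
  move: (psub_act _) (psub_act _); case: _ / e; case: _ / e' => h1 h2.
  apply: cast_sq; exact: q_Res_irr.
- move=> p q i e e'; rewrite /act_hom /=.
  move: (exch_act _ _) (exch_act _ _); case: _ / e; case: _ / e' => h1 h2.
  apply: cast_sq; exact: q_tauV_irr.
Qed.

Lemma act_hom1 p q (f : hom Q p q)
    (e : p = osp_act 1%g p) (e' : q = osp_act 1%g q) :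
  act_hom 1%g f \c qcast e =~ qcast e' \c f.
Proof.
rewrite /act_hom; elim: f e e' => {p q} /=.
- move=> p e e'.
  apply: (@heq_trans k Q) (comp1m (qcast e)) _.
  apply: (@heq_trans k Q) (qcast_irr e e') _.
  exact: (heq_sym (compm1 (qcast e'))).
- move=> p q r f IHf f' IHf' e e'.
  have e1 := esym (osp_act1 q).
  suff : act_hom 1%g f \c act_hom 1%g f' \c qcast e =~
      qcast e' \c ((f : hom Q q r) \c f') by [].
  have {}IHf : act_hom 1%g f \c qcast e1 =~ qcast e' \c f := IHf e1 e'.
  have {}IHf' : act_hom 1%g f' \c qcast e =~ qcast e1 \c f' := IHf' e e1.
  by rewrite -compA IHf' compA IHf compA.
- move=> p q e e'.
  exact: (@heq_trans k Q _ _ _ _ _ (comp0l _ _) (heq_sym (comp0r _ _))).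
- move=> p q f IHf f' IHf' e e'.
  apply: (@heq_trans k Q) (compDl _ _ _) _.
  apply: (@heq_trans k Q) (heq_sym (compDr _ _ _)).
  by apply: (@hadd_heq k Q); [apply: IHf|apply: IHf'].
- move=> p q x f IHf e e'.
  apply: (@heq_trans k Q) (compZl _ _ _) _.
  apply: (@heq_trans k Q) (heq_sym (compZr _ _ _)).
  by apply: (@hscale_heq k Q); apply: IHf.
- move=> p q i e e'.
  move: (psub_act _); case: _ / e; case: _ / e' => h1.
  apply: cast_sq; exact: q_Ind_irr.
- move=> p q i e e'.
  move: (psub_act _); case: _ / e; case: _ / e' => h1.
  apply: cast_sq; exact: q_Res_irr.
- move=> p q i e e'.
  move: (exch_act _ _); case: _ / e; case: _ / e' => h1.
  apply: cast_sq; exact: q_tauV_irr.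
Qed.

(* The component at [g] of a morphism [V -> V'] is a morphism [gV -> V']. *)
Definition sd_hom (V V' : osp) : Type := forall g, hom Q (osp_act g V) V'.

Definition sd_heq (V V' : osp) (phi psi : sd_hom V V') : Prop :=
  forall g, phi g =~ psi g.

Definition sd_zero (V V' : osp) : sd_hom V V' := fun g => hzero _ _.
Definition sd_add (V V' : osp) (phi psi : sd_hom V V') : sd_hom V V' :=
  fun g => hadd (phi g) (psi g).
Definition sd_scale (V V' : osp) (x : k) (phi : sd_hom V V') : sd_hom V V' :=
  fun g => hscale x (phi g).

(* The element written [(xi, g)]. *)
Definition sd_in (V V' : osp) g (xi : hom Q (osp_act g V) V') : sd_hom V V' :=
  fun g' => match g' =P g with
    | ReflectT e => xi \c qcast (congr1 (fun m => osp_act m V) e)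
    | ReflectF _ => hzero _ _
    end.

Definition sd_id (V : osp) : sd_hom V V := sd_in (qcast (osp_act1 V)).

Lemma sd_subproof g m (V : osp) :
  osp_act m V = osp_act g (osp_act (m * g^-1)%g V).
Proof. by rewrite osp_actM mulgKV. Qed.

(* The component at [m] of the composite sums over the pairs [(g, h)] whose
   product (first [h], then [g]) is [m]; see [sd_comp_in] below. *)
Definition sd_comp (V V' V'' : osp) (phi : sd_hom V' V'') (psi : sd_hom V V') :
    sd_hom V V'' :=
  fun m => \big[hadd/hzero _ _]_(g : 'S_n)
    (phi g \c act_hom g (psi (m * g^-1)%g) \c qcast (sd_subproof g m V)).

Lemma sd_in_eq (V V' : osp) g (xi : hom Q (osp_act g V) V') :
  sd_in xi g =~ xi.
Proof.
by rewrite /sd_in; case: eqP => // e; rewrite qcast_id compm1.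
Qed.

Lemma sd_in_neq (V V' : osp) g g' (xi : hom Q (osp_act g V) V') :
  g' != g -> sd_in xi g' =~ hzero _ _.
Proof. by move=> ne; rewrite /sd_in; case: eqP ne => // ->; rewrite eqxx. Qed.

Lemma sd_cast (V V' : osp) (phi : sd_hom V V') g g'
    (e : osp_act g V = osp_act g' V) : g = g' -> phi g' \c qcast e =~ phi g.
Proof. by move=> eg; case: _ / eg e => e; rewrite qcast_id compm1. Qed.

Lemma sd_compE (V V' V'' : osp) (phi : sd_hom V' V'') (psi : sd_hom V V') m :
  sd_comp phi psi m = hsum (index_enum {perm 'I_n}) (fun g =>
    phi g \c act_hom g (psi (m * g^-1)%g) \c qcast (sd_subproof g m V)).
Proof. by []. Qed.

Lemma sd_comp_in (V V' V'' : osp) g h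
    (xi : hom Q (osp_act g V') V'') (zeta : hom Q (osp_act h V) V') :
  sd_heq (sd_comp (sd_in xi) (sd_in zeta))
    (sd_in (g := (h * g)%g)
      (xi \c act_hom g zeta \c qcast (esym (osp_actM g h V)))).
Proof.
move=> m; rewrite sd_compE (hsum_single (i0 := g)) ?index_enum_uniq
  ?mem_index_enum //; last first.
  by move=> g' g'g; rewrite sd_in_neq // !comp0l.
rewrite sd_in_eq; case: (m =P (h * g)%g) => [->|ne].
  rewrite sd_in_eq.
  have eh : h = (h * g * g^-1)%g by rewrite mulgK.
  have e0 : osp_act (h * g * g^-1)%g V = osp_act h V by rewrite -eh.
  have -> : sd_in zeta (h * g * g^-1)%g =~ zeta \c qcast e0.
    rewrite /sd_in; case: eqP => [e|/(_ (esym eh))//].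
    by rewrite (qcast_irr _ e0).
  rewrite act_homM -!compA.
  have e1 : osp_act g (osp_act (h * g * g^-1)%g V) = osp_act g (osp_act h V).
    by rewrite e0.
  by rewrite (act_hom_cast e0 e1) (qcastM _ _ (esym (osp_actM g h V))).
rewrite [X in heq _ X]sd_in_neq; last exact/eqP.
rewrite sd_in_neq; first by rewrite act_hom0 comp0r comp0l.
by apply/eqP => e; apply: ne; rewrite -e mulgKV.
Qed.

Lemma sd_heq_refl V V' (f : sd_hom V V') : sd_heq f f.
Proof. by move=> g. Qed.

Lemma sd_heq_sym V V' (f f' : sd_hom V V') : sd_heq f f' -> sd_heq f' f.
Proof. by move=> ff' g; apply: heq_sym. Qed.

Lemma sd_heq_trans V V' (f f' f'' : sd_hom V V') :
  sd_heq f f' -> sd_heq f' f'' -> sd_heq f f''.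
Proof. by move=> ff' ff'' g; rewrite (ff' g). Qed.

Lemma sd_comp_heq V V' V'' (f f' : sd_hom V' V'') (h h' : sd_hom V V') :
  sd_heq f f' -> sd_heq h h' -> sd_heq (sd_comp f h) (sd_comp f' h').
Proof.
move=> ff' hh' m; rewrite !sd_compE; apply: (@hsum_heq _ Q) => g.
by rewrite (ff' g) (hh' _).
Qed.

Lemma sd_compA V1 V2 V3 V4 (f : sd_hom V3 V4) (f' : sd_hom V2 V3)
    (f'' : sd_hom V1 V2) :
  sd_heq (sd_comp f (sd_comp f' f'')) (sd_comp (sd_comp f f') f'').
Proof.
have key b c c' d d' m m'
    (e1 : osp_act m' V1 = osp_act c (osp_act d V1))
    (e2 : osp_act m V1 = osp_act b (osp_act m' V1))
    (e3 : osp_act (c * b)%g V2 = osp_act b (osp_act c' V2))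
    (e4 : osp_act m V1 = osp_act (c * b)%g (osp_act d' V1)) :
    c = c' -> d = d' ->
    f b \c act_hom b (f' c \c act_hom c (f'' d) \c qcast e1) \c qcast e2 =~
    (f b \c act_hom b (f' c') \c qcast e3) \c
      act_hom (c * b)%g (f'' d') \c qcast e4.
  move=> ec ed; case: _ / ec e3 => e3; case: _ / ed e4 => e4.
  have e5 : osp_act b (osp_act m' V1) = osp_act b (osp_act c (osp_act d V1)).
    by rewrite e1.
  have e6 := esym (osp_actM b c (osp_act d V1)).
  have e7 : osp_act m V1 = osp_act b (osp_act c (osp_act d V1)) by rewrite e2.
  rewrite !act_homM -!compA (act_hom_cast e1 e5) (qcastM e2 e5 e7).
  rewrite -(qcastM e4 e6 e7) !compA; apply: (@comp_heq _ Q) => //.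
  rewrite -!compA; do 2!apply: (@comp_heq _ Q) => //.
  exact: act_hom_act.
move=> m; rewrite !sd_compE.
set r := index_enum _.
have -> : hsum r (fun a => sd_comp f f' a \c act_hom a (f'' (m * a^-1)%g)
    \c qcast (sd_subproof a m V1)) =~
  hsum r (fun a => hsum r (fun b =>
    (f b \c act_hom b (f' (a * b^-1)%g) \c qcast (sd_subproof b a V2)) \c
    act_hom a (f'' (m * a^-1)%g) \c qcast (sd_subproof a m V1))).
  by apply: (@hsum_heq _ Q) => a; rewrite sd_compE !hsum_compl.
rewrite hsum_exchange; apply: (@hsum_heq _ Q) => b.
rewrite sd_compE act_hom_sum hsum_compr hsum_compl.
have pr : perm_eq r (map (fun c => (c * b)%g) r).
  apply: uniq_perm; first exact: index_enum_uniq.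
    by rewrite map_inj_uniq ?index_enum_uniq //; apply: mulIg.
  move=> a; rewrite mem_index_enum; apply/esym/mapP.
  by exists (a * b^-1)%g; rewrite ?mem_index_enum ?mulgKV.
rewrite [X in heq _ X](hsum_perm _ pr) hsum_map.
apply: (@hsum_heq _ Q) => c; apply: key; first by rewrite /= mulgK.
by rewrite invMg mulgA.
Qed.

Lemma sd_comp1m V V' (f : sd_hom V V') : sd_heq (sd_comp (sd_id V') f) f.
Proof.
move=> m; rewrite sd_compE (hsum_single (i0 := 1%g)) ?index_enum_uniq
  ?mem_index_enum //; last first.
  by move=> g g1; rewrite /sd_id sd_in_neq // !comp0l.
rewrite /sd_id sd_in_eq.
have em : m = (m * 1^-1)%g by rewrite invg1 mulg1.
have e : osp_act m V = osp_act (m * 1^-1)%g V by rewrite -em.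
rewrite -[X in heq _ X](sd_cast f e em).
have e1 : osp_act (m * 1^-1)%g V = osp_act 1%g (osp_act (m * 1^-1)%g V).
  by rewrite osp_act1.
rewrite -(qcastM e e1) compA; apply: (@comp_heq _ Q) => //.
rewrite -compA (act_hom1 _ e1 (esym (osp_act1 V'))) compA.
by rewrite (qcastM _ _ erefl) qcast_id comp1m.
Qed.

Lemma sd_compm1 V V' (f : sd_hom V V') : sd_heq (sd_comp f (sd_id V)) f.
Proof.
move=> m; rewrite sd_compE (hsum_single (i0 := m)) ?index_enum_uniq
  ?mem_index_enum //; last first.
  move=> g gm; rewrite /sd_id sd_in_neq; first by rewrite act_hom0 comp0r comp0l.
  by apply: contraNneq gm => e; rewrite -[m](mulgKV g) e mul1g.
have em : (m * m^-1)%g = 1%g by rewrite mulgV.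
have e : osp_act (m * m^-1)%g V = V by rewrite em osp_act1.
have -> : sd_id V (m * m^-1)%g =~ qcast e.
  rewrite /sd_id /sd_in; case: eqP => [e'|/(_ em)//].
  exact: qcastM.
have e1 : osp_act m (osp_act (m * m^-1)%g V) = osp_act m V by rewrite e.
by rewrite (act_hom_cast e e1) -compA (qcastM _ _ erefl) qcast_id compm1.
Qed.

Definition semidirect : linCat k.
Proof.
apply: (@LinCat k osp sd_hom sd_heq sd_id sd_comp sd_zero sd_add sd_scale
  sd_heq_refl sd_heq_sym sd_heq_trans sd_comp_heq _ _
  sd_compA sd_comp1m sd_compm1).
- by move=> V V' f f' h h' ff' hh' g; apply: hadd_heq.
- by move=> V V' x f f' ff' g; apply: hscale_heq.
- by move=> V V' f f' f'' g; apply: haddA.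
- by move=> V V' f f' g; apply: haddC.
- by move=> V V' f g; apply: hadd0.
- by move=> V V' f g; apply: haddN.
- by move=> V V' x y f g; apply: hscaleA.
- by move=> V V' f g; apply: hscale1.
- by move=> V V' x f f' g; apply: hscaleDr.
- by move=> V V' x y f g; apply: hscaleDl.
- move=> V V' V'' f f' h m; rewrite [X in heq _ X]/sd_add !sd_compE -hsumD.
  by apply: (@hsum_heq _ Q) => g; rewrite -!compDl.
- move=> V V' V'' f h h' m; rewrite [X in heq _ X]/sd_add !sd_compE -hsumD.
  apply: (@hsum_heq _ Q) => g.
  by rewrite -compDl -compDr.
- move=> V V' V'' x f h m; rewrite [X in heq _ X]/sd_scale !sd_compE -hsumZ.
  by apply: (@hsum_heq _ Q) => g; rewrite !compZl.
- move=> V V' V'' x f h m; rewrite [X in heq _ X]/sd_scale !sd_compE -hsumZ.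
  apply: (@hsum_heq _ Q) => g.
  by rewrite -compZl -compZr.
Defined.

End Semidirect.

(* Main.v *)
(* Both sides are controlled by one algebra.  In Q_n the object gl_n has, for every
   subset S of {1..n}, the idempotent E_S = Ind Res through the parabolic of
   (S, ~: S); the idempotent of an arbitrary parabolic is the product of the E_S
   over its flag of cuts, and collinearity reduces to relations between E_S and E_W.
   In the PROB the object u_{1..n} has the idempotents mu Delta, which satisfy the
   same relations by (SB0)-(SB3), and the wall-crossing inverses come from the
   inverse braiding.  Hence Q_n, with S_n acting by relabelling, is realized in
   SB_n (functor [realization]).  Conversely a morphism f : a -> b of the PROB is
   sent to a matrix [Fop f] over End(gl_n), indexed by the bijective labellings of
   a and b by {1..n}: mu and Delta insert an E_S, a braiding inserts E_S or a
   wall-crossing inverse, structural isomorphisms permute labels.  [Fop_sound] says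
   that the matrix respects the relations and [Fop_realizes] that f acts through
   it, so the realization is fully faithful.  It is essentially surjective because
   an object of degree n is determined, up to isomorphism, by the idempotent that
   its decomposition into tensor factors cuts out of u_{1..n}. *)
From Stdlib Require Import Setoid Morphisms.
Require Import Defs.
From mathcomp Require Import all_boot all_order all_algebra all_fingroup.
From mathcomp Require Import reals complex zify.
Import Defs.

Set Implicit Arguments.
Unset Strict Implicit.
Unset Printing Implicit Defensive.

Import Order.TTheory GRing.Theory Num.Theory.
Local Open Scope ring_scope.
Local Open Scope lincat_scope.

(** * An equivalence from a fully faithful functor *)

(** Neither side comes with a normal form for its morphisms: both are terms modulo a generated
    congruence, so faithfulness cannot be read off from a basis. It is obtained by letting the terms
    of each side act on the other, through [Ghat] and [Fop], and by checking that the resulting maps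
    on morphisms are mutually inverse. The common interface is the record [chain_idem]: six
    relations between the [E S], from which follow the collinearity relation on one side and the
    hexagons and (SB3) on the other. Three obstacles shape the rest. A subterm under a tensor
    product has smaller degree, so [Fop] is defined in all degrees, with a set [U] of labels to its
    left and labellings onto a subset [S]. The braiding is represented by a single idempotent, which
    crosses tensor factors correctly only on columns fixed by the cuts of their source ([inv]), so
    soundness is claimed on those alone. Inverse braidings and inverse wall-crossings have no common
    formula; they are compared through the uniqueness of an inverse between the images of two
    idempotents ([inv_intertwine]). *)

Section FullyFaithful.
Variables (k : fieldType) (C D : linCat k) (G : linFunctor D C).
Variable Psi : forall p q, hom C (G p) (G q) -> hom D p q.
Hypothesis Psi_heq : forall p q (f f' : hom C (G p) (G q)),
  f =~ f' -> Psi f =~ Psi f'.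
Hypothesis PsiK : forall p q (f : hom C (G p) (G q)), fmap G (Psi f) =~ f.
Hypothesis mapK : forall p q (f : hom D p q), Psi (fmap G f) =~ f.
Variables (P : C -> D) (i : forall b, hom C (G (P b)) b)
  (j : forall b, hom C b (G (P b))).
Hypothesis ijK : forall b, i b \c j b =~ idm b.
Hypothesis jiK : forall b, j b \c i b =~ idm (G (P b)).

Lemma fmap_inj p q (f f' : hom D p q) : fmap G f =~ fmap G f' -> f =~ f'.
Proof. by move=> e; rewrite -(mapK f) (Psi_heq e) mapK. Qed.

(** Conjugation by the chosen isomorphisms, brought back by [Psi]. The functor laws are checked
    after applying the faithful [G], where [PsiK] removes [Psi]. *)
Definition ff_inverse : linFunctor C D.
Proof.
apply: (@LinFunctor k C D P (fun a b f => Psi (j b \c f \c i a))).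
- by move=> a b f g fg; apply: Psi_heq; rewrite fg.
- move=> a; apply: fmap_inj.
  by rewrite PsiK (fmap1 G) compm1 jiK.
- move=> a b c f g; apply: fmap_inj.
  by rewrite (fmapM G) !PsiK -!compA (compA (i b)) ijK comp1m.
- move=> a b f g; apply: fmap_inj.
  by rewrite (fmapD G) !PsiK compDr compDl.
- move=> a b x f; apply: fmap_inj.
  by rewrite (fmapZ G) !PsiK compZr compZl.
Defined.

Lemma lin_equivalent_of_ff : lin_equivalent C D.
Proof.
exists ff_inverse, G; split.
  constructor.
  apply: (@NatIso k C C (compFunctor G ff_inverse) (idFunctor C) i j).
  - exact: jiK.
  - exact: ijK.
  - by move=> a b f /=; rewrite PsiK !compA ijK comp1m.
constructor.
apply: (@NatIso k D D (compFunctor ff_inverse G) (idFunctor D)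
  (fun p => Psi (i (G p))) (fun p => Psi (j (G p)))).
- by move=> p /=; apply: fmap_inj; rewrite (fmapM G) !PsiK jiK (fmap1 G).
- by move=> p /=; apply: fmap_inj; rewrite (fmapM G) !PsiK ijK (fmap1 G).
- move=> p q f /=; apply: fmap_inj.
  by rewrite !(fmapM G) !PsiK !compA ijK comp1m.
Qed.

End FullyFaithful.

(** * Idempotents indexed by subsets *)

Section ChainIdempotents.
Variables (k : fieldType) (C : linCat k) (t : C) (T : finType).
Implicit Types (S W U V Z : {set T}) (x y : hom C t t).

(* [E S] abstracts the idempotent of the two-block partition (S, ~: S): in Q_n
   it is [Ind Res] through gl_n, in SB_n it is [mu Delta]. *)
Record chain_idem (E : {set T} -> hom C t t) : Prop := ChainIdem {
  chain0 : E set0 =~ idm t;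
  chainT : E setT =~ idm t;
  chain_id : forall S, E S \c E S =~ E S;
  chainC : forall S W, S \subset W -> E S \c E W =~ E W \c E S;
  chainI : forall S W, E W \c E S =~ E W \c (E (S :&: W) \c E S);
  chainU : forall S W, E W \c E S =~ E W \c (E (S :|: W) \c E S)
}.

(** [o S W] stands for something visited on the way from [S] to [W]. As it absorbs [E (S :&: W)],
    this factor appears between [E W] and [E S]; being comparable with [W], it moves left past
    [E W], after which [o] can be removed again. The union is treated alike. *)
Lemma chain_idem_meet (E : {set T} -> hom C t t) (o : {set T} -> {set T} -> hom C t t) :
  E set0 =~ idm t -> E setT =~ idm t -> (forall S, E S \c E S =~ E S) ->
  (forall S W, S \subset W -> E S \c E W =~ E W \c E S) ->
  (forall S W, E W \c (o S W \c E S) =~ E W \c E S) ->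
  (forall S W, E (S :&: W) \c o S W =~ o S W) ->
  (forall S W, E (S :|: W) \c o S W =~ o S W) -> chain_idem E.
Proof.
move=> e0 eT ei ec eo oI oU; split=> // S W.
  rewrite -(eo S) -oI -!compA compA -(ec (S :&: W)) ?subsetIr //.
  by rewrite -compA (eo S) compA ec ?subsetIr // -compA.
rewrite -(eo S) -oU -!compA compA (ec W) ?subsetUr //.
by rewrite -compA (eo S) compA -ec ?subsetUr // -compA.
Qed.

Variable E : {set T} -> hom C t t.
Hypothesis EP : chain_idem E.

Definition prodE (l : seq {set T}) : hom C t t :=
  foldr (fun S x => E S \c x) (idm t) l.

Lemma prodE_nil : prodE [::] = idm t.
Proof. by []. Qed.

Lemma prodE_cons S l : prodE (S :: l) = E S \c prodE l.
Proof. by []. Qed.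

Lemma prodE1 S : prodE [:: S] =~ E S.
Proof. by rewrite /= compm1. Qed.

Definition cmpset S W := (S \subset W) || (W \subset S).

Lemma chain_comm S W : cmpset S W -> E S \c E W =~ E W \c E S.
Proof.
by case/orP=> h; [apply: (chainC EP)|apply: heq_sym; apply: (chainC EP)].
Qed.

Lemma prodE_cat l l' : prodE (l ++ l') =~ prodE l \c prodE l'.
Proof.
elim: l => [|S l IH] /=; first by rewrite comp1m.
by rewrite IH compA.
Qed.

Lemma prodE_comm x l : (forall S, S \in l -> x \c E S =~ E S \c x) ->
  x \c prodE l =~ prodE l \c x.
Proof.
elim: l => [|S l IH] h /=; first by rewrite comp1m compm1.
rewrite compA h ?mem_head // -compA IH ?compA // => V Vl.
by apply: h; rewrite inE Vl orbT.
Qed.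

Lemma prodE_absl S l : S \in l -> all (cmpset S) l -> E S \c prodE l =~ prodE l.
Proof.
elim: l => [//|V l IH] /=; rewrite inE => Sl /andP[SV lS].
have [eSV|nSV] := eqVneq S V; first by rewrite -eSV compA (chain_id EP).
rewrite compA (chain_comm SV) -compA IH //.
by rewrite (negPf nSV) in Sl.
Qed.

Lemma prodE_absr S l : S \in l -> all (cmpset S) l -> prodE l \c E S =~ prodE l.
Proof.
move=> Sl h; rewrite -[X in heq _ X](prodE_absl Sl h); apply: heq_sym.
by apply: prodE_comm => V /(allP h) /chain_comm.
Qed.

Definition is_chain (l : seq {set T}) := all (fun S => all (cmpset S) l) l.

Lemma chain_absl S l : is_chain l -> S \in l -> E S \c prodE l =~ prodE l.
Proof. by move=> /allP h Sl; apply: prodE_absl => //; apply: h. Qed.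

Lemma chain_absr S l : is_chain l -> S \in l -> prodE l \c E S =~ prodE l.
Proof. by move=> /allP h Sl; apply: prodE_absr => //; apply: h. Qed.

Lemma is_chain_sub l l' : {subset l <= l'} -> is_chain l' -> is_chain l.
Proof.
move=> ll' /allP cl'; apply/allP => S /ll' /cl' /allP Sl'.
by apply/allP => W /ll' /Sl'.
Qed.

Lemma is_chainP l S W : is_chain l -> S \in l -> W \in l -> cmpset S W.
Proof. by move=> /allP h /h /allP; apply. Qed.

Lemma prodE_fixl x l : (forall S, S \in l -> E S \c x =~ x) -> prodE l \c x =~ x.
Proof.
elim: l => [|S l IH] h /=; first by rewrite comp1m.
rewrite -compA IH ?h ?mem_head // => V Vl.
by apply: h; rewrite inE Vl orbT.
Qed.

Lemma prodE_fixr x l : (forall S, S \in l -> x \c E S =~ x) -> x \c prodE l =~ x.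
Proof.
elim: l => [|S l IH] h /=; first by rewrite compm1.
rewrite compA h ?mem_head // IH // => V Vl.
by apply: h; rewrite inE Vl orbT.
Qed.

(* The product of a chain depends only on the underlying set of proper nonempty
   subsets. *)
Definition chain_sub (l l' : seq {set T}) :=
  all (fun S => [|| S == set0, S == setT | S \in l']) l.

Lemma chain_sub_absl S l : is_chain l -> [|| S == set0, S == setT | S \in l] ->
  E S \c prodE l =~ prodE l.
Proof.
move=> cl /or3P[/eqP->|/eqP->|Sl]; last exact: chain_absl.
  by rewrite (chain0 EP) comp1m.
by rewrite (chainT EP) comp1m.
Qed.

Lemma chain_sub_absr S l : is_chain l -> [|| S == set0, S == setT | S \in l] ->
  prodE l \c E S =~ prodE l.
Proof.
move=> cl /or3P[/eqP->|/eqP->|Sl]; last exact: chain_absr.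
  by rewrite (chain0 EP) compm1.
by rewrite (chainT EP) compm1.
Qed.

Lemma prodE_eq l l' : is_chain l -> is_chain l' -> chain_sub l l' ->
  chain_sub l' l -> prodE l =~ prodE l'.
Proof.
move=> cl cl' /allP ll' /allP l'l.
(* The composite of the two products equals either one, since each absorbs the factors of the
   other. *)
have <- : prodE l \c prodE l' =~ prodE l'.
  by apply: prodE_fixl => S Sl; apply: chain_sub_absl; rewrite ?ll'.
by apply: heq_sym; apply: prodE_fixr => S Sl; apply: chain_sub_absr; rewrite ?l'l.
Qed.

Lemma prodE_idem l : is_chain l -> prodE l \c prodE l =~ prodE l.
Proof. by move=> cl; apply: prodE_fixl => S; apply: chain_absl. Qed.

(* Along a segment from the cell of the preorder [rk1] to that of [rk2], the
   sets cut out at an intermediate point are lower sets [W] of the product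
   preorder.  The union of intersections of cuts exhausting such a [W] is built
   one [rk2]-level at a time. *)
Section Insertion.
Variables (rk1 rk2 : T -> nat).

Let cut1 S := [set i | [exists w in S, (rk1 i <= rk1 w)%N]].
Let cut2 m := [set i | (rk2 i < m)%N].

Definition lower_set W := [forall w in W, forall i,
  (rk1 i <= rk1 w)%N ==> (rk2 i <= rk2 w)%N ==> (i \in W)].

Variable y : hom C t t.
Hypothesis y_abs : forall S, E (cut1 S) \c y =~ y.

(** [cut2 j :&: V] is the intersection of [V] with a set whose idempotent [x] absorbs, so [chainI]
    makes it free next to [E V]. Hence [x \c E V] can take the role of [x] relative to the smaller
    set [V]. *)
Lemma insert_cut_abs x Z V : (forall j, x \c E (cut2 j :&: Z) =~ x) ->
  V \subset Z -> forall j, x \c E V \c E (cut2 j :&: V) =~ x \c E V.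
Proof.
move=> xP VZ j.
have -> : cut2 j :&: V = V :&: (cut2 j :&: Z).
  apply/setP=> i; rewrite [LHS]in_setI [RHS]in_setI in_setI.
  have [iV|//] := boolP (i \in V); last by rewrite andbF.
  by rewrite (subsetP VZ i iV) andbT.
rewrite -!compA -(chainC EP (subsetIl V (cut2 j :&: Z))).
have a (z : hom C t t) : x \c (E (cut2 j :&: Z) \c z) =~ x \c z.
  by rewrite compA xP.
by rewrite -(a (E V)) (chainI EP V (cut2 j :&: Z)) a.
Qed.

(** [x] absorbs the cuts of [rk2] inside [Z], and [y] those of [rk1]. The part of [W] below level
    [m.+1] arises from the part below [m] by a union with a cut of [rk1], free by [chainU] next to
    [y], and an intersection with a cut of [rk2], free by [chainI] next to [x]. *)
Lemma insert_level W m x Z : lower_set W -> W :&: cut2 m \subset Z ->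
  (forall j, x \c E (cut2 j :&: Z) =~ x) ->
  x \c E (W :&: cut2 m) \c y =~ x \c y.
Proof.
move=> Wl; elim: m x Z => [|m IH] x Z VZ xP.
  have -> : W :&: cut2 0 = set0 by apply/setP=> i; rewrite !inE ltn0 andbF.
  by rewrite (chain0 EP) compm1.
set V1 := W :&: cut2 m.+1 in VZ *; set V := W :&: cut2 m.
have VV1 : V \subset V1.
  by apply/subsetP=> i; rewrite !inE => /andP[-> /ltnW].
pose S := cut1 [set w in W | (m <= rk2 w)%N]; pose T1 := cut2 m.+1 :&: Z.
have V1E : V1 = T1 :&: (V :|: S).
  apply/setP=> i; apply/idP/idP => [iV1|].
    move: (iV1); rewrite !inE => /andP[iW im]; rewrite im (subsetP VZ) //= iW /=.
    case: (ltnP (rk2 i) m) => //= mi; apply/existsP; exists i.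
    by rewrite !inE iW mi leqnn.
  rewrite !inE => /andP[/andP[im iZ] /orP[/andP[iW _]|]]; first by rewrite iW.
  case/existsP=> w; rewrite !inE => /andP[/andP[wW mw] iw].
  rewrite im andbT; move/forallP: Wl => /(_ w); rewrite wW /= => /forallP/(_ i).
  by rewrite iw (leq_trans (im : (rk2 i <= m)%N) mw).
have VT1 : V \subset T1.
  apply/subsetP=> i iV; have := subsetP VV1 i iV; rewrite V1E inE.
  by case/andP.
have xyV : x \c E V \c y =~ x \c y.
  by apply: IH xP; apply: subset_trans VV1 VZ.
have e1 : E V \c (E (V :|: S) \c y) =~ E V \c y.
  by rewrite -(y_abs [set w in W | (m <= rk2 w)%N]) -/S [X in heq _ X]compA
    [X in heq _ (X \c _)](chainU EP) -!compA setUC.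
have e2 : E T1 \c E (V :|: S) =~ E V1 \c (E T1 \c E (V :|: S)).
  rewrite [X in heq X _](chainI EP) setIC -V1E !compA; apply: comp_heq => //.
  by apply: chain_comm; rewrite /cmpset V1E subsetIl orbT.
have e3 : x \c (E V1 \c E T1) =~ x \c E V1.
  rewrite -(chain_comm (S := T1)); last by rewrite /cmpset V1E subsetIl orbT.
  by rewrite (compA x) xP.
have cVT1 := chainC EP VT1.
have key : x \c (E V1 \c (E V \c y)) =~ x \c y.
  transitivity (x \c (E V \c (E V1 \c (E T1 \c (E (V :|: S) \c y))))).
    rewrite (compA (E V)) (chainC EP VV1) -(compA (E V1)) (compA (E V)).
    by rewrite cVT1 -(compA (E T1)) e1 (compA (E V1) (E T1)) (compA x (E V1 \c E T1)) e3 -(compA x).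
  rewrite (compA (E T1)) (compA (E V1)) -e2 -(compA (E T1)) (compA (E V)) cVT1.
  by rewrite -(compA (E T1)) e1 (compA x) xP compA xyV.
(* [E V] remains to be removed between [x \c E V1] and [y]: the induction hypothesis once more, with
   [x \c E V1] on the left and [V1] in place of [Z]. *)
rewrite -[X in heq _ X]key -compA; apply: heq_sym.
rewrite !compA; apply: (IH (x \c E V1) V1) => //.
exact: insert_cut_abs xP VZ.
Qed.

Lemma insert_chain l x : all lower_set l -> pairwise (fun V W => W \subset V) l ->
  (forall j, x \c E (cut2 j) =~ x) -> x \c prodE l \c y =~ x \c y.
Proof.
move=> ll lp xP.
have {}xP j : x \c E (cut2 j :&: setT) =~ x by rewrite setIT.
have lT : all (fun W => W \subset setT) l.
  by apply/allP => W _; apply: subsetT.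
elim: l x setT xP lT ll lp => [|W l IH] x Z xP /=; first by rewrite compm1.
case/andP=> WZ lZ /andP[Wl ll] /andP[lW lp].
(* The sets decrease along the list, so those that follow lie in [W] and are inserted with
   [x \c E W] on the left. *)
rewrite (compA x) (IH _ W) //; last exact: insert_cut_abs.
have WE : W = W :&: cut2 (\max_i rk2 i).+1.
  by apply/esym/setIidPl/subsetP => i _; rewrite inE ltnS; apply: leq_bigmax.
by rewrite WE; apply: (insert_level (Z := Z)) => //; rewrite -WE.
Qed.

End Insertion.
End ChainIdempotents.

(** * Inverses between the images of idempotents *)

Section Intertwining.
Variables (k : fieldType) (C : linCat k).

(** [h] inverts [c] between the images of [e1] and [e2]. The two absorption laws make [h] unique: a
    second inverse [h'] satisfies [h' =~ h' \c c \c h =~ h]. *)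
Record inv_between (t : C) (e1 e2 c h : hom C t t) : Prop := InvBetween {
  inv_l : h \c c =~ e1;
  inv_r : c \c h =~ e2;
  inv_absl : e1 \c h =~ h;
  inv_absr : h \c e2 =~ h
}.

Lemma inv_between_idem (t : C) (e1 e2 : hom C t t) :
  e2 =~ e1 -> e1 \c e1 =~ e1 -> inv_between e1 e2 (e2 \c e1) e1.
Proof. by move=> e ee; split; rewrite ?e ?ee. Qed.

(** The uniqueness argument for [h] with [x] carried through the middle. *)
Lemma inv_intertwine (t t' : C) e1 e2 c h e1' e2' c' h' (x : hom C t t') :
  inv_between e1 e2 c h -> inv_between e1' e2' c' h' ->
  x \c e1 =~ e1' \c x -> x \c e2 =~ e2' \c x -> x \c c =~ c' \c x ->
  x \c h =~ h' \c x.
Proof.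
move=> hP h'P xe1 xe2 xc.
rewrite -(inv_absl hP) compA xe1 -(inv_l h'P) -!compA (compA c') -xc.
by rewrite -compA (inv_r hP) xe2 compA (inv_absr h'P).
Qed.

Lemma prodE_intertwine (t t' : C) (T T' : finType) (E : {set T} -> hom C t t)
    (E' : {set T'} -> hom C t' t') (x : hom C t t') l (f : {set T} -> {set T'}) :
  (forall S, S \in l -> x \c E S =~ E' (f S) \c x) ->
  x \c prodE E l =~ prodE E' (map f l) \c x.
Proof.
elim: l => [|S l IH] h /=; first by rewrite comp1m compm1.
rewrite compA h ?mem_head // -compA IH ?compA // => V Vl.
by apply: h; rewrite inE Vl orbT.
Qed.

(* The chain of the partition whose blocks are [U], [S], [W] and the rest. *)
Definition cuts3 (T : finType) (U S W : {set T}) :=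
  [:: U; U :|: S; U :|: (S :|: W)].

(** Seen at one object, the wall-crossing from one partition to another is the product of their
    idempotents. Here the two partitions differ by exchanging the adjacent blocks [S] and [W]. *)
Definition swap_inv (t : C) (T : finType) (E : {set T} -> hom C t t)
    (U S W : {set T}) (h : hom C t t) :=
  inv_between (prodE E (cuts3 U S W)) (prodE E (cuts3 U W S))
    (prodE E (cuts3 U W S) \c prodE E (cuts3 U S W)) h.

Lemma swap_inv_intertwine (t t' : C) (T T' : finType)
    (E : {set T} -> hom C t t) (E' : {set T'} -> hom C t' t') (x : hom C t t')
    (U S W : {set T}) (U' S' W' : {set T'}) h h' :
  swap_inv E U S W h -> swap_inv E' U' S' W' h' ->
  x \c E U =~ E' U' \c x -> x \c E (U :|: S) =~ E' (U' :|: S') \c x ->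
  x \c E (U :|: W) =~ E' (U' :|: W') \c x ->
  x \c E (U :|: (S :|: W)) =~ E' (U' :|: (S' :|: W')) \c x ->
  x \c h =~ h' \c x.
Proof.
move=> hP h'P xU xS xW xSW.
have e1 : x \c prodE E (cuts3 U S W) =~ prodE E' (cuts3 U' S' W') \c x.
  by rewrite /= !compm1 compA xU -compA (compA x) xS -compA xSW !compA.
have e2 : x \c prodE E (cuts3 U W S) =~ prodE E' (cuts3 U' W' S') \c x.
  rewrite /= !compm1 compA xU -compA (compA x) xW -compA ![_ :|: S]setUC.
  by rewrite (setUC W') xSW !compA.
apply: (inv_intertwine hP h'P e1 e2).
by rewrite compA e2 -compA e1 compA.
Qed.

(* Refining the blocks [U] and [~: (U :|: S :|: W)] multiplies the two chains by
   a common factor [K]. *)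
Lemma swap_inv_refine (t : C) (T : finType) (E : {set T} -> hom C t t)
    (U S W : {set T}) h K e1 e2 :
  swap_inv E U S W h -> K \c K =~ K ->
  (forall V, V \in [:: U; U :|: S; U :|: W; U :|: (S :|: W)] -> K \c E V =~ E V \c K) ->
  e1 =~ K \c prodE E (cuts3 U S W) -> e2 =~ K \c prodE E (cuts3 U W S) ->
  inv_between e1 e2 (e2 \c e1) (e1 \c (h \c e2)).
Proof.
move=> hP KK KE e1K e2K.
have Kh : K \c h =~ h \c K.
  by apply: (swap_inv_intertwine hP hP); apply: KE; rewrite !inE eqxx ?orbT.
have [hl hr al ar] := hP.
set f1 := prodE E (cuts3 U S W) in e1K hl hr al *.
set f2 := prodE E (cuts3 U W S) in e2K hl hr ar *.
have Kf1 : K \c f1 =~ f1 \c K.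
  by apply: prodE_comm => V Vl; apply: KE; move: Vl; rewrite !inE => /or3P[]->;
    rewrite ?orbT.
have Kf2 : K \c f2 =~ f2 \c K.
  apply: prodE_comm => V Vl; apply: KE; move: Vl.
  by rewrite !inE [W :|: S]setUC => /or3P[]->; rewrite ?orbT.
have aux : (K \c f1) \c (K \c h) =~ K \c h.
  by rewrite -(compA K f1) (compA f1 K) -Kf1 -(compA K f1) al compA KK.
have hE : e1 \c (h \c e2) =~ K \c h.
  by rewrite e1K e2K Kf2 (compA h) ar -Kh aux.
have cE : e2 \c e1 =~ K \c (f2 \c f1).
  by rewrite e2K e1K -(compA K f2) (compA f2 K) -Kf2 -(compA K f2) (compA K K) KK.
split; rewrite hE ?cE.
- by rewrite -(compA K h) (compA h K) -Kh -(compA K h) hl compA KK e1K.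
- by rewrite Kh -(compA K) (compA (f2 \c f1)) hr -Kf2 compA KK e2K.
- by rewrite e1K aux.
- by rewrite e2K -(compA K h) (compA h K) -Kh -(compA K h) ar compA KK.
Qed.

End Intertwining.

(** * The double incidence category *)

Section Partitions.
Variables (R : realType) (n : nat).
Local Notation osp := (osp n).
Implicit Types (p q r : osp) (rk : 'I_n -> nat).

Lemma part_lt p i : (part_of p i < size (sval p))%N.
Proof.
rewrite /part_of -has_find.
case: p => s /= /and3P[_ _ /eqP /setP/(_ i)]; rewrite in_setT.
elim: s => [|A s IH]; first by rewrite big_nil in_set0.
by rewrite big_cons in_setU /=; case: (i \in A) => //= /IH.
Qed.

Definition finer p q :=
  forall i j, (part_of p i <= part_of p j)%N -> (part_of q i <= part_of q j)%N.

Lemma flagE p nu (v : 'cV[R[i]]_n) :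
  flag p nu v <-> forall i, v i 0 != 0 -> (part_of p i < nu)%N.
Proof.
by split=> h i /h; rewrite /part_of has_take // has_find part_lt.
Qed.

Lemma parabolicE p (X : 'M[R[i]]_n) :
  parabolic p X <-> forall i j, X i j != 0 -> (part_of p i <= part_of p j)%N.
Proof.
split=> [XP i j Xij|XP nu v /flagE vP]; last first.
  apply/flagE => i; apply: contraNltn => pi; rewrite mxE big1 // => j _.
  have [->|/vP pj] := eqVneq (v j 0) 0; first by rewrite mulr0.
  have [->|/XP pij] := eqVneq (X i j) 0; first by rewrite mul0r.
  by have := leq_trans pi pij; rewrite leqNgt pj.
have fd : flag p (part_of p j).+1 (delta_mx j 0 : 'cV[R[i]]_n).
  apply/flagE => l; rewrite mxE eqxx andbT.
  by have [-> //|_] := eqVneq l j; rewrite eqxx.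
have /flagE/(_ i) := XP _ _ fd.
by rewrite -colE mxE ltnS; apply.
Qed.

Lemma psubE p q : psub R p q <-> finer p q.
Proof.
split=> [pq i j pij|pq X /parabolicE XP]; last first.
  by apply/parabolicE => i j /XP /pq.
have /pq /parabolicE : parabolic p (delta_mx i j : 'M[R[i]]_n).
  apply/parabolicE => i' j'; rewrite mxE.
  by case: andP => [[/eqP-> /eqP->]//|_]; rewrite eqxx.
by apply; rewrite mxE !eqxx oner_neq0.
Qed.

(** A rank function need not be normalized to consecutive values. Rank functions can therefore be
    added, which is how partitions lying between two others are produced. *)
Definition ranks p rk :=
  forall i j, (part_of p i <= part_of p j)%N = (rk i <= rk j)%N.

Lemma cell_ranks p rk : ranks p rk -> cell p (\row_i (rk i)%:R : 'rV[R]_n).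
Proof.
move=> pr i j; rewrite !mxE; split=> [e|].
  have /eqP -> // : rk i == rk j.
  by rewrite eqn_leq -!pr e leqnn.
by rewrite ltnNge pr -ltnNge ltr_nat.
Qed.

(** The rank functions are themselves points of the two cells, and half of their sum is the midpoint
    of the segment; halving does not leave a cell. *)
Lemma ranks_collinear p q r rk1 rk2 : ranks p rk1 -> ranks r rk2 ->
  ranks q (fun i => rk1 i + rk2 i)%N -> collinear R p q r.
Proof.
move=> /cell_ranks h1 /cell_ranks h2 /cell_ranks h.
have cs s (t : 'rV[R]_n) : cell s t -> cell s (2^-1 *: t).
  move=> st i j; rewrite !mxE; have [e l] := st i j; split=> [/e -> //|/l].
  by rewrite ltr_pM2l // invr_gt0 ltr0n.
exists (\row_i (rk1 i)%:R), (2^-1 *: \row_i (rk1 i + rk2 i)%:R), (\row_i (rk2 i)%:R).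
split=> //; first exact: cs.
exists 2^-1.
  by rewrite invr_ge0 ler0n invf_le1 ?ltr0n // ler1n.
apply/rowP => i; rewrite !mxE natrD mulrDr; congr (_ * _ + _).
by rewrite {2}(splitr 1) -[1 / 2]/(1 * 2^-1) mul1r addrK.
Qed.

(** The coordinates of a point of the segment are convex combinations of those of its ends, so they
    compare as the ends do where these agree. This makes the cuts of the middle partition lower sets
    for [insert_chain]. *)
Lemma collinear_mono p q r i j : collinear R p q r ->
  (part_of p i <= part_of p j)%N -> (part_of r i <= part_of r j)%N ->
  (part_of q i <= part_of q j)%N.
Proof.
have cle s (t : 'rV[R]_n) : cell s t -> (part_of s i <= part_of s j)%N ->
    t 0 i <= t 0 j.
  move=> st; rewrite leq_eqVlt => /orP[/eqP|].
    by case: (st i j) => h _ /h ->.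
  by case: (st i j) => _ h /h /ltW.
move=> [a [b [c [pa qb rc [s /andP[s0 s1] e]]]]] /(cle _ _ pa) aij /(cle _ _ rc) cij.
rewrite leqNgt; apply/negP => qji; have [_ /(_ qji)] := qb j i.
rewrite e !mxE ltNge => /negP; apply; apply: lerD.
  by apply: ler_wpM2l => //; rewrite subr_ge0.
exact: ler_wpM2l.
Qed.

(** Restricting to attained values keeps the parts nonempty. *)
Definition rk_vals rk := [seq v <- iota 0 (\max_i rk i).+1 | v \in codom rk].

Definition rk_seq rk := [seq [set i | rk i == v] | v <- rk_vals rk].

Lemma mem_rk_vals rk i : rk i \in rk_vals rk.
Proof.
by rewrite mem_filter codom_f mem_iota /= ltnS; apply: leq_bigmax.
Qed.

Lemma rk_seq_subproof rk : is_osp (rk_seq rk).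
Proof.
apply/and3P; split.
- rewrite all_map; apply/allP => v; rewrite mem_filter => /andP[/codomP[i ->] _].
  by apply/set0Pn; exists i; rewrite inE.
- rewrite pairwise_map; apply: (@sub_pairwise _ [rel a b | a != b]).
    move=> a b /= ab; rewrite -setI_eq0; apply/eqP/setP => i.
    by rewrite !inE; apply/negP => /andP[/eqP-> /eqP e]; rewrite e eqxx in ab.
  by rewrite -uniq_pairwise filter_uniq ?iota_uniq.
- apply/eqP/setP => i; rewrite in_setT big_map.
  have := mem_rk_vals rk i; elim: (rk_vals rk) => //= v s IH.
  by rewrite big_cons !inE => /orP[->//|/IH ->]; rewrite orbT.
Qed.

Definition osp_rk rk : osp := exist _ (rk_seq rk) (rk_seq_subproof rk).

Lemma part_of_rk rk i : part_of (osp_rk rk) i = index (rk i) (rk_vals rk).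
Proof.
rewrite /part_of /= /rk_seq find_map; apply: eq_find => v /=.
by rewrite inE eq_sym.
Qed.

Lemma ranks_rk rk : ranks (osp_rk rk) rk.
Proof.
have st : sorted ltn (rk_vals rk).
  by apply: sorted_filter; [exact: ltn_trans|exact: iota_ltn_sorted].
have lt i j : (part_of (osp_rk rk) i < part_of (osp_rk rk) j)%N ->
    (rk i < rk j)%N.
  rewrite !part_of_rk => h.
  by apply: (sorted_ltn_index ltn_trans st) h; rewrite mem_rk_vals.
have eq i j : rk i = rk j -> part_of (osp_rk rk) i = part_of (osp_rk rk) j.
  by rewrite !part_of_rk => ->.
move=> i j; apply/idP/idP.
  apply: contraTT; rewrite -!ltnNge => h; rewrite ltn_neqAle.
  rewrite leqNgt; apply/andP; split.
    apply: contraTneq h => /esym e; rewrite -leqNgt.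
    move: e; rewrite !part_of_rk => /(congr1 (nth 0%N (rk_vals rk))).
    by rewrite !nth_index ?mem_rk_vals // => ->.
  by apply/negP => /lt; rewrite ltnNge (ltnW h).
apply: contraTT; rewrite -!ltnNge; exact: lt.
Qed.

Lemma rk_valsE rk K : (forall i, (rk i < K)%N) ->
  rk_vals rk = [seq v <- iota 0 K | v \in codom rk].
Proof.
move=> rkK; apply: (irr_sorted_eq ltn_trans ltnn).
- by apply: sorted_filter; [exact: ltn_trans|exact: iota_ltn_sorted].
- by apply: sorted_filter; [exact: ltn_trans|exact: iota_ltn_sorted].
move=> v; rewrite !mem_filter !mem_iota /= !add0n.
have [/codomP[i ->]|//] := boolP (v \in codom rk).
by rewrite rkK ltnS leq_bigmax.
Qed.

(** For disjoint sets: 0 on [U], 1 on [S], 2 on [W], 3 elsewhere. Each of the three indicators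
    belongs to one cut of [cuts3] and is added by one collinear step in [prodE_cuts3]. *)
Definition rk3 (U S W : {set 'I_n}) i :=
  ((i \notin U :|: (S :|: W)) + (i \notin U :|: S) + (i \notin U))%N.

Definition swappable (U S W : {set 'I_n}) :=
  [&& [disjoint U & S], [disjoint U & W], [disjoint S & W], S != set0 & W != set0].

Lemma rk3_seq U S W : swappable U S W -> sval (osp_rk (rk3 U S W)) =
  [seq A <- [:: U] | A != set0] ++ S :: W ::
  [seq A <- [:: ~: (U :|: (S :|: W))] | A != set0].
Proof.
case/and5P=> US UW SW /set0Pn[s sS] /set0Pn[w wW].
have D i : ~~ ((i \in U) && (i \in S)) && ~~ ((i \in U) && (i \in W)) &&
    ~~ ((i \in S) && (i \in W)).
  move: US UW SW; rewrite -!setI_eq0 => /eqP/setP/(_ i) + /eqP/setP/(_ i) + /eqP/setP/(_ i).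
  by rewrite !inE => -> -> ->.
rewrite /= /rk_seq (rk_valsE (K := 4)); last first.
  by move=> i; rewrite /rk3; do 3!case: (_ \notin _).
have E v (A : {set 'I_n}) : (forall i, (rk3 U S W i == v) = (i \in A)) ->
    (v \in codom (rk3 U S W)) = (A != set0) /\ [set i | rk3 U S W i == v] = A.
  move=> vA; split; last by apply/setP => i; rewrite inE vA.
  apply/codomP/set0Pn => [[i e]|[i iA]]; exists i; first by rewrite -vA e.
  by apply/eqP; rewrite eq_sym vA.
have [|c0 A0] := E 0%N U.
  by move=> i; rewrite /rk3 !inE; move: (D i); do 3!case: (i \in _).
have [|c1 A1] := E 1%N S.
  by move=> i; rewrite /rk3 !inE; move: (D i); do 3!case: (i \in _).
have [|c2 A2] := E 2%N W.
  by move=> i; rewrite /rk3 !inE; move: (D i); do 3!case: (i \in _).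
have [|c3 A3] := E 3%N (~: (U :|: (S :|: W))).
  by move=> i; rewrite /rk3 !inE; move: (D i); do 3!case: (i \in _).
have S0 : S != set0 by apply/set0Pn; exists s.
have W0 : W != set0 by apply/set0Pn; exists w.
rewrite /= c0 c1 c2 c3 S0 W0.
by case: (U != set0); case: (~: _ != set0); rewrite /= ?A0 ?A1 ?A2 ?A3.
Qed.

Lemma exch_rk3 U S W : swappable U S W ->
  exch (osp_rk (rk3 U S W)) (osp_rk (rk3 U W S)).
Proof.
move=> sw; have sw' : swappable U W S.
  case/and5P: sw => *; apply/and5P; split=> //; by rewrite disjoint_sym.
exists [seq A <- [:: U] | A != set0], S, W.
exists [seq A <- [:: ~: (U :|: (S :|: W))] | A != set0].
by rewrite !rk3_seq // [W :|: S]setUC.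
Qed.

Lemma part_top i : part_of (osp_top n) i = 0%N.
Proof.
have := part_lt (osp_top n) i; rewrite /= /osp_top_seq /=.
by case: ifP => //= _; case: (part_of _ _).
Qed.

End Partitions.

(** * Idempotents and wall-crossing inverses at the object gl_n *)

Section DoubleIncidenceIdempotents.
Variables (k : fieldType) (R : realType) (n : nat).
Local Notation Q := (Q k R n).
Local Notation osp := (osp n).
Local Notation top := (osp_top n).
Implicit Types (p q r : osp) (S W U V : {set 'I_n}) (rk : 'I_n -> nat).

Definition incl p : hom Q p top := q_Ind k (psub_top (R := R) (I := p)).
Definition proj p : hom Q top p := q_Res k (psub_top (R := R) (I := p)).

Lemma projK p : proj p \c incl p =~ idm (p : Q).
Proof. exact: qe_ResInd. Qed.

Lemma incl_Ind p q (h : psub R p q) : incl q \c (q_Ind k h : hom Q p q) =~ incl p.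
Proof. exact: qe_IndM. Qed.

Lemma proj_Res p q (h : psub R p q) : (q_Res k h : hom Q q p) \c proj q =~ proj p.
Proof. exact: qe_ResM. Qed.

Definition osp_idem p : hom Q top top := incl p \c proj p.

Lemma osp_idem_incl p : osp_idem p \c incl p =~ incl p.
Proof. by rewrite /osp_idem -compA projK compm1. Qed.

Lemma osp_idem_proj p : proj p \c osp_idem p =~ proj p.
Proof. by rewrite /osp_idem compA projK comp1m. Qed.

Lemma osp_idem_id p : osp_idem p \c osp_idem p =~ osp_idem p.
Proof. by rewrite {2}/osp_idem compA osp_idem_incl. Qed.

Lemma osp_idem_finer p q : finer p q -> osp_idem q \c osp_idem p =~ osp_idem p.
Proof.
move=> /psubE - /(_ R) h; rewrite {2 3}/osp_idem -(incl_Ind h) compA.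
by rewrite [osp_idem q \c _]compA osp_idem_incl.
Qed.

Lemma osp_idem_finerr p q : finer p q -> osp_idem p \c osp_idem q =~ osp_idem p.
Proof.
move=> /psubE - /(_ R) h; rewrite {1 3}/osp_idem -(proj_Res h) -!compA.
by rewrite osp_idem_proj.
Qed.

Lemma osp_idem_eq p q : finer p q -> finer q p -> osp_idem p =~ osp_idem q.
Proof. by move=> /osp_idem_finer <- /osp_idem_finerr ->. Qed.

(** The relation [qe_tauM], composed with [incl r] on the left and [proj p] on the right. *)
Lemma osp_idem_collinear p q r : collinear R p q r ->
  osp_idem r \c (osp_idem q \c osp_idem p) =~ osp_idem r \c osp_idem p.
Proof.
move=> h; rewrite /osp_idem -!compA; apply: comp_heq => //.
rewrite !compA; apply: comp_heq => //.
have e : proj r \c incl p =~ (proj r \c incl q) \c (proj q \c incl p) :=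
  qe_tauM k h.
by rewrite e !compA.
Qed.

Lemma osp_idem_top : osp_idem top =~ idm (top : Q).
Proof.
have e1 : incl top =~ idm (top : Q) := qe_Ind1 k _.
have e2 : proj top =~ idm (top : Q) := qe_Res1 k _.
by rewrite /osp_idem e1 e2 comp1m.
Qed.

Definition osp2 S : osp := osp_rk (fun i => (i \notin S) : nat).

Definition qE S : hom Q top top := osp_idem (osp2 S).

Lemma finer_ranks p q rk rk' : ranks p rk -> ranks q rk' ->
  (forall i j, (rk i <= rk j)%N -> (rk' i <= rk' j)%N) -> finer p q.
Proof. by move=> hp hq h i j; rewrite hp hq; apply: h. Qed.

Lemma qE_top S : (forall i j, (i \in S) = (j \in S)) -> qE S =~ idm (top : Q).
Proof.
move=> h; rewrite -osp_idem_top; apply: osp_idem_eq => i j _.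
  by rewrite part_top.
by rewrite ranks_rk (h i j).
Qed.

(* The level sets of the sum of the two rank functions are the minimal
   partition visited between (S, ~: S) and (W, ~: W). *)
Lemma qE_comp S W rk : (forall i, rk i = (i \notin S) + (i \notin W))%N ->
  qE W \c (osp_idem (osp_rk rk) \c qE S) =~ qE W \c qE S.
Proof.
move=> e; apply: osp_idem_collinear.
apply: ranks_collinear (ranks_rk _) (ranks_rk _) _ => i j.
by rewrite ranks_rk !e.
Qed.

(** The partition halfway from [S] to [W] has the cuts [S :&: W] and [S :|: W], so it serves as the
    meet. For nested sets it refines both ends, and the products in either order collapse to its
    idempotent. *)
Lemma qE_chain : chain_idem (C := Q) (t := top) qE.
Proof.
have id S : qE S \c qE S =~ qE S by exact: osp_idem_id.
have comm S W : S \subset W -> qE S \c qE W =~ qE W \c qE S.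
  move=> /subsetP SW; pose rk i := ((i \notin S) + (i \notin W))%N.
  have f1 : finer (osp_rk rk) (osp2 S).
    apply: finer_ranks (ranks_rk _) (ranks_rk _) _ => i j; rewrite /rk.
    by move: (SW i) (SW j); do 4!case: (_ \in _) => //; move=> *; exfalso; auto.
  have f2 : finer (osp_rk rk) (osp2 W).
    apply: finer_ranks (ranks_rk _) (ranks_rk _) _ => i j; rewrite /rk.
    by move: (SW i) (SW j); do 4!case: (_ \in _) => //; move=> *; exfalso; auto.
  rewrite -(qE_comp (S := W) (W := S) (rk := rk)); last by move=> i; rewrite addnC.
  rewrite -(qE_comp (S := S) (W := W) (rk := rk)) //.
  rewrite (osp_idem_finerr f2) (osp_idem_finerr f1).
  by rewrite (osp_idem_finer f1) (osp_idem_finer f2).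
apply: (chain_idem_meet
  (o := fun S W => osp_idem (osp_rk (fun i => (i \notin S) + (i \notin W))%N))).
- by apply: qE_top => i j; rewrite !in_set0.
- by apply: qE_top => i j; rewrite !in_setT.
- exact: id.
- exact: comm.
- by move=> S W; apply: qE_comp.
- move=> S W; apply: osp_idem_finer.
  apply: finer_ranks (ranks_rk _) (ranks_rk _) _ => i j; rewrite !inE.
  by do 4!case: (_ \in _).
- move=> S W; apply: osp_idem_finer.
  apply: finer_ranks (ranks_rk _) (ranks_rk _) _ => i j; rewrite !inE.
  by do 4!case: (_ \in _).
Qed.

Definition cut p m : {set 'I_n} := [set i | (part_of p i < m)%N].
Definition cuts p : seq {set 'I_n} := [seq cut p m | m <- rev (iota 0 (size (sval p)).+1)].

Lemma cut_sub p m m' : (m <= m')%N -> cut p m \subset cut p m'.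
Proof.
by move=> mm'; apply/subsetP => i; rewrite !inE => h; apply: leq_trans h mm'.
Qed.

Lemma cuts_chain p : is_chain (cuts p).
Proof.
apply/allP => _ /mapP[m _ ->]; apply/allP => _ /mapP[m' _ ->].
by apply/orP; case/orP: (leq_total m m') => h; [left|right]; apply: cut_sub.
Qed.

(** Truncating part indices at [m] gives coarsenings of [p]. Since [minn r m.+1] is [minn r m] plus
    the indicator of [m < r], the truncation at [m.+1] lies between the truncation at [m] and the
    two-block partition of the next cut, and it refines both; this triple contributes one factor. *)
Lemma osp_idem_cuts p : osp_idem p =~ prodE qE (cuts p).
Proof.
pose pm m := osp_rk (fun i => minn (part_of p i) m).
have key m : osp_idem (pm m) =~ prodE qE [seq cut p m | m <- rev (iota 0 m.+1)].
  elim: m => [|m IH].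
    have -> : prodE qE [seq cut p m | m <- rev (iota 0 1)] =~ idm (top : Q).
      have -> : [seq cut p m | m <- rev (iota 0 1)] = [:: cut p 0] by [].
      by rewrite prodE1 qE_top // => i j; rewrite !inE !ltn0.
    rewrite -osp_idem_top.
    apply: osp_idem_eq => i j _; first by rewrite part_top.
    by rewrite ranks_rk !minn0.
  have -> : [seq cut p m | m <- rev (iota 0 m.+2)] =
      cut p m.+1 :: [seq cut p m | m <- rev (iota 0 m.+1)].
    by rewrite -(addn1 m.+1) iotaD rev_cat map_cat.
  rewrite prodE_cons -IH.
  have c : collinear R (pm m) (pm m.+1) (osp2 (cut p m.+1)).
    apply: ranks_collinear (ranks_rk _) (ranks_rk _) _ => i j.
    by rewrite ranks_rk !inE; lia.
  have f1 : finer (pm m.+1) (pm m).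
    apply: finer_ranks (ranks_rk _) (ranks_rk _) _ => i j; lia.
  have f2 : finer (pm m.+1) (osp2 (cut p m.+1)).
    apply: finer_ranks (ranks_rk _) (ranks_rk _) _ => i j; rewrite !inE; lia.
  by rewrite -(osp_idem_collinear c) (osp_idem_finerr f1) (osp_idem_finer f2).
rewrite -key; apply: osp_idem_eq => i j; rewrite ranks_rk.
all: have hi := part_lt p i.
all: have hj := part_lt p j.
all: lia.
Qed.

Lemma qE_osp_rk S rk rk' : (forall i, rk' i = (i \notin S) + rk i)%N ->
  (forall i j, (rk' i <= rk' j)%N ->
    (rk i <= rk j)%N /\ ((i \notin S) <= (j \notin S))%N) ->
  qE S \c osp_idem (osp_rk rk) =~ osp_idem (osp_rk rk').
Proof.
move=> e h.
have c : collinear R (osp_rk rk) (osp_rk rk') (osp2 S).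
  apply: ranks_collinear (ranks_rk _) (ranks_rk _) _ => i j.
  by rewrite ranks_rk !e addnC [(_ + rk j)%N]addnC.
have f1 : finer (osp_rk rk') (osp_rk rk).
  by apply: finer_ranks (ranks_rk _) (ranks_rk _) _ => i j /h[].
have f2 : finer (osp_rk rk') (osp2 S).
  by apply: finer_ranks (ranks_rk _) (ranks_rk _) _ => i j /h[].
by rewrite -(osp_idem_collinear c) (osp_idem_finerr f1) (osp_idem_finer f2).
Qed.

Lemma prodE_cuts3 U S W :
  prodE qE (cuts3 U S W) =~ osp_idem (osp_rk (rk3 U S W)).
Proof.
rewrite /cuts3 !prodE_cons [prodE _ [::]]/(idm (top : Q)) compm1.
rewrite (@qE_osp_rk (U :|: S) (fun i => (i \notin U :|: (S :|: W)) : nat)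
  (fun i => (i \notin U :|: (S :|: W)) + (i \notin U :|: S))%N).
- apply: qE_osp_rk => [i|i j]; first by rewrite /rk3 addnC.
  rewrite /rk3 !inE.
  by do 6!case: (_ \in _).
- by move=> i; rewrite addnC.
- by move=> i j; rewrite !inE; do 6!case: (_ \in _).
Qed.

Lemma tauV_inv p q (h : exch p q) :
  inv_between (osp_idem p) (osp_idem q) (osp_idem q \c osp_idem p)
    (incl p \c ((q_tauV k R h : hom Q q p) \c proj q)).
Proof.
have e1 : (q_tauV k R h : hom Q q p) \c (proj q \c incl p) =~ idm (p : Q) :=
  qe_tauK k R h.
have e2 : (proj q \c incl p) \c (q_tauV k R h : hom Q q p) =~ idm (q : Q) :=
  qe_tauVK k R h.
split.
- rewrite (compA _ (osp_idem q)) -(compA (incl p)) -(compA _ (proj q)).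
  rewrite osp_idem_proj /osp_idem -(compA (incl p)) -(compA _ (proj q)).
  by rewrite (compA (proj q)) (compA _ (proj q \c incl p)) e1 comp1m.
- rewrite -(compA (osp_idem q)) (compA (osp_idem p)) osp_idem_incl /osp_idem.
  rewrite -(compA (incl q)) (compA (proj q) (incl p)) (compA (proj q \c incl p)).
  by rewrite e2 comp1m.
- by rewrite compA osp_idem_incl.
- by rewrite -(compA (incl p)) -(compA _ (proj q)) osp_idem_proj.
Qed.

(** The formal inverse takes a proof that the partitions differ by an exchange, available only for
    nonempty [S] and [W] and disjoint blocks; the dependent match supplies it. If [S] or [W] is
    empty, the exchange changes nothing and the idempotent is its own inverse. *)
Definition qh U S W : hom Q top top :=
  match swappable U S W as b return swappable U S W = b -> hom Q top top with
  | true => fun sw =>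
      incl _ \c ((q_tauV k R (exch_rk3 sw) : hom Q _ _) \c proj _)
  | false => fun _ => osp_idem (osp_rk (rk3 U S W))
  end erefl.

Lemma qhP U S W : [disjoint U & S] -> [disjoint U & W] -> [disjoint S & W] ->
  swap_inv (t := top : Q) qE U S W (qh U S W).
Proof.
move=> US UW SW; rewrite /swap_inv.
have e1 := prodE_cuts3 U S W; have e2 := prodE_cuts3 U W S.
suff : inv_between (osp_idem (osp_rk (rk3 U S W))) (osp_idem (osp_rk (rk3 U W S)))
    (osp_idem (osp_rk (rk3 U W S)) \c osp_idem (osp_rk (rk3 U S W))) (qh U S W).
  by case=> h1 h2 h3 h4; split; rewrite ?e1 ?e2.
rewrite /qh; move: (erefl (swappable U S W)).
case: {2 3}(swappable U S W) => [sw|]; first exact: tauV_inv.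
move/negbT; rewrite /swappable US UW SW /= negb_and !negbK => SW0.
have f : finer (osp_rk (rk3 U S W)) (osp_rk (rk3 U W S)) /\
         finer (osp_rk (rk3 U W S)) (osp_rk (rk3 U S W)).
  split; apply: finer_ranks (ranks_rk _) (ranks_rk _) _ => i j; rewrite /rk3 !inE;
  case/orP: SW0 => /eqP->; rewrite !in_set0; do 4!case: (_ \in _) => //.
have e : osp_idem (osp_rk (rk3 U W S)) =~ osp_idem (osp_rk (rk3 U S W)).
  by case: f => f1 f2; apply: osp_idem_eq.
exact: inv_between_idem e (osp_idem_id _).
Qed.

End DoubleIncidenceIdempotents.

(** * Set bialgebras *)

Section CompRewriting.
Variables (k : fieldType) (C : linCat k).

(** Composites are kept nested to the right; this lemma and the next two apply an equation to a
    prefix of such a composite. *)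
Lemma comp2 (a b c d : C) (f : hom C b c) (g : hom C a b) h (x : hom C d a) :
  f \c g =~ h -> f \c (g \c x) =~ h \c x.
Proof. by move=> e; rewrite compA e. Qed.

Lemma comp22 (a b b' c d : C) (f : hom C b c) (g : hom C a b) (h : hom C b' c)
    (l : hom C a b') (x : hom C d a) :
  f \c g =~ h \c l -> f \c (g \c x) =~ h \c (l \c x).
Proof. by move=> e; rewrite !compA e. Qed.

Lemma comp3 (a b c d e : C) (f : hom C c d) (g : hom C b c) (h : hom C a b) r
    (x : hom C e a) :
  f \c (g \c h) =~ r -> f \c (g \c (h \c x)) =~ r \c x.
Proof. by move=> er; rewrite !compA -(compA f) er. Qed.

Lemma iso_monic (a b c : C) (i : hom C b c) (j : hom C c b) (f g : hom C a b) :
  j \c i =~ idm b -> i \c f =~ i \c g -> f =~ g.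
Proof. by move=> ji e; rewrite -(comp1m f) -ji -compA e compA ji comp1m. Qed.

Lemma iso_epic (a b c : C) (i : hom C a b) (j : hom C b a) (f g : hom C b c) :
  i \c j =~ idm b -> f \c i =~ g \c i -> f =~ g.
Proof. by move=> ij e; rewrite -(compm1 f) -ij compA e -compA ij compm1. Qed.

End CompRewriting.

(** * Unit coherence in a braided category *)

Section Braided.
Variable k : fieldType.
Local Notation SB := (SB k).
Implicit Types a b c d : SB.

Definition tens a a' b b' (f : hom SB a a') (g : hom SB b b') :
  hom SB (a \ox b) (a' \ox b') := sb_tens f g.
Definition asc a b c : hom SB ((a \ox b) \ox c) (a \ox (b \ox c)) :=
  sb_assoc k a b c.
Definition ascV a b c : hom SB (a \ox (b \ox c)) ((a \ox b) \ox c) :=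
  sb_assocV k a b c.
Definition lun a : hom SB (sb1 \ox a) a := sb_lunit k a.
Definition lunV a : hom SB a (sb1 \ox a) := sb_lunitV k a.
Definition run a : hom SB (a \ox sb1) a := sb_runit k a.
Definition runV a : hom SB a (a \ox sb1) := sb_runitV k a.
Definition brd a b : hom SB (a \ox b) (b \ox a) := sb_braid k a b.
Definition brdV a b : hom SB (b \ox a) (a \ox b) := sb_braidV k a b.

Local Notation "f \ot g" := (tens f g) (at level 35) : lincat_scope.
Local Notation "1_ a" := (@idm k SB a) (at level 0, a at level 0, format "1_ a").

#[global] Instance tens_proper a a' b b' :
  Proper (@heq k SB a a' ==> @heq k SB b b' ==> @heq k SB _ _) (@tens a a' b b').
Proof. by move=> f f' ff' g g' gg'; apply: sbe_tens. Qed.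

Lemma tens1 a b : 1_ a \ot 1_ b =~ 1_ (a \ox b).
Proof. exact: sbe_tens1. Qed.

Lemma tensM a a' a'' b b' b'' (f' : hom SB a' a'') (f : hom SB a a')
    (g' : hom SB b' b'') (g : hom SB b b') :
  (f' \c f) \ot (g' \c g) =~ (f' \ot g') \c (f \ot g).
Proof. exact: sbe_tensM. Qed.

Lemma tensMl a a' a'' b (f' : hom SB a' a'') (f : hom SB a a') :
  (f' \c f) \ot 1_ b =~ (f' \ot 1_ b) \c (f \ot 1_ b).
Proof. by rewrite -tensM comp1m. Qed.

Lemma tensMr a b b' b'' (g' : hom SB b' b'') (g : hom SB b b') :
  1_ a \ot (g' \c g) =~ (1_ a \ot g') \c (1_ a \ot g).
Proof. by rewrite -tensM comp1m. Qed.

Lemma tens_lr a a' b b' (f : hom SB a a') (g : hom SB b b') :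
  (f \ot 1_ b') \c (1_ a \ot g) =~ f \ot g.
Proof. by rewrite -tensM compm1 comp1m. Qed.

Lemma tens_rl a a' b b' (f : hom SB a a') (g : hom SB b b') :
  (1_ a' \ot g) \c (f \ot 1_ b) =~ f \ot g.
Proof. by rewrite -tensM compm1 comp1m. Qed.

Lemma ascK a b c : ascV a b c \c asc a b c =~ 1_ _.
Proof. exact: sbe_assocK. Qed.
Lemma ascVK a b c : asc a b c \c ascV a b c =~ 1_ _.
Proof. exact: sbe_assocVK. Qed.
Lemma lunK a : lunV a \c lun a =~ 1_ _.
Proof. exact: sbe_lunitK. Qed.
Lemma lunVK a : lun a \c lunV a =~ 1_ _.
Proof. exact: sbe_lunitVK. Qed.
Lemma runK a : runV a \c run a =~ 1_ _.
Proof. exact: sbe_runitK. Qed.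
Lemma runVK a : run a \c runV a =~ 1_ _.
Proof. exact: sbe_runitVK. Qed.
Lemma brdK a b : brdV a b \c brd a b =~ 1_ _.
Proof. exact: sbe_braidK. Qed.
Lemma brdVK a b : brd a b \c brdV a b =~ 1_ _.
Proof. exact: sbe_braidVK. Qed.

Lemma asc_nat a a' b b' c c' (f : hom SB a a') (g : hom SB b b') (h : hom SB c c') :
  asc a' b' c' \c ((f \ot g) \ot h) =~ (f \ot (g \ot h)) \c asc a b c.
Proof. exact: sbe_assoc_nat. Qed.

Lemma ascV_nat a a' b b' c c' (f : hom SB a a') (g : hom SB b b') (h : hom SB c c') :
  ascV a' b' c' \c (f \ot (g \ot h)) =~ ((f \ot g) \ot h) \c ascV a b c.
Proof.
apply: (iso_monic (ascK a' b' c')); rewrite (comp2 _ (ascVK _ _ _)) comp1m.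
by rewrite (comp2 _ (asc_nat _ _ _)) -compA ascVK compm1.
Qed.

Lemma lun_nat a b (f : hom SB a b) : lun b \c (1_ sb1 \ot f) =~ f \c lun a.
Proof. exact: sbe_lunit_nat. Qed.
Lemma run_nat a b (f : hom SB a b) : run b \c (f \ot 1_ sb1) =~ f \c run a.
Proof. exact: sbe_runit_nat. Qed.
Lemma brd_nat a a' b b' (f : hom SB a a') (g : hom SB b b') :
  brd a' b' \c (f \ot g) =~ (g \ot f) \c brd a b.
Proof. exact: sbe_braid_nat. Qed.

Lemma pentagon a b c d :
  asc a b (c \ox d) \c asc (a \ox b) c d =~
  (1_ a \ot asc b c d) \c (asc a (b \ox c) d \c (asc a b c \ot 1_ d)).
Proof. by rewrite compA; apply: sbe_pentagon. Qed.

Lemma triangle a b : (1_ a \ot lun b) \c asc a sb1 b =~ run a \ot 1_ b.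
Proof. exact: sbe_triangle. Qed.

Lemma hexagon1 a b c : asc b c a \c (brd a (b \ox c) \c asc a b c) =~
  (1_ b \ot brd a c) \c (asc b a c \c (brd a b \ot 1_ c)).
Proof. by rewrite !compA; apply: sbe_hexagon1. Qed.

Lemma hexagon2 a b c : ascV c a b \c (brd (a \ox b) c \c ascV a b c) =~
  (brd a c \ot 1_ b) \c (ascV a c b \c (1_ a \ot brd b c)).
Proof. by rewrite !compA; apply: sbe_hexagon2. Qed.

Lemma tens1l_inj a b (f g : hom SB a b) : 1_ sb1 \ot f =~ 1_ sb1 \ot g -> f =~ g.
Proof.
move=> e; apply: (iso_epic (lunVK a)).
by rewrite -!lun_nat e.
Qed.

Lemma tens1r_inj a b (f g : hom SB a b) : f \ot 1_ sb1 =~ g \ot 1_ sb1 -> f =~ g.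
Proof.
move=> e; apply: (iso_epic (runVK a)).
by rewrite -!run_nat e.
Qed.

Lemma tens_iso1 a a' b (i : hom SB a a') (j : hom SB a' a) :
  j \c i =~ 1_ a -> (j \ot 1_ b) \c (i \ot 1_ b) =~ 1_ (a \ox b).
Proof. by move=> e; rewrite -tensMl e tens1. Qed.

Lemma tens_iso2 a a' b (i : hom SB a a') (j : hom SB a' a) :
  j \c i =~ 1_ a -> (1_ b \ot j) \c (1_ b \ot i) =~ 1_ (b \ox a).
Proof. by move=> e; rewrite -tensMr e tens1. Qed.

(** Kelly's argument: associativity constraints are invertible and tensoring with the unit is
    faithful, so it suffices to treat the equation tensored with [sb1], where pentagon and triangle
    yield it. *)
Lemma lun_asc a b : lun (a \ox b) \c asc sb1 a b =~ lun a \ot 1_ b.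
Proof.
apply: tens1l_inj; apply: (iso_epic (ascVK sb1 (sb1 \ox a) b)).
apply: (iso_epic (tens_iso1 b (ascVK sb1 sb1 a))).
rewrite tensMr -!compA -pentagon (comp2 _ (triangle _ _)).
rewrite -(comp22 _ (asc_nat _ _ _)) -tensMl triangle -[in X in heq X _]tens1.
by rewrite -asc_nat.
Qed.

Lemma run_asc a b : (1_ a \ot run b) \c asc a b sb1 =~ run (a \ox b).
Proof.
apply: tens1r_inj; apply: (iso_monic (ascK a b sb1)).
rewrite tensMl (comp2 _ (asc_nat _ _ _)) -triangle tensMr -!compA -pentagon.
by rewrite -(comp22 _ (asc_nat _ _ _)) tens1 triangle.
Qed.

(** The hexagon with two of its three objects equal to the unit, after cancelling one braiding;
    [run_brd] is the mirror image. *)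
Lemma lun_brd a : lun a \c brd a sb1 =~ run a.
Proof.
apply: tens1l_inj; apply: (iso_epic (ascVK sb1 a sb1)).
apply: (iso_epic (tens_iso1 sb1 (brdVK a sb1))).
rewrite run_asc run_nat tensMr -!compA -hexagon1 (comp2 _ (triangle _ _)).
by rewrite -(comp22 _ (brd_nat _ _)) run_asc.
Qed.

Lemma run_brd a : run a \c brd sb1 a =~ lun a.
Proof.
apply: tens1r_inj.
have ea c d : lun c \ot 1_ d =~ lun (c \ox d) \c asc sb1 c d.
  by rewrite lun_asc.
apply: (iso_epic (ascK sb1 a sb1)).
apply: (iso_epic (tens_iso2 sb1 (brdVK sb1 a))).
rewrite ea -!compA (comp2 _ (ascVK _ _ _)) comp1m lun_nat tensMl -!compA -hexagon2.
rewrite -triangle. rewrite -!compA (comp2 _ (ascVK _ _ _)) comp1m.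
by rewrite -(comp22 _ (brd_nat _ _)) ea -!compA ascVK compm1.
Qed.

Fact mid_sig a b c d :
  {f : hom SB ((a \ox b) \ox (c \ox d)) ((a \ox c) \ox (b \ox d)) |
   f =~ (sb_braid_mid k a b c d : hom SB _ _)}.
Proof. by exists (sb_braid_mid k a b c d). Qed.

(* Morphisms such as [mid] are sealed so that rewriting with associativity does
   not unfold them. *)
Definition mid a b c d := sval (mid_sig a b c d).

Lemma mid_braid a b c d : mid a b c d =~ (sb_braid_mid k a b c d : hom SB _ _).
Proof. exact: svalP (mid_sig a b c d). Qed.

Lemma midE a b c d : mid a b c d =~ ascV a c (b \ox d) \c
  ((1_ a \ot (asc c b d \c ((brd b c \ot 1_ d) \c ascV b c d))) \c
   asc a b (c \ox d)).
Proof. by rewrite mid_braid !compA. Qed.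

Lemma mid_nat a a' b b' c c' d d' (f : hom SB a a') (g : hom SB b b')
    (h : hom SB c c') (l : hom SB d d') :
  mid a' b' c' d' \c ((f \ot g) \ot (h \ot l)) =~
  ((f \ot h) \ot (g \ot l)) \c mid a b c d.
Proof.
rewrite !midE -!compA asc_nat.
have em : (asc c' b' d' \c ((brd b' c' \ot 1_ d') \c ascV b' c' d')) \c
    (g \ot (h \ot l)) =~
    (h \ot (g \ot l)) \c (asc c b d \c ((brd b c \ot 1_ d) \c ascV b c d)).
  rewrite -!compA ascV_nat -(comp22 _ (asc_nat _ _ _)).
  rewrite !(compA (brd b' c' \ot _)) -tensM brd_nat comp1m.
  by rewrite !(compA ((h \ot g) \ot l)) -tensM compm1.
have e : (1_ a' \ot (asc c' b' d' \c ((brd b' c' \ot 1_ d') \c ascV b' c' d'))) \c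
    (f \ot (g \ot (h \ot l))) =~ (f \ot (h \ot (g \ot l))) \c
    (1_ a \ot (asc c b d \c ((brd b c \ot 1_ d) \c ascV b c d))).
  by rewrite -!tensM em comp1m compm1.
by rewrite (comp22 _ e) (comp22 _ (ascV_nat _ _ _)).
Qed.

(** When a block of (SB3) is empty the middle exchange degenerates: to an associativity constraint
    here and in [mid_unit3], and to the bare braiding in [mid_unit14], where both outer blocks are
    empty. *)
Lemma mid_unit2 a c d :
  (1_ (a \ox c) \ot lun d) \c (mid a sb1 c d \c (runV a \ot 1_ (c \ox d))) =~
  ascV a c d.
Proof.
have em : (1_ c \ot lun d) \c (asc c sb1 d \c ((brd sb1 c \ot 1_ d) \c ascV sb1 c d))
    =~ lun (c \ox d).
  rewrite (comp2 _ (triangle _ _)) compA -tensMl run_brd -lun_asc -compA ascVK.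
  by rewrite compm1.
rewrite midE -tens1 -!compA -(comp22 _ (ascV_nat _ _ _)) (compA (_ \ot (_ \ot _))).
rewrite -tensMr em (compA _ (asc _ _ _)) triangle -tensMl runVK.
by rewrite !tens1 compm1.
Qed.

Lemma mid_unit3 a b d :
  (run a \ot 1_ (b \ox d)) \c (mid a b sb1 d \c (1_ (a \ox b) \ot lunV d)) =~
  asc a b d.
Proof.
have em : lun (b \ox d) \c (asc sb1 b d \c ((brd b sb1 \ot 1_ d) \c ascV b sb1 d))
    =~ 1_ b \ot lun d.
  rewrite (comp2 _ (lun_asc _ _)) compA -tensMl lun_brd -triangle -compA ascVK.
  by rewrite compm1.
have et : (run a \ot 1_ (b \ox d)) \c ascV a sb1 (b \ox d) =~ 1_ a \ot lun (b \ox d).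
  by rewrite -triangle -compA ascVK compm1.
rewrite midE -(tens1 a b) -!compA (comp2 _ et) (compA (1_ a \ot _)) -tensMr em.
rewrite asc_nat compA -!tensMr lunVK.
by rewrite !tens1 comp1m.
Qed.

Lemma mid_unit14 b c :
  (lun c \ot run b) \c (mid sb1 b c sb1 \c (lunV b \ot runV c)) =~ brd b c.
Proof.
have em : (1_ c \ot run b) \c
    (asc c b sb1 \c ((brd b c \ot 1_ sb1) \c ascV b c sb1)) =~
    brd b c \c (1_ b \ot run c).
  rewrite (comp2 _ (run_asc _ _)) (comp22 _ (run_nat _)); apply: comp_heq => //.
  by rewrite -run_asc -compA ascVK compm1.
have el : (lun c \ot run b) \c ascV sb1 c (b \ox sb1) =~
    (1_ c \ot run b) \c lun (c \ox (b \ox sb1)).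
  by rewrite -tens_rl -lun_asc -!compA ascVK compm1.
rewrite midE -!compA (comp2 _ el) -!compA (comp22 _ (lun_nat _)) (compA (1_ c \ot _)).
rewrite em -!compA (comp2 _ (lun_asc _ _)) -tensM lunVK comp1m.
by rewrite -tensMr runVK !tens1 compm1.
Qed.

(** The empty subset of the label set indexes an object that is only isomorphic to [sb1]; [i] and
    [j] account for the difference. *)
Lemma mid_weak_unit2 a c d z (i : hom SB sb1 z) (j : hom SB z sb1) :
  j \c i =~ 1_ sb1 ->
  (1_ (a \ox c) \ot (lun d \c (j \ot 1_ d))) \c
    (mid a z c d \c (((1_ a \ot i) \c runV a) \ot 1_ (c \ox d))) =~ ascV a c d.
Proof.
move=> ji; rewrite tensMr tensMl -!compA -(tens1 c) (comp22 _ (mid_nat _ _ _ _)).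
rewrite (tens1 a c) (compA (1_ (a \ox c) \ot (j \ot _))) -tensMr -tensMl ji.
by rewrite !tens1 comp1m mid_unit2.
Qed.

Lemma mid_weak_unit3 a b d z (i : hom SB sb1 z) (j : hom SB z sb1) :
  j \c i =~ 1_ sb1 ->
  ((run a \c (1_ a \ot j)) \ot 1_ (b \ox d)) \c
    (mid a b z d \c (1_ (a \ox b) \ot ((i \ot 1_ d) \c lunV d))) =~ asc a b d.
Proof.
move=> ji; rewrite tensMr tensMl -!compA -(tens1 a b) (comp22 _ (mid_nat _ _ _ _)).
rewrite (tens1 b d) (compA ((1_ a \ot j) \ot _)) -tensMl -tensMr ji.
by rewrite !tens1 comp1m mid_unit3.
Qed.

Lemma mid_weak_unit14 b c z (i : hom SB sb1 z) (j : hom SB z sb1) :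
  j \c i =~ 1_ sb1 ->
  ((lun c \c (j \ot 1_ c)) \ot (run b \c (1_ b \ot j))) \c
    (mid z b c z \c (((i \ot 1_ b) \c lunV b) \ot ((1_ c \ot i) \c runV c))) =~
  brd b c.
Proof.
move=> ji; rewrite !tensM -!compA (comp22 _ (mid_nat _ _ _ _)).
rewrite (compA ((j \ot _) \ot _)) -!tensM ji !comp1m !tens1 comp1m.
exact: mid_unit14.
Qed.

End Braided.

Notation "f \ot g" := (tens f g) (at level 35) : lincat_scope.

(** * Labellings of finite sets *)

Section Labels.
Variable T : finType.

Definition lsum (I J : Type) (al : I -> T) (be : J -> T) (x : I + J) : T :=
  match x with inl i => al i | inr j => be j end.

Definition img (I : finType) (al : I -> T) : {set T} := [set x in codom al].

Lemma imgP (I : finType) (al : I -> T) x :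
  reflect (exists i, x = al i) (x \in img al).
Proof. by rewrite inE; apply: (iffP codomP). Qed.

Lemma mem_img (I : finType) (al : I -> T) i : al i \in img al.
Proof. by apply/imgP; exists i. Qed.

Lemma img_lsum (I J : finType) (al : I -> T) (be : J -> T) :
  img (lsum al be) = img al :|: img be.
Proof.
apply/setP => x; rewrite in_setU; apply/imgP/orP => [[[i|j] ->]|].
- by left; apply: mem_img.
- by right; apply: mem_img.
- by case=> /imgP[i ->]; [exists (inl i)|exists (inr i)].
Qed.

Lemma lsum_inj (I J : finType) (al : I -> T) (be : J -> T) :
  injective al -> injective be -> [disjoint img al & img be] ->
  injective (lsum al be).
Proof.
move=> ia ib d [i|j] [i'|j'] /= => [/ia->|e|e|/ib->] //.
- by have := disjointFr d (mem_img al i); rewrite e mem_img.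
- by have := disjointFr d (mem_img al i'); rewrite -e mem_img.
Qed.

Lemma same_img_bij (I J : finType) (al : I -> T) (be : J -> T) :
  injective al -> injective be -> img al = img be ->
  exists2 s : I -> J, bijective s & forall i, be (s i) = al i.
Proof.
move=> ia ib e.
have ex i : exists j, be j == al i.
  have : al i \in img be by rewrite -e mem_img.
  by case/imgP => j ->; exists j.
have ey j : exists i, al i == be j.
  have : be j \in img al by rewrite e mem_img.
  by case/imgP => i ->; exists i.
pose s i := xchoose (ex i); pose t j := xchoose (ey j).
have sE i : be (s i) = al i by apply/eqP/(xchooseP (ex i)).
have tE j : al (t j) = be j by apply/eqP/(xchooseP (ey j)).
exists s => //; exists t => [i|j]; first by apply: ia; rewrite tE sE.
by apply: ib; rewrite sE tE.
Qed.

Definition sub (S : {set T}) : finType := {x : T | x \in S}.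

Lemma img_sub S : img (fun x : sub S => val x) = S.
Proof.
apply/setP => x; apply/imgP/idP => [[[y yS] ->//]|xS].
by exists (exist _ x xS).
Qed.

End Labels.

(** * Structure bijections determined by labels *)

Section Transport.
Variables (k : fieldType) (T : finType).
Local Notation SB := (SB k).
Local Notation "1_ a" := (@idm k SB a) (at level 0, a at level 0, format "1_ a").

Definition gam (I J : finType) (s : I -> J) (sP : bijective s) :
  hom SB (sbU I) (sbU J) := sb_gamma k sP.
Definition mu (I J : finType) : hom SB (sbU I \ox sbU J) (sbU (I + J)%type) :=
  sb_mu k I J.
Definition dl (I J : finType) : hom SB (sbU (I + J)%type) (sbU I \ox sbU J) :=
  sb_delta k I J.

Definition tr_pred (I J : finType) (al : I -> T) (be : J -> T) (s : {ffun I -> J}) :=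
  [&& injectiveb s, (#|J| <= #|I|)%N & [forall i, be (s i) == al i]].

Lemma tr_bij (I J : finType) (al : I -> T) (be : J -> T) (s : {ffun I -> J}) :
  tr_pred al be s -> bijective s.
Proof. by case/and3P=> /injectiveP si IJ _; apply: inj_card_bij. Qed.

(* The structure morphism of the bijection matching two labellings by [T]; junk
   value [0] when there is none. *)
Definition tr_def (I J : finType) (al : I -> T) (be : J -> T) :
    hom SB (sbU I) (sbU J) :=
  match pickP (tr_pred al be) with
  | Pick s sP => gam (tr_bij sP)
  | Nopick _ => hzero _ _
  end.

Fact tr_sig (I J : finType) (al : I -> T) (be : J -> T) :
  {f : hom SB (sbU I) (sbU J) | f =~ tr_def al be}.
Proof. by exists (tr_def al be). Qed.

Definition tr (I J : finType) (al : I -> T) (be : J -> T) := sval (tr_sig al be).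

Lemma gam_ext (I J : finType) (s t : I -> J) (sP : bijective s) (tP : bijective t) :
  s =1 t -> gam sP =~ gam tP.
Proof. exact: sbe_gamma_ext. Qed.

Lemma trE (I J : finType) (al : I -> T) (be : J -> T) (s : I -> J)
    (sP : bijective s) : injective be -> (forall i, be (s i) = al i) ->
  tr al be =~ gam sP.
Proof.
move=> ib e; apply: heq_trans (svalP (tr_sig al be)) _.
rewrite /tr_def; case: pickP => [s' s'P|/(_ (finfun s))].
  apply: gam_ext => i; apply: ib; rewrite e.
  by case/and3P: s'P => _ _ /forallP/(_ i)/eqP.
move/negP; case; apply/and3P; split.
- by apply/injectiveP => i j; rewrite !ffunE => /(bij_inj sP).
- by rewrite (bij_eq_card sP).
- by apply/forallP => i; rewrite ffunE e.
Qed.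

Lemma tr_id (I : finType) (al : I -> T) : injective al -> tr al al =~ 1_ (sbU I).
Proof.
move=> ia; rewrite (trE (s := id) (inv_bij (fun _ => erefl))) //.
exact: sbe_gamma1.
Qed.

(** Injective labels leave only one bijection compatible with them, so coherence between iterated
    disjoint unions reduces to equality of images. *)
Lemma tr_comp (I J K : finType) (al : I -> T) (be : J -> T) (ga : K -> T) :
  injective al -> injective be -> injective ga ->
  img al = img be -> img be = img ga ->
  tr be ga \c tr al be =~ tr al ga.
Proof.
move=> ia ib ic e1 e2.
have [s sP se] := same_img_bij ia ib e1.
have [t tP te] := same_img_bij ib ic e2.
rewrite (trE sP) // (trE tP) // (trE (bij_comp tP sP)) //.
  by apply: heq_sym; apply: sbe_gammaM.
by move=> i /=; rewrite te se.
Qed.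

Lemma tr_mu (I I' J J' : finType) (al : I -> T) (al' : I' -> T) (be : J -> T)
    (be' : J' -> T) : injective al -> injective al' -> injective be ->
  injective be' -> img al = img al' -> img be = img be' ->
  [disjoint img al & img be] ->
  tr (lsum al be) (lsum al' be') \c mu I J =~ mu I' J' \c (tr al al' \ot tr be be').
Proof.
move=> ia ia' ib ib' ea eb d.
have [s sP se] := same_img_bij ia ia' ea.
have [t tP te] := same_img_bij ib ib' eb.
rewrite (trE sP) // (trE tP) // (trE (sum_map_bij sP tP)).
- exact: sbe_mu_nat.
- by apply: lsum_inj; rewrite -?ea -?eb.
- by case=> i /=; rewrite ?se ?te.
Qed.

Lemma tr_dl (I I' J J' : finType) (al : I -> T) (al' : I' -> T) (be : J -> T)
    (be' : J' -> T) : injective al -> injective al' -> injective be ->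
  injective be' -> img al = img al' -> img be = img be' ->
  [disjoint img al & img be] ->
  dl I' J' \c tr (lsum al be) (lsum al' be') =~ (tr al al' \ot tr be be') \c dl I J.
Proof.
move=> ia ia' ib ib' ea eb d.
have [s sP se] := same_img_bij ia ia' ea.
have [t tP te] := same_img_bij ib ib' eb.
rewrite (trE sP) // (trE tP) // (trE (sum_map_bij sP tP)).
- exact: sbe_delta_nat.
- by apply: lsum_inj; rewrite -?ea -?eb.
- by case=> i /=; rewrite ?se ?te.
Qed.

End Transport.

(** * The set bialgebra relations in terms of subsets *)

Section SetBialgebra.
Variables (k : fieldType) (T : finType).
Local Notation SB := (SB k).
Local Notation "1_ a" := (@idm k SB a) (at level 0, a at level 0, format "1_ a").
Implicit Types A B S J L K U W : {set T}.

Definition cz S (x : sub S) : T := val x.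
Definition us S : SB := sbU (sub S).

Definition part A B S := [disjoint A & B] /\ A :|: B = S.

Lemma cz_inj S : injective (@cz S).
Proof. exact: val_inj. Qed.

Lemma img_cz S : img (@cz S) = S.
Proof. exact: img_sub. Qed.

Fact Mh_sig A B S : {f : hom SB (us A \ox us B) (us S) |
  f =~ tr k (lsum (@cz A) (@cz B)) (@cz S) \c mu k (sub A) (sub B)}.
Proof. by exists (tr k (lsum (@cz A) (@cz B)) (@cz S) \c mu k (sub A) (sub B)). Qed.

Fact Dh_sig S A B : {f : hom SB (us S) (us A \ox us B) |
  f =~ dl k (sub A) (sub B) \c tr k (@cz S) (lsum (@cz A) (@cz B))}.
Proof. by exists (dl k (sub A) (sub B) \c tr k (@cz S) (lsum (@cz A) (@cz B))). Qed.

(** The product indexed by subsets instead of sum types. [S] is a separate argument, tied to [A] and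
    [B] only through [part] in the lemmas, so that sets presented in different ways need no
    casts. *)
Definition Mh A B S := sval (Mh_sig A B S).
Definition Dh S A B := sval (Dh_sig S A B).

Lemma MhE A B S :
  Mh A B S =~ tr k (lsum (@cz A) (@cz B)) (@cz S) \c mu k (sub A) (sub B).
Proof. exact: svalP (Mh_sig A B S). Qed.

Lemma DhE S A B :
  Dh S A B =~ dl k (sub A) (sub B) \c tr k (@cz S) (lsum (@cz A) (@cz B)).
Proof. exact: svalP (Dh_sig S A B). Qed.

Lemma part_inj A B S : part A B S -> injective (lsum (@cz A) (@cz B)).
Proof. by case=> d _; apply: lsum_inj; rewrite ?img_cz //; apply: cz_inj. Qed.

Lemma part_img A B S : part A B S -> img (lsum (@cz A) (@cz B)) = S.
Proof. by case=> _ <-; rewrite img_lsum !img_cz. Qed.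

(** All bijections of the axiom become transports, which pass through [mu] and [dl] by naturality
    and are merged by [tr_comp]. *)
Lemma Dh_Mh_SB3 K11 K12 K21 K22 J1 J2 L1 L2 S :
  part K11 K12 J1 -> part K21 K22 J2 -> part K11 K21 L1 -> part K12 K22 L2 ->
  part J1 J2 S -> part L1 L2 S ->
  Dh S L1 L2 \c Mh J1 J2 S =~ (Mh K11 K21 L1 \ot Mh K12 K22 L2) \c
    (mid (us K11) (us K12) (us K21) (us K22) \c (Dh J1 K11 K12 \ot Dh J2 K21 K22)).
Proof.
move=> pJ1 pJ2 pL1 pL2 pJ pL.
have SB3 : dl k (sub K11 + sub K21)%type (sub K12 + sub K22)%type \c
      (gam k (@sum_mid_bij (sub K11) (sub K12) (sub K21) (sub K22)) \c
      mu k (sub K11 + sub K12)%type (sub K21 + sub K22)%type) =~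
    (mu k (sub K11) (sub K21) \ot mu k (sub K12) (sub K22)) \c
      (mid (us K11) (us K12) (us K21) (us K22) \c
      (dl k (sub K11) (sub K12) \ot dl k (sub K21) (sub K22))).
  rewrite mid_braid !(compA (dl _ _ _)) (compA (mu _ _ _ \ot mu _ _ _)).
  exact: sbe_SB3.
have midE : gam k (@sum_mid_bij (sub K11) (sub K12) (sub K21) (sub K22)) =~
  tr k (lsum (lsum (@cz K11) (@cz K12)) (lsum (@cz K21) (@cz K22)))
     (lsum (lsum (@cz K11) (@cz K21)) (lsum (@cz K12) (@cz K22))).
  apply: heq_sym; apply: trE => [|[[]|[]]//].
  by apply: lsum_inj; rewrite ?(part_img pL1) ?(part_img pL2);
    [apply: part_inj pL1|apply: part_inj pL2|case: pL].
have JJ : img (lsum (lsum (@cz K11) (@cz K12)) (lsum (@cz K21) (@cz K22))) = S.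
  by rewrite img_lsum (part_img pJ1) (part_img pJ2); case: pJ.
have LL : img (lsum (lsum (@cz K11) (@cz K21)) (lsum (@cz K12) (@cz K22))) = S.
  by rewrite img_lsum (part_img pL1) (part_img pL2); case: pL.
have iJJ : injective (lsum (lsum (@cz K11) (@cz K12)) (lsum (@cz K21) (@cz K22))).
  by apply: lsum_inj; rewrite ?(part_img pJ1) ?(part_img pJ2);
    [apply: part_inj pJ1|apply: part_inj pJ2|case: pJ].
have iLL : injective (lsum (lsum (@cz K11) (@cz K21)) (lsum (@cz K12) (@cz K22))).
  by apply: lsum_inj; rewrite ?(part_img pL1) ?(part_img pL2);
    [apply: part_inj pL1|apply: part_inj pL2|case: pL].
rewrite !MhE !DhE !tensM -!compA (comp3 _ (heq_sym SB3)) -!compA midE.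
rewrite -(tr_mu k (@cz_inj J1) (part_inj pJ1) (@cz_inj J2) (part_inj pJ2));
  rewrite ?(part_img pJ1) ?(part_img pJ2) ?img_cz //; last by case: pJ.
rewrite -(comp22 _ (tr_dl k (part_inj pL1) (@cz_inj L1) (part_inj pL2) (@cz_inj L2) _ _ _));
  rewrite ?(part_img pL1) ?(part_img pL2) ?img_cz //; last by case: pL.
apply: comp_heq => //; rewrite !compA; apply: comp_heq => //.
have iJ := part_inj pJ; have iL := part_inj pL.
by rewrite !tr_comp ?img_cz ?(part_img pJ) ?(part_img pL) ?JJ ?LL //; apply: cz_inj.
Qed.

Lemma Mh_assoc A B C AB BC S : part A B AB -> part B C BC ->
  part AB C S -> part A BC S ->
  Mh AB C S \c (Mh A B AB \ot 1_ (us C)) =~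
  Mh A BC S \c ((1_ (us A) \ot Mh B C BC) \c asc (us A) (us B) (us C)).
Proof.
move=> pAB pBC pl pr.
have ax : gam k (@sum_assoc_bij (sub A) (sub B) (sub C)) \c
    (mu k (sub A + sub B)%type (sub C) \c (mu k (sub A) (sub B) \ot 1_ (us C))) =~
    mu k (sub A) (sub B + sub C)%type \c
    ((1_ (us A) \ot mu k (sub B) (sub C)) \c asc (us A) (us B) (us C)).
  by rewrite !compA; apply: sbe_muA.
have i1 : injective (lsum (lsum (@cz A) (@cz B)) (@cz C)).
  by apply: lsum_inj; rewrite ?(part_img pAB) ?img_cz;
    [apply: part_inj pAB|apply: cz_inj|case: pl].
have i2 : injective (lsum (@cz A) (lsum (@cz B) (@cz C))).
  by apply: lsum_inj; rewrite ?(part_img pBC) ?img_cz;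
    [apply: cz_inj|apply: part_inj pBC|case: pr].
have m1 : img (lsum (lsum (@cz A) (@cz B)) (@cz C)) = S.
  by rewrite img_lsum (part_img pAB) img_cz; case: pl.
have m2 : img (lsum (@cz A) (lsum (@cz B) (@cz C))) = S.
  by rewrite img_lsum (part_img pBC) img_cz; case: pr.
have ga : gam k (@sum_assoc_bij (sub A) (sub B) (sub C)) =~
    tr k (lsum (lsum (@cz A) (@cz B)) (@cz C)) (lsum (@cz A) (lsum (@cz B) (@cz C))).
  by apply: heq_sym; apply: trE => // -[[]|].
have tC := tr_id k (@cz_inj C); have tA := tr_id k (@cz_inj A).
have eL : mu k (sub AB) (sub C) \c (tr k (lsum (@cz A) (@cz B)) (@cz AB) \ot 1_ (us C))
    =~ tr k (lsum (lsum (@cz A) (@cz B)) (@cz C)) (lsum (@cz AB) (@cz C)) \c mu k _ _.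
  rewrite -tC -(tr_mu k (part_inj pAB) (@cz_inj AB) (@cz_inj C) (@cz_inj C)) //;
  by rewrite ?(part_img pAB) ?img_cz //; case: pl.
have eR : mu k (sub A) (sub BC) \c (1_ (us A) \ot tr k (lsum (@cz B) (@cz C)) (@cz BC))
    =~ tr k (lsum (@cz A) (lsum (@cz B) (@cz C))) (lsum (@cz A) (@cz BC)) \c mu k _ _.
  rewrite -tA -(tr_mu k (@cz_inj A) (@cz_inj A) (part_inj pBC) (@cz_inj BC)) //;
  by rewrite ?(part_img pBC) ?img_cz //; case: pr.
rewrite !MhE tensMl tensMr -!compA (comp22 _ eL) (comp22 _ eR) -ax ga.
have il := part_inj pl; have ir := part_inj pr.
rewrite !compA !tr_comp ?img_cz ?m1 ?m2 ?(part_img pl) ?(part_img pr) //;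
  exact: cz_inj.
Qed.

Lemma Dh_coassoc A B C AB BC S : part A B AB -> part B C BC ->
  part AB C S -> part A BC S ->
  asc (us A) (us B) (us C) \c ((Dh AB A B \ot 1_ (us C)) \c Dh S AB C) =~
  (1_ (us A) \ot Dh BC B C) \c Dh S A BC.
Proof.
move=> pAB pBC pl pr.
have ax : asc (us A) (us B) (us C) \c ((dl k (sub A) (sub B) \ot 1_ (us C)) \c
      dl k (sub A + sub B)%type (sub C)) =~
    (1_ (us A) \ot dl k (sub B) (sub C)) \c
    (dl k (sub A) (sub B + sub C)%type \c
     gam k (@sum_assoc_bij (sub A) (sub B) (sub C))).
  by rewrite !compA; apply: sbe_deltaA.
have i1 : injective (lsum (lsum (@cz A) (@cz B)) (@cz C)).
  by apply: lsum_inj; rewrite ?(part_img pAB) ?img_cz;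
    [apply: part_inj pAB|apply: cz_inj|case: pl].
have i2 : injective (lsum (@cz A) (lsum (@cz B) (@cz C))).
  by apply: lsum_inj; rewrite ?(part_img pBC) ?img_cz;
    [apply: cz_inj|apply: part_inj pBC|case: pr].
have m1 : img (lsum (lsum (@cz A) (@cz B)) (@cz C)) = S.
  by rewrite img_lsum (part_img pAB) img_cz; case: pl.
have m2 : img (lsum (@cz A) (lsum (@cz B) (@cz C))) = S.
  by rewrite img_lsum (part_img pBC) img_cz; case: pr.
have ga : gam k (@sum_assoc_bij (sub A) (sub B) (sub C)) =~
    tr k (lsum (lsum (@cz A) (@cz B)) (@cz C)) (lsum (@cz A) (lsum (@cz B) (@cz C))).
  by apply: heq_sym; apply: trE => // -[[]|].
have tC := tr_id k (@cz_inj C); have tA := tr_id k (@cz_inj A).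
have eL : (tr k (@cz AB) (lsum (@cz A) (@cz B)) \ot 1_ (us C)) \c dl k (sub AB) (sub C)
    =~ dl k _ _ \c tr k (lsum (@cz AB) (@cz C)) (lsum (lsum (@cz A) (@cz B)) (@cz C)).
  rewrite -tC -(tr_dl k (@cz_inj AB) (part_inj pAB) (@cz_inj C) (@cz_inj C)) //;
  by rewrite ?(part_img pAB) ?img_cz //; case: pl.
have eR : (1_ (us A) \ot tr k (@cz BC) (lsum (@cz B) (@cz C))) \c dl k (sub A) (sub BC)
    =~ dl k _ _ \c tr k (lsum (@cz A) (@cz BC)) (lsum (@cz A) (lsum (@cz B) (@cz C))).
  rewrite -tA -(tr_dl k (@cz_inj A) (@cz_inj A) (@cz_inj BC) (part_inj pBC)) //;
  by rewrite ?(part_img pBC) ?img_cz //; case: pr.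
rewrite !DhE tensMl tensMr -!compA (comp22 _ eL) (comp22 _ eR) (comp3 _ ax) -!compA ga.
have il := part_inj pl; have ir := part_inj pr.
rewrite !tr_comp ?img_cz ?m1 ?m2 ?(part_img pl) ?(part_img pr) //;
  exact: cz_inj.
Qed.

Definition vz (x : void) : T := of_void T x.

Lemma vz_inj : injective vz. Proof. by case. Qed.

Lemma img_vz : img vz = set0.
Proof. by apply/setP => x; rewrite in_set0; apply/imgP => -[[]]. Qed.

Definition eps : hom SB (us set0) sb1 := tr k (@cz set0) vz.
Definition epsV : hom SB sb1 (us set0) := tr k vz (@cz set0).

Lemma epsVK : eps \c epsV =~ 1_ sb1.
Proof.
rewrite tr_comp ?img_vz ?img_cz ?tr_id //; try exact: vz_inj; exact: cz_inj.
Qed.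

Lemma part0l S : part set0 S S.
Proof. by split; rewrite ?set0U // -setI_eq0 set0I. Qed.

Lemma part0r S : part S set0 S.
Proof. by split; rewrite ?setU0 // -setI_eq0 setI0. Qed.

Lemma vz_lsum_inj S : injective (lsum vz (@cz S)).
Proof.
apply: lsum_inj; [exact: vz_inj|exact: cz_inj|].
by rewrite img_vz -setI_eq0 set0I.
Qed.

Lemma vz_lsum_injr S : injective (lsum (@cz S) vz).
Proof.
apply: lsum_inj; [exact: cz_inj|exact: vz_inj|].
by rewrite img_vz -setI_eq0 setI0.
Qed.

Lemma vz_lsum_img S : img (lsum vz (@cz S)) = S.
Proof. by rewrite img_lsum img_vz img_cz set0U. Qed.

Lemma vz_lsum_imgr S : img (lsum (@cz S) vz) = S.
Proof. by rewrite img_lsum img_vz img_cz setU0. Qed.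

Lemma gam_void_l S : gam k (@sum_void_l_bij (sub S)) =~ tr k (lsum vz (@cz S)) (@cz S).
Proof. by apply: heq_sym; apply: trE => [|[[]|]//]; apply: cz_inj. Qed.

Lemma gam_void_r S : gam k (@sum_void_r_bij (sub S)) =~ tr k (lsum (@cz S) vz) (@cz S).
Proof. by apply: heq_sym; apply: trE => [|[|[]]//]; apply: cz_inj. Qed.

Lemma Mh_0l S : Mh set0 S S =~ lun (us S) \c (eps \ot 1_ (us S)).
Proof.
have ax : gam k (@sum_void_l_bij (sub S)) \c mu k void (sub S) =~ lun (us S).
  exact: sbe_mu_l.
rewrite MhE -ax -compA -(tr_id k (@cz_inj S)) -tr_mu ?img_vz ?img_cz //;
  try solve [exact: cz_inj|exact: vz_inj|by rewrite -setI_eq0 set0I].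
rewrite gam_void_l compA tr_comp ?vz_lsum_img ?(part_img (part0l S)) ?img_cz //.
- exact: part_inj (part0l S).
- exact: vz_lsum_inj.
- exact: cz_inj.
Qed.

Lemma Mh_0r S : Mh S set0 S =~ run (us S) \c (1_ (us S) \ot eps).
Proof.
have ax : gam k (@sum_void_r_bij (sub S)) \c mu k (sub S) void =~ run (us S).
  exact: sbe_mu_r.
rewrite MhE -ax -compA -(tr_id k (@cz_inj S)) -tr_mu ?img_vz ?img_cz //;
  try solve [exact: cz_inj|exact: vz_inj|by rewrite -setI_eq0 setI0].
rewrite gam_void_r compA tr_comp ?vz_lsum_imgr ?(part_img (part0r S)) ?img_cz //.
- exact: part_inj (part0r S).
- exact: vz_lsum_injr.
- exact: cz_inj.
Qed.

Lemma Dh_0l S : Dh S set0 S =~ (epsV \ot 1_ (us S)) \c lunV (us S).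
Proof.
have ax : dl k void (sub S) =~ lunV (us S) \c gam k (@sum_void_l_bij (sub S)).
  exact: sbe_delta_l.
have ax' : lunV (us S) =~ dl k void (sub S) \c tr k (@cz S) (lsum vz (@cz S)).
  rewrite ax gam_void_l -compA tr_comp ?vz_lsum_img ?img_cz ?tr_id ?compm1 //;
  by [apply: cz_inj|apply: vz_lsum_inj].
rewrite DhE ax' -(tr_id k (@cz_inj S)) compA -tr_dl ?img_vz ?img_cz //;
  try solve [exact: cz_inj|exact: vz_inj|by rewrite -setI_eq0 set0I].
rewrite -compA tr_comp ?vz_lsum_img ?(part_img (part0l S)) ?img_cz //.
- exact: cz_inj.
- exact: vz_lsum_inj.
- exact: part_inj (part0l S).
Qed.

Lemma Dh_0r S : Dh S S set0 =~ (1_ (us S) \ot epsV) \c runV (us S).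
Proof.
have ax : dl k (sub S) void =~ runV (us S) \c gam k (@sum_void_r_bij (sub S)).
  exact: sbe_delta_r.
have ax' : runV (us S) =~ dl k (sub S) void \c tr k (@cz S) (lsum (@cz S) vz).
  rewrite ax gam_void_r -compA tr_comp ?vz_lsum_imgr ?img_cz ?tr_id ?compm1 //;
  by [apply: cz_inj|apply: vz_lsum_injr].
rewrite DhE ax' -(tr_id k (@cz_inj S)) compA -tr_dl ?img_vz ?img_cz //;
  try solve [exact: cz_inj|exact: vz_inj|by rewrite -setI_eq0 setI0].
rewrite -compA tr_comp ?vz_lsum_imgr ?(part_img (part0r S)) ?img_cz //.
- exact: cz_inj.
- exact: vz_lsum_injr.
- exact: part_inj (part0r S).
Qed.

(** (SB3) with [K12] empty: [J1] lies inside [L1], so nothing is braided. *)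
Lemma Dh_Mh_l J1 K L1 L2 J2 S : part J1 K L1 -> part K L2 J2 ->
  part J1 J2 S -> part L1 L2 S ->
  Dh S L1 L2 \c Mh J1 J2 S =~ (Mh J1 K L1 \ot 1_ (us L2)) \c
    (ascV (us J1) (us K) (us L2) \c (1_ (us J1) \ot Dh J2 K L2)).
Proof.
move=> p1 p2 p3 p4.
rewrite (Dh_Mh_SB3 (part0r J1) p2 p1 (part0l L2)) // Mh_0l Dh_0r.
rewrite -tens_lr -(tens_lr _ (Dh J2 K L2)) -!compA.
by rewrite (comp3 _ (mid_weak_unit2 _ _ _ epsVK)).
Qed.

Lemma Dh_Mh_r L1 K J1 J2 L2 S : part L1 K J1 -> part K J2 L2 ->
  part J1 J2 S -> part L1 L2 S ->
  Dh S L1 L2 \c Mh J1 J2 S =~ (1_ (us L1) \ot Mh K J2 L2) \c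
    (asc (us L1) (us K) (us J2) \c (Dh J1 L1 K \ot 1_ (us J2))).
Proof.
move=> p1 p2 p3 p4.
rewrite (Dh_Mh_SB3 p1 (part0l J2) (part0r L1) p2) // Mh_0r Dh_0l.
rewrite -(tens_rl _ (Mh K J2 L2)) -(tens_rl (Dh J1 L1 K)) -!compA.
by rewrite (comp3 _ (mid_weak_unit3 _ _ _ epsVK)).
Qed.

Lemma part_sym A B S : part A B S -> part B A S.
Proof. by case=> d e; split; rewrite 1?disjoint_sym 1?setUC. Qed.

(** (SB3) with [K11] and [K22] empty, so that the two blocks cross. The braiding is thereby a
    composite of [Mh] and [Dh], which is why it can be represented by the idempotents [Eh]. *)
Lemma Dh_Mh_brd A B S : part A B S -> Dh S B A \c Mh A B S =~ brd (us A) (us B).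
Proof.
move=> p; have p' := part_sym p.
rewrite (Dh_Mh_SB3 (part0l A) (part0r B) (part0l B) (part0r A)) //.
rewrite Mh_0l Mh_0r Dh_0l Dh_0r; exact: mid_weak_unit14 epsVK.
Qed.

Lemma Dh_MhK A B S : part A B S -> Dh S A B \c Mh A B S =~ 1_ (us A \ox us B).
Proof.
move=> p; rewrite (Dh_Mh_l (part0r A) (part0l B) p p) Mh_0r Dh_0l.
rewrite tensMl tensMr -!compA (comp22 _ (ascV_nat _ _ _)).
rewrite (compA ((1_ _ \ot eps) \ot _)) -tensMl -tensMr epsVK tens1 tens1 comp1m.
by rewrite -triangle -compA (comp2 _ (ascVK _ _ _)) comp1m -tensMr lunVK tens1.
Qed.

(* The counterpart of [qE] in the PROB. *)
Fact Eh_sig S W : {f : hom SB (us S) (us S) |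
  f =~ Mh (S :&: W) (S :\: W) S \c Dh S (S :&: W) (S :\: W)}.
Proof. by exists (Mh (S :&: W) (S :\: W) S \c Dh S (S :&: W) (S :\: W)). Qed.

Definition Eh S W := sval (Eh_sig S W).

Lemma EhE A B S : part A B S -> Eh S A =~ Mh A B S \c Dh S A B.
Proof.
move=> [d <-]; apply: heq_trans (svalP (Eh_sig _ A)) _.
have -> : (A :|: B) :&: A = A by rewrite setUK.
have -> // : (A :|: B) :\: A = B.
by rewrite setDUl setDv set0U; apply/setDidPl; rewrite disjoint_sym.
Qed.

Lemma part_sub W S : W \subset S -> part W (S :\: W) S.
Proof.
move=> WS; split; last by rewrite setDE setUIr setUCr setIT; apply/setUidPr.
by rewrite -setI_eq0 setIDA setDIl setDv set0I.
Qed.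

(** A smaller cut acts inside the left factor once [A] is split off: nested (SB3), then
    coassociativity. [Dh_Eh_r] does the same for larger cuts and the right factor. *)
Lemma Dh_Eh_l A B S W : part A B S -> W \subset A ->
  Dh S A B \c Eh S W =~ (Eh A W \ot 1_ (us B)) \c Dh S A B.
Proof.
move=> p WA; have p1 := part_sub WA.
have p2 : part (A :\: W) B ((A :\: W) :|: B).
  case: p => d _; split=> //; rewrite -setI_eq0 setIDAC.
  by move/disjoint_setI0: d => ->; rewrite set0D.
have p3 : part W ((A :\: W) :|: B) S.
  case: (p) (p1) => d <- [d1 e1]; split; last by rewrite setUA e1.
  rewrite -setI_eq0 setIUr (disjoint_setI0 d1) set0U -subset0.
  by rewrite -(disjoint_setI0 d); apply: setSI.
rewrite (EhE p3) (EhE p1) compA (Dh_Mh_l p1 p2 p3 p) tensMl -!compA.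
apply: comp_heq => //; rewrite -(Dh_coassoc p1 p2 p p3).
by rewrite (comp2 _ (ascK _ _ _)) comp1m.
Qed.

Lemma Dh_Eh_r A B S W : part A B S -> A \subset W -> W \subset S ->
  Dh S A B \c Eh S W =~ (1_ (us A) \ot Eh B (W :\: A)) \c Dh S A B.
Proof.
move=> p AW WS; have p1 := part_sub AW; have p2 := part_sub WS.
have BE : (W :\: A) :|: (S :\: W) = B.
  case: p => /disjoint_setI0/setP d e; apply/setP => x; move: (d x).
  have : (x \in A) ==> (x \in W) by apply/implyP/(subsetP AW).
  have : (x \in W) ==> (x \in S) by apply/implyP/(subsetP WS).
  by rewrite -e !inE; do 3!case: (x \in _).
have p3 : part (W :\: A) (S :\: W) B.
  split=> //; rewrite -setI_eq0 -subset0; apply/subsetP => x.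
  by rewrite !inE; case: (x \in W) => //; rewrite !andbF.
rewrite (EhE p2) (EhE p3) compA (Dh_Mh_r p1 p3 p2 p) tensMr -!compA.
by apply: comp_heq => //; rewrite (Dh_coassoc p1 p3 p2 p).
Qed.

Lemma Eh_Mh_l A B S W : part A B S -> W \subset A ->
  Eh S W \c Mh A B S =~ Mh A B S \c (Eh A W \ot 1_ (us B)).
Proof.
move=> p WA; have p1 := part_sub WA.
have p2 : part (A :\: W) B ((A :\: W) :|: B).
  case: p => d _; split=> //; rewrite -setI_eq0 setIDAC.
  by move/disjoint_setI0: d => ->; rewrite set0D.
have p3 : part W ((A :\: W) :|: B) S.
  case: (p) (p1) => d <- [d1 e1]; split; last by rewrite setUA e1.
  rewrite -setI_eq0 setIUr (disjoint_setI0 d1) set0U -subset0.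
  by rewrite -(disjoint_setI0 d); apply: setSI.
rewrite (EhE p3) (EhE p1) -compA (Dh_Mh_r p1 p2 p p3) tensMl.
by rewrite [X in heq _ X]compA (Mh_assoc p1 p2 p p3) -!compA.
Qed.

Lemma Eh_absorb A B S : part A B S -> Dh S A B \c Eh S A =~ Dh S A B.
Proof. by move=> p; rewrite (EhE p) compA (Dh_MhK p) comp1m. Qed.

Lemma Eh_absorbl A B S : part A B S -> Eh S A \c Mh A B S =~ Mh A B S.
Proof. by move=> p; rewrite (EhE p) -compA (Dh_MhK p) compm1. Qed.

Lemma Eh0 S : Eh S set0 =~ 1_ (us S).
Proof.
rewrite (EhE (part0l S)) Mh_0l Dh_0l -compA (compA (eps \ot _)) -tensMl epsVK.
by rewrite tens1 comp1m lunVK.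
Qed.

Lemma EhT S : Eh S S =~ 1_ (us S).
Proof.
rewrite (EhE (part0r S)) Mh_0r Dh_0r -compA (compA (_ \ot eps)) -tensMr epsVK.
by rewrite tens1 comp1m runVK.
Qed.

Local Ltac part_tac := split; [rewrite -setI_eq0; apply/eqP|];
  apply/setP => ?; rewrite !inE; do ?case: (_ \in _).

(** (SB3) rewrites [Eh setT B \c Eh setT A] so that the splitting by [A] comes first, followed by
    splittings of [A] along [A :&: B] and of its complement along [B :\: A]. These absorb on the
    right the idempotents of [A :&: B] and [A :|: B], whose product serves as the meet. *)
Lemma Eh_chain : chain_idem (C := SB) (t := us setT) (Eh setT).
Proof.
have pT A : part A (setT :\: A) setT by apply: part_sub; apply: subsetT.
have comm A B : A \subset B -> Eh setT A \c Eh setT B =~ Eh setT B \c Eh setT A.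
  move=> AB; rewrite (EhE (pT B)) compA (Eh_Mh_l (pT B) AB) -!compA.
  by rewrite (Dh_Eh_l (pT B) AB).
have id A : Eh setT A \c Eh setT A =~ Eh setT A.
  by rewrite {1}(EhE (pT A)) -compA (Eh_absorb (pT A)) -(EhE (pT A)).
have absorb A B : Eh setT B \c Eh setT A \c Eh setT (A :&: B) =~ Eh setT B \c Eh setT A
    /\ Eh setT B \c Eh setT A \c Eh setT (A :|: B) =~ Eh setT B \c Eh setT A.
  have pJ1 : part (A :&: B) (A :\: B) A by part_tac.
  have pJ2 : part (B :\: A) (~: (A :|: B)) (setT :\: A) by part_tac.
  have pL1 : part (A :&: B) (B :\: A) B by part_tac.
  have pL2 : part (A :\: B) (~: (A :|: B)) (setT :\: B) by part_tac.
  have AE : (A :|: B) :\: A = B :\: A.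
    by apply/setP => x; rewrite !inE; do 2!case: (x \in _).
  have base : Eh setT B \c Eh setT A =~ Mh B (setT :\: B) setT \c
      ((Mh (A :&: B) (B :\: A) B \ot Mh (A :\: B) (~: (A :|: B)) (setT :\: B)) \c
      (mid (us (A :&: B)) (us (A :\: B)) (us (B :\: A)) (us (~: (A :|: B))) \c
      ((Dh A (A :&: B) (A :\: B) \ot
        Dh (setT :\: A) (B :\: A) (~: (A :|: B))) \c Dh setT A (setT :\: A)))).
    rewrite (EhE (pT A)) (EhE (pT B)) -!compA (compA (Dh _ _ _) (Mh _ _ _)).
    by rewrite (Dh_Mh_SB3 pJ1 pJ2 pL1 pL2 (pT A) (pT B)) -!compA.
  rewrite base -!compA (Dh_Eh_l (pT A) (subsetIl A B)).
  rewrite (Dh_Eh_r (pT A) (subsetUl A B) (subsetT _)) AE !(compA (Dh A _ _ \ot _)).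
  by rewrite -!tensM !compm1 (Eh_absorb pJ1) (Eh_absorb pJ2).
apply: (chain_idem_meet (o := fun A B => Eh setT (A :&: B) \c Eh setT (A :|: B))).
- exact: Eh0.
- exact: EhT.
- exact: id.
- exact: comm.
- move=> A B; have IU : A :&: B \subset A :|: B.
    by apply: subset_trans (subsetIl _ _) (subsetUl _ _).
  have [eI eU] := absorb A B.
  rewrite -eU -eI -!compA -(comm _ _ (subsetUl A B)).
  by rewrite (compA (Eh _ (A :&: B)) (Eh _ A)) (comm _ _ (subsetIl A B)) -!compA.
- by move=> A B; rewrite compA id.
- move=> A B; have IU : A :&: B \subset A :|: B.
    by apply: subset_trans (subsetIl _ _) (subsetUl _ _).
  by rewrite compA -(comm _ _ IU) -compA id.
Qed.

End SetBialgebra.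

(** * Tensor contexts and inverse wall-crossings in the PROB *)

Section Contexts.
Variables (k : fieldType) (T : finType).
Local Notation SB := (SB k).
Local Notation "1_ a" := (@idm k SB a) (at level 0, a at level 0, format "1_ a").
Implicit Types A B S J L K U W : {set T}.

Definition tensL (a : SB) : linFunctor SB SB.
Proof.
apply: (@LinFunctor k SB SB (sbTens a) (fun b c f => 1_ a \ot f)).
- by move=> b c f g fg; rewrite fg.
- by move=> b; apply: tens1.
- by move=> b c d f g; apply: tensMr.
- by move=> b c f g; apply: sbe_tensDr.
- by move=> b c x f; apply: sbe_tensZr.
Defined.

Definition tensR (a : SB) : linFunctor SB SB.
Proof.
apply: (@LinFunctor k SB SB (sbTens^~ a) (fun b c f => f \ot 1_ a)).
- by move=> b c f g fg; rewrite fg.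
- by move=> b; apply: tens1.
- by move=> b c d f g; apply: tensMl.
- by move=> b c f g; apply: sbe_tensDl.
- by move=> b c x f; apply: sbe_tensZl.
Defined.

#[global] Instance fmap_proper (F : linFunctor SB SB) a b :
  Proper (@heq k SB a b ==> @heq k SB _ _) (@fmap k SB SB F a b).
Proof. by move=> f g fg; apply: fmap_heq. Qed.

(* [p] exhibits [F (us S)] as the part of [us setT] seen when the labels in [U]
   and those outside of [U :|: S] are put aside. *)
Definition ctx (F : linFunctor SB SB) (U S : {set T})
    (p : hom SB (us k setT) (F (us k S))) :=
  forall W, W \subset S ->
    p \c Eh k setT (U :|: W) =~ fmap F (Eh k S W) \c p.

Lemma ctx_id : ctx (F := idFunctor SB) set0 (S := setT) (1_ (us k setT)).
Proof. by move=> W _; rewrite set0U comp1m compm1. Qed.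

Lemma ctx0 F U S p : @ctx F U S p -> p \c Eh k setT U =~ p.
Proof.
move=> pP; have := pP set0 (sub0set _); rewrite setU0 => ->.
by rewrite Eh0 (fmap1 F) comp1m.
Qed.

Lemma ctxS F U S p : @ctx F U S p -> p \c Eh k setT (U :|: S) =~ p.
Proof. by move=> pP; rewrite pP // EhT (fmap1 F) comp1m. Qed.

(** Putting a right factor aside leaves [U] unchanged, whereas in [ctx_tensL] the labels of the left
    factor join [U]. *)
Lemma ctx_tensR F U S p A B (b : SB) (d : hom SB (us k B) b) :
  @ctx F U S p -> part A B S ->
  ctx (F := compFunctor F (tensR b)) U (S := A)
    (fmap F ((1_ (us k A) \ot d) \c Dh k S A B) \c p).
Proof.
move=> pP pAB W WA; have WS : W \subset S.
  by case: pAB => _ <-; apply: subset_trans WA (subsetUl _ _).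
rewrite -compA (pP W WS) !compA; apply: comp_heq => //.
change (fmap (compFunctor F (tensR b)) (Eh k A W)) with
  (fmap F (Eh k A W \ot 1_ b)).
rewrite -!(fmapM F); apply: fmap_heq.
by rewrite -!compA (Dh_Eh_l k pAB WA) !compA tens_rl tens_lr.
Qed.

Lemma ctx_tensL F U S p A B (a : SB) (d : hom SB (us k A) a) :
  @ctx F U S p -> part A B S ->
  ctx (F := compFunctor F (tensL a)) (U :|: A) (S := B)
    (fmap F ((d \ot 1_ (us k B)) \c Dh k S A B) \c p).
Proof.
move=> pP pAB W WB; have WS : A :|: W \subset S.
  by case: pAB => _ <-; apply: setUS.
have AWE : (A :|: W) :\: A = W.
  rewrite setDUl setDv set0U; apply/setDidPl.
  case: pAB => d' _; rewrite disjoint_sym; apply: disjointWr d'.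
  exact: WB.
rewrite -setUA -compA (pP _ WS) !compA; apply: comp_heq => //.
change (fmap (compFunctor F (tensL a)) (Eh k B W)) with
  (fmap F (1_ a \ot Eh k B W)).
rewrite -!(fmapM F); apply: fmap_heq.
by rewrite -!compA (Dh_Eh_r k pAB (subsetUl A W) WS) AWE !compA tens_rl tens_lr.
Qed.

(** By [Dh_Mh_brd], the product of the two idempotents is [Dh k S A B] followed by the braiding and
    [Mh k B A S]. Replacing the braiding by its inverse, with the opposite splitting and product,
    inverts it. *)
Lemma local_swap A B S : part A B S ->
  inv_between (Eh k S A) (Eh k S B) (Eh k S B \c Eh k S A)
    (Mh k A B S \c (brdV (us k A) (us k B) \c Dh k S B A)).
Proof.
move=> p; have p' := part_sym p.
have c : Eh k S B \c Eh k S A =~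
    Mh k B A S \c (brd (us k A) (us k B) \c Dh k S A B).
  rewrite (EhE k p) (EhE k p') -!compA (compA (Dh k S B A) (Mh k A B S)).
  by rewrite (Dh_Mh_brd k p).
split.
- rewrite c -!compA (comp2 _ (Dh_MhK k p')) comp1m (comp2 _ (brdK _ _)) comp1m.
  by rewrite -(EhE k p).
- rewrite c -!compA (comp2 _ (Dh_MhK k p)) comp1m (comp2 _ (brdVK _ _)) comp1m.
  by rewrite -(EhE k p').
- by rewrite compA (Eh_absorbl k p).
- by rewrite -!compA (Eh_absorb k p').
Qed.

Section SwapInverse.
Variables (U A B : {set T}).
Let S := A :|: B.
Let F := compFunctor (tensL (us k U)) (tensR (us k ((setT :\: U) :\: S))).

(** The exchange of [A] and [B] takes place in the middle factor; [U] and the remaining labels are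
    spectators. *)
Definition proj3 : hom SB (us k setT) (F (us k S)) :=
  (1_ (us k U) \ot Dh k (setT :\: U) S ((setT :\: U) :\: S)) \c
  Dh k setT U (setT :\: U).

Definition incl3 : hom SB (F (us k S)) (us k setT) :=
  Mh k U (setT :\: U) setT \c
  (1_ (us k U) \ot Mh k S ((setT :\: U) :\: S) (setT :\: U)).

Fact Hh_sig : {f : hom SB (us k setT) (us k setT) | f =~ incl3 \c
  (fmap F (Mh k A B S \c (brdV (us k A) (us k B) \c Dh k S B A)) \c proj3)}.
Proof.
by exists (incl3 \c
  (fmap F (Mh k A B S \c (brdV (us k A) (us k B) \c Dh k S B A)) \c proj3)).
Qed.

Definition Hh := sval Hh_sig.

Hypotheses (UA : [disjoint U & A]) (UB : [disjoint U & B]) (AB : [disjoint A & B]).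

Let US : [disjoint U & S].
Proof.
by rewrite -setI_eq0 setIUr (disjoint_setI0 UA) (disjoint_setI0 UB) setU0.
Qed.

Let pU : part U (setT :\: U) setT.
Proof. by apply: part_sub; apply: subsetT. Qed.

Let pS : part S ((setT :\: U) :\: S) (setT :\: U).
Proof. by apply: part_sub; rewrite subsetD subsetT disjoint_sym. Qed.

Lemma proj3_ctx : @ctx F U S proj3.
Proof.
move=> W WS.
have UW : (U :|: W) :\: U = W.
  rewrite setDUl setDv set0U; apply/setDidPl; rewrite disjoint_sym.
  exact: disjointWr WS US.
rewrite /proj3 -compA (Dh_Eh_r k pU (subsetUl U W) (subsetT _)) UW !compA.
apply: comp_heq => //.
change (fmap F (Eh k S W)) with (1_ (us k U) \ot (Eh k S W \ot 1_ (us k ((setT :\: U) :\: S)))).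
by rewrite -!tensMr (Dh_Eh_l k pS WS).
Qed.

Lemma proj3K : proj3 \c incl3 =~ idm (F (us k S)).
Proof.
rewrite /proj3 /incl3 -!compA (comp2 _ (Dh_MhK k pU)) comp1m -tensMr.
by rewrite (Dh_MhK k pS) tens1.
Qed.

Lemma incl3K : incl3 \c proj3 =~ Eh k setT U \c Eh k setT (U :|: S).
Proof.
have UW : (U :|: S) :\: U = S.
  by rewrite setDUl setDv set0U; apply/setDidPl; rewrite disjoint_sym.
rewrite (EhE k pU) -compA (Dh_Eh_r k pU (subsetUl U S) (subsetT _)) UW.
by rewrite (EhE k pS) tensMr /incl3 /proj3 -!compA.
Qed.

Lemma ctx3_transport (x : hom SB (us k setT) (us k setT)) (y : hom SB (us k S) (us k S)) :
  Eh k setT U \c x =~ x -> Eh k setT (U :|: S) \c x =~ x ->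
  proj3 \c x =~ fmap F y \c proj3 -> x =~ incl3 \c (fmap F y \c proj3).
Proof.
by move=> h1 h2 h3; rewrite -h3 compA incl3K -compA h2 h1.
Qed.

Lemma ctx3_comp (y y' : hom SB (us k S) (us k S)) :
  incl3 \c (fmap F y \c proj3) \c (incl3 \c (fmap F y' \c proj3)) =~
  incl3 \c (fmap F (y \c y') \c proj3).
Proof.
by rewrite -(compA incl3) -(compA _ proj3) (compA proj3) proj3K comp1m
  (compA (fmap F y)) -(fmapM F).
Qed.

Lemma HhP : swap_inv (t := us k setT : SB) (Eh k setT) U A B Hh.
Proof.
have EP := Eh_chain k T.
(* A chain through [U] and [U :|: S] is the idempotent of [C] on the middle factor, conjugated by
   [incl3] and [proj3]; [local_swap] thus transfers. *)
have key (C : {set T}) : C \subset S -> prodE (t := us k setT : SB) (Eh k setT) [:: U; U :|: C; U :|: S] =~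
    incl3 \c (fmap F (Eh k S C) \c proj3).
  move=> CS.
  have cl : is_chain [:: U; U :|: C; U :|: S].
    by rewrite /is_chain /= /cmpset !subxx !subsetUl !(setUS U CS) ?orbT.
  apply: ctx3_transport.
  - by apply: (chain_absl EP) => //; rewrite inE eqxx.
  - by apply: (chain_absl EP) => //; rewrite !inE eqxx !orbT.
  rewrite !prodE_cons compA (ctx0 proj3_ctx) (comp22 _ (proj3_ctx CS)).
  by rewrite compm1 (ctxS proj3_ctx).
have e1 : prodE (t := us k setT : SB) (Eh k setT) (cuts3 U A B) =~ _ :=
  key A (subsetUl A B).
have e2 : prodE (t := us k setT : SB) (Eh k setT) (cuts3 U B A) =~
    incl3 \c (fmap F (Eh k S B) \c proj3).
  by rewrite -(key B (subsetUr A B)) /cuts3 (setUC B).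
have pAB : part A B S by split.
have [l1 l2 l3 l4] := local_swap pAB.
have hE := svalP Hh_sig; rewrite -/Hh in hE.
rewrite /swap_inv; split; rewrite ?e1 ?e2 ?hE ?ctx3_comp.
- by rewrite l1.
- by rewrite l2.
- by rewrite l3.
- by rewrite l4.
Qed.

End SwapInverse.

End Contexts.

(** * Objects with labelled points *)

Fixpoint pts (a : sbOb) : finType :=
  match a with
  | sbU J => J
  | sbTens a b => (pts a + pts b)%type
  end.

Lemma card_pts a : #|pts a| = sb_deg a.
Proof. by elim: a => //= a IHa b IHb; rewrite card_sum IHa IHb. Qed.

Section LabelledObjects.
Variables (k : fieldType) (T : finType).
Local Notation SB := (SB k).
Local Notation "1_ a" := (@idm k SB a) (at level 0, a at level 0, format "1_ a").
Local Notation us := (us k).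
Local Notation Mh := (Mh k).
Local Notation Dh := (Dh k).
Local Notation Eh := (Eh k).
Implicit Types A B S J L K U W : {set T}.

Definition lab (a : sbOb) := {ffun pts a -> T}.

Definition labl a b (al : lab (a \ox b)) : lab a := [ffun i => al (inl i)].
Definition labr a b (al : lab (a \ox b)) : lab b := [ffun i => al (inr i)].
Definition labp a b (al : lab a) (be : lab b) : lab (a \ox b) :=
  [ffun x => lsum al be x].

Lemma labpl a b (al : lab a) (be : lab b) : labl (labp al be) = al.
Proof. by apply/ffunP => i; rewrite !ffunE. Qed.

Lemma labpr a b (al : lab a) (be : lab b) : labr (labp al be) = be.
Proof. by apply/ffunP => i; rewrite !ffunE. Qed.

Lemma labpK a b (al : lab (a \ox b)) : labp (labl al) (labr al) = al.
Proof. by apply/ffunP => -[i|i]; rewrite !ffunE /= ffunE. Qed.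

Lemma img_lab a b (al : lab (a \ox b)) : img al = img (labl al) :|: img (labr al).
Proof.
rewrite -img_lsum; apply/setP => x; apply/imgP/imgP => -[i ->]; exists i;
  by case: i => i /=; rewrite ffunE.
Qed.

Definition good S a (al : lab a) := injectiveb al && (img al == S).

Lemma goodP S a (al : lab a) : reflect (injective al /\ img al = S) (good S al).
Proof. by apply: (iffP andP) => -[/injectiveP h /eqP]. Qed.

Lemma good_tens S a b (al : lab (a \ox b)) :
  good S al <-> [/\ good (img (labl al)) (labl al), good (img (labr al)) (labr al)
                 & part (img (labl al)) (img (labr al)) S].
Proof.
split=> [/goodP[ia e]|[/goodP[il _] /goodP[ir _] [d e]]].
  split.
  - by apply/goodP; split=> // i j; rewrite !ffunE => /ia[].
  - by apply/goodP; split=> // i j; rewrite !ffunE => /ia[].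
  split; last by rewrite -e img_lab.
  rewrite -setI_eq0; apply/eqP/setP => x; rewrite !in_set0 in_setI.
  apply/negP => /andP[/imgP[i ->] /imgP[j]]; rewrite !ffunE => /ia.
  by [].
apply/goodP; split; last by rewrite img_lab.
move=> x y; rewrite -[al]labpK !ffunE; exact: lsum_inj.
Qed.

(** The iterated coproduct cutting [us S] into the labelled factors of [a]; [Mlab] is the iterated
    product. For a good labelling they make [a] a retract of [us S]. *)
Fixpoint Dlab (a : sbOb) : forall S, lab a -> hom SB (us S) a :=
  match a return forall S, lab a -> hom SB (us S) a with
  | sbU _ => fun S al => tr k (@cz T S) al
  | sbTens a b => fun S al =>
      (Dlab (img (labl al)) (labl al) \ot Dlab (img (labr al)) (labr al)) \c
      Dh S (img (labl al)) (img (labr al))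
  end.

Fixpoint Mlab (a : sbOb) : forall S, lab a -> hom SB a (us S) :=
  match a return forall S, lab a -> hom SB a (us S) with
  | sbU _ => fun S al => tr k al (@cz T S)
  | sbTens a b => fun S al =>
      Mh (img (labl al)) (img (labr al)) S \c
      (Mlab (img (labl al)) (labl al) \ot Mlab (img (labr al)) (labr al))
  end.

Lemma DlabU I S (al : lab (sbU I)) : Dlab S al = tr k (@cz T S) al.
Proof. by []. Qed.

Lemma DlabT a b S (al : lab (a \ox b)) : Dlab S al =
  (Dlab (img (labl al)) (labl al) \ot Dlab (img (labr al)) (labr al)) \c
  Dh S (img (labl al)) (img (labr al)).
Proof. by []. Qed.

Lemma DlabP a b S A B (al : lab a) (be : lab b) : img al = A -> img be = B ->
  Dlab S (labp al be) = (Dlab A al \ot Dlab B be) \c Dh S A B.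
Proof. by move=> <- <-; rewrite DlabT labpl labpr. Qed.

Lemma MlabT a b S (al : lab (a \ox b)) : Mlab S al =
  Mh (img (labl al)) (img (labr al)) S \c
  (Mlab (img (labl al)) (labl al) \ot Mlab (img (labr al)) (labr al)).
Proof. by []. Qed.

Lemma Dlab_Mlab a S (al : lab a) : good S al -> Dlab S al \c Mlab S al =~ 1_ a.
Proof.
elim: a S al => [I|a IHa b IHb] S al gS.
  have [ia <-] := goodP _ _ gS.
  rewrite /Dlab /Mlab tr_comp ?tr_id ?img_cz //; exact: cz_inj.
have [gl gr p] := (good_tens _ _).1 gS.
rewrite DlabT MlabT -!compA (comp2 _ (Dh_MhK k p)) comp1m -tensM.
by rewrite IHa // IHb // tens1.
Qed.

(** For every tensor node, the union of the factors of [a] that stand to the left of its sign, in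
    the order in which [Mlab_Dlab] composes their idempotents. *)
Fixpoint rcuts (a : sbOb) : lab a -> seq {set T} :=
  match a return lab a -> seq {set T} with
  | sbU _ => fun _ => [::]
  | sbTens a b => fun al => img (labl al) ::
      map (fun W => img (labl al) :|: W) (rcuts (labr al)) ++ rcuts (labl al)
  end.

Lemma rcutsT a b (al : lab (a \ox b)) : rcuts al = img (labl al) ::
  map (fun W => img (labl al) :|: W) (rcuts (labr al)) ++ rcuts (labl al).
Proof. by []. Qed.

Lemma rcuts_sub a (al : lab a) W : W \in rcuts al -> W \subset img al.
Proof.
elim: a al W => [//|a IHa b IHb] al W; rewrite img_lab /= inE mem_cat.
case/or3P=> [/eqP->|/mapP[V /IHb Vr ->]|/IHa Wl].
- exact: subsetUl.
- exact: setUS.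
- exact: subset_trans Wl (subsetUl _ _).
Qed.

(** By [Dh_Eh_l] and [Dh_Eh_r] the idempotents that induction gives for the two factors move past
    [Dh] to [us S]; the cuts of the right factor are thereby enlarged by the labels of the left
    one. *)
Lemma Mlab_Dlab a S (al : lab a) : good S al ->
  Mlab S al \c Dlab S al =~ prodE (t := us S : SB) (Eh S) (rcuts al).
Proof.
elim: a S al => [I|a IHa b IHb] S al gS.
  have [ia e] := goodP _ _ gS.
  rewrite /Dlab /Mlab tr_comp ?tr_id ?img_cz //; exact: cz_inj.
have [gl gr p] := (good_tens _ _).1 gS.
rewrite DlabT MlabT -!compA (compA (Mlab _ _ \ot _)) -tensM IHa // IHb //.
rewrite -tens_rl -!compA rcutsT prodE_cons (EhE k p) -!compA prodE_cat.
have h1 : (prodE (t := us _ : SB) (Eh (img (labl al))) (rcuts (labl al)) \ot 1_ _) \c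
    Dh S (img (labl al)) (img (labr al)) =~
    Dh S (img (labl al)) (img (labr al)) \c
    prodE (t := us S : SB) (Eh S) (rcuts (labl al)).
  elim: (rcuts (labl al)) (@rcuts_sub _ (labl al)) => [|W l IH] ls.
    by rewrite prodE_nil tens1 comp1m compm1.
  rewrite prodE_cons tensMl -!compA IH; last by move=> V Vl; apply: ls; rewrite inE Vl orbT.
  rewrite compA -(Dh_Eh_l k p) -?compA //; apply: ls; exact: mem_head.
have h2 : (1_ _ \ot prodE (t := us _ : SB) (Eh (img (labr al))) (rcuts (labr al))) \c
    Dh S (img (labl al)) (img (labr al)) =~
    Dh S (img (labl al)) (img (labr al)) \c
    prodE (t := us S : SB) (Eh S)
      [seq img (labl al) :|: W | W <- rcuts (labr al)].
  elim: (rcuts (labr al)) (@rcuts_sub _ (labr al)) => [|W l IH] ls.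
    by rewrite prodE_nil tens1 comp1m compm1.
  rewrite map_cons !prodE_cons tensMr -!compA IH; last by move=> V Vl; apply: ls; rewrite inE Vl orbT.
  have Wr : W \subset img (labr al) by apply: ls; exact: mem_head.
  have WE : (img (labl al) :|: W) :\: img (labl al) = W.
    rewrite setDUl setDv set0U; apply/setDidPl; rewrite disjoint_sym.
    by case: p => d _; apply: disjointWr d.
  rewrite compA -{1}WE -(Dh_Eh_r k p) -?compA //; first exact: subsetUl.
  by case: p => _ <-; apply: setUS.
by rewrite h1 (comp22 _ h2).
Qed.

End LabelledObjects.

(** * Realization of the double incidence category in the PROB *)

Section CutsOfPartitions.
Variable n : nat.
Local Notation osp := (osp n).
Implicit Types (p q : osp) (W : {set 'I_n}).

Lemma mem_cut p m i : (i \in cut p m) = has (fun A : {set 'I_n} => i \in A) (take m (sval p)).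
Proof. by rewrite inE /part_of has_take // has_find; apply: (part_lt p i). Qed.

Definition lower p W :=
  forall i w, w \in W -> (part_of p i <= part_of p w)%N -> i \in W.

Lemma lower_cut p m : lower p (cut p m).
Proof. by move=> i w; rewrite !inE => wm iw; apply: leq_ltn_trans iw wm. Qed.

Lemma lower_cutE p W : lower p W ->
  exists2 m, (m <= size (sval p))%N & W = cut p m.
Proof.
move=> lW; exists (\max_(w in W) (part_of p w).+1).
  by apply/bigmax_leqP => w _; apply: part_lt.
apply/setP => i; rewrite inE; apply/idP/idP => [iW|].
  exact: (leq_bigmax_cond (F := fun w => (part_of p w).+1)).
have [/eqP W0|W0] := boolP (W == set0).
  by rewrite W0 big_pred0 // => w; rewrite in_set0.
have c : (0 < #|W|)%N by rewrite card_gt0.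
have [w wW ->] := eq_bigmax_cond (fun w => (part_of p w).+1) c.
by rewrite ltnS; apply: lW.
Qed.

(** Exchanging the parts with indices [m] and [m.+1], counted from 0, alters only the cut that
    separates them. *)
Lemma exch_cuts p q s A B t (m := size s) (U := cut p m) :
  sval p = s ++ A :: B :: t -> sval q = s ++ B :: A :: t ->
  [/\ [/\ [disjoint U & A], [disjoint U & B] & [disjoint A & B]],
      [/\ cut p m.+1 = U :|: A, cut q m.+1 = U :|: B &
          cut p m.+2 = U :|: (A :|: B)],
      (m.+2 <= size (sval p))%N, size (sval p) = size (sval q) &
      forall j, j != m.+1 -> cut p j = cut q j].
Proof.
rewrite {}/U {}/m => ep eq.
have [_ pd _] := and3P (svalP p).
rewrite ep pairwise_cat allrel_consr /= in pd.
rewrite allrel_consr /= in pd.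
move: pd => /and3P[/and3P[sA sB _] _ /andP[/andP[AB _] _]].
have hasU i : (i \in \bigcup_(C <- s) C) = has (fun C : {set 'I_n} => i \in C) s.
  elim: s {ep eq sA sB} => [|C s IH]; first by rewrite big_nil in_set0.
  by rewrite big_cons in_setU IH.
have dis (C : {set 'I_n}) : all (fun D : {set 'I_n} => [disjoint D & C]) s ->
    [disjoint \bigcup_(D <- s) D & C].
  move=> /allP sC; rewrite -setI_eq0; apply/eqP/setP => i.
  rewrite in_set0 in_setI hasU; apply/negP => /andP[/hasP[D Ds iD] iC].
  by rewrite (disjointFr (sC _ Ds) iD) in iC.
have -> : cut p (size s) = \bigcup_(C <- s) C.
  by apply/setP => i; rewrite mem_cut hasU ep take_size_cat.
split.
- by split=> //; apply: dis.
- split; apply/setP => i; rewrite mem_cut ?in_setU hasU ?ep ?eq.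
  + by rewrite take_cat ltnNge leqnSn /= subSnn has_cat /= orbF.
  + by rewrite take_cat ltnNge leqnSn /= subSnn has_cat /= orbF.
  + rewrite take_cat ltnNge leqW ?leqnSn //= -addn2 addKn /= has_cat /=.
    by rewrite take0 /= orbF.
- by rewrite (congr1 size ep) size_cat /=; lia.
- by rewrite (congr1 size ep) (congr1 size eq) !size_cat.
- move=> j js; apply/setP => i; rewrite !mem_cut ep eq !take_cat.
  case: ltnP => // sj; rewrite !has_cat; congr (_ || _).
  have : (j - size s != 1)%N by lia.
  case: (j - size s)%N => [|[|d]] //= _.
  by rewrite orbCA.
Qed.

End CutsOfPartitions.

(** * The relations of Q_n among products of [Eh] *)

Section Realization.
Variables (k : fieldType) (R : realType) (n : nat).
Local Notation SB := (SB k).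
Local Notation Q := (Q k R n).
Local Notation osp := (osp n).
Local Notation X := (us k [set: 'I_n] : SB).
Local Notation E := (Eh k [set: 'I_n]).
Implicit Types (p q r : osp) (W : {set 'I_n}).

Let EP : chain_idem (C := SB) (t := X) E := Eh_chain k 'I_n.

Definition ehat p : hom SB X X := prodE (t := X) E (cuts p).

Lemma ehat_absl p W : lower p W -> E W \c ehat p =~ ehat p.
Proof.
move=> /lower_cutE[m mp ->]; apply: (chain_absl EP (cuts_chain p)).
by apply/mapP; exists m => //; rewrite mem_rev mem_iota ltnS.
Qed.

Lemma ehat_absr p W : lower p W -> ehat p \c E W =~ ehat p.
Proof.
move=> /lower_cutE[m mp ->]; apply: (chain_absr EP (cuts_chain p)).
by apply/mapP; exists m => //; rewrite mem_rev mem_iota ltnS.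
Qed.

Lemma ehat_id p : ehat p \c ehat p =~ ehat p.
Proof. exact: (prodE_idem EP (cuts_chain p)). Qed.

Lemma lower_finer p q W : finer p q -> lower q W -> lower p W.
Proof. by move=> pq lW i w wW /pq; apply: lW. Qed.

Lemma ehat_finerl p q : finer p q -> ehat q \c ehat p =~ ehat p.
Proof.
move=> pq; apply: prodE_fixl => _ /mapP[m _ ->].
apply: ehat_absl; exact: lower_finer pq (@lower_cut _ q m).
Qed.

Lemma ehat_finerr p q : finer p q -> ehat p \c ehat q =~ ehat p.
Proof.
move=> pq; apply: prodE_fixr => _ /mapP[m _ ->].
apply: ehat_absr; exact: lower_finer pq (@lower_cut _ q m).
Qed.

(** The cuts of [q] are lower for the product of the preorders of [p] and [r], so [insert_chain]
    places their product between [ehat r] and [ehat p]. *)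
Lemma ehat_collinear p q r : collinear R p q r ->
  ehat r \c (ehat q \c ehat p) =~ ehat r \c ehat p.
Proof.
move=> c; rewrite compA.
apply: (insert_chain EP (rk1 := part_of p) (rk2 := part_of r)).
- move=> S; apply: ehat_absl => i w; rewrite !inE => /existsP[v /andP[vS wv]] iw.
  by apply/existsP; exists v; rewrite vS (leq_trans iw wv).
- apply/allP => _ /mapP[m _ ->]; apply/forallP => w; apply/implyP => wm.
  apply/forallP => i; apply/implyP => iw1; apply/implyP => iw2.
  exact: lower_cut wm (collinear_mono c iw1 iw2).
- rewrite pairwise_map; have : sorted gtn (rev (iota 0 (size (sval q)).+1)).
    by rewrite rev_sorted iota_ltn_sorted.
  rewrite sorted_pairwise => [|x y z yx zy]; last exact: ltn_trans zy yx.
  by apply: sub_pairwise => m m' /= /ltnW; apply: cut_sub.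
- move=> j; have -> : [set i | (part_of r i < j)%N] = cut r j by [].
  exact: ehat_absr (@lower_cut _ r j).
Qed.

Definition exchb p q i :=
  (i.+1 < size (sval p))%N && (sval q == take i (sval p) ++
    nth set0 (sval p) i.+1 :: nth set0 (sval p) i :: drop i.+2 (sval p)).

(* The blocks exchanged by [exch p q] are recovered from [p] and [q], since the
   existential statement [exch p q] cannot be eliminated into a morphism. *)
Definition htau p q : hom SB X X :=
  if [pick i : 'I_(size (sval p)) | exchb p q i] is Some i then
    ehat p \c (Hh k (cut p i) (nth set0 (sval p) i) (nth set0 (sval p) i.+1) \c ehat q)
  else hzero X X.

Lemma htauP p q : exch p q ->
  inv_between (ehat p) (ehat q) (ehat q \c ehat p) (htau p q).
Proof.
move=> [s [A [B [t [ep eq]]]]]; rewrite /htau; case: pickP => [i|]; last first.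
  have si : (size s < size (sval p))%N.
    by rewrite (congr1 size ep) size_cat /=; lia.
  move/(_ (Ordinal si)) => /=; rewrite /exchb ep eq /= => /negP[].
  have n0 : nth set0 (s ++ [:: A, B & t]) (size s) = A by rewrite nth_cat ltnn subnn.
  have n1 : nth set0 (s ++ [:: A, B & t]) (size s).+1 = B.
    by rewrite nth_cat ltnNge leqnSn /= subSnn.
  have dr : drop (size s).+2 (s ++ [:: A, B & t]) = t.
    by rewrite drop_cat ltnNge leqW ?leqnSn //= -addn2 addKn /= drop0.
  by rewrite n0 n1 dr take_size_cat // eqxx andbT size_cat /=; lia.
case/andP=> ip /eqP {s A B t ep}eq.
have {}ep : sval p = take i (sval p) ++
    nth set0 (sval p) i :: nth set0 (sval p) i.+1 :: drop i.+2 (sval p).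
  by rewrite -!drop_nth ?cat_take_drop // ltnW.
have := exch_cuts ep eq.
move: (nth _ _ i) (nth _ _ i.+1) => A B.
rewrite size_take ltnW ?ip // {ep eq}.
set U := cut p i => -[[UA UB AB] [cA cB cAB] _ sz cj].
(* The cuts shared by [p] and [q]: all but the one between the exchanged parts. Their product is the
   factor [K] of [swap_inv_refine]. *)
pose com := [seq cut p m | m <- rev (iota 0 (size (sval p)).+1) & m != i.+1].
have hP := HhP k UA UB AB.
have memj r m : (m <= size (sval r))%N -> cut r m \in cuts r.
  by move=> mr; apply/mapP; exists m => //; rewrite mem_rev mem_iota ltnS.
have inc m : (m <= size (sval p))%N -> m != i.+1 -> cut p m \in com.
  by move=> mp mi; apply/mapP; exists m => //; rewrite mem_filter mi mem_rev mem_iota ltnS.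
have subcom : {subset com <= cuts p}.
  by move=> V /mapP[m]; rewrite mem_filter => /andP[_ mm] ->; apply/mapP; exists m.
have comq V : V \in com -> V \in cuts q.
  case/mapP=> m; rewrite mem_filter => /andP[mi]; rewrite mem_rev mem_iota /= => mp {V}->.
  by rewrite cj //; apply: memj; rewrite -sz; move: mp; rewrite ltnS.
have Up : U \in cuts p by apply: memj; apply: ltnW.
have UAp : U :|: A \in cuts p by rewrite -cA memj // ltnW.
have UABp : U :|: (A :|: B) \in cuts p by rewrite -cAB memj.
have Uq : U \in cuts q by rewrite /U cj ?memj -?sz ?(ltnW ip) //; lia.
have UBq : U :|: B \in cuts q by rewrite -cB memj // -sz ltnW.
have UBAq : U :|: (B :|: A) \in cuts q.
  by rewrite (setUC B) -cAB cj ?memj -?sz //; lia.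
have cp := cuts_chain p; have cq := cuts_chain q.
have chcom : is_chain com := is_chain_sub subcom cp.
apply: (swap_inv_refine hP (K := prodE (t := X) E com)).
- exact: (prodE_idem EP chcom).
- move=> V Vl; apply: heq_sym; apply: prodE_comm => W Wcom; apply: (chain_comm EP).
  move: Vl; rewrite !inE => /or4P[]/eqP->.
  + exact: is_chainP cp Up (subcom _ Wcom).
  + exact: is_chainP cp UAp (subcom _ Wcom).
  + exact: is_chainP cq UBq (comq _ Wcom).
  + exact: is_chainP cp UABp (subcom _ Wcom).
- rewrite -(prodE_cat (t := X)); have sub : {subset com ++ cuts3 U A B <= cuts p}.
    move=> V; rewrite mem_cat !inE => /or4P[/subcom//|/eqP->|/eqP->|/eqP->]//.
  apply: (prodE_eq EP cp (is_chain_sub sub cp)).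
    apply/allP => V /mapP[m]; rewrite mem_rev mem_iota ltnS => mp {V}->.
    have [->|mi] := eqVneq m i.+1; first by rewrite cA !(mem_cat, inE) eqxx !orbT.
    by rewrite mem_cat inc // !orbT.
  by apply/allP => V /sub ->; rewrite !orbT.
- rewrite -(prodE_cat (t := X)); have sub : {subset com ++ cuts3 U B A <= cuts q}.
    move=> V; rewrite mem_cat !inE => /or4P[/comq//|/eqP->|/eqP->|/eqP->]//.
  apply: (prodE_eq EP cq (is_chain_sub sub cq)).
    apply/allP => V /mapP[m]; rewrite mem_rev mem_iota ltnS -sz => mp {V}->.
    have [->|mi] := eqVneq m i.+1; first by rewrite cB !(mem_cat, inE) eqxx !orbT.
    by rewrite -cj // mem_cat inc // !orbT.
  by apply/allP => V /sub ->; rewrite !orbT.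
Qed.

(** The object [p] is represented by the image of [ehat p], so that all morphisms land in the single
    algebra of endomorphisms of [X]; Ind and Res become the idempotent of the smaller parabolic. *)
Fixpoint Ghat p q (f : qHom k R p q) : hom SB X X :=
  match f with
  | q_id p => ehat p
  | q_comp _ _ _ f1 f2 => Ghat f1 \c Ghat f2
  | q_zero _ _ => hzero X X
  | q_add _ _ f1 f2 => hadd (Ghat f1) (Ghat f2)
  | q_scale _ _ x f1 => hscale x (Ghat f1)
  | q_Ind p _ _ => ehat p
  | q_Res _ p _ => ehat p
  | q_tauV p q _ => htau p q
  end.

Lemma Ghat_comp p q r (f : hom Q q r) (g : hom Q p q) :
  Ghat (f \c g) = Ghat f \c Ghat g.
Proof. by []. Qed.

(** The form that the unit laws take, identities being sent to idempotents. *)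
Lemma Ghat_abs p q (f : hom Q p q) :
  ehat q \c Ghat f =~ Ghat f /\ Ghat f \c ehat p =~ Ghat f.
Proof.
elim: f => {p q} [p|p q r f [IHf _] g [_ IHg]|p q|p q f [IHf IHf'] g [IHg IHg']|
  p q x f [IHf IHf']|p q h|q p h|p q h].
- by split; apply: ehat_id.
- have -> : Ghat (q_comp f g) = Ghat f \c Ghat g by [].
  by rewrite compA IHf -compA IHg.
- by split; [apply: comp0r|apply: comp0l].
- have -> : Ghat (q_add f g) = hadd (Ghat f) (Ghat g) by [].
  by rewrite compDr compDl IHf IHf' IHg IHg'.
- have -> : Ghat (q_scale x f) = hscale x (Ghat f) by [].
  by rewrite compZr compZl IHf IHf'.
- by have /psubE h' := h; split; [apply: ehat_finerl|apply: ehat_id].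
- by have /psubE h' := h; split; [apply: ehat_id|apply: ehat_finerr].
- have [_ _ h1 h2] := htauP h; split; [exact: h1|exact: h2].
Qed.

Lemma Ghat_tau p q : Ghat (q_tau k R p q) = ehat q \c ehat p.
Proof. by []. Qed.

Lemma Ghat_heq p q (f g : hom Q p q) : f =~ g -> Ghat f =~ Ghat g.
Proof.
elim=> {p q f g}.
- by move=> p q f; apply: heq_refl.
- by move=> p q f g _ IH; apply: heq_sym.
- by move=> p q f g h _ IH1 _ IH2; apply: heq_trans IH1 IH2.
- by move=> p q r f f' g g' _ IHf _ IHg; apply: comp_heq.
- by move=> p q f f' g g' _ IHf _ IHg; apply: hadd_heq.
- by move=> p q x f f' _ IHf; apply: hscale_heq.
- by move=> p q r s f g h; apply: compA.
- by move=> p q f; case: (Ghat_abs f).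
- by move=> p q f; case: (Ghat_abs f).
- by move=> p q f g h; apply: haddA.
- by move=> p q f g; apply: haddC.
- by move=> p q f; apply: hadd0.
- by move=> p q f; apply: haddN.
- by move=> p q x y f; apply: hscaleA.
- by move=> p q f; apply: hscale1.
- by move=> p q x f g; apply: hscaleDr.
- by move=> p q x y f; apply: hscaleDl.
- by move=> p q r f f' g; apply: compDl.
- by move=> p q r f g g'; apply: compDr.
- by move=> p q r x f g; apply: compZl.
- by move=> p q r x f g; apply: compZr.
- by move=> p h; apply: heq_refl.
- by move=> p h; apply: heq_refl.
- by move=> p q r h1 h2 h3; apply: ehat_finerl; have /psubE := h1.
- by move=> p q r h1 h2 h3; apply: ehat_finerr; have /psubE := h1.
- by move=> p q h; apply: ehat_id.
- move=> p q r c; rewrite Ghat_tau.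
  have -> : Ghat (q_comp (q_tau k R q r) (q_tau k R p q)) =
      (ehat r \c ehat q) \c (ehat q \c ehat p) by [].
  by rewrite -(compA (ehat r)) (compA (ehat q)) ehat_id ehat_collinear.
- by move=> p q h; case: (htauP h).
- by move=> p q h; case: (htauP h).
Qed.

#[global] Instance Ghat_proper p q :
  Proper (@heq k Q p q ==> @heq k SB X X) (@Ghat p q).
Proof. by move=> f g; apply: Ghat_heq. Qed.

Lemma Ghat_osp_idem p : Ghat (osp_idem k R p) =~ ehat p.
Proof. exact: ehat_id. Qed.

(** Besides [W], the only cuts of a two-block partition are the empty and the full set, which
    contribute identities. *)
Lemma ehat2 W : ehat (osp2 W) =~ E W.
Proof.
have c : is_chain [:: W] by rewrite /is_chain /= /cmpset subxx.
rewrite -(prodE1 E W).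
have lowE V : lower (osp2 W) V -> [|| V == set0, V == setT | V \in [:: W]].
  move=> lV; rewrite inE; have r := ranks_rk (fun i => (i \notin W) : nat).
  have lVi i w : w \in V -> ((i \notin W) <= (w \notin W))%N -> i \in V.
    by move=> wV; rewrite -r; apply: lV wV.
  have [|/set0Pn[w wV]] := eqVneq V set0; rewrite //=.
  have WV : W \subset V by apply/subsetP => i iW; apply: lVi wV _; rewrite iW.
  have [VW|/subsetPn[v vV vW]] := boolP (V \subset W).
    by apply/orP; right; rewrite eqEsubset VW.
  apply/orP; left; rewrite eqEsubset subsetT; apply/subsetP => i _.
  by apply: lVi vV _; rewrite vW leq_b1.
apply: (prodE_eq EP (cuts_chain _) c).
  apply/allP => _ /mapP[m _ ->]; apply: lowE; exact: lower_cut.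
rewrite /chain_sub /= andbT; apply/or3P; apply: Or33.
have lW : lower (osp2 W) W.
  by move=> i w wW; rewrite (ranks_rk (fun i => (i \notin W) : nat)) wW; case: (i \in W).
have [m mW {1}->] := lower_cutE lW.
by apply/mapP; exists m => //; rewrite mem_rev mem_iota ltnS.
Qed.

Lemma Ghat_qE W : Ghat (qE k R W) =~ E W.
Proof. by rewrite -ehat2; apply: Ghat_osp_idem. Qed.

End Realization.

(** * Permutations of the labels *)

Section Relabelling.
Variables (k : fieldType) (T : finType).
Local Notation SB := (SB k).
Local Notation "1_ a" := (@idm k SB a) (at level 0, a at level 0, format "1_ a").
Implicit Types (g h : {perm T}) (A B S : {set T}).

Lemma img_perm g (I : finType) (al : I -> T) : img (g \o al) = g @: img al.
Proof.
apply/setP => x; apply/imgP/imsetP => [[i ->]|[_ /imgP[i ->] ->]].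
  by exists (al i); rewrite ?mem_img.
by exists i.
Qed.

Lemma perm_comp_inj g (I : finType) (al : I -> T) :
  injective al -> injective (g \o al).
Proof. by move=> ia; apply: inj_comp ia; apply: perm_inj. Qed.

Lemma tr_ext (I J : finType) (al al' : I -> T) (be be' : J -> T) :
  injective al -> injective be -> img al = img be -> al =1 al' -> be =1 be' ->
  tr k al be =~ tr k al' be'.
Proof.
move=> ia ib e ea eb; have [s sP se] := same_img_bij ia ib e.
have ib' : injective be' by move=> i j; rewrite -!eb; apply: ib.
have se' i : be' (s i) = al' i by rewrite -ea -eb.
by apply: heq_trans (trE k sP ib se) (heq_sym (trE k sP ib' se')).
Qed.

Lemma tr_perm g (I J : finType) (al : I -> T) (be : J -> T) :
  injective al -> injective be -> img al = img be ->
  tr k (g \o al) (g \o be) =~ tr k al be.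
Proof.
move=> ia ib e; have [s sP se] := same_img_bij ia ib e.
have se' i : (g \o be) (s i) = (g \o al) i by rewrite /= se.
exact: heq_trans (trE k sP (@perm_comp_inj g _ _ ib) se') (heq_sym (trE k sP ib se)).
Qed.

(** Meaningful for [S' = g @: S]; the target is a free argument for the same reason as in [Mh]. *)
Definition gmap g S S' : hom SB (us k S) (us k S') := tr k (g \o @cz T S) (@cz T S').

Lemma part_perm g A B S : part A B S -> part (g @: A) (g @: B) (g @: S).
Proof.
case=> d <-; split; last by rewrite imsetU.
by rewrite -setI_eq0 -imsetI ?(disjoint_setI0 d) ?imset0 // => x y _ _; apply: perm_inj.
Qed.

Lemma gmap_comp g h A B C : B = h @: A -> C = g @: B ->
  gmap g B C \c gmap h A B =~ gmap (h * g)%g A C.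
Proof.
move=> eB eC; rewrite /gmap.
have ih : injective (h \o @cz T A) by apply/perm_comp_inj/cz_inj.
have igh : injective (g \o (h \o @cz T A)) by apply/perm_comp_inj.
have ig : injective (g \o @cz T B) by apply/perm_comp_inj/cz_inj.
have e1 : img (h \o @cz T A) = B by rewrite img_perm img_cz.
rewrite -(tr_perm g ih (@cz_inj _ B)) ?img_cz ?e1 //.
rewrite tr_comp //; try exact: cz_inj; try by rewrite !img_perm ?e1 ?img_cz.
- apply: tr_ext => //; try exact: cz_inj; first by rewrite img_perm e1 img_cz.
  by move=> x /=; rewrite permM.
- by rewrite [LHS]img_perm [RHS]img_perm e1 img_cz.
Qed.

Lemma gmap1 S : gmap 1%g S S =~ 1_ (us k S).
Proof.
rewrite -(tr_id k (@cz_inj T S)); apply: tr_ext => //; try exact: cz_inj.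
- by apply/perm_comp_inj/cz_inj.
- by rewrite img_perm img_cz; apply/setP => x; rewrite -{1}[x]perm1 mem_imset //;
    apply: perm_inj.
- by move=> x /=; rewrite perm1.
Qed.

Lemma gmap_Mh g A B S A' B' S' : part A B S ->
  A' = g @: A -> B' = g @: B -> S' = g @: S ->
  gmap g S S' \c Mh k A B S =~ Mh k A' B' S' \c (gmap g A A' \ot gmap g B B').
Proof.
move=> p eA eB eS; have p' : part A' B' S' by rewrite eA eB eS; apply: part_perm.
have [d _] := p; have [d' _] := p'.
have iA : injective (g \o @cz T A) by apply/perm_comp_inj/cz_inj.
have iB : injective (g \o @cz T B) by apply/perm_comp_inj/cz_inj.
have iS : injective (g \o @cz T S) by apply/perm_comp_inj/cz_inj.
have mA : img (g \o @cz T A) = A' by rewrite img_perm img_cz.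
have mB : img (g \o @cz T B) = B' by rewrite img_perm img_cz.
have mS : img (g \o @cz T S) = S' by rewrite img_perm img_cz.
have mAB : img (g \o lsum (@cz T A) (@cz T B)) = S'.
  by rewrite img_perm (part_img p).
have iAB : injective (g \o lsum (@cz T A) (@cz T B)).
  by apply/perm_comp_inj/(part_inj p).
rewrite !MhE -compA -tr_mu ?mA ?mB ?img_cz //; try exact: cz_inj.
rewrite /gmap compA compA -(tr_perm g (part_inj p) (@cz_inj _ S)); last first.
  by rewrite (part_img p) img_cz.
apply: comp_heq => //.
have iAB' : injective (lsum (g \o @cz T A) (g \o @cz T B)).
  by apply: lsum_inj; rewrite ?mA ?mB.
have mAB' : img (lsum (g \o @cz T A) (g \o @cz T B)) = S'.
  by rewrite img_lsum mA mB; case: p'.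
rewrite !tr_comp ?img_cz ?mAB ?mS ?mAB' ?(part_img p') //;
  try solve [exact: cz_inj|exact: part_inj p'].
by apply: tr_ext => //; [exact: cz_inj|rewrite mAB img_cz|case].
Qed.

Lemma gmap_Dh g A B S A' B' S' : part A B S ->
  A' = g @: A -> B' = g @: B -> S' = g @: S ->
  Dh k S' A' B' \c gmap g S S' =~ (gmap g A A' \ot gmap g B B') \c Dh k S A B.
Proof.
move=> p eA eB eS; have p' : part A' B' S' by rewrite eA eB eS; apply: part_perm.
have [d _] := p; have [d' _] := p'.
have iA : injective (g \o @cz T A) by apply/perm_comp_inj/cz_inj.
have iB : injective (g \o @cz T B) by apply/perm_comp_inj/cz_inj.
have iS : injective (g \o @cz T S) by apply/perm_comp_inj/cz_inj.
have mA : img (g \o @cz T A) = A' by rewrite img_perm img_cz.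
have mB : img (g \o @cz T B) = B' by rewrite img_perm img_cz.
have mS : img (g \o @cz T S) = S' by rewrite img_perm img_cz.
have mAB : img (g \o lsum (@cz T A) (@cz T B)) = S'.
  by rewrite img_perm (part_img p).
have iAB : injective (g \o lsum (@cz T A) (@cz T B)).
  by apply/perm_comp_inj/(part_inj p).
rewrite !DhE -compA [X in heq _ X]compA -tr_dl ?mA ?mB ?img_cz //; try exact: cz_inj.
rewrite /gmap -[X in heq _ X]compA -(tr_perm g (@cz_inj _ S) (part_inj p)); last first.
  by rewrite (part_img p) img_cz.
apply: comp_heq => //.
have iAB' : injective (lsum (g \o @cz T A) (g \o @cz T B)).
  by apply: lsum_inj; rewrite ?mA ?mB.
have mAB' : img (lsum (g \o @cz T A) (g \o @cz T B)) = S'.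
  by rewrite img_lsum mA mB; case: p'.
have -> : tr k (g \o @cz T S) (g \o lsum (@cz T A) (@cz T B)) =~
    tr k (g \o @cz T S) (lsum (g \o @cz T A) (g \o @cz T B)).
  by apply: tr_ext => //; [rewrite mAB mS|case].
by rewrite !tr_comp ?img_cz ?mAB ?mS ?mAB' ?(part_img p') //;
  try solve [exact: cz_inj|exact: part_inj p'].
Qed.

Lemma imset_permT g : [set: T] = g @: setT.
Proof.
apply/setP => x; rewrite in_setT; apply/esym/imsetP.
by exists ((g^-1)%g x); rewrite ?permKV.
Qed.

Lemma gmap_Eh g W : gmap g setT setT \c Eh k setT W =~
  Eh k setT (g @: W) \c gmap g setT setT.
Proof.
have pT A : part A (setT :\: A) setT by apply: part_sub; apply: subsetT.
have gT := imset_permT g.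
have p' : part (g @: W) (g @: (setT :\: W)) setT.
  by rewrite {2}gT; apply: part_perm.
rewrite (EhE k (pT W)) (EhE k p') compA (gmap_Mh (pT W) erefl erefl gT).
by rewrite -!compA (gmap_Dh (pT W) erefl erefl gT).
Qed.

Lemma gmap_Dlab g a S S' (al al' : lab T a) : good S al -> S' = g @: S ->
  al' = [ffun i => g (al i)] -> Dlab k S' al' \c gmap g S S' =~ Dlab k S al.
Proof.
elim: a S S' al al' => [J|a IHa b IHb] S S' al al' gS eS eal.
  have [ia e] := goodP _ _ gS.
  have iS : injective (g \o @cz T S) by apply/perm_comp_inj/cz_inj.
  have ea : al' =1 g \o al by move=> i; rewrite eal ffunE.
  have ia' : injective al' by move=> i j; rewrite !ea => /perm_inj/ia.
  have me : img al' = S'.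
    by rewrite eS -e -img_perm; apply/setP => x; apply/imgP/imgP => -[i ->]; exists i.
  rewrite !DlabU tr_comp ?img_perm ?img_cz -?eS ?me //; try exact: cz_inj.
  rewrite -(tr_perm g (@cz_inj T S) ia) ?img_cz //; apply: tr_ext => //.
  by rewrite img_perm img_cz me.
have [gl gr p] := (good_tens _ _).1 gS.
have el : labl al' = [ffun i => g (labl al i)].
  by apply/ffunP => i; rewrite eal !ffunE.
have er : labr al' = [ffun i => g (labr al i)].
  by apply/ffunP => i; rewrite eal !ffunE.
have im c (be : lab T c) : img [ffun i => g (be i)] = g @: img be.
  by rewrite -img_perm; apply/setP => x; apply/imgP/imgP => -[i ->]; exists i;
    rewrite /= ?ffunE.
rewrite !DlabT -compA (gmap_Dh p) ?el ?er ?im // compA -tensM.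
by rewrite (IHa _ _ _ _ gl) ?(IHb _ _ _ _ gr).
Qed.

End Relabelling.

(** * Equivariance of the realization *)

Section Equivariance.
Variables (k : fieldType) (R : realType) (n : nat).
Local Notation SB := (SB k).
Local Notation Q := (Q k R n).
Local Notation osp := (osp n).
Local Notation X := (us k [set: 'I_n] : SB).
Local Notation E := (Eh k [set: 'I_n]).
Implicit Types (p q r : osp) (g : 'S_n).

Definition gm g : hom SB X X := gmap k g setT setT.

Lemma gmM g h : gm g \c gm h =~ gm (h * g)%g.
Proof. by apply: gmap_comp; apply: imset_permT. Qed.

Lemma gm1 : gm 1%g =~ idm X.
Proof. exact: gmap1. Qed.

Lemma cut_act g p m : cut (osp_act g p) m = g @: cut p m.
Proof.
apply/setP => i; rewrite -(permKV g i) mem_act !inE.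
by rewrite part_of_act.
Qed.

Lemma cuts_act g p : cuts (osp_act g p) = [seq g @: W | W : {set 'I_n} <- cuts p].
Proof.
rewrite /cuts -map_comp /= /osp_act_seq size_map; apply: eq_map => m /=.
exact: cut_act.
Qed.

Lemma gm_ehat g p : gm g \c ehat k p =~ ehat k (osp_act g p) \c gm g.
Proof.
rewrite /ehat cuts_act; apply: prodE_intertwine => W _; exact: gmap_Eh.
Qed.

Lemma gm_Ghat g p q (f : hom Q p q) :
  gm g \c Ghat f =~ Ghat (q_act g f) \c gm g.
Proof.
elim: f => {p q} [p|p q r f IHf f' IHf'|p q|p q f IHf f' IHf'|p q x f IHf|
  p q h|q p h|p q h].
- exact: gm_ehat.
- have -> : Ghat (q_comp f f') = Ghat f \c Ghat f' by [].
  have -> : Ghat (q_act g (q_comp f f')) = Ghat (q_act g f) \c Ghat (q_act g f') by [].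
  by rewrite compA IHf -!compA IHf'.
- exact: heq_trans (comp0r _ _) (heq_sym (comp0l _ _)).
- have -> : Ghat (q_add f f') = hadd (Ghat f) (Ghat f') by [].
  have -> : Ghat (q_act g (q_add f f')) =
    hadd (Ghat (q_act g f)) (Ghat (q_act g f')) by [].
  by rewrite compDr compDl IHf IHf'.
- have -> : Ghat (q_scale x f) = hscale x (Ghat f) by [].
  have -> : Ghat (q_act g (q_scale x f)) = hscale x (Ghat (q_act g f)) by [].
  by rewrite compZr compZl IHf.
- exact: gm_ehat.
- exact: gm_ehat.
(* Both sides are inverses between idempotents that [gm g] carries into each other, so they are
   carried into each other as well. *)
- apply: (inv_intertwine (htauP k h) (htauP k (exch_act g h))).
  + exact: gm_ehat.
  + exact: gm_ehat.
  + by rewrite (compA (gm g)) (gm_ehat g q) -(compA _ (gm g)) (gm_ehat g p) compA.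
Qed.

Lemma Ghat_prodE l : Ghat (prodE (t := osp_top n : Q) (qE k R (n := n)) l) =~
  prodE (t := X) E l.
Proof.
elim: l => [|W l IH].
  rewrite !prodE_nil; have -> : Ghat (idm (osp_top n : Q)) = ehat k (osp_top n) by [].
  have EP := Eh_chain k 'I_n.
  rewrite -(prodE_nil (t := X) E); apply: (prodE_eq EP (cuts_chain _)) => //.
  apply/allP => _ /mapP[m _ ->]; rewrite in_nil orbF; case: m => [|m].
    by apply/orP; left; apply/eqP/setP => i; rewrite !inE.
  by apply/orP; right; apply/eqP/setP => i; rewrite !inE part_top.
by rewrite !prodE_cons Ghat_comp Ghat_qE IH.
Qed.

Lemma Ghat_qhP (U S W : {set 'I_n}) : [disjoint U & S] -> [disjoint U & W] -> [disjoint S & W] ->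
  swap_inv (t := X) E U S W (Ghat (qh k R U S W)).
Proof.
move=> US UW SW; have [l1 l2 l3 l4] := qhP k R US UW SW; split.
- by rewrite -!Ghat_prodE -!Ghat_comp; apply: Ghat_heq.
- by rewrite -!Ghat_prodE -!Ghat_comp; apply: Ghat_heq.
- by rewrite -!Ghat_prodE -!Ghat_comp; apply: Ghat_heq.
- by rewrite -!Ghat_prodE -!Ghat_comp; apply: Ghat_heq.
Qed.

End Equivariance.

(** * Operators attached to the morphisms of the PROB *)

Section LabelOperations.
Variable T : finType.
Implicit Types (U S W A B : {set T}) (th : {perm T}).
Local Notation lab := (lab T).

Definition lab0 : lab sb1 := [ffun v : void => of_void T v].

(** Labels are pulled back from the target of a structural morphism to its source, because [Fop]
    computes a row from the label of the target. *)
Definition labA a b c (be : lab (a \ox (b \ox c))) : lab ((a \ox b) \ox c) :=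
  labp (labp (labl be) (labl (labr be))) (labr (labr be)).

Definition labAV a b c (be : lab ((a \ox b) \ox c)) : lab (a \ox (b \ox c)) :=
  labp (labl (labl be)) (labp (labr (labl be)) (labr be)).

Definition labC a b (be : lab (b \ox a)) : lab (a \ox b) := labp (labr be) (labl be).

Definition labs (I J : finType) (s : I -> J) (be : lab (sbU J)) : lab (sbU I) :=
  [ffun i => be (s i)].

Definition plab th a (be : lab a) : lab a := [ffun i => th (be i)].

Lemma labCl a b (be : lab (b \ox a)) : labl (labC be) = labr be.
Proof. exact: labpl. Qed.

Lemma labCr a b (be : lab (b \ox a)) : labr (labC be) = labl be.
Proof. exact: labpr. Qed.

Lemma lab0E (be : lab sb1) : be = lab0.
Proof. by apply/ffunP => -[]. Qed.

Lemma img_lab0 : img lab0 = set0.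
Proof. by apply/setP => x; rewrite in_set0; apply/imgP => -[[]]. Qed.

Lemma img_labp a b (al : lab a) (be : lab b) : img (labp al be) = img al :|: img be.
Proof. by rewrite img_lab labpl labpr. Qed.

Lemma img_plab th a (be : lab a) : img (plab th be) = th @: img be.
Proof.
rewrite -img_perm; apply/setP => x; apply/imgP/imgP => -[i ->]; exists i;
  by rewrite /= ?ffunE.
Qed.

Lemma plab_l th a b (be : lab (a \ox b)) : labl (plab th be) = plab th (labl be).
Proof. by apply/ffunP => i; rewrite !ffunE. Qed.

Lemma plab_r th a b (be : lab (a \ox b)) : labr (plab th be) = plab th (labr be).
Proof. by apply/ffunP => i; rewrite !ffunE. Qed.

Lemma plab_p th a b (al : lab a) (be : lab b) :
  plab th (labp al be) = labp (plab th al) (plab th be).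
Proof. by apply/ffunP => -[i|i]; rewrite !ffunE /= ffunE. Qed.

Lemma plab1 a (be : lab a) : plab 1%g be = be.
Proof. by apply/ffunP => i; rewrite ffunE perm1. Qed.

Lemma img_labs (I J : finType) (s : I -> J) (be : lab (sbU J)) :
  bijective s -> img (labs s be) = img be.
Proof.
case=> t _ ts; apply/setP => x; apply/imgP/imgP => -[i ->].
  by exists (s i); rewrite ffunE.
by exists (t i); rewrite ffunE ts.
Qed.

Lemma good_labp S a b (al : lab a) (be : lab b) A B :
  good A al -> good B be -> part A B S -> good S (labp al be).
Proof.
move=> ga gb p; apply/good_tens; rewrite labpl labpr.
by have /goodP[_ ->] := ga; have /goodP[_ ->] := gb.
Qed.

Lemma good_img S a (al : lab a) : good S al -> img al = S.
Proof. by case/goodP. Qed.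

Lemma good_labs S (I J : finType) (s : I -> J) (be : lab (sbU J)) :
  bijective s -> good S be -> good S (labs s be).
Proof.
move=> sP /goodP[ib e]; apply/goodP; rewrite img_labs //; split=> // i j.
by rewrite !ffunE => /ib/(bij_inj sP).
Qed.

Lemma good_plab th S a (al : lab a) : good S al -> good (th @: S) (plab th al).
Proof.
move=> /goodP[ia <-]; apply/goodP; rewrite img_plab; split=> // i j.
by rewrite !ffunE => /perm_inj/ia.
Qed.

Lemma good_lab0 : good set0 lab0.
Proof. by apply/goodP; rewrite img_lab0; split=> // -[]. Qed.

Lemma good_labA S a b c (be : lab (a \ox (b \ox c))) : good S be -> good S (labA be).
Proof.
move=> /good_tens[g1 /good_tens[g2 g3 [d2 e2]] [d1 e1]].
apply: (good_labp (good_labp g1 g2 _) g3); split=> //.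
- by apply: disjointWr d1; rewrite -e2 subsetUl.
- rewrite -setI_eq0 setIUl (disjoint_setI0 d2) setU0 -subset0.
  by rewrite -(disjoint_setI0 d1); apply: setIS; rewrite -e2 subsetUr.
- by rewrite -setUA e2.
Qed.

Lemma good_labAV S a b c (be : lab ((a \ox b) \ox c)) : good S be -> good S (labAV be).
Proof.
move=> /good_tens[/good_tens[g1 g2 [d1 e1]] g3 [d e]].
apply: (good_labp g1 (good_labp g2 g3 _)); split=> //.
- by apply: disjointWl d; rewrite -e1 subsetUr.
- rewrite -setI_eq0 setIUr (disjoint_setI0 d1) set0U -subset0.
  by rewrite -(disjoint_setI0 d); apply: setSI; rewrite -e1 subsetUl.
- by rewrite setUA e1.
Qed.

Lemma good_labC S a b (be : lab (b \ox a)) : good S be -> good S (labC be).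
Proof. by move=> /good_tens[g1 g2 p]; apply: (good_labp g2 g1); apply: part_sym. Qed.

Lemma good_lunit S a (be : lab a) : good S be -> good S (labp lab0 be).
Proof. by move=> g; apply: (good_labp good_lab0 g); apply: part0l. Qed.

Lemma good_runit S a (be : lab a) : good S be -> good S (labp be lab0).
Proof. by move=> g; apply: (good_labp g good_lab0); apply: part0r. Qed.

Lemma good_lunitV S a (be : lab (sb1 \ox a)) : good S be -> good S (labr be).
Proof.
by move=> /good_tens[_ g [_]]; rewrite [labl be]lab0E img_lab0 set0U => <-.
Qed.

Lemma good_runitV S a (be : lab (a \ox sb1)) : good S be -> good S (labl be).
Proof.
by move=> /good_tens[g _ [_]]; rewrite [labr be]lab0E img_lab0 setU0 => <-.
Qed.

End LabelOperations.

(** * The matrix of a morphism of the PROB *)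

Section Interpretation.
Variables (k : fieldType) (R : realType) (n : nat).
Local Notation Q := (Q k R n).
Local Notation top := (osp_top n : Q).
Local Notation BB := (hom Q top top).
Local Notation lab := (lab 'I_n).
Local Notation E := (qE k R (n := n)).
Local Notation H := (qh k R (n := n)).
Implicit Types (U S W A B V : {set 'I_n}).

Let EP : chain_idem (C := Q) (t := top) E := qE_chain k R n.

(* [Fop f U w be] is the row [be] of the matrix of [f] applied to the column [w]
   of endomorphisms of [top]; [U] is the union of the blocks standing to the left
   of [f] in a tensor product. *)
Fixpoint Fop a b (f : sbHom k a b) :
    {set 'I_n} -> (lab a -> BB) -> lab b -> BB :=
  match f in sbHom _ a b return {set 'I_n} -> (lab a -> BB) -> lab b -> BB with
  | sb_id a => fun U w be => w be
  | sb_comp _ _ _ f g => fun U w be => Fop f U (Fop g U w) be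
  | sb_zero _ _ => fun U w be => hzero top top
  | sb_add _ _ f g => fun U w be => hadd (Fop f U w be) (Fop g U w be)
  | sb_scale _ _ x f => fun U w be => hscale x (Fop f U w be)
  | sb_tens _ _ _ _ f g => fun U w be =>
      Fop g (U :|: img (labl be))
        (fun ar => Fop f U (fun al => w (labp al ar)) (labl be)) (labr be)
  | sb_assoc a b c => fun U w be => w (labA be)
  | sb_assocV a b c => fun U w be => w (labAV be)
  | sb_lunit a => fun U w be => w (labp (lab0 _) be)
  | sb_lunitV a => fun U w be => w (labr be)
  | sb_runit a => fun U w be => w (labp be (lab0 _))
  | sb_runitV a => fun U w be => w (labl be)
  | sb_braid a b => fun U w be => E (U :|: img (labl be)) \c w (labC be)
  | sb_braidV a b => fun U w be =>
      H U (img (labl be)) (img (labr be)) \c w (labC be)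
  | sb_gamma K L s _ => fun U w be => w (labs s be)
  | sb_mu K L => fun U w be =>
      E (U :|: img (labl (be : lab (sbU K \ox sbU L)))) \c w be
  | sb_delta K L => fun U w be => E (U :|: img (labl be)) \c w be
  end.

Lemma Fop_compE a b c (f : sbHom k b c) (g : sbHom k a b) U w be :
  Fop (sb_comp f g) U w be = Fop f U (Fop g U w) be.
Proof. by []. Qed.

Lemma Fop_addE a b (f g : sbHom k a b) U w be :
  Fop (sb_add f g) U w be = hadd (Fop f U w be) (Fop g U w be).
Proof. by []. Qed.

Lemma Fop_scaleE a b x (f : sbHom k a b) U w be :
  Fop (sb_scale x f) U w be = hscale x (Fop f U w be).
Proof. by []. Qed.

Lemma Fop_tensE a a' b b' (f : sbHom k a a') (g : sbHom k b b') U w be :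
  Fop (sb_tens f g) U w be = Fop g (U :|: img (labl be))
    (fun ar => Fop f U (fun al => w (labp al ar)) (labl be)) (labr be).
Proof. by []. Qed.

(** The left multipliers that a generator can contribute to a row, with sets taken relative to
    [U]. *)
Inductive rop := rE of {set 'I_n} | rH of {set 'I_n} & {set 'I_n}.

Definition ract U (r : rop) : BB :=
  match r with rE W => E (U :|: W) | rH A B => H U A B end.

Definition rlocal S (r : rop) :=
  match r with
  | rE W => W \subset S
  | rH A B => [&& A \subset S, B \subset S & [disjoint A & B]]
  end.

Definition rperm (th : 'S_n) (r : rop) :=
  match r with rE W => rE (th @: W) | rH A B => rH (th @: A) (th @: B) end.

Definition racts U (l : seq rop) (x : BB) : BB :=
  foldr (fun r y => ract U r \c y) x l.

Lemma racts_cons U r l x : racts U (r :: l) x = ract U r \c racts U l x.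
Proof. by []. Qed.

(** The matrix has one nonzero entry per row: the column is read at [s be] and multiplied by the
    word [l be]. The other clauses record locality and equivariance. All generators except zero are
    of this kind, which reduces inductions on morphisms to the six cases of [sbHom_mono_ind]. *)
Definition monomial a b (f : sbHom k a b) (l : lab b -> seq rop)
    (s : lab b -> lab a) :=
  [/\ forall U w be, Fop f U w be = racts U (l be) (w (s be)),
      forall S be, good S be -> good S (s be),
      forall S be, good S be -> all (rlocal S) (l be),
      forall th be, l (plab th be) = map (rperm th) (l be) &
      forall th be, s (plab th be) = plab th (s be)].

Lemma sbHom_mono_ind (P : forall a b, sbHom k a b -> Prop) :
  (forall a b (f : sbHom k a b) l s, monomial f l s -> P _ _ f) ->
  (forall a b c (f : sbHom k b c) (g : sbHom k a b),
    P _ _ f -> P _ _ g -> P _ _ (sb_comp f g)) ->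
  (forall a b, P _ _ (sb_zero k a b)) ->
  (forall a b (f g : sbHom k a b), P _ _ f -> P _ _ g -> P _ _ (sb_add f g)) ->
  (forall a b x (f : sbHom k a b), P _ _ f -> P _ _ (sb_scale x f)) ->
  (forall a a' b b' (f : sbHom k a a') (g : sbHom k b b'),
    P _ _ f -> P _ _ g -> P _ _ (sb_tens f g)) ->
  forall a b (f : sbHom k a b), P _ _ f.
Proof.
move=> Pm Pc P0 Pa Ps Pt a b; elim=> {a b}.
- move=> a; apply: (Pm _ _ _ (fun _ => [::]) id); split=> //.
- by move=> *; apply: Pc.
- by move=> *; apply: P0.
- by move=> *; apply: Pa.
- by move=> *; apply: Ps.
- by move=> *; apply: Pt.
- move=> a b c; apply: (Pm _ _ _ (fun _ => [::]) (@labA _ a b c)); split=> //.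
    by move=> S be; apply: good_labA.
  by move=> th be; rewrite /labA !(plab_l, plab_r, plab_p).
- move=> a b c; apply: (Pm _ _ _ (fun _ => [::]) (@labAV _ a b c)); split=> //.
    by move=> S be; apply: good_labAV.
  by move=> th be; rewrite /labAV !(plab_l, plab_r, plab_p).
- move=> a; apply: (Pm _ _ _ (fun _ => [::]) (fun be => labp (lab0 _) be)).
  split=> //.
    by move=> S be; apply: good_lunit.
  by move=> th be; rewrite plab_p (lab0E (plab _ _)).
- move=> a; apply: (Pm _ _ _ (fun _ => [::]) (@labr _ sb1 a)); split=> //.
    by move=> S be; apply: good_lunitV.
  by move=> th be; rewrite plab_r.
- move=> a; apply: (Pm _ _ _ (fun _ => [::]) (fun be => labp be (lab0 _))).
  split=> //.
    by move=> S be; apply: good_runit.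
  by move=> th be; rewrite plab_p (lab0E (plab _ (lab0 _))).
- move=> a; apply: (Pm _ _ _ (fun _ => [::]) (@labl _ a sb1)); split=> //.
    by move=> S be; apply: good_runitV.
  by move=> th be; rewrite plab_l.
- move=> a b; apply: (Pm _ _ _ (fun be => [:: rE (img (labl be))]) (@labC _ a b)).
  split=> //.
  + by move=> S be; apply: good_labC.
  + by move=> S be /good_img <-; rewrite /= img_lab subsetUl.
  + by move=> th be; rewrite /= plab_l img_plab.
  + by move=> th be; rewrite /labC plab_l plab_r plab_p.
- move=> a b; apply: (Pm _ _ _ (fun be => [:: rH (img (labl be)) (img (labr be))])
    (@labC _ b a)); split=> //.
  + by move=> S be; apply: good_labC.
  + by move=> S be /good_tens[_ _ [d <-]]; rewrite /= subsetUl subsetUr d.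
  + by move=> th be; rewrite /= plab_l plab_r !img_plab.
  + by move=> th be; rewrite /labC plab_l plab_r plab_p.
- move=> I J s sP; apply: (Pm _ _ _ (fun _ => [::]) (labs s)); split=> //.
    by move=> S be; apply: good_labs.
  by move=> th be; apply/ffunP => i; rewrite !ffunE.
(* The labellings of [sbU I \ox sbU J] and of [sbU (I + J)%type] form convertible types, as both
   objects have the points [I + J]; type annotations suffice to pass between them. *)
- move=> I J; apply: (Pm (sbU I \ox sbU J) (sbU (I + J)%type) (sb_mu k I J)
    (fun be : lab (sbU (I + J)%type) =>
       [:: rE (img (labl (be : lab (sbU I \ox sbU J))))])
    (fun be : lab (sbU (I + J)%type) => (be : lab (sbU I \ox sbU J)))); split=> //.
  + by move=> S be /good_img <-; rewrite /= (@img_lab _ (sbU I) (sbU J)) subsetUl.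
  + move=> th be.
    rewrite -[RHS]/[:: rE (th @: img (labl (be : lab (sbU I \ox sbU J))))].
    by rewrite -img_plab -plab_l.
- move=> I J; apply: (Pm (sbU (I + J)%type) (sbU I \ox sbU J) (sb_delta k I J)
    (fun be => [:: rE (img (labl be))])
    (fun be : lab (sbU I \ox sbU J) => (be : lab (sbU (I + J)%type)))); split=> //.
  + by move=> S be /good_tens[_ _ [_ <-]]; rewrite /= subsetUl.
  + move=> th be; rewrite -[LHS]/[:: rE (img (labl (plab th be)))].
    by rewrite plab_l img_plab.
Qed.

(** The closure properties that let a relation propagate from columns to rows, proved once in
    [Fop_rel]. Instances are congruence, right multiplication, left multiplication by an operator
    that shifts cuts, and relabelling. In [relH] the set [W] collects the labels that nested left
    factors add to the base set. *)
Record relok (th : 'S_n) U1 U2 S (Rel : BB -> BB -> Prop) : Prop := RelOk {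
  rel0 : Rel (hzero top top) (hzero top top);
  relD : forall x x' y y', Rel x y -> Rel x' y' -> Rel (hadd x x') (hadd y y');
  relZ : forall c x y, Rel x y -> Rel (hscale c x) (hscale c y);
  relE : forall W x y, W \subset S -> Rel x y ->
    Rel (E (U1 :|: W) \c x) (E (U2 :|: th @: W) \c y);
  relH : forall W A B x y, W \subset S -> A \subset S -> B \subset S ->
    [disjoint W & A] -> [disjoint W & B] -> [disjoint A & B] -> Rel x y ->
    Rel (H (U1 :|: W) A B \c x) (H (U2 :|: th @: W) (th @: A) (th @: B) \c y)
}.

Lemma relok_sub th U1 U2 S A B Rel : relok th U1 U2 S Rel -> part A B S ->
  relok th U1 U2 A Rel /\ relok th (U1 :|: A) (U2 :|: th @: A) B Rel.
Proof.
case=> r0 rD rZ rE' rH' [d e].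
have AS : A \subset S by rewrite -e subsetUl.
have BS : B \subset S by rewrite -e subsetUr.
split; split=> //.
- by move=> W x y WA; apply: rE'; apply: subset_trans WA AS.
- move=> W C D x y WA CA DA; apply: rH'; by apply: subset_trans AS.
- move=> W x y WB xy; rewrite -!setUA -imsetU; apply: rE' => //.
  by rewrite subUset AS (subset_trans WB BS).
- move=> W C D x y WB CB DB WC WD CD xy; rewrite -!setUA -imsetU.
  have dis V : V \subset B -> [disjoint W & V] -> [disjoint A :|: W & V].
    move=> VB WV; rewrite -setI_eq0 setIUl (disjoint_setI0 WV) setU0 -subset0.
    by rewrite -(disjoint_setI0 d); apply: setIS.
  apply: rH' => //; try exact: dis.
  - by rewrite subUset AS (subset_trans WB BS).
  - exact: subset_trans CB BS.
  - exact: subset_trans DB BS.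
Qed.

Lemma racts_rel th U1 U2 S Rel l x y : relok th U1 U2 S Rel ->
  all (rlocal S) l -> Rel x y -> Rel (racts U1 l x) (racts U2 (map (rperm th) l) y).
Proof.
move=> ok; elim: l => //= r l IH /andP[rl ll] xy; case: r rl => [W WS|A B].
  by apply: (relE ok) => //; apply: IH.
case/and3P=> AS BS AB.
have d0 V : [disjoint (set0 : {set 'I_n}) & V] by rewrite -setI_eq0 set0I.
have := relH ok (sub0set _) AS BS (d0 A) (d0 B) AB (IH ll xy).
by rewrite imset0 !setU0.
Qed.

Lemma Fop_rel th a b (f : sbHom k a b) U1 U2 S Rel w w' be :
  relok th U1 U2 S Rel -> good S be ->
  (forall al, good S al -> Rel (w al) (w' (plab th al))) ->
  Rel (Fop f U1 w be) (Fop f U2 w' (plab th be)).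
Proof.
move: U1 U2 S w w' be; elim/sbHom_mono_ind: a b / f.
- move=> a b f l s [fE sg lg lp sp] U1 U2 S w w' be ok g ww'.
  rewrite !fE lp; apply: racts_rel ok (lg _ _ g) _.
  by rewrite sp; apply: ww'; apply: sg.
- move=> a b c f g IHf IHg U1 U2 S w w' be ok gS ww' /=.
  by apply: (IHf _ _ S) => // al gal; apply: (IHg _ _ S).
- by move=> a b U1 U2 S w w' be ok _ _; apply: rel0 ok.
- move=> a b f g IHf IHg U1 U2 S w w' be ok gS ww' /=.
  by apply: (relD ok); [apply: (IHf _ _ S)|apply: (IHg _ _ S)].
- move=> a b x f IHf U1 U2 S w w' be ok gS ww' /=.
  by apply: (relZ ok); apply: (IHf _ _ S).
- move=> a a' b b' f g IHf IHg U1 U2 S w w' be ok gS ww' /=.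
  have /good_tens[gl gr p] := gS; have [okl okr] := relok_sub ok p.
  rewrite plab_l plab_r img_plab.
  apply: (IHg _ _ (img (labr be))) => // ar gar.
  apply: (IHf _ _ (img (labl be))) => // al gal; rewrite -plab_p; apply: ww'.
  exact: good_labp p.
Qed.

Lemma Fop_rel1 a b (f : sbHom k a b) U1 U2 S Rel w w' be :
  relok 1%g U1 U2 S Rel -> good S be ->
  (forall al, good S al -> Rel (w al) (w' al)) ->
  Rel (Fop f U1 w be) (Fop f U2 w' be).
Proof.
move=> ok g ww'; rewrite -{2}[be]plab1; apply: Fop_rel ok g _ => al gal.
by rewrite plab1; apply: ww'.
Qed.

Lemma imset1g A : (1%g : 'S_n) @: A = A.
Proof.
apply/setP => x; apply/imsetP/idP => [[y yA ->]|xA]; first by rewrite perm1.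
by exists x; rewrite ?perm1.
Qed.

Lemma Fop_ext a b (f : sbHom k a b) U S w w' be : good S be ->
  (forall al, good S al -> w al =~ w' al) -> Fop f U w be =~ Fop f U w' be.
Proof.
move=> g ww'; apply: (@Fop_rel1 _ _ f U U S (fun x y => x =~ y)) => //.
split=> //.
- by move=> x x' y y' -> ->.
- by move=> c x y ->.
- by move=> W x y _ ->; rewrite imset1g.
- by move=> W A B x y _ _ _ _ _ _ ->; rewrite !imset1g.
Qed.

Lemma Fop_mulr a b (f : sbHom k a b) U S w z be : good S be ->
  Fop f U w be \c z =~ Fop f U (fun al => w al \c z) be.
Proof.
move=> g; apply: (@Fop_rel1 _ _ f U U S (fun x y => x \c z =~ y)) => //.
split.
- exact: comp0l.
- by move=> x x' y y' <- <-; apply: compDl.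
- by move=> c x y <-; apply: compZl.
- by move=> W x y _ <-; rewrite imset1g compA.
- by move=> W A B x y _ _ _ _ _ _ <-; rewrite !imset1g compA.
Qed.

Lemma qh_shift (c : BB) U1 U2 W A B :
  (forall V, V \subset W :|: (A :|: B) -> c \c E (U1 :|: V) =~ E (U2 :|: V) \c c) ->
  [disjoint U1 :|: W & A] -> [disjoint U1 :|: W & B] ->
  [disjoint U2 :|: W & A] -> [disjoint U2 :|: W & B] -> [disjoint A & B] ->
  c \c H (U1 :|: W) A B =~ H (U2 :|: W) A B \c c.
Proof.
move=> cE d1A d1B d2A d2B dAB.
apply: (swap_inv_intertwine (qhP k R d1A d1B dAB) (qhP k R d2A d2B dAB));
  rewrite -?setUA; apply: cE.
- exact: subsetUl.
- by apply: setUS; apply: subsetUl.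
- by apply: setUS; apply: subsetUr.
- by [].
Qed.

Lemma Fop_shift (c : BB) a b (f : sbHom k a b) U1 U2 S w be : good S be ->
  [disjoint U1 & S] -> [disjoint U2 & S] ->
  (forall V, V \subset S -> c \c E (U1 :|: V) =~ E (U2 :|: V) \c c) ->
  c \c Fop f U1 w be =~ Fop f U2 (fun al => c \c w al) be.
Proof.
move=> g d1 d2 cE.
apply: (@Fop_rel1 _ _ f U1 U2 S (fun x y => c \c x =~ y)) => //; split.
- exact: comp0r.
- by move=> x x' y y' <- <-; apply: compDr.
- by move=> x y z <-; apply: compZr.
- by move=> W x y WS <-; rewrite imset1g (compA c) (cE W WS) -(compA _ c).
- move=> W A B x y WS AS BS WA WB AB <-; rewrite !imset1g (compA c).
  rewrite [X in heq _ X]compA; apply: comp_heq => //.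
  have dis V (V' : {set 'I_n}) : [disjoint V & S] -> V' \subset S ->
      [disjoint W & V'] -> [disjoint V :|: W & V'].
    move=> VS V'S WV; rewrite -setI_eq0 setIUl (disjoint_setI0 WV) setU0 -subset0.
    by rewrite -(disjoint_setI0 VS); apply: setIS.
  apply: qh_shift; try exact: dis; last exact: AB.
  move=> V VW; apply: cE; apply: subset_trans VW _.
  by rewrite !subUset WS AS BS.
Qed.

(** A zero column is a right multiple by zero, and [Fop] commutes with right multiplication; [FopZ]
    uses the same device for scalars. *)
Lemma Fop0 a b (f : sbHom k a b) U S be : good S be ->
  Fop f U (fun _ => hzero top top) be =~ hzero top top.
Proof.
move=> g; have -> : Fop f U (fun _ => hzero top top) be =~
    Fop f U (fun _ => hzero top top \c hzero top top) be.
  by apply: (Fop_ext _ _ g) => // al _; rewrite comp0l.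
by rewrite -(Fop_mulr _ _ _ _ g) comp0r.
Qed.

Lemma FopZ a b (f : sbHom k a b) U S x w be : good S be ->
  Fop f U (fun al => hscale x (w al)) be =~ hscale x (Fop f U w be).
Proof.
move=> g; have -> : Fop f U (fun al => hscale x (w al)) be =~
    Fop f U (fun al => w al \c hscale x (idm top)) be.
  by apply: (Fop_ext _ _ g) => // al _; rewrite compZr compm1.
by rewrite -(Fop_mulr _ _ _ _ g) compZr compm1.
Qed.

(** Additivity relates three columns and so is not an instance of [Fop_rel]. *)
Lemma FopD a b (f : sbHom k a b) U S w w' be : good S be ->
  Fop f U (fun al => hadd (w al) (w' al)) be =~ hadd (Fop f U w be) (Fop f U w' be).
Proof.
move: U S w w' be; elim/sbHom_mono_ind: a b / f.
- move=> a b f l s [fE _ _ _ _] U S w w' be _; rewrite !fE.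
  elim: (l be) => [|r m IH]; first exact: heq_refl.
  by rewrite !racts_cons IH compDr.
- move=> a b c f g IHf IHg U S w w' be gS.
  rewrite !Fop_compE -(IHf _ _ _ _ _ gS); apply: (Fop_ext _ _ gS) => // al gal.
  exact: IHg gal.
- by move=> a b U S w w' be _; apply: heq_sym; apply: hadd0.
- move=> a b f g IHf IHg U S w w' be gS.
  rewrite !Fop_addE haddACA.
  by apply: hadd_heq; [apply: IHf gS|apply: IHg gS].
- move=> a b x f IHf U S w w' be gS.
  by rewrite !Fop_scaleE -hscaleDr; apply: hscale_heq; apply: IHf gS.
- move=> a a' b b' f g IHf IHg U S w w' be /good_tens[gl gr p].
  rewrite !Fop_tensE -(IHg _ _ _ _ _ gr).
  apply: (Fop_ext _ _ gr) => // ar _; exact: IHf gl.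
Qed.

(** The multipliers of [f] involve cuts inside [U :|: A], those of [g] cuts containing [U']. The
    former sets lie in the latter, so everything commutes. *)
Lemma interchange a a' b b' (f : sbHom k a a') (g : sbHom k b b') U A U' B
    (v : lab a -> lab b -> BB) (be : lab a') (ga : lab b') :
  good A be -> good B ga -> [disjoint U & A] -> U :|: A \subset U' ->
  [disjoint U' & B] ->
  Fop g U' (fun ar => Fop f U (fun al => v al ar) be) ga =~
  Fop f U (fun al => Fop g U' (v al) ga) be.
Proof.
move=> gA gB UA UAU' U'B; move: gA UA UAU' v; move: U A be.
elim/sbHom_mono_ind: a a' / f.
- move=> a a' f l s [fE _ lg _ _] U A be gA UA UAU' v; rewrite fE.
  have -> : Fop g U' (fun ar => Fop f U (fun al => v al ar) be) ga =~
      Fop g U' (fun ar => racts U (l be) (v (s be) ar)) ga.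
    by apply: (Fop_ext _ _ gB) => // ar _; rewrite fE.
  elim: (l be) (lg _ _ gA) => [_|r m IH /andP[rl ml]]; first exact: heq_refl.
  rewrite racts_cons -IH //; apply: heq_sym.
  apply: (@Fop_shift (ract U r) _ _ g U' U' B (fun ar => racts U m (v (s be) ar))
    ga gB) => // V VB.
  case: r rl => [W WA|C D /and3P[CA DA CD]].
    apply: (chain_comm EP); apply/orP; left; apply: subset_trans (subsetUl _ _).
    by apply: subset_trans UAU'; apply: setUS.
  have UC : [disjoint U & C] by apply: disjointWr UA.
  have UD : [disjoint U & D] by apply: disjointWr UA.
  apply: heq_sym; have hP := qhP k R UC UD CD.
  have sub (C' : {set 'I_n}) : C' \subset A -> U :|: C' \subset U' :|: V.
    move=> CA'; apply: subset_trans (subsetUl _ _).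
    by apply: subset_trans UAU'; apply: setUS.
  apply: (swap_inv_intertwine hP hP); apply: (chain_comm EP); apply/orP; right.
  + by rewrite -[U]setU0; apply: sub; apply: sub0set.
  + exact: sub.
  + exact: sub.
  + by apply: sub; rewrite subUset CA DA.
- move=> a c d f f' IHf IHf' U A be gA UA UAU' v.
  rewrite !Fop_compE (IHf _ _ _ gA) //; apply: (Fop_ext _ _ gA) => // al gal.
  exact: (IHf' U A al gal UA UAU').
- by move=> c d U A be gA UA UAU' v /=; apply: Fop0 gB.
- move=> c d f f' IHf IHf' U A be gA UA UAU' v.
  rewrite !Fop_addE (FopD _ _ _ _ gB); apply: hadd_heq; [exact: (IHf U A be gA UA UAU' v)|exact: (IHf' U A be gA UA UAU' v)].
- move=> c d x f IHf U A be gA UA UAU' v.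
  by rewrite !Fop_scaleE (FopZ _ _ _ _ gB); apply: hscale_heq; exact: (IHf U A be gA UA UAU' v).
- move=> c c' d d' f f' IHf IHf' U A be gA UA UAU' v.
  have /good_tens[gl gr [d0 e0]] := gA.
  have UA1 : [disjoint U & img (labl be)].
    by apply: disjointWr UA; rewrite -e0 subsetUl.
  have UA2 : [disjoint U :|: img (labl be) & img (labr be)].
    rewrite -setI_eq0 setIUl (disjoint_setI0 d0) setU0 -subset0.
    by rewrite -(disjoint_setI0 UA); apply: setIS; rewrite -e0 subsetUr.
  rewrite Fop_tensE (IHf' _ _ _ gr) //; last by rewrite -setUA e0.
  apply: (Fop_ext _ _ gr) => // ar gar.
  apply: (IHf U _ (labl be) gl UA1 _ (fun al => v (labp al ar))).
  by apply: subset_trans UAU'; apply: setUS; rewrite -e0 subsetUl.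
Qed.

End Interpretation.

(** * Cuts moved through the exchange of two blocks *)

Section Swap.
Variables (k : fieldType) (C : linCat k) (t : C) (T : finType).
Variables (E : {set T} -> hom C t t) (EP : chain_idem E).
Implicit Types (U A B V : {set T}).

Lemma inv_shift (e1 e2 c h x x' : hom C t t) : inv_between e1 e2 c h ->
  c \c x =~ x' \c c -> x \c e1 =~ e1 \c x -> x' \c e2 =~ e2 \c x' ->
  h \c x' =~ x \c h.
Proof.
move=> hP cx xe1 xe2; rewrite -{1}(inv_absr hP) -compA -xe2 -(inv_r hP) !compA.
rewrite -(compA h) -cx compA (inv_l hP) -xe1 -compA (inv_absl hP).
by [].
Qed.

Definition swapc U A B := prodE E (cuts3 U B A) \c prodE E (cuts3 U A B).

Lemma cuts3_chain U A B : is_chain (cuts3 U A B).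
Proof.
by rewrite /is_chain /= /cmpset !subxx !subsetUl !(setUS U (subsetUl A B)) ?orbT.
Qed.

Lemma cuts3_commute U A B V : V \subset A ->
  E (U :|: V) \c prodE E (cuts3 U A B) =~ prodE E (cuts3 U A B) \c E (U :|: V).
Proof.
move=> VA; apply: prodE_comm => W; rewrite !inE => /or3P[]/eqP->;
  apply: (chain_comm EP); apply/orP.
- by right; apply: subsetUl.
- by left; apply: setUS.
- by left; apply: setUS; apply: subset_trans VA (subsetUl _ _).
Qed.

Lemma cuts3_commuter U A B V : V \subset B ->
  E (U :|: (A :|: V)) \c prodE E (cuts3 U A B) =~
  prodE E (cuts3 U A B) \c E (U :|: (A :|: V)).
Proof.
move=> VB; apply: prodE_comm => W; rewrite !inE => /or3P[]/eqP->;
  apply: (chain_comm EP); apply/orP.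
- by right; apply: subsetUl.
- by right; apply: setUS; apply: subsetUl.
- by left; apply: setUS; apply: setUS.
Qed.

Lemma cuts3_absl U A B : E (U :|: A) \c prodE E (cuts3 U A B) =~ prodE E (cuts3 U A B).
Proof. by apply: (chain_absl EP (cuts3_chain _ _ _)); rewrite !inE eqxx orbT. Qed.

Lemma cuts3_absr U A B : prodE E (cuts3 U A B) \c E (U :|: A) =~ prodE E (cuts3 U A B).
Proof. by apply: (chain_absr EP (cuts3_chain _ _ _)); rewrite !inE eqxx orbT. Qed.

(* After the exchange of [A] and [B], the labels in [A] have [B] on their left. *)
Lemma swapc_shiftl U A B V : [disjoint A & B] -> V \subset A ->
  swapc U A B \c E (U :|: V) =~ E (U :|: (B :|: V)) \c swapc U A B.
Proof.
move=> AB VA; rewrite /swapc.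
set e1 := prodE E (cuts3 U A B); set e2 := prodE E (cuts3 U B A).
rewrite -(compA e2) -(cuts3_commute U B VA) (compA _ e2) (cuts3_commuter U B VA).
rewrite -(compA e2) -/e1 -/e2.
have a1 : E (U :|: A) \c e1 =~ e1 := cuts3_absl U A B.
have a2 : e2 \c E (U :|: B) =~ e2 := cuts3_absr U B A.
(* Next to [e2], which absorbs [E (U :|: B)], the cut [U :|: V] may be joined with [U :|: B]; in
   [k2], next to [e1], the larger cut is intersected with [U :|: A]. *)
have k1 : e2 \c E (U :|: V) =~ e2 \c (E (U :|: (B :|: V)) \c E (U :|: V)).
  have -> : U :|: (B :|: V) = (U :|: V) :|: (U :|: B).
    by apply/setP => x; rewrite !inE; do 3!case: (x \in _).
  rewrite -a2 -!(compA e2).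
  by rewrite [X in heq (e2 \c X) _](chainU EP).
have k2 : E (U :|: (B :|: V)) \c e1 =~ E (U :|: (B :|: V)) \c (E (U :|: V) \c e1).
  rewrite -a1 (compA (E (U :|: V))) !(compA (E (U :|: (B :|: V)))).
  apply: comp_heq => //; rewrite [X in heq X _](chainI EP) compA.
  have -> // : (U :|: A) :&: (U :|: (B :|: V)) = U :|: V.
  apply/setP => x; have /setP/(_ x) := disjoint_setI0 AB.
  have : (x \in V) ==> (x \in A) by apply/implyP/(subsetP VA).
  by rewrite !inE; do 4!case: (x \in _).
by rewrite k2 !(compA e2) k1 !compA.
Qed.

Lemma swapc_shiftr U A B V : [disjoint A & B] -> V \subset B ->
  swapc U A B \c E (U :|: (A :|: V)) =~ E (U :|: V) \c swapc U A B.
Proof.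
move=> AB VB; rewrite /swapc.
set e1 := prodE E (cuts3 U A B); set e2 := prodE E (cuts3 U B A).
rewrite -(compA e2) -(cuts3_commuter U A VB) (compA _ e2) (cuts3_commute U A VB).
rewrite -(compA e2) -/e1 -/e2.
have a1 : E (U :|: A) \c e1 =~ e1 := cuts3_absl U A B.
have a2 : e2 \c E (U :|: B) =~ e2 := cuts3_absr U B A.
have k1 : e2 \c E (U :|: (A :|: V)) =~ e2 \c (E (U :|: V) \c E (U :|: (A :|: V))).
  have -> : U :|: V = (U :|: (A :|: V)) :&: (U :|: B).
    apply/setP => x; have /setP/(_ x) := disjoint_setI0 AB.
    have : (x \in V) ==> (x \in B) by apply/implyP/(subsetP VB).
    by rewrite !inE; do 4!case: (x \in _).
  rewrite -a2 -!(compA e2).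
  by rewrite [X in heq (e2 \c X) _](chainI EP).
have k2 : E (U :|: V) \c e1 =~ E (U :|: V) \c (E (U :|: (A :|: V)) \c e1).
  rewrite -a1 (compA (E (U :|: (A :|: V)))) !(compA (E (U :|: V))).
  apply: comp_heq => //; rewrite [X in heq X _](chainU EP) compA.
  have -> // : (U :|: A) :|: (U :|: V) = U :|: (A :|: V).
  by apply/setP => x; rewrite !inE; do 3!case: (x \in _).
by rewrite k2 !(compA e2) k1 !compA.
Qed.

Lemma swap_inv_shiftr U A B V h : swap_inv E U A B h -> [disjoint A & B] ->
  V \subset B -> h \c E (U :|: V) =~ E (U :|: (A :|: V)) \c h.
Proof.
move=> hP AB VB; apply: (inv_shift hP).
- exact: swapc_shiftr.
- exact: cuts3_commuter.
- exact: cuts3_commute.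
Qed.

Lemma swap_inv_shiftl U A B V h : swap_inv E U A B h -> [disjoint A & B] ->
  V \subset A -> h \c E (U :|: (B :|: V)) =~ E (U :|: V) \c h.
Proof.
move=> hP AB VA; apply: (inv_shift hP).
- exact: swapc_shiftl.
- exact: cuts3_commute.
- exact: cuts3_commuter.
Qed.

End Swap.

(** * Columns fixed by the cuts of their source *)

Section Invariance.
Variables (k : fieldType) (R : realType) (n : nat).
Local Notation Q := (Q k R n).
Local Notation top := (osp_top n : Q).
Local Notation BB := (hom Q top top).
Local Notation lab := (lab 'I_n).
Local Notation E := (qE k R (n := n)).
Local Notation H := (qh k R (n := n)).
Local Notation Fop := (@Fop k R n _ _).
Implicit Types (U S W A B V : {set 'I_n}).

Let EP : chain_idem (C := Q) (t := top) E := qE_chain k R n.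

(** The empty set and the full image, shifted by [U], are the cuts at the two ends of the object;
    [rcuts] lists the internal ones. *)
Definition locs a (al : lab a) := [:: set0, img al & rcuts al].

(** [x] lies in the image of the chain idempotent of the labelled decomposition, placed to the right
    of [U]. *)
Definition inv U a (al : lab a) (x : BB) :=
  forall V, V \in locs al -> E (U :|: V) \c x =~ x.

Lemma locs_sub a (al : lab a) V : V \in locs al -> V \subset img al.
Proof.
by rewrite !inE => /or3P[/eqP->|/eqP->|/rcuts_sub//]; rewrite ?sub0set.
Qed.

Lemma inv0 U a (al : lab a) x : inv U al x -> E U \c x =~ x.
Proof. by move=> h; have := h set0 (mem_head _ _); rewrite setU0. Qed.

Lemma inv_img U a (al : lab a) x : inv U al x -> E (U :|: img al) \c x =~ x.
Proof. by apply; rewrite !inE eqxx orbT. Qed.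

Lemma inv_tens U a b (be : lab (a \ox b)) x :
  inv U be x <-> inv U (labl be) x /\ inv (U :|: img (labl be)) (labr be) x.
Proof.
split=> [h|[hl hr] V].
  split=> V.
    rewrite !inE => /or3P[/eqP->|/eqP->|Vl]; apply: h;
    by rewrite /locs rcutsT !(inE, mem_cat) ?eqxx ?Vl ?orbT.
  rewrite !inE -setUA => /or3P[/eqP->|/eqP->|Vr].
  - by rewrite setU0; apply: h; rewrite /locs rcutsT !inE eqxx !orbT.
  - by rewrite -img_lab; apply: h; rewrite !inE eqxx orbT.
  - by apply: h; rewrite /locs rcutsT !(inE, mem_cat) (map_f (fun W => _ :|: W) Vr) !orbT.
rewrite /locs rcutsT !(inE, mem_cat) img_lab.
case/or4P=> [/eqP->|/eqP->|/eqP->|/orP[/mapP[W Wr ->]|Vl]].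
- by apply: hl; apply: mem_head.
- by rewrite setUA; apply: hr; rewrite !inE eqxx orbT.
- by apply: hl; rewrite !inE eqxx orbT.
- by rewrite setUA; apply: hr; rewrite !inE Wr !orbT.
- by apply: hl; rewrite !inE Vl !orbT.
Qed.

Lemma inv_heq U a (al : lab a) x y : x =~ y -> inv U al x -> inv U al y.
Proof. by move=> xy h V /h; rewrite xy. Qed.

Lemma inv_lab0 U x : E U \c x =~ x -> inv U (lab0 'I_n) x.
Proof.
move=> h V; rewrite /locs img_lab0 -[rcuts _]/[::] !inE orbb => /eqP->.
by rewrite setU0.
Qed.

Lemma inv_lunit U a (be : lab a) x : inv U (labp (lab0 _) be) x <-> inv U be x.
Proof.
split=> [/inv_tens[_]|h]; first by rewrite labpl labpr img_lab0 setU0.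
apply/inv_tens; rewrite labpl labpr img_lab0 setU0; split=> //.
by apply: inv_lab0; apply: inv0 h.
Qed.

Lemma inv_runit U a (be : lab a) x : inv U (labp be (lab0 _)) x <-> inv U be x.
Proof.
split=> [/inv_tens[]|h]; first by rewrite labpl.
apply/inv_tens; rewrite labpl labpr; split=> //.
by apply: inv_lab0; apply: inv_img h.
Qed.

Lemma inv_assoc U a b c (be : lab (a \ox (b \ox c))) x :
  inv U (labA be) x <-> inv U be x.
Proof.
split.
  move=> /inv_tens[]; rewrite labpl labpr => /inv_tens[]; rewrite labpl labpr.
  rewrite img_labp setUA => h1 h2 h3.
  by apply/inv_tens; split=> //; apply/inv_tens.
move=> /inv_tens[h1 /inv_tens[h2 h3]].
apply/inv_tens; rewrite labpl labpr img_labp setUA; split=> //.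
by apply/inv_tens; rewrite labpl labpr.
Qed.

Lemma labAK a b c (be : lab (a \ox (b \ox c))) : labAV (labA be) = be.
Proof. by rewrite /labAV /labA !(labpl, labpr) !labpK. Qed.

Lemma labAVK a b c (be : lab ((a \ox b) \ox c)) : labA (labAV be) = be.
Proof. by rewrite /labAV /labA !(labpl, labpr) !labpK. Qed.

Lemma labCK a b (be : lab (a \ox b)) : labC (labC be) = be.
Proof. by rewrite /labC !(labpl, labpr) labpK. Qed.

Lemma inv_assocV U a b c (be : lab ((a \ox b) \ox c)) x :
  inv U (labAV be) x <-> inv U be x.
Proof. by rewrite -{2}[be]labAVK; symmetry; apply: inv_assoc. Qed.

Lemma inv_sbU U (I : finType) (be : lab (sbU I)) x :
  E U \c x =~ x -> E (U :|: img be) \c x =~ x -> inv U be x.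
Proof.
by move=> h1 h2 V; rewrite /locs -[rcuts _]/[::] !inE => /orP[/eqP->|/eqP->]; rewrite ?setU0.
Qed.

Lemma inv_labs U (I J : finType) (s : I -> J) (be : lab (sbU J)) x :
  bijective s -> inv U (labs s be) x <-> inv U be x.
Proof.
move=> sP; split=> h; apply: inv_sbU; try exact: inv0 h.
  by rewrite -(img_labs be sP); apply: inv_img h.
by rewrite img_labs //; apply: inv_img h.
Qed.

(* [swapc] intertwines the chains before and after the exchange while the single
   idempotent does not; this is why [Fop] is only compared on invariant columns. *)
Lemma inv_swapc U a b (be : lab (b \ox a)) x : inv U (labC be) x ->
  E (U :|: img (labl be)) \c x =~ swapc E U (img (labr be)) (img (labl be)) \c x.
Proof.
move=> /inv_tens[]; rewrite labpl labpr => h1 h2.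
have hU := inv0 h1; have hA := inv_img h1; have hAB := inv_img h2.
have hS : E (U :|: (img (labr be) :|: img (labl be))) \c x =~ x by rewrite setUA.
rewrite /swapc -compA (prodE_fixl (x := x)) => [|V]; last first.
  by rewrite !inE => /or3P[]/eqP->.
rewrite /cuts3 !prodE_cons prodE_nil compm1 -(compA (E U)) -(compA (E (U :|: img _))).
rewrite (setUC (img (labl be))) hS compA (chainC EP (subsetUl U _)).
by rewrite -(compA _ (E U)) hU.
Qed.

(** By [inv_swapc] the multiplier may be replaced by [swapc], which carries the cuts of the source
    to those of the target. *)
Lemma inv_braid U a b (be : lab (b \ox a)) x : good (img be) be ->
  inv U (labC be) x -> inv U be (E (U :|: img (labl be)) \c x).
Proof.
move=> gb hx; have /good_tens[_ _ [d _]] := gb.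
have e := inv_swapc hx; have /inv_tens[] := hx; rewrite labpl labpr => h1 h2.
apply/inv_tens; split=> V Vl.
  rewrite e compA -(swapc_shiftr EP U _ (locs_sub Vl)); last by rewrite disjoint_sym.
  by rewrite -compA setUA h2.
rewrite e compA -setUA -(swapc_shiftl EP U _ (locs_sub Vl)); last by rewrite disjoint_sym.
by rewrite -compA h1.
Qed.

Lemma inv_braidV U a b (be : lab (a \ox b)) x : good (img be) be ->
  [disjoint U & img be] ->
  inv U (labC be) x -> inv U be (H U (img (labl be)) (img (labr be)) \c x).
Proof.
move=> gb dU hx; have /good_tens[_ _ [d eb]] := gb.
have dA : [disjoint U & img (labl be)] by apply: disjointWr dU; rewrite -eb subsetUl.
have dB : [disjoint U & img (labr be)] by apply: disjointWr dU; rewrite -eb subsetUr.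
have hP := qhP k R dA dB d; have /inv_tens[] := hx; rewrite labpl labpr => h1 h2.
apply/inv_tens; split=> V Vl.
  rewrite compA -(swap_inv_shiftl EP hP d (locs_sub Vl)) -compA.
  by rewrite setUA h2.
rewrite compA -setUA -(swap_inv_shiftr EP hP d (locs_sub Vl)) -compA.
by rewrite h1.
Qed.

Lemma inv_split U S a b (be : lab (a \ox b)) :
  good S be -> [disjoint U & S] ->
  [/\ good (img (labl be)) (labl be), good (img (labr be)) (labr be),
      part (img (labl be)) (img (labr be)) S,
      [disjoint U & img (labl be)] & [disjoint U :|: img (labl be) & img (labr be)]].
Proof.
move=> /good_tens[gl gr p] dU; have [d e] := p; split=> //.
  by apply: disjointWr dU; rewrite -e subsetUl.
rewrite -setI_eq0 setIUl (disjoint_setI0 d) setU0 -subset0 -(disjoint_setI0 dU).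
by apply: setIS; rewrite -e subsetUr.
Qed.

Lemma Fop_absorb (c : BB) a b (f : sbHom k a b) U S w be : good S be ->
  [disjoint U & S] ->
  (forall V, V \subset S -> c \c E (U :|: V) =~ E (U :|: V) \c c) ->
  (forall al, good S al -> c \c w al =~ w al) ->
  c \c Fop f U w be =~ Fop f U w be.
Proof.
move=> g dU cE cw; rewrite (Fop_shift f w g dU dU cE).
exact: Fop_ext cw.
Qed.

(** The multipliers of [f] involve cuts inside [U :|: A], which commute with the cuts of the right
    factor and so preserve its invariance. *)
Lemma inv_inner a a' b (f : sbHom k a a') U A B (w : lab (a \ox b) -> BB) be ar :
  good A be -> good B ar -> [disjoint U & A] -> part A B (A :|: B) ->
  (forall al, good (A :|: B) al -> inv U al (w al)) ->
  inv (U :|: A) ar (Fop f U (fun al => w (labp al ar)) be).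
Proof.
move=> gA gB dU p wP V Vl; apply: (Fop_absorb f gA dU) => [W WA|al gal].
  apply: (chain_comm EP); apply/orP; right; apply: subset_trans (subsetUl _ _).
  exact: setUS.
have /inv_tens[_] := wP _ (good_labp gal gB p).
by rewrite labpl labpr (good_img gal); apply.
Qed.

Lemma inv_inner_l a b U A B (w : lab (a \ox b) -> BB) al ar :
  good A al -> good B ar -> part A B (A :|: B) ->
  (forall al, good (A :|: B) al -> inv U al (w al)) -> inv U al (w (labp al ar)).
Proof.
move=> gA gB p wP; have /inv_tens[] := wP _ (good_labp gA gB p).
by rewrite labpl.
Qed.

Lemma Fop_inv a b (f : sbHom k a b) U S w be : good S be -> [disjoint U & S] ->
  (forall al, good S al -> inv U al (w al)) -> inv U be (Fop f U w be).
Proof.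
elim: f U S w be => {a b}.
- by move=> a U S w be g dU; apply.
- move=> a b c f IHf g IHg U S w be gS dU wP.
  by apply: (IHf _ S) => // al gal; apply: (IHg _ S).
- by move=> a b U S w be _ _ _ V _; apply: comp0r.
- move=> a b f IHf g IHg U S w be gS dU wP V Vl.
  rewrite Fop_addE compDr (IHf _ S) // (IHg _ S) //.
- move=> a b x f IHf U S w be gS dU wP V Vl.
  by rewrite Fop_scaleE compZr (IHf _ S).
- move=> a a' b b' f IHf g IHg U S w be gS dU wP.
  have [gl gr [d e] dl dr] := inv_split gS dU; rewrite -e in wP.
  have p : part (img (labl be)) (img (labr be)) (img (labl be) :|: img (labr be)) by [].
  have vP ar : good (img (labr be)) ar -> inv (U :|: img (labl be)) ar
      (Fop f U (fun al => w (labp al ar)) (labl be)).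
    by move=> gar; apply: (inv_inner f gl gar dl p wP).
  apply/inv_tens; split; last exact: (IHg _ _ _ _ gr dr vP).
  move=> V Vl; rewrite Fop_tensE; apply: (Fop_absorb g gr dr) => [W WB|ar gar].
    apply: (chain_comm EP); apply/orP; left; apply: subset_trans (subsetUl _ _).
    by apply: setUS; apply: locs_sub.
  by apply: (IHf _ _ _ _ gl dl) => // al gal; apply: (inv_inner_l gal gar p wP).
- move=> a b c U S w be gS dU wP.
  exact: ((inv_assoc U be (w (labA be))).1 (wP _ (good_labA gS))).
- move=> a b c U S w be gS dU wP.
  exact: ((inv_assocV U be (w (labAV be))).1 (wP _ (good_labAV gS))).
- move=> a U S w be gS dU wP.
  exact: ((inv_lunit U be (w (labp (lab0 _) be))).1 (wP _ (good_lunit gS))).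
- move=> a U S w be gS dU wP; have h := wP _ (good_lunitV gS).
  have eb : be = labp (lab0 _) (labr be) by rewrite -(lab0E (labl be)) labpK.
  by rewrite {1}eb; apply/inv_lunit.
- move=> a U S w be gS dU wP.
  exact: ((inv_runit U be (w (labp be (lab0 _)))).1 (wP _ (good_runit gS))).
- move=> a U S w be gS dU wP; have h := wP _ (good_runitV gS).
  have eb : be = labp (labl be) (lab0 _) by rewrite -(lab0E (labr be)) labpK.
  by rewrite {1}eb; apply/inv_runit.
- move=> a b U S w be gS dU wP; have e := good_img gS; apply: inv_braid.
    by rewrite e.
  by apply: wP; apply: good_labC.
- move=> a b U S w be gS dU wP; have e := good_img gS; apply: inv_braidV.
  + by rewrite e.
  + by rewrite e.
  + by apply: wP; apply: good_labC.
- move=> I J s sP U S w be gS dU wP.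
  exact: ((inv_labs U be (w (labs s be)) sP).1 (wP _ (good_labs sP gS))).
- move=> I J U S w be gS dU wP.
  pose be' := be : lab (sbU I \ox sbU J).
  have /inv_tens[h1 h2] : inv U be' (w be') := wP be' gS.
  have hA : E (U :|: img (labl be')) \c w be' =~ w be' := inv_img h1.
  have hS : E (U :|: img be') \c w be' =~ w be' by rewrite img_lab setUA; apply: inv_img h2.
  rewrite [Fop _ _ _ _]/(E (U :|: img (labl be')) \c w be').
  apply: (inv_heq (heq_sym hA)); apply: inv_sbU; last exact: hS.
  exact: inv0 h1.
- move=> I J U S w be gS dU wP.
  pose be' := be : lab (sbU (I + J)%type).
  have h : inv U be' (w be') := wP be' gS.
  have h0 := inv0 h; have hS : E (U :|: img be) \c w be' =~ w be' := inv_img h.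
  rewrite [Fop _ _ _ _]/(E (U :|: img (labl be)) \c w be').
  have kU : E U \c (E (U :|: img (labl be)) \c w be') =~
      E (U :|: img (labl be)) \c w be'.
    by rewrite compA (chainC EP (subsetUl U _)) -(compA _ (E U)) h0.
  have kA : E (U :|: img (labl be)) \c (E (U :|: img (labl be)) \c w be') =~
      E (U :|: img (labl be)) \c w be'.
    by rewrite compA (chain_id EP).
  have kS : E (U :|: img be) \c (E (U :|: img (labl be)) \c w be') =~
      E (U :|: img (labl be)) \c w be'.
    rewrite compA -(chainC EP) ?hS; last by apply: setUS; rewrite img_lab subsetUl.
    by rewrite -(compA _ (E (U :|: img be))) hS.
  apply/inv_tens; split; apply: inv_sbU => //.
  by rewrite -setUA -img_lab.
Qed.

End Invariance.

Section ChainMid.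
Variables (k : fieldType) (C : linCat k) (t : C) (T : finType).
Variables (E : {set T} -> hom C t t) (EP : chain_idem E).
Implicit Types (U A B : {set T}).

(** (SB3) in terms of cuts: [A], [B], [D] are the labels of [K11], [K21], [K12], and [hy] is the
    invariance of the column at the cut after J_1. The cuts on the left side are nested and commute;
    what is left is one use each of [chainU] and [chainI] for the pair of cuts after L_1 and J_1. *)
Lemma chain_mid U A B (D : {set T}) (y : hom C t t) : [disjoint B & D] ->
  E (U :|: (A :|: D)) \c y =~ y ->
  E (U :|: (A :|: B) :|: D) \c (E (U :|: A) \c (E (U :|: A :|: B) \c
    (E (U :|: (A :|: D) :|: B) \c (E (U :|: A) \c y)))) =~ E (U :|: (A :|: B)) \c y.
Proof.
move=> BC hy.
have eU : U :|: (A :|: D) :|: B = U :|: (A :|: B) :|: D.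
  by rewrite -setUA (setUAC A) setUA.
have sA : U :|: A \subset U :|: (A :|: B) by rewrite setUA subsetUl.
have sT : U :|: (A :|: B) \subset U :|: (A :|: B) :|: D by apply: subsetUl.
have sAT := subset_trans sA sT.
rewrite eU -(setUA U A B).
set S := U :|: (A :|: B) :|: D in sT sAT *.
set V := U :|: (A :|: B) in sA sT *.
set W := U :|: A in sA sAT *.
have -> : E S \c (E W \c (E V \c (E S \c (E W \c y)))) =~
    E V \c (E W \c (E S \c y)).
  rewrite (compA (E S) (E W) y) -(chainC EP sAT) -(compA (E W) (E S) y).
  rewrite (compA (E V) (E W)) -(chainC EP sA) -(compA (E W) (E V)).
  rewrite (compA (E W) (E W)) (chain_id EP).
  rewrite (compA (E W) (E V)) (chainC EP sA) -(compA (E V) (E W)).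
  rewrite (compA (E S) (E V)) -(chainC EP sT) -(compA (E V) (E S)).
  rewrite (compA (E S) (E W)) -(chainC EP sAT) -(compA (E W) (E S)).
  by rewrite (compA (E S) (E S)) (chain_id EP).
rewrite -{1}hy (compA (E S)) -(chainC EP (S := U :|: (A :|: D))); last first.
  by rewrite /S -eU subsetUl.
rewrite -[X in heq _ (_ \c X)]hy [X in heq _ X]compA [X in heq _ (X \c _)](chainU EP).
have -> : U :|: (A :|: D) :|: V = S.
  by rewrite /S /V; apply/setP => i; rewrite !inE; do 4!case: (i \in _).
rewrite -(chainC EP (S := U :|: (A :|: D))); last by rewrite /S -eU subsetUl.
rewrite [X in heq _ (X \c _)]compA [X in heq _ (X \c _ \c _)](chainI EP).
have -> : (U :|: (A :|: D)) :&: V = W.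
  apply/setP => i; have /setP/(_ i) := disjoint_setI0 BC.
  by rewrite /W /V !inE; do 4!case: (i \in _).
by rewrite -!compA.
Qed.

End ChainMid.

(** * The matrices respect the relations of the PROB *)

Section Soundness.
Variables (k : fieldType) (R : realType) (n : nat).
Local Notation Q := (Q k R n).
Local Notation top := (osp_top n : Q).
Local Notation BB := (hom Q top top).
Local Notation lab := (lab 'I_n).
Local Notation E := (qE k R (n := n)).
Local Notation H := (qh k R (n := n)).
Local Notation Fop := (@Fop k R n _ _).
Implicit Types (U S W A B V : {set 'I_n}).

Let EP : chain_idem (C := Q) (t := top) E := qE_chain k R n.

(** Already the unit laws of [mu] use that the column absorbs the cuts at its ends. *)
Definition sound a b (f g : sbHom k a b) := forall U S (w : lab a -> BB) be,
  good S be -> [disjoint U & S] -> (forall al, good S al -> inv U al (w al)) ->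
  Fop f U w be =~ Fop g U w be.

Lemma sound_comp a b c (f f' : sbHom k b c) (g g' : sbHom k a b) :
  sound f f' -> sound g g' -> sound (sb_comp f g) (sb_comp f' g').
Proof.
move=> ff' gg' U S w be gS dU wP; rewrite !Fop_compE.
rewrite (ff' _ _ _ _ gS dU) => [|al gal]; last exact: Fop_inv gal dU wP.
by apply: (Fop_ext _ _ gS) => al gal; apply: gg' gal dU wP.
Qed.

Lemma sound_tens a a' b b' (f f' : sbHom k a a') (g g' : sbHom k b b') :
  sound f f' -> sound g g' -> sound (sb_tens f g) (sb_tens f' g').
Proof.
move=> ff' gg' U S w be gS dU wP; rewrite !Fop_tensE.
have [gl gr [d e] dl dr] := inv_split gS dU; rewrite -e in wP.
have p : part (img (labl be)) (img (labr be)) (img (labl be) :|: img (labr be)) by [].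
rewrite (gg' _ _ _ _ gr dr) => [|ar gar]; last exact: (inv_inner f gl gar dl p wP).
apply: (Fop_ext _ _ gr) => ar gar; apply: ff' gl dl _ => al gal.
exact: (inv_inner_l gal gar p wP).
Qed.

(** The operators of [f'] and [g] occur in opposite orders on the two sides, and [interchange] swaps
    them. *)
Lemma sound_tensM a a' a'' b b' b'' (f' : sbHom k a' a'') (f : sbHom k a a')
    (g' : sbHom k b' b'') (g : sbHom k b b') :
  sound (sb_tens (sb_comp f' f) (sb_comp g' g)) (sb_comp (sb_tens f' g') (sb_tens f g)).
Proof.
move=> U S w be gS dU wP; rewrite Fop_tensE !Fop_compE Fop_tensE.
have [gl gr [d e] dl dr] := inv_split gS dU.
apply: (Fop_ext _ _ gr) => ga gga.
have -> : Fop g (U :|: img (labl be))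
    (fun ar => Fop (sb_comp f' f) U (fun al => w (labp al ar)) (labl be)) ga =~
  Fop g (U :|: img (labl be)) (fun ar => Fop f' U
    (fun al => Fop f U (fun al => w (labp al ar)) al) (labl be)) ga by apply: heq_refl.
rewrite (interchange (A := img (labl be)) (B := img (labr be))
  f' g (fun al ar => Fop f U (fun al => w (labp al ar)) al)) //.
apply: (Fop_ext _ _ gl) => al gal.
by rewrite Fop_tensE labpl labpr (good_img gal).
Qed.

Lemma sound_assoc_nat a a' b b' c c'
    (f : sbHom k a a') (g : sbHom k b b') (h : sbHom k c c') :
  sound (sb_comp (sb_assoc k a' b' c') (sb_tens (sb_tens f g) h))
    (sb_comp (sb_tens f (sb_tens g h)) (sb_assoc k a b c)).
Proof.
move=> U S w be gS dU wP; rewrite !Fop_compE.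
have [gl gr p dl dr] := inv_split gS dU; have [grl grr p' drl drr] := inv_split gr dr.
have -> : Fop (sb_assoc k a' b' c') U (Fop (sb_tens (sb_tens f g) h) U w) be =
    Fop (sb_tens (sb_tens f g) h) U w (labA be) by [].
rewrite !Fop_tensE /labA !labpl !labpr img_labp setUA.
apply: (Fop_ext _ _ grr) => ar gar; rewrite Fop_tensE !labpl !labpr.
apply: (Fop_ext _ _ grl) => br gbr; apply: (Fop_ext _ _ gl) => al gal.
have -> : Fop (sb_assoc k a b c) U w (labp al (labp br ar)) =
  w (labA (labp al (labp br ar))) by [].
by rewrite /labA !labpl !labpr labpl.
Qed.

Lemma sound_braidK a b :
  sound (sb_comp (sb_braidV k a b) (sb_braid k a b)) (sb_id k (a \ox b)).
Proof.
move=> U S w be gS dU wP.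
have [gl gr [d e] dl dr] := inv_split gS dU.
have dB : [disjoint U & img (labr be)] by apply: disjointWr dU; rewrite -e subsetUr.
have hP := qhP k R dl dB d.
change (H U (img (labl be)) (img (labr be)) \c
  (E (U :|: img (labl (labC be))) \c w (labC (labC be))) =~ w be).
have wbe := wP _ gS; rewrite labCK.
have := @inv_swapc k R n U _ _ (labC be) (w be); rewrite labCK => /(_ wbe) ->.
rewrite labCl labCr compA (inv_l hP).
apply: prodE_fixl => V; rewrite !inE => /or3P[]/eqP->.
- exact: inv0 wbe.
- by have /inv_tens[h _] := wbe; apply: inv_img h.
- by rewrite -img_lab; apply: inv_img wbe.
Qed.

Lemma sound_braidVK a b :
  sound (sb_comp (sb_braid k a b) (sb_braidV k a b)) (sb_id k (b \ox a)).
Proof.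
move=> U S w be gS dU wP.
have [gl gr [d e] dl dr] := inv_split gS dU.
have dB : [disjoint U & img (labr be)] by apply: disjointWr dU; rewrite -e subsetUr.
have wbe := wP _ gS.
have gC := good_labC gS; have eC := good_img gC.
change (E (U :|: img (labl be)) \c (H U (img (labl (labC be))) (img (labr (labC be))) \c
  w (labC (labC be))) =~ w be).
have := @inv_braidV k R n U _ _ (labC be) (w (labC (labC be))).
rewrite eC labCK => /(_ gC dU wbe) h.
rewrite (inv_swapc h) labCl labCr.
have dAB : [disjoint img (labr be) & img (labl be)] by rewrite disjoint_sym.
have hP := qhP k R dB dl dAB; rewrite compA (inv_r hP).
apply: prodE_fixl => V; rewrite !inE => /or3P[]/eqP->.
- exact: inv0 wbe.
- by have /inv_tens[h' _] := wbe; apply: inv_img h'.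
- by rewrite -img_lab; apply: inv_img wbe.
Qed.

(** On invariant columns the multiplier is [swapc]. It shifts the base set of each of the two
    operators as it passes them, [interchange] corrects their order, and [swapc] is turned back into
    a single idempotent. *)
Lemma sound_braid_nat a a' b b' (f : sbHom k a a') (g : sbHom k b b') :
  sound (sb_comp (sb_braid k a' b') (sb_tens f g))
    (sb_comp (sb_tens g f) (sb_braid k a b)).
Proof.
move=> U S w be gS dU wP.
have [gl gr p dl dr] := inv_split gS dU; have [d e] := p.
have dB : [disjoint U & img (labr be)] by apply: disjointWr dU; rewrite -e subsetUr.
have dAB : [disjoint img (labr be) & img (labl be)] by rewrite disjoint_sym.
have gC := good_labC gS.
have h : inv U (labC be) (Fop (sb_tens f g) U w (labC be)) := Fop_inv (sb_tens f g) gC dU wP.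
change (E (U :|: img (labl be)) \c Fop (sb_tens f g) U w (labC be) =~
  Fop (sb_tens g f) U (Fop (sb_braid k a b) U w) be).
rewrite (inv_swapc h) !Fop_tensE labCl labCr.
set c := swapc _ _ _ _.
rewrite (Fop_shift (U2 := U) _ _ gl) //; first last.
- move=> V VB; rewrite -setUA; exact: swapc_shiftr.
- rewrite -setI_eq0 setIUl (disjoint_setI0 dl) set0U.
  exact/eqP/disjoint_setI0.
rewrite (interchange (A := img (labl be)) (B := img (labr be))
  g f (fun ar al => Fop (sb_braid k a b) U w (labp ar al))) //.
apply: (Fop_ext _ _ gl) => ar gar.
rewrite (Fop_shift (U2 := U :|: img (labl be)) _ _ gr) //; last first.
  by move=> V VA; rewrite -setUA; exact: swapc_shiftl.
apply: (Fop_ext _ _ gr) => al gal.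
change (c \c w (labp al ar) =~
  E (U :|: img (labl (labp ar al))) \c w (labC (labp ar al))).
have gal' : good S (labp al ar) by apply: (good_labp gal gar); apply: part_sym.
have lC : labC (labp ar al) = labp al ar by rewrite /labC labpl labpr.
have := @inv_swapc k R n U _ _ (labp ar al) (w (labp al ar)).
rewrite lC => /(_ (wP _ gal')) ->.
by rewrite /c labpl labpr (good_img gar) (good_img gal).
Qed.

Lemma setU_disj A B V : [disjoint A & B] -> (V :|: A) :&: (V :|: B) = V.
Proof. by move=> d; rewrite -setUIr (disjoint_setI0 d) setU0. Qed.

(** The hexagon is an instance of [chainI]: the column absorbs the cut after [a] and [b], whose
    intersection with the cut after [b] and [c] is the cut after [b]. The second hexagon is an
    instance of [chainU]. *)
Lemma sound_hexagon1 a b c :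
  sound (sb_comp (sb_comp (sb_assoc k b c a) (sb_braid k a (b \ox c))) (sb_assoc k a b c))
    (sb_comp (sb_comp (sb_tens (sb_id k b) (sb_braid k a c)) (sb_assoc k b a c))
      (sb_tens (sb_braid k a b) (sb_id k c))).
Proof.
move=> U S w be gS dU wP.
have [gl gr [d e] dl dr] := inv_split gS dU.
have [grl grr [d' e'] drl drr] := inv_split gr dr.
pose x := labA (labC (labA be)).
change (E (U :|: img (labl (labA be))) \c w x =~
  Fop (sb_comp (sb_tens (sb_id k b) (sb_braid k a c)) (sb_assoc k b a c)) U
    (Fop (sb_tens (sb_braid k a b) (sb_id k c)) U w) be).
pose y := labA (labp (labl be) (labC (labr be))).
have -> : Fop (sb_comp (sb_tens (sb_id k b) (sb_braid k a c)) (sb_assoc k b a c)) U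
    (Fop (sb_tens (sb_braid k a b) (sb_id k c)) U w) be =
    E (U :|: img (labl be) :|: img (labl (labr be))) \c
    (E (U :|: img (labl (labl y))) \c w (labp (labC (labl y)) (labr y))) by [].
have xE : labp (labC (labl y)) (labr y) = x.
  by rewrite /x /y /labA /labC !(labpl, labpr).
have lE : labl (labl y) = labl be by rewrite /y /labA !(labpl, labpr).
have lA : img (labl (labA be)) = img (labl be) :|: img (labl (labr be)).
  by rewrite /labA labpl img_labp.
rewrite xE lE lA setUA.
have gx : good S x by exact: (good_labA (good_labC (good_labA gS))).
have := wP x gx => /inv_tens[/inv_tens[h1 h2] _].
have := inv_img h2; have -> : labl (labl x) = labr (labr be).
  by rewrite /x /labA /labC !(labpl, labpr).
have -> : labr (labl x) = labl be by rewrite /x /labA /labC !(labpl, labpr).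
move=> h; rewrite -h (compA (E (U :|: img (labl be) :|: _))).
rewrite [X in heq (X \c _) _](chainI EP).
have -> : (U :|: img (labr (labr be)) :|: img (labl be)) :&:
    (U :|: img (labl be) :|: img (labl (labr be))) = U :|: img (labl be).
  rewrite (setUAC U) setU_disj // disjoint_sym //.
by rewrite -(compA _ _ (w x)) -(compA (E (U :|: img (labl be))) _ (w x)) h
  -(compA _ _ (w x)).
Qed.

Lemma sound_hexagon2 a b c :
  sound (sb_comp (sb_comp (sb_assocV k c a b) (sb_braid k (a \ox b) c)) (sb_assocV k a b c))
    (sb_comp (sb_comp (sb_tens (sb_braid k a c) (sb_id k b)) (sb_assocV k a c b))
      (sb_tens (sb_id k a) (sb_braid k b c))).
Proof.
move=> U S w be gS dU wP.
pose x := labAV (labC (labAV be)).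
change (E (U :|: img (labl (labAV be))) \c w x =~
  Fop (sb_comp (sb_tens (sb_braid k a c) (sb_id k b)) (sb_assocV k a c b)) U
    (Fop (sb_tens (sb_id k a) (sb_braid k b c)) U w) be).
pose y := labAV (labp (labC (labl be)) (labr be)).
have -> : Fop (sb_comp (sb_tens (sb_braid k a c) (sb_id k b)) (sb_assocV k a c b)) U
    (Fop (sb_tens (sb_id k a) (sb_braid k b c)) U w) be =
    E (U :|: img (labl (labl be))) \c
    (E (U :|: img (labl y) :|: img (labl (labr y))) \c
      w (labp (labl y) (labC (labr y)))) by [].
have xE : labp (labl y) (labC (labr y)) = x.
  by rewrite /x /y /labAV /labC !(labpl, labpr).
have lE : labl y = labr (labl be) by rewrite /y /labAV /labC !(labpl, labpr).
have rE : labl (labr y) = labl (labl be) by rewrite /y /labAV /labC !(labpl, labpr).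
have lA : labl (labAV be) = labl (labl be) by rewrite /labAV labpl.
rewrite xE lE rE lA.
have gx : good S x by exact: (good_labAV (good_labC (good_labAV gS))).
have := wP x gx => /inv_tens[h1 _].
have := inv_img h1; have -> : labl x = labr (labl be).
  by rewrite /x /labAV /labC !(labpl, labpr).
move=> h; rewrite -h (compA (E (U :|: img (labl (labl be))))).
rewrite [X in heq (X \c _) _](chainU EP).
have -> : (U :|: img (labr (labl be))) :|: (U :|: img (labl (labl be))) =
    U :|: img (labr (labl be)) :|: img (labl (labl be)).
  by rewrite setUACA setUid setUA.
by rewrite -(compA _ _ (w x)) -(compA _ _ (w x)) h -(compA _ _ (w x)).
Qed.

Lemma labl_sum_map (I I' J J' : finType) (s : I -> I') (t : J -> J')
    (be : lab (sbU I' \ox sbU J')) :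
  labs (sum_map s t) (be : lab (sbU (I' + J')%type)) =
  labp (labs s (labl be)) (labs t (labr be)) :> lab (sbU I \ox sbU J).
Proof. by apply/ffunP => -[i|i]; rewrite !ffunE /= !ffunE. Qed.

Lemma sound_mu_nat (I I' J J' : finType) (s : I -> I') (t : J -> J')
    (sP : bijective s) (tP : bijective t) :
  sound (sb_comp (sb_gamma k (sum_map_bij sP tP)) (sb_mu k I J))
    (sb_comp (sb_mu k I' J') (sb_tens (sb_gamma k sP) (sb_gamma k tP))).
Proof.
move=> U S w be gS dU wP; pose b2 : lab (sbU I' \ox sbU J') := be.
change (E (U :|: img (labl (labs (sum_map s t) be : lab (sbU I \ox sbU J)))) \c
   w (labs (sum_map s t) be : lab (sbU I \ox sbU J)) =~
  E (U :|: img (labl b2)) \c w (labp (labs s (labl b2)) (labs t (labr b2)))).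
rewrite (labl_sum_map s t b2) labpl img_labs //.
Qed.

Lemma sound_delta_nat (I I' J J' : finType) (s : I -> I') (t : J -> J')
    (sP : bijective s) (tP : bijective t) :
  sound (sb_comp (sb_delta k I' J') (sb_gamma k (sum_map_bij sP tP)))
    (sb_comp (sb_tens (sb_gamma k sP) (sb_gamma k tP)) (sb_delta k I J)).
Proof.
move=> U S w be gS dU wP; pose b2 := labp (labs s (labl be)) (labs t (labr be)).
change (E (U :|: img (labl be)) \c
   w (labs (sum_map s t) (be : lab (sbU (I' + J')%type))) =~
  E (U :|: img (labl b2)) \c w b2).
rewrite (labl_sum_map s t be) labpl img_labs //.
Qed.

Lemma labs_sum_assoc (I J K : finType) (be : lab (sbU I \ox (sbU J \ox sbU K))) :
  labs (@sum_assoc I J K) (be : lab (sbU (I + (J + K))%type)) =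
  labA be :> lab ((sbU I \ox sbU J) \ox sbU K).
Proof. by apply/ffunP => -[[i|i]|i]; rewrite !ffunE /= ?ffunE /= ?ffunE. Qed.

Lemma sound_muA (I J K : finType) :
  sound (sb_comp (sb_comp (sb_gamma k (@sum_assoc_bij I J K)) (sb_mu k (I + J)%type K))
      (sb_tens (sb_mu k I J) (sb_id k (sbU K))))
    (sb_comp (sb_comp (sb_mu k I (J + K)%type) (sb_tens (sb_id k (sbU I)) (sb_mu k J K)))
      (sb_assoc k (sbU I) (sbU J) (sbU K))).
Proof.
move=> U S w be gS dU wP; pose b2 : lab (sbU I \ox (sbU J \ox sbU K)) := be.
pose x : lab ((sbU I \ox sbU J) \ox sbU K) := labs (@sum_assoc I J K) be.
have -> : Fop (sb_comp (sb_comp (sb_gamma k (@sum_assoc_bij I J K))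
      (sb_mu k (I + J)%type K)) (sb_tens (sb_mu k I J) (sb_id k (sbU K)))) U w be =
    E (U :|: img (labl x)) \c (E (U :|: img (labl (labl x))) \c
      w (labp (labl x) (labr x))) by [].
have -> : Fop (sb_comp (sb_comp (sb_mu k I (J + K)%type)
      (sb_tens (sb_id k (sbU I)) (sb_mu k J K)))
      (sb_assoc k (sbU I) (sbU J) (sbU K))) U w be =
    E (U :|: img (labl b2)) \c (E (U :|: img (labl b2) :|: img (labl (labr b2))) \c
      w (labA (labp (labl b2) (labr b2)))) by [].
have xE : x = labA b2 := labs_sum_assoc b2.
rewrite !labpK xE [labl (labA b2)]labpl labpl img_labp setUA.
rewrite (compA (E (U :|: img (labl b2) :|: _))) (compA (E (U :|: img (labl b2)))).
by rewrite (chainC EP (subsetUl (U :|: img (labl b2)) _)).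
Qed.

Lemma sound_deltaA (I J K : finType) :
  sound (sb_comp (sb_comp (sb_assoc k (sbU I) (sbU J) (sbU K))
      (sb_tens (sb_delta k I J) (sb_id k (sbU K)))) (sb_delta k (I + J)%type K))
    (sb_comp (sb_comp (sb_tens (sb_id k (sbU I)) (sb_delta k J K))
      (sb_delta k I (J + K)%type)) (sb_gamma k (@sum_assoc_bij I J K))).
Proof.
move=> U S w be gS dU wP.
pose x := labA be; pose y := labp (labl x) (labr x).
have -> : Fop (sb_comp (sb_comp (sb_assoc k (sbU I) (sbU J) (sbU K))
      (sb_tens (sb_delta k I J) (sb_id k (sbU K)))) (sb_delta k (I + J)%type K)) U w be =
    E (U :|: img (labl (labl x))) \c
      (E (U :|: img (labl y)) \c w y) by [].
pose b2 := labp (labl be) (labr be).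
have -> : Fop (sb_comp (sb_comp (sb_tens (sb_id k (sbU I)) (sb_delta k J K))
      (sb_delta k I (J + K)%type)) (sb_gamma k (@sum_assoc_bij I J K))) U w be =
    E (U :|: img (labl be) :|: img (labl (labr be))) \c
      (E (U :|: img (labl b2)) \c w (labs (@sum_assoc I J K) b2)) by [].
have -> : labs (@sum_assoc I J K) b2 = y.
  by rewrite /b2 labpK /y labpK; apply: labs_sum_assoc.
rewrite /b2 labpl /y labpl /x [labl (labA be)]labpl labpl img_labp setUA.
rewrite (compA (E (U :|: img (labl be) :|: _))) (compA (E (U :|: img (labl be)))).
by rewrite (chainC EP (subsetUl (U :|: img (labl be)) _)).
Qed.

Lemma labs_void_r (I : finType) (be : lab (sbU I)) :
  labs (@sum_void_r I) be = labp be (lab0 _) :> lab (sbU I \ox sb1).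
Proof. by apply/ffunP => -[i|[]]; rewrite !ffunE. Qed.

Lemma labs_void_l (I : finType) (be : lab (sbU I)) :
  labs (@sum_void_l I) be = labp (lab0 _) be :> lab (sb1 \ox sbU I).
Proof. by apply/ffunP => -[[]|i]; rewrite !ffunE. Qed.

Lemma sound_mu_r (I : finType) :
  sound (sb_comp (sb_gamma k (@sum_void_r_bij I)) (sb_mu k I void)) (sb_runit k (sbU I)).
Proof.
move=> U S w be gS dU wP.
pose x : lab (sbU I \ox sb1) := labs (@sum_void_r I) be.
change (E (U :|: img (labl x)) \c w x =~ w (labp be (lab0 _))).
have -> : x = labp be (lab0 _) := labs_void_r be.
by have /inv_tens[h _] := wP _ (good_runit gS); apply: inv_img h.
Qed.

Lemma sound_mu_l (I : finType) :
  sound (sb_comp (sb_gamma k (@sum_void_l_bij I)) (sb_mu k void I)) (sb_lunit k (sbU I)).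
Proof.
move=> U S w be gS dU wP.
pose x : lab (sb1 \ox sbU I) := labs (@sum_void_l I) be.
change (E (U :|: img (labl x)) \c w x =~ w (labp (lab0 _) be)).
have -> : x = labp (lab0 _) be := labs_void_l be.
by have /inv_tens[h _] := wP _ (good_lunit gS); apply: inv_img h.
Qed.

Lemma sound_delta_r (I : finType) :
  sound (sb_delta k I void)
    (sb_comp (sb_runitV k (sbU I)) (sb_gamma k (@sum_void_r_bij I))).
Proof.
move=> U S w be gS dU wP; pose b2 : lab (sbU (I + void)%type) := be.
change (E (U :|: img (labl be)) \c w b2 =~
  w (labs (@sum_void_r I) (labl be) : lab (sbU (I + void)%type))).
have -> : labs (@sum_void_r I) (labl be) = b2.
  by rewrite labs_void_r -(lab0E (labr be)) labpK.
have hb : inv U b2 (w b2) := wP b2 gS.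
have -> : img (labl be) = img b2.
  rewrite -[RHS]/(img be) img_lab (lab0E (labr be)) img_lab0 setU0 //.
exact: inv_img hb.
Qed.

Lemma sound_delta_l (I : finType) :
  sound (sb_delta k void I)
    (sb_comp (sb_lunitV k (sbU I)) (sb_gamma k (@sum_void_l_bij I))).
Proof.
move=> U S w be gS dU wP; pose b2 : lab (sbU (void + I)%type) := be.
change (E (U :|: img (labl be)) \c w b2 =~
  w (labs (@sum_void_l I) (labr be) : lab (sbU (void + I)%type))).
have -> : labs (@sum_void_l I) (labr be) = b2.
  by rewrite labs_void_l -(lab0E (labl be)) labpK.
have hb : inv U b2 (w b2) := wP b2 gS.
by rewrite (lab0E (labl be)) img_lab0 setU0; apply: inv0 hb.
Qed.

Lemma Fop_mid a b c d U (w : lab ((a \ox b) \ox (c \ox d)) -> BB) be :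
  Fop (sb_braid_mid k a b c d) U w be =
  E (U :|: img (labl (labl be)) :|: img (labr (labl be))) \c
    w (labp (labp (labl (labl be)) (labl (labr be)))
         (labp (labr (labl be)) (labr (labr be)))).
Proof.
pose y := labAV be; pose z := labA (labr y).
have -> : Fop (sb_braid_mid k a b c d) U w be =
    E (U :|: img (labl y) :|: img (labl (labl z))) \c
    w (labA (labp (labl y) (labAV (labp (labC (labl z)) (labr z))))) by [].
have -> : labl y = labl (labl be) by rewrite /y /labAV labpl.
have -> : labl (labl z) = labr (labl be).
  by rewrite /z /y /labA /labAV !(labpl, labpr).
by congr (_ \c w _); rewrite /z /y /labA /labAV /labC !(labpl, labpr).
Qed.

Lemma sound_SB3 (K11 K12 K21 K22 : finType) :
  sound (sb_comp (sb_comp (sb_delta k (K11 + K21)%type (K12 + K22)%type)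
      (sb_gamma k (@sum_mid_bij K11 K12 K21 K22)))
      (sb_mu k (K11 + K12)%type (K21 + K22)%type))
    (sb_comp (sb_comp (sb_tens (sb_mu k K11 K21) (sb_mu k K12 K22))
      (sb_braid_mid k (sbU K11) (sbU K12) (sbU K21) (sbU K22)))
      (sb_tens (sb_delta k K11 K12) (sb_delta k K21 K22))).
Proof.
move=> U S w be gS dU wP.
pose b2 : lab ((sbU K11 \ox sbU K21) \ox (sbU K12 \ox sbU K22)) := be.
pose x : lab ((sbU K11 \ox sbU K12) \ox (sbU K21 \ox sbU K22)) :=
  labp (labp (labl (labl b2)) (labl (labr b2)))
       (labp (labr (labl b2)) (labr (labr b2))).
pose x1 : lab (sbU (K11 + K12)%type \ox sbU (K21 + K22)%type) := x.
have xE : labs (@sum_mid K11 K12 K21 K22) (be : lab (sbU _)) = x1.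
  by apply/ffunP => -[[i|i]|[i|i]]; rewrite !ffunE /= ?ffunE /= ?ffunE.
have -> : Fop (sb_comp (sb_comp (sb_delta k (K11 + K21)%type (K12 + K22)%type)
      (sb_gamma k (@sum_mid_bij K11 K12 K21 K22)))
      (sb_mu k (K11 + K12)%type (K21 + K22)%type)) U w be =
    E (U :|: img (labl b2)) \c (E (U :|: img (labl
      (labs (@sum_mid K11 K12 K21 K22) (be : lab (sbU _)) : lab (sbU (K11 + K12)%type \ox sbU (K21 + K22)%type)))) \c
      w (labs (@sum_mid K11 K12 K21 K22) (be : lab (sbU _)))) by [].
rewrite xE.
pose b3 := labp (labl b2) (labr b2).
have -> : Fop (sb_comp (sb_comp (sb_tens (sb_mu k K11 K21) (sb_mu k K12 K22))
      (sb_braid_mid k (sbU K11) (sbU K12) (sbU K21) (sbU K22)))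
      (sb_tens (sb_delta k K11 K12) (sb_delta k K21 K22))) U w be =
    E (U :|: img (labl b2) :|: img (labl (labr b2))) \c
    (E (U :|: img (labl (labl b2))) \c
      Fop (sb_braid_mid k (sbU K11) (sbU K12) (sbU K21) (sbU K22)) U
        (Fop (sb_tens (sb_delta k K11 K12) (sb_delta k K21 K22)) U w) b3) by [].
rewrite /b3 labpK Fop_mid -/x.
have -> : Fop (sb_tens (sb_delta k K11 K12) (sb_delta k K21 K22)) U w x =
    E (U :|: img (labl x) :|: img (labl (labr x))) \c
    (E (U :|: img (labl (labl x))) \c w (labp (labl x) (labr x))) by [].
rewrite labpK -[w x]/(w x1).
have /good_tens[_ _ [d _]] : good S b2 := gS.
have dBC : [disjoint img (labr (labl b2)) & img (labl (labr b2))].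
  by apply: disjointWl (disjointWr _ d); rewrite img_lab ?subsetUl ?subsetUr.
have g1 : good S x1 by rewrite -xE; apply: good_labs gS; apply: sum_mid_bij.
have /inv_tens[h _] : inv U x1 (w x1) := wP x1 g1.
have eJ : img (labl x1) = img (labl (labl b2)) :|: img (labl (labr b2)).
  by rewrite -[LHS]/(img (labl x)) labpl img_labp.
have hJ := inv_img h; rewrite eJ in hJ.
have -> : E (U :|: img (labl x1)) \c w x1 =~ w x1 by rewrite eJ.
have eJ2 : img (labl x) = img (labl (labl b2)) :|: img (labl (labr b2)) := eJ.
rewrite eJ2 /x !labpl !labpr labpl -/x1 (img_lab (labl b2)).
by apply: heq_sym; apply: (chain_mid EP dBC hJ).
Qed.

Lemma Fop_sound a b (f g : sbHom k a b) : sbEq f g -> sound f g.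
Proof.
elim=> {a b f g}.
- by move=> a b f U S w be gS dU wP.
- by move=> a b f g _ IH U S w be gS dU wP; apply: heq_sym; apply: IH gS dU wP.
- move=> a b f g h _ IH _ IH' U S w be gS dU wP.
  by rewrite (IH _ _ _ _ gS dU wP); apply: IH' gS dU wP.
- by move=> a b c f f' g g' _ IH _ IH'; apply: sound_comp.
- move=> a b f f' g g' _ IH _ IH' U S w be gS dU wP; rewrite !Fop_addE.
  by apply: hadd_heq; [apply: IH gS dU wP|apply: IH' gS dU wP].
- move=> a b x f f' _ IH U S w be gS dU wP; rewrite !Fop_scaleE.
  by apply: hscale_heq; apply: IH gS dU wP.
- by move=> a a' b b' f f' g g' _ IH _ IH'; apply: sound_tens.
- by move=> a b c d f g h U S w be gS dU wP; apply: heq_refl.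
- by move=> a b f U S w be gS dU wP; apply: heq_refl.
- by move=> a b f U S w be gS dU wP; apply: heq_refl.
- by move=> a b f g h U S w be gS dU wP; apply: haddA.
- by move=> a b f g U S w be gS dU wP; apply: haddC.
- by move=> a b f U S w be gS dU wP; apply: hadd0.
- by move=> a b f U S w be gS dU wP; apply: haddN.
- by move=> a b x y f U S w be gS dU wP; apply: hscaleA.
- by move=> a b f U S w be gS dU wP; apply: hscale1.
- by move=> a b x f g U S w be gS dU wP; apply: hscaleDr.
- by move=> a b x y f U S w be gS dU wP; apply: hscaleDl.
- by move=> a b c f f' g U S w be gS dU wP; apply: heq_refl.
- by move=> a b c f g g' U S w be gS dU wP; apply: FopD gS.
- by move=> a b c x f g U S w be gS dU wP; apply: heq_refl.
- by move=> a b c x f g U S w be gS dU wP; apply: FopZ gS.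
- move=> a b U S w be gS dU wP.
  by change (w (labp (labl be) (labr be)) =~ w be); rewrite labpK.
- by move=> *; apply: sound_tensM.
- move=> a a' b b' f f' g U S w be gS dU wP; have /good_tens[_ gr _] := gS.
  by rewrite Fop_addE !Fop_tensE; apply: FopD gr.
- by move=> a a' b b' f g g' U S w be gS dU wP; apply: heq_refl.
- move=> a a' b b' x f g U S w be gS dU wP; have /good_tens[_ gr _] := gS.
  by rewrite Fop_scaleE !Fop_tensE; apply: FopZ gr.
- by move=> a a' b b' x f g U S w be gS dU wP; apply: heq_refl.
- by move=> a b c U S w be gS dU wP; change (w (labA (labAV be)) =~ w be); rewrite labAVK.
- by move=> a b c U S w be gS dU wP; change (w (labAV (labA be)) =~ w be); rewrite labAK.
- by move=> *; apply: sound_assoc_nat.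
- move=> a U S w be gS dU wP; change (w (labp (lab0 _) (labr be)) =~ w be).
  by rewrite -(lab0E (labl be)) labpK.
- by move=> a U S w be gS dU wP; change (w (labr (labp (lab0 _) be)) =~ w be); rewrite labpr.
- move=> a b f U S w be gS dU wP.
  change (Fop f (U :|: img (labl (labp (lab0 _) be)))
    (fun ar => w (labp (labl (labp (lab0 _) be)) ar)) (labr (labp (lab0 _) be)) =~
    Fop f U (fun ar => w (labp (lab0 _) ar)) be).
  by rewrite labpl labpr img_lab0 setU0.
- move=> a U S w be gS dU wP; change (w (labp (labl be) (lab0 _)) =~ w be).
  by rewrite -(lab0E (labr be)) labpK.
- by move=> a U S w be gS dU wP; change (w (labl (labp be (lab0 _))) =~ w be); rewrite labpl.
- move=> a b f U S w be gS dU wP.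
  change (Fop f U (fun al => w (labp al (labr (labp be (lab0 _)))))
    (labl (labp be (lab0 _))) =~ Fop f U (fun al => w (labp al (lab0 _))) be).
  by rewrite labpl labpr.
- move=> a b c d U S w be gS dU wP.
  change (w (labA (labA be)) =~
    w (labp (labA (labl (labA (labp (labl be) (labA (labr be))))))
         (labr (labA (labp (labl be) (labA (labr be))))))).
  by rewrite /labA !(labpl, labpr).
- move=> a b U S w be gS dU wP.
  change (w (labA (labp (labl be) (labp (lab0 _) (labr be)))) =~
    w (labp (labp (labl be) (lab0 _)) (labr be))).
  by rewrite /labA !(labpl, labpr).
- by move=> *; apply: sound_braidK.
- by move=> *; apply: sound_braidVK.
- by move=> *; apply: sound_braid_nat.
- by move=> *; apply: sound_hexagon1.
- by move=> *; apply: sound_hexagon2.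
- move=> I J s t sP tP st U S w be gS dU wP.
  change (w (labs s be) =~ w (labs t be)).
  suff -> : labs s be = labs t be by [].
  by apply/ffunP => i; rewrite !ffunE st.
- move=> I iP U S w be gS dU wP.
  change (w (labs (fun i => i) be) =~ w be).
  suff -> : labs (fun i => i) be = be by [].
  by apply/ffunP => i; rewrite !ffunE.
- move=> I J K s t sP tP U S w be gS dU wP.
  change (w (labs (t \o s) be) =~ w (labs s (labs t be))).
  suff -> : labs (t \o s) be = labs s (labs t be) by [].
  by apply/ffunP => i; rewrite !ffunE.
- by move=> *; apply: sound_mu_nat.
- by move=> *; apply: sound_delta_nat.
- by move=> *; apply: sound_muA.
- by move=> *; apply: sound_deltaA.
- by move=> *; apply: sound_mu_r.
- by move=> *; apply: sound_mu_l.
- by move=> *; apply: sound_delta_r.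
- by move=> *; apply: sound_delta_l.
- by move=> *; apply: sound_SB3.
Qed.

End Soundness.

(** * Morphisms of the PROB act through their operators *)

Section SumsOverLabels.
Variables (k : fieldType) (C : linCat k) (T : finType).
Local Notation lab := (lab T).
Implicit Types (S A B : {set T}).

Lemma fmap0 (D D' : linCat k) (F : linFunctor D D') (a b : D) :
  fmap F (hzero a b) =~ hzero (F a) (F b).
Proof.
apply: (@hadd_cancel _ _ _ _ (fmap F (hzero a b))).
by rewrite -(fmapD F) [X in heq _ X]haddr0; apply: fmap_heq; rewrite haddr0.
Qed.

Lemma hsum_allpairs (I J K : eqType) (x y : C) (s : seq I) (r : seq J)
    (h : I -> J -> K) (F : K -> hom C x y) :
  hsum [seq h i j | i <- s, j <- r] F =~ hsum s (fun i => hsum r (fun j => F (h i j))).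
Proof.
elim: s => [|i s IH]; first by rewrite /hsum !big_nil.
rewrite allpairs_cons hsum_cat hsum_map IH.
by rewrite [X in heq _ X]/hsum big_cons.
Qed.

Definition gsum S a (x y : C) (F : lab a -> hom C x y) : hom C x y :=
  hsum (enum {: lab a}) (fun al => if good S al then F al else hzero x y).

Lemma gsum_heq S a (x y : C) (F F' : lab a -> hom C x y) :
  (forall al, good S al -> F al =~ F' al) -> gsum S F =~ gsum S F'.
Proof. by move=> FF'; apply: hsum_heq => al; case: ifP => // /FF'. Qed.

Lemma gsum_compr S a (x y z : C) (g : hom C y z) (F : lab a -> hom C x y) :
  g \c gsum S F =~ gsum S (fun al => g \c F al).
Proof.
rewrite [X in heq X _]hsum_compr; apply: hsum_heq => al.
by case: ifP => // _; apply: comp0r.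
Qed.

Lemma gsumD S a (x y : C) (F F' : lab a -> hom C x y) :
  gsum S (fun al => hadd (F al) (F' al)) =~ hadd (gsum S F) (gsum S F').
Proof.
rewrite -[X in heq _ X]hsumD; apply: hsum_heq => al.
by case: ifP => // _; rewrite hadd0.
Qed.

Lemma gsumZ S a (x y : C) c (F : lab a -> hom C x y) :
  gsum S (fun al => hscale c (F al)) =~ hscale c (gsum S F).
Proof.
rewrite -[X in heq _ X]hsumZ; apply: hsum_heq => al.
by case: ifP => // _; rewrite hscale0.
Qed.

Lemma gsum0 S a (x y : C) : gsum S (fun _ : lab a => hzero x y) =~ hzero x y.
Proof. by apply: hsum0 => al _; case: ifP. Qed.

Lemma gsum_reindex S a b (s : lab b -> lab a) (t : lab a -> lab b) (x y : C)
    (F : lab a -> hom C x y) : cancel s t -> cancel t s ->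
  (forall be, good S be -> good S (s be)) -> (forall al, good S al -> good S (t al)) ->
  gsum S F =~ gsum S (fun be => F (s be)).
Proof.
move=> st ts gs gt.
have gE be : good S (s be) = good S be.
  by apply/idP/idP => [/gt|/gs//]; rewrite st.
have -> : gsum S (fun be => F (s be)) =~ hsum [seq s be | be <- enum {: lab b}]
    (fun al => if good S al then F al else hzero x y).
  by rewrite hsum_map; apply: hsum_heq => be; rewrite gE.
apply: hsum_perm; apply: uniq_perm; first exact: enum_uniq.
  by rewrite map_inj_uniq ?enum_uniq //; apply: can_inj st.
move=> al; rewrite mem_enum; apply/esym/mapP; exists (t al); rewrite ?ts //.
by rewrite mem_enum.
Qed.

Lemma gsum_single S a (x y : C) (F : lab a -> hom C x y) al0 : good S al0 ->
  (forall al, al != al0 -> F al =~ hzero x y) -> gsum S F =~ F al0.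
Proof.
move=> g F0; rewrite [X in heq X _](hsum_single (i0 := al0)) ?g ?enum_uniq ?mem_enum //.
by move=> al /F0 e; case: ifP.
Qed.

Lemma good_labpE S a b (al : lab a) (be : lab b) :
  good S (labp al be) =
  [&& injectiveb be, img be \subset S & good (S :\: img be) al].
Proof.
apply/idP/and3P => [/good_tens[]|[ib bS ga]].
  rewrite labpl labpr => ga /goodP[ib _] [d e]; split.
  - exact/injectiveP.
  - by rewrite -e subsetUr.
  suff -> : S :\: img be = img al by [].
  by rewrite -e setDUl setDv setU0; apply/setDidPl.
have gb : good (img be) be by rewrite /good ib eqxx.
by apply: (good_labp ga gb); apply: part_sym; apply: part_sub.
Qed.

Lemma good_labpEl S a b (al : lab a) (be : lab b) :
  good S (labp al be) =
  [&& injectiveb al, img al \subset S & good (S :\: img al) be].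
Proof.
apply/idP/and3P => [/good_tens[]|[ib bS ga]].
  rewrite labpl labpr => /goodP[ia _] gb [d e]; split.
  - exact/injectiveP.
  - by rewrite -e subsetUl.
  suff -> : S :\: img al = img be by [].
  by rewrite -e setDUl setDv set0U; apply/setDidPl; rewrite disjoint_sym.
have gb : good (img al) al by rewrite /good ib eqxx.
by apply: (good_labp gb ga); apply: part_sub.
Qed.

(** The outer sum when [gsum] is split over a tensor product: one factor takes part of [S] and the
    other must take the complement. *)
Definition psum S a (x y : C) (F : lab a -> hom C x y) : hom C x y :=
  hsum (enum {: lab a})
    (fun al => if injectiveb al && (img al \subset S) then F al else hzero x y).

Lemma psum_heq S a (x y : C) (F F' : lab a -> hom C x y) :
  (forall al : lab a, good (img al) al -> img al \subset S -> F al =~ F' al) ->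
  psum S F =~ psum S F'.
Proof.
move=> FF'; apply: hsum_heq => al; case: ifP => // /andP[ia al_S].
by apply: FF' => //; rewrite /good ia eqxx.
Qed.

Lemma gsum_tensr S a b (x y : C) (F : lab (a \ox b) -> hom C x y) :
  gsum S F =~ psum S (fun ar => gsum (S :\: img ar) (fun al => F (labp al ar))).
Proof.
pose P al := if good S al then F al else hzero x y.
have -> : gsum S F =~ hsum [seq labp al ar | ar <- enum {: lab b}, al <- enum {: lab a}] P.
  apply: hsum_perm; apply: uniq_perm; first exact: enum_uniq.
    apply: allpairs_uniq; try exact: enum_uniq.
    move=> [ar al] [ar' al'] _ _ /= e; have := congr1 (@labl _ a b) e.
    by have := congr1 (@labr _ a b) e; rewrite !labpl !labpr => -> ->.
  move=> al; rewrite mem_enum; apply/esym/allpairsP.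
  by exists (labr al, labl al); rewrite !mem_enum /= labpK.
rewrite (hsum_allpairs _ _ (fun ar al => labp al ar) _); apply: hsum_heq => ar.
case: ifP => [/andP[ir rS]|rF].
  by apply: hsum_heq => al; rewrite /P good_labpE ir rS.
by apply: hsum0 => al _; rewrite /P good_labpE andbA rF.
Qed.

Lemma gsum_tensl S a b (x y : C) (F : lab (a \ox b) -> hom C x y) :
  gsum S F =~ psum S (fun al => gsum (S :\: img al) (fun ar => F (labp al ar))).
Proof.
pose P al := if good S al then F al else hzero x y.
have -> : gsum S F =~ hsum [seq labp al ar | al <- enum {: lab a}, ar <- enum {: lab b}] P.
  apply: hsum_perm; apply: uniq_perm; first exact: enum_uniq.
    apply: allpairs_uniq; try exact: enum_uniq.
    move=> [al ar] [al' ar'] _ _ /= e; have := congr1 (@labl _ a b) e.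
    by have := congr1 (@labr _ a b) e; rewrite !labpl !labpr => -> ->.
  move=> al; rewrite mem_enum; apply/esym/allpairsP.
  by exists (labl al, labr al); rewrite !mem_enum /= labpK.
rewrite (hsum_allpairs _ _ (fun al ar => labp al ar) _); apply: hsum_heq => al.
case: ifP => [/andP[ir rS]|rF].
  by apply: hsum_heq => ar; rewrite /P good_labpEl ir rS.
by apply: hsum0 => ar _; rewrite /P good_labpEl andbA rF.
Qed.

End SumsOverLabels.

(** * Labelled splittings composed with the generators *)

Section LabelCalculus.
Variables (k : fieldType) (T : finType).
Local Notation SB := (SB k).
Local Notation "1_ a" := (@idm k SB a) (at level 0, a at level 0, format "1_ a").
Local Notation lab := (lab T).
Local Notation Dlab := (Dlab k).
Implicit Types (S U A B : {set T}).

Lemma tens_compl (a a' a'' b b' : SB) (f : hom SB a' a'') (g : hom SB a a') (h : hom SB b b') :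
  (f \c g) \ot h =~ (f \ot h) \c (g \ot 1_ b).
Proof. by rewrite -tensM compm1. Qed.

Lemma tens_compr (a a' a'' b b' : SB) (f : hom SB a' a'') (g : hom SB a a') (h : hom SB b b') :
  h \ot (f \c g) =~ (h \ot f) \c (1_ b \ot g).
Proof. by rewrite -tensM compm1. Qed.

Lemma Dlab_assoc S a b c (be : lab (a \ox (b \ox c))) : good S be ->
  asc a b c \c Dlab S (labA be) =~ Dlab S be.
Proof.
move=> g; have gA := good_labA g.
have /good_tens[_ gr p1] := g; have /good_tens[_ _ p2] := gr.
have := gA => /good_tens[gl' _ p3]; have /good_tens[_ _ p4] := gl'.
move: p1 p2 p3 p4; rewrite /labA !labpl !labpr => p1 p2 p3 p4.
rewrite (DlabP _ _ erefl erefl) (DlabP _ _ erefl erefl) (DlabT _ _ be) (DlabT _ _ (labr be)).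
set A := img (labl be); set B := img (labl (labr be)); set D := img (labr (labr be)).
set AB := img (labp _ _); set BD := img (labr be).
rewrite tens_compl tens_compr -!(compA (_ \ot _)) -(Dh_coassoc k p4 p2 p3 p1).
by rewrite (compA (asc _ _ _)) asc_nat -!compA.
Qed.

Lemma Dlab_lab0 : Dlab set0 (lab0 T) =~ eps k T.
Proof.
rewrite DlabU; apply: tr_ext => //; try exact: cz_inj.
by rewrite img_cz img_lab0.
Qed.

Lemma Dlab_lunit S a (be : lab a) : good S be ->
  lun a \c Dlab S (labp (lab0 _) be) =~ Dlab S be.
Proof.
move=> g; rewrite (DlabP _ _ (img_lab0 _) (good_img g)) Dh_0l.
rewrite Dlab_lab0 (compA (eps k T \ot _)) -tensM epsVK compm1.
by rewrite compA lun_nat -compA lunVK compm1.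
Qed.

Lemma Dlab_runit S a (be : lab a) : good S be ->
  run a \c Dlab S (labp be (lab0 _)) =~ Dlab S be.
Proof.
move=> g; rewrite (DlabP _ _ (good_img g) (img_lab0 _)) Dh_0r.
rewrite Dlab_lab0 (compA (_ \ot eps k T)) -tensM epsVK compm1.
by rewrite compA run_nat -compA runVK compm1.
Qed.

Lemma Dlab_labs S (I J : finType) (s : I -> J) (sP : bijective s) (be : lab (sbU J)) :
  good S be -> gam k sP \c Dlab S (labs s be) =~ Dlab S be.
Proof.
move=> g; have [ib e] := goodP _ _ g; have [is' e'] := goodP _ _ (good_labs sP g).
have <- : tr k (labs s be) be =~ gam k sP.
  by apply: trE => // i; rewrite ffunE.
by rewrite !DlabU tr_comp ?img_cz ?e ?e' //; apply: cz_inj.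
Qed.

Lemma tr_lsum_lab S (I J : finType) (be : lab (sbU I \ox sbU J)) : good S be ->
  tr k (lsum (@cz T (img (labl be))) (@cz T (img (labr be)))) (lsum (labl be) (labr be)) =~
  tr k (lsum (@cz T (img (labl be))) (@cz T (img (labr be)))) be.
Proof.
move=> g; have /good_tens[/goodP[il el] /goodP[ir er] p] := g.
apply: tr_ext => //.
- exact: part_inj p.
- by apply: lsum_inj => //; case: p.
- by rewrite !img_lsum !img_cz.
- by case=> x; rewrite /= ffunE.
Qed.

(** After [mu] the two factors are no longer separated, and the splitting survives as the idempotent
    of the left labels. This is where the multiplier of [mu] in [Fop] comes from. *)
Lemma Dlab_mu S (I J : finType) (be : lab (sbU I \ox sbU J)) : good S be ->
  mu k I J \c Dlab S be =~
  Dlab (a := sbU (I + J)%type) S be \c Eh k S (img (labl be)).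
Proof.
move=> g; have [ib e] := goodP _ _ g.
have /good_tens[/goodP[il el] /goodP[ir er] p] := g.
rewrite DlabT compA !DlabU -tr_mu ?img_cz //; try exact: cz_inj; last by case: p.
rewrite (EhE k p) MhE -[X in heq _ (_ \c X)]compA !compA.
do 2 apply: comp_heq => //; rewrite tr_comp ?(part_img p) ?img_cz //.
- exact: tr_lsum_lab g.
- exact: part_inj p.
- exact: cz_inj.
Qed.

Lemma Dlab_delta S (I J : finType) (be : lab (sbU I \ox sbU J)) : good S be ->
  dl k I J \c Dlab (a := sbU (I + J)%type) S be =~ Dlab S be.
Proof.
move=> g; have [ib e] := goodP _ _ g.
have /good_tens[/goodP[il el] /goodP[ir er] p] := g.
rewrite DlabT DhE compA !DlabU -tr_dl ?img_cz //; try exact: cz_inj; last by case: p.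
rewrite -compA; apply: comp_heq => //; rewrite (tr_lsum_lab g).
rewrite tr_comp ?(part_img p) ?img_cz //; [exact: cz_inj|exact: part_inj p].
Qed.

Lemma Dlab_braid S a b (be : lab (b \ox a)) : good S be ->
  brd a b \c Dlab S (labC be) =~ Dlab S be \c Eh k S (img (labr be)).
Proof.
move=> g; have /good_tens[gl gr p] := g.
rewrite (DlabP _ _ erefl erefl) DlabT compA brd_nat -!compA; apply: comp_heq => //.
rewrite (EhE k (part_sym p)) (compA (Dh k S _ _)) (Dh_Mh_brd k (part_sym p)).
by [].
Qed.

Lemma Dlab_absorb S a b (be : lab (a \ox b)) : good S be ->
  Dlab S be \c Eh k S (img (labl be)) =~ Dlab S be.
Proof.
by move=> g; have /good_tens[_ _ p] := g; rewrite DlabT -compA (Eh_absorb k p).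
Qed.

End LabelCalculus.

(** * Morphisms act through their matrices *)

Section Realizing.
Variables (k : fieldType) (R : realType) (n : nat).
Local Notation SB := (SB k).
Local Notation Q := (Q k R n).
Local Notation top := (osp_top n : Q).
Local Notation BB := (hom Q top top).
Local Notation X := (us k [set: 'I_n] : SB).
Local Notation lab := (lab 'I_n).
Local Notation E := (qE k R (n := n)).
Local Notation H := (qh k R (n := n)).
Local Notation Fop := (@Fop k R n _ _).
Local Notation Dlab := (Dlab k).
Implicit Types (U S W A B V : {set 'I_n}).

Let EP : chain_idem (C := Q) (t := top) E := qE_chain k R n.

(* [f] acts through the matrix [M]; the tensor context [F], [p] makes the
   statement stable under induction on [f]. *)
Definition realizes a b (f : hom SB a b) (M : {set 'I_n} -> (lab a -> BB) -> lab b -> BB) :=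
  forall F U S p w, @ctx k _ F U S p -> [disjoint U & S] ->
  (forall al, good S al -> inv U al (w al)) ->
  gsum S (fun al => fmap F (f \c Dlab S al) \c (p \c Ghat (w al))) =~
  gsum S (fun be => fmap F (Dlab S be) \c (p \c Ghat (M U w be))).

Lemma ctx_Ghat F U S p W (x : BB) : @ctx k _ F U S p -> W \subset S ->
  p \c Ghat (E (U :|: W) \c x) =~ fmap F (Eh k S W) \c (p \c Ghat x).
Proof.
by move=> pP WS; rewrite Ghat_comp Ghat_qE (compA p) (pP W WS) -(compA _ p).
Qed.

Lemma realizes_mono a b (f : hom SB a b) (s : lab b -> lab a) (t : lab a -> lab b)
    (M : {set 'I_n} -> lab b -> BB -> BB) :
  cancel s t -> cancel t s ->
  (forall S be, good S be -> good S (s be)) -> (forall S al, good S al -> good S (t al)) ->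
  (forall F U S p be x, @ctx k _ F U S p -> [disjoint U & S] -> good S be ->
    inv U (s be) x ->
    fmap F (f \c Dlab S (s be)) \c (p \c Ghat x) =~
    fmap F (Dlab S be) \c (p \c Ghat (M U be x))) ->
  realizes f (fun U w be => M U be (w (s be))).
Proof.
move=> st ts gs gt key F U S p w pP dU wP.
rewrite (gsum_reindex _ st ts (gs S) (gt S)); apply: gsum_heq => be g.
by apply: key => //; apply/wP/gs.
Qed.

Lemma realizes_id_mono a b (f : hom SB a b) (s : lab b -> lab a) (t : lab a -> lab b) :
  cancel s t -> cancel t s ->
  (forall S be, good S be -> good S (s be)) -> (forall S al, good S al -> good S (t al)) ->
  (forall S be, good S be -> f \c Dlab S (s be) =~ Dlab S be) ->
  realizes f (fun U w be => w (s be)).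
Proof.
move=> st ts gs gt key; apply: (realizes_mono (M := fun U be x => x) st) => //.
by move=> F U S p be x pP dU g _; rewrite key.
Qed.

Lemma realizes_comp a b c (f : sbHom k b c) (g : sbHom k a b) :
  realizes f (Fop f) -> realizes g (Fop g) ->
  realizes (sb_comp f g) (Fop (sb_comp f g)).
Proof.
move=> IHf IHg F U S p w pP dU wP.
have -> : gsum S (fun al => fmap F ((sb_comp f g : hom SB a c) \c Dlab S al) \c (p \c Ghat (w al))) =~
    fmap F (f : hom SB b c) \c gsum S (fun al => fmap F ((g : hom SB a b) \c Dlab S al) \c (p \c Ghat (w al))).
  rewrite gsum_compr; apply: gsum_heq => al _.
  rewrite [X in heq _ X]compA -(fmapM F); apply: comp_heq => //; apply: fmap_heq.
  exact: heq_sym (compA _ _ _).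
rewrite (IHg _ _ _ _ _ pP dU wP) gsum_compr -[X in heq _ X](IHf _ _ _ _ _ pP dU).
  by apply: gsum_heq => al _; rewrite [X in heq X _]compA -(fmapM F).
by move=> al gal; apply: Fop_inv gal dU wP.
Qed.

Lemma tens_ctxr F U S p A B a a' b b' (h : hom SB a a') (g : hom SB b b')
    (al : lab a) (ar : lab b) (z : hom SB X X) : @ctx k _ F U S p -> img al = A -> img ar = B ->
  fmap F ((h \ot g) \c Dlab S (labp al ar)) \c (p \c z) =~
  fmap F (@idm k SB a' \ot g) \c (fmap (compFunctor F (tensR b)) (h \c Dlab A al) \c
    (fmap F ((idm (us k A) \ot Dlab B ar) \c Dh k S A B) \c p \c z)).
Proof.
move=> pP eA eB; rewrite (DlabP _ _ eA eB).
change (fmap (compFunctor F (tensR b)) (h \c Dlab A al))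
  with (fmap F ((h \c Dlab A al) \ot @idm k SB b)).
rewrite -(compA _ p z) !compA -!(fmapM F); do 2 apply: comp_heq => //.
apply: fmap_heq; rewrite !compA; apply: comp_heq => //.
by rewrite -!tensM !comp1m !compm1.
Qed.

Lemma tens_ctxl F U S p A B a b b' (g : hom SB b b')
    (al : lab a) (ar : lab b) (z : hom SB X X) : @ctx k _ F U S p -> img al = A -> img ar = B ->
  fmap F ((@idm k SB a \ot g) \c Dlab S (labp al ar)) \c (p \c z) =~
  fmap (compFunctor F (tensL a)) (g \c Dlab B ar) \c
    (fmap F ((Dlab A al \ot idm (us k B)) \c Dh k S A B) \c p \c z).
Proof.
move=> pP eA eB; rewrite (DlabP _ _ eA eB).
change (fmap (compFunctor F (tensL a)) (g \c Dlab B ar))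
  with (fmap F (@idm k SB a \ot (g \c Dlab B ar))).
rewrite -(compA _ p z) !compA -!(fmapM F); do 2 apply: comp_heq => //.
apply: fmap_heq; rewrite !compA; apply: comp_heq => //.
by rewrite -!tensM !comp1m !compm1.
Qed.

(** [f \ot g] is [f] followed by [g], each in a context where the other factor is put aside; [v] is
    the intermediate column, indexed by the labellings of [a' \ox b]. *)
Lemma realizes_tens a a' b b' (f : sbHom k a a') (g : sbHom k b b') :
  realizes f (Fop f) -> realizes g (Fop g) ->
  realizes (sb_tens f g) (Fop (sb_tens f g)).
Proof.
move=> IHf IHg F U S p w pP dU wP.
pose v (be : lab (a' \ox b)) := Fop f U (fun al => w (labp al (labr be))) (labl be).
transitivity (gsum S (fun be : lab (a' \ox b) =>
    fmap F ((@idm k SB a' \ot (g : hom SB b b')) \c Dlab S be) \c (p \c Ghat (v be)))).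
  rewrite !gsum_tensr; apply: psum_heq => ar gar arS.
  have pB := part_sym (part_sub arS); set A := S :\: img ar in pB *.
  have pP' := ctx_tensR (Dlab (img ar) ar) pP pB.
  have dA : [disjoint U & A] by apply: disjointWr dU; apply: subsetDl.
  have AE : A :|: img ar = S by case: pB.
  have pB' : part A (img ar) (A :|: img ar) by rewrite AE.
  transitivity (fmap F (@idm k SB a' \ot (g : hom SB b b')) \c gsum A (fun al =>
      fmap (compFunctor F (tensR b)) ((f : hom SB a a') \c Dlab A al) \c
      (fmap F ((idm (us k A) \ot Dlab (img ar) ar) \c Dh k S A (img ar)) \c p \c
       Ghat (w (labp al ar))))).
    rewrite gsum_compr; apply: gsum_heq => al gal.
    exact: (tens_ctxr _ _ _ pP (good_img gal) erefl).
  rewrite (IHf _ _ _ _ (fun al => w (labp al ar)) pP' dA) => [|al gal]; last first.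
    by apply: (inv_inner_l gal gar pB'); rewrite AE.
  rewrite gsum_compr; apply: gsum_heq => al gal; apply: heq_sym.
  rewrite (tens_ctxr _ _ _ pP (good_img gal) erefl) /v labpl labpr.
  apply: comp_heq => //; apply: comp_heq => //.
  by apply: fmap_heq; rewrite comp1m.
rewrite !gsum_tensl; apply: psum_heq => al gal alS.
have pB := part_sub alS; set B := S :\: img al in pB *.
have pP' := ctx_tensL (Dlab (img al) al) pP pB.
have AE : img al :|: B = S by case: pB.
have pB' : part (img al) B (img al :|: B) by rewrite AE.
have dA : [disjoint U & img al] by apply: disjointWr dU.
have dB : [disjoint U :|: img al & B].
  case: pB => d _; rewrite -setI_eq0 setIUl (disjoint_setI0 d) setU0 setI_eq0.
  by apply: disjointWr dU; apply: subsetDl.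
transitivity (gsum B (fun ar =>
    fmap (compFunctor F (tensL a')) ((g : hom SB b b') \c Dlab B ar) \c
    (fmap F ((Dlab (img al) al \ot idm (us k B)) \c Dh k S (img al) B) \c p \c
     Ghat (Fop f U (fun al' => w (labp al' ar)) al)))).
  apply: gsum_heq => ar gar; rewrite /v labpl labpr.
  exact: (tens_ctxl _ _ pP erefl (good_img gar)).
rewrite (IHg _ _ _ _ (fun ar => Fop f U (fun al' => w (labp al' ar)) al) pP' dB) =>
    [|ar gar]; last first.
  by apply: (inv_inner f gal gar dA pB'); rewrite AE.
apply: gsum_heq => ar gar; rewrite Fop_tensE labpl labpr.
have /(_ a' al) h := tens_ctxl (@idm k SB b') (Ghat (Fop g (U :|: img al)
   (fun ar0 => Fop f U (fun al0 => w (labp al0 ar0)) al) ar)) pP erefl (good_img gar).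
rewrite tens1 comp1m in h; rewrite h; apply: comp_heq => //.
by apply: fmap_heq; rewrite comp1m.
Qed.

Lemma realizes_iso a b (f : hom SB a b) (g : hom SB b a) (s : lab b -> lab a) (t : lab a -> lab b) :
  f \c g =~ idm b -> cancel s t -> cancel t s ->
  (forall S be, good S be -> good S (s be)) -> (forall S al, good S al -> good S (t al)) ->
  (forall S al, good S al -> g \c Dlab S (t al) =~ Dlab S al) ->
  realizes f (fun U w be => w (s be)).
Proof.
move=> fg st ts gs gt key; apply: (realizes_id_mono st ts gs gt) => S be gbe.
by rewrite -(key _ _ (gs _ _ gbe)) st compA fg comp1m.
Qed.

Lemma labp0K a : cancel (fun be : lab a => labp (lab0 _) be) (@labr _ sb1 a).
Proof. by move=> be; rewrite labpr. Qed.

Lemma labp0VK a : cancel (@labr _ sb1 a) (fun be : lab a => labp (lab0 _) be).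
Proof. by move=> be; rewrite -(lab0E (labl be)) labpK. Qed.

Lemma labp1K a : cancel (fun be : lab a => labp be (lab0 _)) (@labl _ a sb1).
Proof. by move=> be; rewrite labpl. Qed.

Lemma labp1VK a : cancel (@labl _ a sb1) (fun be : lab a => labp be (lab0 _)).
Proof. by move=> be; rewrite -(lab0E (labr be)) labpK. Qed.

Lemma realizes_gamma (I J : finType) (s : I -> J) (sP : bijective s) :
  realizes (sb_gamma k sP) (Fop (sb_gamma k sP)).
Proof.
have [t st ts] := sP.
have tP : bijective t by exists s.
apply: (realizes_id_mono (s := labs s) (t := labs t)).
- by move=> be; apply/ffunP => i; rewrite !ffunE ts.
- by move=> be; apply/ffunP => i; rewrite !ffunE st.
- by move=> S be; apply: good_labs.
- by move=> S be; apply: good_labs.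
- by move=> S be; apply: Dlab_labs.
Qed.

Lemma realizes_mu (I J : finType) : realizes (sb_mu k I J) (Fop (sb_mu k I J)).
Proof.
apply: (realizes_mono (a := sbU I \ox sbU J) (b := sbU (I + J)%type)
  (M := fun U (be : lab (sbU (I + J)%type)) x =>
    E (U :|: img (labl (be : lab (sbU I \ox sbU J)))) \c x)
  (s := fun be : lab (sbU (I + J)%type) => (be : lab (sbU I \ox sbU J)))
  (t := fun al : lab (sbU I \ox sbU J) => (al : lab (sbU (I + J)%type)))) => //.
move=> F U S p be x pP dU g _.
have g' : good S (be : lab (sbU I \ox sbU J)) := g.
have /good_tens[_ _ [_ e]] := g'.
have WS : img (labl (be : lab (sbU I \ox sbU J))) \subset S by rewrite -e subsetUl.
rewrite (ctx_Ghat x pP WS) [X in heq _ X]compA -(fmapM F); apply: comp_heq => //.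
by apply: fmap_heq; apply: Dlab_mu.
Qed.

Lemma realizes_delta (I J : finType) : realizes (sb_delta k I J) (Fop (sb_delta k I J)).
Proof.
apply: (realizes_mono (a := sbU (I + J)%type) (b := sbU I \ox sbU J)
  (M := fun U be x => E (U :|: img (labl be)) \c x)
  (t := fun be : lab (sbU (I + J)%type) => (be : lab (sbU I \ox sbU J)))
  (s := fun al : lab (sbU I \ox sbU J) => (al : lab (sbU (I + J)%type)))) => //.
move=> F U S p be x pP dU g _.
have /good_tens[_ _ [_ e]] := g.
have WS : img (labl be) \subset S by rewrite -e subsetUl.
rewrite (ctx_Ghat x pP WS) [X in heq _ X]compA -(fmapM F); apply: comp_heq => //.
by apply: fmap_heq; rewrite (Dlab_absorb k g); apply: Dlab_delta.
Qed.

Lemma realizes_braid a b : realizes (sb_braid k a b) (Fop (sb_braid k a b)).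
Proof.
apply: (realizes_mono (M := fun U be x => E (U :|: img (labl be)) \c x)
  (s := @labC _ a b) (t := @labC _ b a)) => //.
- exact: labCK.
- exact: labCK.
- by move=> S be; apply: good_labC.
- by move=> S be; apply: good_labC.
move=> F U S p be x pP dU g /inv_tens[h _].
have /good_tens[_ _ [_ e]] := g.
have lS : img (labl be) \subset S by rewrite -e subsetUl.
have rS : img (labr be) \subset S by rewrite -e subsetUr.
have hx := inv_img h; rewrite labCl in hx.
rewrite (ctx_Ghat x pP lS) [X in heq _ X]compA -(fmapM F).
rewrite (fmap_heq F (Dlab_absorb k g)) (fmap_heq F (Dlab_braid k g)) (fmapM F).
by rewrite -compA -(ctx_Ghat x pP rS) hx.
Qed.

(** The source entry is rewritten as [e2 \c (e1 \c (h \c x))], where [Dlab] absorbs [e2] and [h]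
    absorbs all of [e1] but the middle cut. That cut turns into the forward braiding, which cancels
    the inverse one. *)
Lemma realizes_braidV a b : realizes (sb_braidV k a b) (Fop (sb_braidV k a b)).
Proof.
apply: (realizes_mono (M := fun U be x => H U (img (labl be)) (img (labr be)) \c x)
  (s := @labC _ b a) (t := @labC _ a b)) => //.
- exact: labCK.
- exact: labCK.
- by move=> S be; apply: good_labC.
- by move=> S be; apply: good_labC.
move=> F U S p be x pP dU g wP.
have [gl gr pAB dl dr] := inv_split g dU; have [d e] := pAB.
have dB : [disjoint U & img (labr be)] by apply: disjointWr dU; rewrite -e subsetUr.
have lS : img (labl be) \subset S by rewrite -e subsetUl.
have rS : img (labr be) \subset S by rewrite -e subsetUr.
have [h1 h2 h3 h4] := qhP k R dl dB d.
set h := H U (img (labl be)) (img (labr be)) in h1 h2 h3 h4 *.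
set e1 := prodE _ (cuts3 U (img (labl be)) (img (labr be))) in h1 h2 h3 h4.
set e2 := prodE _ (cuts3 U (img (labr be)) (img (labl be))) in h1 h2 h3 h4.
have [hl hr] := (inv_tens U (labC be) x).1 wP; rewrite labCl labCr in hl hr.
have e2x : e2 \c x =~ x.
  apply: prodE_fixl => V; rewrite !inE => /or3P[]/eqP->.
  - exact: inv0 hl.
  - exact: inv_img hl.
  - by rewrite setUA; apply: inv_img hr.
have e1h : E (U :|: img (labl be)) \c h =~ h by rewrite -h3 compA (cuts3_absl EP).
have gC := good_labC g.
have pe2 y : fmap F (Dlab S (labC be)) \c (p \c Ghat (e2 \c y)) =~
    fmap F (Dlab S (labC be)) \c (p \c Ghat y).
  rewrite Ghat_comp (Ghat_prodE k R (cuts3 U (img (labr be)) (img (labl be)))).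
  rewrite /cuts3 !prodE_cons prodE_nil compm1 -!compA (compA p) (ctx0 pP).
  rewrite (compA p) (pP _ rS) -!compA (compA p) (pP (img (labr be) :|: img (labl be))).
    rewrite (setUC (img (labr be))) e (EhT k S) (fmap1 F) comp1m compA -(fmapM F).
    have := Dlab_absorb k gC; rewrite labCl => a1.
    by rewrite (fmap_heq F a1).
  by rewrite subUset lS rS.
have xE : x =~ e2 \c (e1 \c (h \c x)).
  by rewrite (compA e2) (compA (e2 \c e1)) h2 e2x.
have hE : fmap F (Dlab S (labC be)) \c (p \c Ghat x) =~
    fmap F (Dlab S (labC be)) \c (p \c Ghat (E (U :|: img (labl be)) \c (h \c x))).
  by rewrite {1}xE pe2 (compA e1) h3 (compA (E _)) e1h.
rewrite (fmapM F) -compA hE (ctx_Ghat _ pP lS) (compA _ _ (p \c _)) -(fmapM F).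
have := Dlab_braid k gC; rewrite labCK labCr => <-.
by rewrite (fmapM F) -(compA (fmap F (brd a b))) compA -(fmapM F) (brdK a b) (fmap1 F) comp1m.
Qed.

Lemma Fop_realizes a b (f : sbHom k a b) : realizes f (Fop f).
Proof.
elim: f => {a b}.
- move=> a F U S p w pP dU wP; apply: gsum_heq => al g.
  by apply: comp_heq => //; apply: fmap_heq; apply: comp1m.
- by move=> a b c f IHf g IHg; apply: realizes_comp.
- move=> a b F U S p w pP dU wP.
  rewrite -[X in heq X _]/(gsum S (fun al : lab a => fmap F (@hzero k SB a b \c Dlab S al) \c (p \c Ghat (w al)))).
  transitivity (gsum S (fun _ : lab a => hzero X (F b))).
    by apply: gsum_heq => al _; rewrite comp0l fmap0 comp0l.
  rewrite gsum0; transitivity (gsum S (fun _ : lab b => hzero X (F b))); first by rewrite gsum0.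
  by apply: gsum_heq => al _; rewrite -[Ghat _]/(hzero X X) !comp0r.
- move=> a b f IHf g IHg F U S p w pP dU wP.
  transitivity (gsum S (fun al => hadd
      (fmap F ((f : hom SB a b) \c Dlab S al) \c (p \c Ghat (w al)))
      (fmap F ((g : hom SB a b) \c Dlab S al) \c (p \c Ghat (w al))))).
    apply: gsum_heq => al _; rewrite -compDl -(fmapD F) -compDl; exact: heq_refl.
  rewrite gsumD (IHf _ _ _ _ _ pP dU wP) (IHg _ _ _ _ _ pP dU wP) -gsumD.
  by apply: gsum_heq => al _; rewrite -!compDr.
- move=> a b x f IHf F U S p w pP dU wP.
  transitivity (gsum S (fun al => hscale x
      (fmap F ((f : hom SB a b) \c Dlab S al) \c (p \c Ghat (w al))))).
    apply: gsum_heq => al _; rewrite -compZl -(fmapZ F) -compZl; exact: heq_refl.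
  rewrite gsumZ (IHf _ _ _ _ _ pP dU wP) -gsumZ.
  by apply: gsum_heq => al _; rewrite -!compZr.
- by move=> a a' b b' f IHf g IHg; apply: realizes_tens.
- move=> a b c; apply: (realizes_id_mono (s := @labA _ a b c) (t := @labAV _ a b c)).
  + exact: labAK.
  + exact: labAVK.
  + by move=> S be; apply: good_labA.
  + by move=> S be; apply: good_labAV.
  + by move=> S be; apply: Dlab_assoc.
- move=> a b c; apply: (realizes_iso (g := asc a b c) (s := @labAV _ a b c) (t := @labA _ a b c)).
  + exact: ascK.
  + exact: labAVK.
  + exact: labAK.
  + by move=> S be; apply: good_labAV.
  + by move=> S be; apply: good_labA.
  + by move=> S be; apply: Dlab_assoc.
- move=> a; apply: (realizes_id_mono (@labp0K a) (@labp0VK a)).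
  + by move=> S be; apply: good_lunit.
  + by move=> S be; apply: good_lunitV.
  + by move=> S be; apply: Dlab_lunit.
- move=> a; apply: (realizes_iso (lunK a) (@labp0VK a) (@labp0K a)).
  + by move=> S be; apply: good_lunitV.
  + by move=> S be; apply: good_lunit.
  + by move=> S be; apply: Dlab_lunit.
- move=> a; apply: (realizes_id_mono (@labp1K a) (@labp1VK a)).
  + by move=> S be; apply: good_runit.
  + by move=> S be; apply: good_runitV.
  + by move=> S be; apply: Dlab_runit.
- move=> a; apply: (realizes_iso (runK a) (@labp1VK a) (@labp1K a)).
  + by move=> S be; apply: good_runitV.
  + by move=> S be; apply: good_runit.
  + by move=> S be; apply: Dlab_runit.
- exact: realizes_braid.
- exact: realizes_braidV.
- by move=> I J s sP; apply: realizes_gamma.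
- exact: realizes_mu.
- exact: realizes_delta.
Qed.

End Realizing.

(** * The equivalence *)

Section Blocks.
Variable n : nat.
Local Notation T := 'I_n.
Local Notation lab := (lab T).
Implicit Types (S A B W : {set T}) (s : seq {set T}).

Fixpoint blocks a : lab a -> seq {set T} :=
  match a return lab a -> seq {set T} with
  | sbU _ => fun al => [:: img al]
  | sbTens a b => fun al => blocks (labl al) ++ blocks (labr al)
  end.

Lemma blocksT a b (al : lab (a \ox b)) : blocks al = blocks (labl al) ++ blocks (labr al).
Proof. by []. Qed.

Lemma bigU_blocks a (al : lab a) : \bigcup_(A <- blocks al) A = img al.
Proof.
elim: a al => [I|a IHa b IHb] al; first by rewrite big_seq1.
by rewrite blocksT big_cat /= IHa IHb img_lab.
Qed.

(** Cuts expressed through a list of blocks, a form common to partitions and labelled objects. *)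
Definition prefix_union s W := exists m, W = \bigcup_(A <- take m s) A.

Lemma prefix_union_rcuts a (al : lab a) W : W \in rcuts al -> prefix_union (blocks al) W.
Proof.
elim: a al W => [//|a IHa b IHb] al W.
rewrite rcutsT inE mem_cat blocksT => /or3P[/eqP->|/mapP[V Vr ->]|/IHa[m ->]].
- by exists (size (blocks (labl al))); rewrite take_size_cat // bigU_blocks.
- have [m ->] := IHb _ _ Vr; exists (size (blocks (labl al)) + m)%N.
  by rewrite take_cat ltnNge leq_addr /= addKn big_cat /= bigU_blocks.
- exists (minn m (size (blocks (labl al)))); rewrite take_cat.
  case: ltnP => h; first by have -> : minn m (size (blocks (labl al))) = m by lia.
  have -> : (minn m (size (blocks (labl al))) - size (blocks (labl al)))%N = 0%N by lia.
  by rewrite take0 cats0 take_oversize //; lia.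
Qed.

Lemma prefix_union_locs a (al : lab a) W : prefix_union (blocks al) W -> W \in locs al.
Proof.
elim: a al W => [I|a IHa b IHb] al W [m ->].
  by case: m => [|m] /=; rewrite ?take0 ?big_nil ?big_seq1 !inE eqxx ?orbT.
rewrite blocksT take_cat; case: ltnP => _.
  have /IHa : prefix_union (blocks (labl al)) (\bigcup_(A <- take m (blocks (labl al))) A).
    by exists m.
  rewrite /locs rcutsT !(inE, mem_cat).
  by case/or3P=> ->; rewrite ?orbT.
set m' := (m - _)%N.
have /IHb : prefix_union (blocks (labr al)) (\bigcup_(A <- take m' (blocks (labr al))) A).
  by exists m'.
rewrite big_cat /= bigU_blocks /locs rcutsT !(inE, mem_cat) img_lab.
case/or3P=> [/eqP->|/eqP->|h]; first by rewrite setU0 eqxx !orbT.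
  by rewrite eqxx !orbT.
by rewrite (map_f (fun W => _ :|: W) h) !orbT.
Qed.

Definition nonempty s := [seq A <- s | A != set0].

Lemma bigU_nonempty s : \bigcup_(A <- nonempty s) A = \bigcup_(A <- s) A.
Proof.
elim: s => //= A s IH; case: ifP => [_|/negbFE/eqP->]; rewrite !big_cons IH //.
by rewrite set0U.
Qed.

(** Objects may contain factors indexed by the empty set, while partitions have no empty parts. *)
Lemma prefix_union_nonempty s W :
  prefix_union (nonempty s) W <-> prefix_union s W.
Proof.
split=> -[m ->].
  elim: s m => [|A s IH] m /=; first by exists 0%N.
  case: ifP => [_|/negbFE/eqP->]; last first.
    by have [m' ->] := IH m; exists m'.+1; rewrite /= big_cons set0U.
  case: m => [|m]; first by exists 0%N; rewrite !take0.
  by have [m' e] := IH m; exists m'.+1; rewrite /= !big_cons e.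
exists (size (nonempty (take m s))).
have -> : nonempty s = nonempty (take m s) ++ nonempty (drop m s).
  by rewrite -[LHS]/(filter _ s) -{1}(cat_take_drop m s) filter_cat.
by rewrite take_size_cat // bigU_nonempty.
Qed.

Lemma rcuts_plab (th : {perm T}) a (al : lab a) :
  rcuts (plab th al) = [seq th @: W | W : {set T} <- rcuts al].
Proof.
elim: a al => [//|a IHa b IHb] al.
rewrite !rcutsT plab_l plab_r !img_plab IHa IHb map_cons map_cat -!map_comp.
congr (_ :: _ ++ _); apply: eq_map => W /=; exact: esym (imsetU _ _ _).
Qed.

End Blocks.

(** * Partitions attached to labelled objects, and conversely *)

Section OspOfBlocks.
Variable n : nat.
Local Notation osp := (osp n).
Local Notation lab := (lab 'I_n).
Implicit Types (p q : osp) (W : {set 'I_n}).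

Lemma cut_bigU p m : cut p m = \bigcup_(A <- take m (sval p)) A.
Proof.
apply/setP => i; rewrite mem_cut; elim: (take m _) => [|A s IH].
  by rewrite big_nil in_set0.
by rewrite big_cons in_setU -IH.
Qed.

Lemma mem_cuts p m : cut p m \in cuts p.
Proof.
have [mp|pm] := leqP m (size (sval p)).
  by apply/mapP; exists m => //; rewrite mem_rev mem_iota ltnS.
apply/mapP; exists (size (sval p)); first by rewrite mem_rev mem_iota ltnS leqnn.
by rewrite !cut_bigU take_size take_oversize // ltnW.
Qed.

(** The condition under which [a] and [osp_ob p] split the same idempotent; see [matches_iso]. *)
Definition matches p a (al : lab a) := good setT al && (nonempty (blocks al) == sval p).

Lemma matches_cuts p a (al : lab a) : matches p al ->
  [/\ {subset rcuts al <= cuts p}, chain_sub (rcuts al) (cuts p) & chain_sub (cuts p) (rcuts al)].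
Proof.
case/andP=> g /eqP e.
have sub : {subset rcuts al <= cuts p}.
  move=> W /prefix_union_rcuts/prefix_union_nonempty[m ->].
  by rewrite e -cut_bigU mem_cuts.
split=> //; first by apply/allP => W /sub ->; rewrite !orbT.
apply/allP => _ /mapP[m _ ->].
have /prefix_union_nonempty/prefix_union_locs : prefix_union (nonempty (blocks al)) (cut p m).
  by exists m; rewrite e cut_bigU.
by rewrite /locs !inE (good_img g).
Qed.

Lemma prodE_matches k (C : linCat k) (t : C) (E : {set 'I_n} -> hom C t t) p a (al : lab a) :
  chain_idem E -> matches p al -> prodE E (rcuts al) =~ prodE E (cuts p).
Proof.
move=> EP /matches_cuts[sub h1 h2]; apply: (prodE_eq EP) => //.
  exact: is_chain_sub sub (cuts_chain p).
exact: cuts_chain.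
Qed.

Lemma blocks_disjoint (a : sbOb) (al : lab a) (S : {set 'I_n}) : good S al ->
  pairwise (fun A B : {set 'I_n} => [disjoint A & B]) (blocks al).
Proof.
elim: a S al => [//|a IHa b IHb] S al /good_tens[gl gr [d _]].
rewrite blocksT pairwise_cat (IHa _ _ gl) (IHb _ _ gr) !andbT.
apply/allrelP => A B Aa Bb; apply: disjointWl (disjointWr _ d).
  by rewrite -bigU_blocks bigcup_seq; apply: (bigcup_sup A).
by rewrite -bigU_blocks bigcup_seq; apply: (bigcup_sup B).
Qed.

Lemma osp_of_subproof a (al : lab a) : good setT al -> is_osp (nonempty (blocks al)).
Proof.
move=> g; apply/and3P; split.
- exact: filter_all.
- by apply: pairwise_filter; apply: blocks_disjoint g.
- by rewrite bigU_nonempty bigU_blocks (good_img g).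
Qed.

Definition osp_of a (al : lab a) (g : good setT al) : osp :=
  exist (fun I => is_osp I) (nonempty (blocks al)) (osp_of_subproof g).

Lemma osp_of_matches a (al : lab a) (g : good setT al) : matches (osp_of g) al.
Proof. by rewrite /matches g eqxx. Qed.

(** The closing unit spares a separate case for one remaining part; it is the source of the trailing
    [set0] in [blocks_seq_lab]. *)
Fixpoint seq_ob (s : seq {set 'I_n}) : sbOb :=
  if s is A :: s' then sbU (sub A) \ox seq_ob s' else sb1.

Definition zlab (S : {set 'I_n}) : lab (sbU (sub S)) := finfun (@cz _ S).

Fixpoint seq_lab s : lab (seq_ob s) :=
  match s return lab (seq_ob s) with
  | [::] => lab0 _
  | A :: s' => labp (zlab A) (seq_lab s')
  end.

Lemma good_zlab S : good S (zlab S).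
Proof.
apply/goodP; split=> [x y|]; first by rewrite !ffunE => /cz_inj.
rewrite -[RHS](img_cz S); apply/setP => x; apply/imgP/imgP => -[y ->]; exists y;
  by rewrite ffunE.
Qed.

Lemma blocks_seq_lab s : blocks (seq_lab s) = rcons s set0.
Proof.
elim: s => [|A s IH]; first by rewrite /= img_lab0.
have -> : blocks (seq_lab (A :: s)) = img (labl (seq_lab (A :: s))) ::
  blocks (labr (seq_lab (A :: s))) by [].
by rewrite [seq_lab _]/(labp _ _) labpl labpr IH (good_img (good_zlab A)).
Qed.

Lemma good_seq_lab s : pairwise (fun A B : {set 'I_n} => [disjoint A & B]) s ->
  good (\bigcup_(A <- s) A) (seq_lab s).
Proof.
elim: s => [|A s IH] /=; first by rewrite big_nil => _; apply: good_lab0.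
case/andP=> As /IH g; rewrite big_cons; apply: good_labp (good_zlab A) g _; split=> //.
rewrite bigcup_seq; apply: bigcup_disjoint => B Bs; exact: (allP As).
Qed.

Definition osp_ob p : sbOb := seq_ob (sval p).
Definition osp_lab p : lab (osp_ob p) := seq_lab (sval p).

Lemma osp_lab_matches p : matches p (osp_lab p).
Proof.
have /and3P[ne d /eqP e] := svalP p; apply/andP; split.
  by rewrite -e; apply: good_seq_lab.
rewrite /osp_lab blocks_seq_lab /nonempty filter_rcons eqxx /=.
by apply/eqP/all_filterP.
Qed.

Lemma good_deg a (al : lab a) : good setT al -> sb_deg a = n.
Proof.
case/goodP=> ia e; rewrite -card_pts -(card_codom ia) -[RHS]card_ord -cardsT -e.
by rewrite cardsE.
Qed.

(** An arbitrary numbering of the points, which serves for essential surjectivity. *)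
Definition deg_lab a (e : sb_deg a = n) : lab a :=
  [ffun i => cast_ord (etrans (card_pts a) e) (enum_rank i)].

Lemma good_deg_lab a (e : sb_deg a = n) : good setT (deg_lab e).
Proof.
apply/goodP; split=> [i j|]; first by rewrite !ffunE => /cast_ord_inj/enum_rank_inj.
apply/setP => x; rewrite in_setT; apply/imgP.
exists (enum_val (cast_ord (esym (etrans (card_pts a) e)) x)).
by rewrite ffunE enum_valK cast_ordKV.
Qed.

End OspOfBlocks.

(** * Matrices of the maps used by the realization *)

Section OperatorsOfStructureMaps.
Variables (k : fieldType) (R : realType) (n : nat).
Local Notation SB := (SB k).
Local Notation Q := (Q k R n).
Local Notation top := (osp_top n : Q).
Local Notation BB := (hom Q top top).
Local Notation X := (us k [set: 'I_n] : SB).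
Local Notation lab := (lab 'I_n).
Local Notation E := (qE k R (n := n)).
Local Notation Fop := (@Fop k R n _ _).
Implicit Types (U S W A B V : {set 'I_n}) (th : 'S_n).

Let EP : chain_idem (C := Q) (t := top) E := qE_chain k R n.

Lemma plabM th th' a (al : lab a) : plab th (plab th' al) = plab (th' * th)%g al.
Proof. by apply/ffunP => i; rewrite !ffunE permM. Qed.

Lemma Fop_tr_gam U S (I J : finType) (al : I -> 'I_n) (be : J -> 'I_n)
    (w : lab (sbU I) -> BB) (ga : lab (sbU J)) (s : I -> J) (sP : bijective s) :
  injective be -> (forall i, be (s i) = al i) -> good S ga -> [disjoint U & S] ->
  (forall al, good S al -> inv U al (w al)) ->
  Fop (tr k al be) U w ga =~ w (labs s ga).
Proof.
move=> ib e g dU wP; exact: (Fop_sound (trE k sP ib e) g dU wP).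
Qed.

Lemma Fop_Mh A B S th U (w : lab (us k A \ox us k B) -> BB) :
  part A B S -> [disjoint U & th @: S] ->
  (forall be, good (th @: S) be -> inv U be (w be)) ->
  Fop (Mh k A B S) U w (plab th (zlab S)) =~
  E (U :|: th @: A) \c w (labp (plab th (zlab A)) (plab th (zlab B))).
Proof.
move=> p dU wP.
have gz : good (th @: S) (plab th (zlab S)) := good_plab th (good_zlab S).
rewrite (Fop_sound (MhE k A B S) gz dU wP).
have [s sP se] := same_img_bij (part_inj p) (@cz_inj _ S)
  (etrans (part_img p) (esym (img_cz S))).
set be : lab (sbU (sub A) \ox sbU (sub B)) := labp _ _.
have bE : labs s (plab th (zlab S)) = be :> lab (sbU (sub A + sub B)%type).
  apply/ffunP => x; rewrite !ffunE se; case: x => x /=; by rewrite !ffunE.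
rewrite -[Fop _ _ _ _]/(Fop (tr k (lsum (@cz _ A) (@cz _ B)) (@cz _ S)) U
  (Fop (mu k (sub A) (sub B)) U w) (plab th (zlab S))).
rewrite (Fop_tr_gam sP (@cz_inj _ S) se gz dU); last first.
  by move=> al gal; apply: Fop_inv gal dU wP.
rewrite bE -[Fop _ _ _ _]/(E (U :|: img (labl be)) \c w be).
by rewrite /be labpl img_plab (good_img (good_zlab A)).
Qed.

(** The multipliers of the iterated product are cuts of its labelled source, which the invariant
    column absorbs; a bare entry is left. *)
Lemma Fop_Mlab a S (al : lab a) th U w :
  good S al -> [disjoint U & th @: S] ->
  (forall be, good (th @: S) be -> inv U be (w be)) ->
  Fop (Mlab k S al) U w (plab th (zlab S)) =~ w (plab th al).
Proof.
elim: a S al U w => [I|a IHa b IHb] S al U w g dU wP.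
  have [ia e] := goodP _ _ g.
  have [s sP se] := same_img_bij ia (@cz_inj _ S) (etrans e (esym (img_cz S))).
  have gz : good (th @: S) (plab th (zlab S)) := good_plab th (good_zlab S).
  rewrite (Fop_tr_gam sP (@cz_inj _ S) se gz dU wP).
  suff -> : labs s (plab th (zlab S)) = plab th al by [].
  by apply/ffunP => i; rewrite !ffunE se.
have [gl gr p] := (good_tens _ _).1 g.
have gth := good_plab th g.
have [gl' gr' p' dl dr] := inv_split gth dU.
rewrite plab_l plab_r !img_plab in gl' gr' p' dl dr.
set A := img (labl al) in gl gr p gl' gr' p' dl dr.
set B := img (labr al) in gl gr p gl' gr' p' dl dr.
have [d' e'] := p'; rewrite -e' in wP dU gth.
rewrite -[Fop _ _ _ _]/(Fop (Mh k A B S) U (Fop (sb_tens (Mlab k A (labl al)) (Mlab k B (labr al))) U w) (plab th (zlab S))).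
have dU' : [disjoint U & th @: S] by rewrite -e'.
rewrite (Fop_Mh p dU'); last first.
  by rewrite -e' => be gbe; apply: Fop_inv gbe dU wP.
rewrite Fop_tensE labpl labpr img_plab (good_img (good_zlab A)).
have p2 : part (th @: A) (th @: B) (th @: A :|: th @: B) by [].
have gzA := good_plab th (good_zlab A).
rewrite (IHb _ _ _ _ gr dr); last first.
  by move=> ar gar; apply: (inv_inner _ gzA gar dl p2 wP).
rewrite (IHa _ _ _ _ gl dl); last first.
  by move=> al' gal'; apply: (inv_inner_l gal' gr' p2 wP).
have := wP _ gth => /inv_tens[h _]; have := inv_img h.
by rewrite plab_l img_plab -plab_p labpK.
Qed.

Lemma Fop_Dh A B S U (w : lab (us k S) -> BB) :
  part A B S -> [disjoint U & S] ->
  (forall be, good S be -> inv U be (w be)) ->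
  Fop (Dh k S A B) U w (labp (zlab A) (zlab B)) =~ E (U :|: A) \c w (zlab S).
Proof.
move=> p dU wP.
have gp : good S (labp (zlab A) (zlab B)) := good_labp (good_zlab A) (good_zlab B) p.
rewrite (Fop_sound (DhE k S A B) gp dU wP).
have [s sP se] := same_img_bij (@cz_inj _ S) (part_inj p)
  (etrans (img_cz S) (esym (part_img p))).
set be : lab (sbU (sub A) \ox sbU (sub B)) := labp _ _.
rewrite -[Fop _ _ _ _]/(E (U :|: img (labl be)) \c
  Fop (tr k (@cz _ S) (lsum (@cz _ A) (@cz _ B))) U w (be : lab (sbU (sub A + sub B)%type))).
rewrite (Fop_tr_gam (ga := (be : lab (sbU (sub A + sub B)%type))) sP (part_inj p) se gp dU wP).
suff -> : labs s (be : lab (sbU (sub A + sub B)%type)) = zlab S.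
  by rewrite /be labpl (good_img (good_zlab A)).
apply/ffunP => x; rewrite !ffunE -se; case: (s x) => y /=; by rewrite ?ffunE.
Qed.

(** In contrast with [Fop_Mlab], the source [us S] has no internal cuts, so the multipliers remain
    and build the chain product of the target. *)
Lemma Fop_Dlab a S (al : lab a) U w :
  good S al -> [disjoint U & S] ->
  (forall be, good S be -> inv U be (w be)) ->
  Fop (Dlab k S al) U w al =~
  prodE E [seq U :|: W | W <- rcuts al] \c w (zlab S).
Proof.
elim: a S al U w => [I|a IHa b IHb] S al U w g dU wP.
  have [ia e] := goodP _ _ g.
  have [s sP se] := same_img_bij (@cz_inj _ S) ia (etrans (img_cz S) (esym e)).
  rewrite (Fop_tr_gam sP ia se g dU wP).
  have -> : labs s al = zlab S by apply/ffunP => i; rewrite !ffunE se.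
  by rewrite prodE_nil comp1m.
have [gl gr p dl dr] := inv_split g dU.
set A := img (labl al) in gl gr p dl dr; set B := img (labr al) in gl gr p dl dr.
have [d e] := p.
rewrite -[Fop _ _ _ _]/(Fop (sb_tens (Dlab k A (labl al)) (Dlab k B (labr al))) U (Fop (Dh k S A B) U w) al).
have vP be : good (A :|: B) be -> inv U be (Fop (Dh k S A B) U w be).
  by rewrite e => gbe; apply: Fop_inv gbe dU wP.
have p2 : part A B (A :|: B) by [].
rewrite Fop_tensE -/A (IHb _ _ _ _ gr dr); last first.
  by move=> ar gar; apply: (inv_inner _ gl gar dl p2 vP).
rewrite (IHa _ _ _ _ gl dl); last first.
  by move=> al' gal'; apply: (inv_inner_l gal' (good_zlab B) p2 vP).
rewrite (Fop_Dh p dU wP) rcutsT map_cons map_cat prodE_cons prodE_cat -/A.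
rewrite -map_comp.
have -> : [seq U :|: A :|: W | W <- rcuts (labr al)] =
    [seq (((fun W => U :|: W) \o (fun W => A :|: W)) W) | W <- rcuts (labr al)].
  by apply: eq_map => W /=; rewrite setUA.
set l1 := [seq _ | W <- rcuts (labr al)]; set l2 := [seq _ | W <- rcuts (labl al)].
rewrite (compA (prodE E l2)) compA; apply: comp_heq => //.
have c1 : E (U :|: A) \c prodE E l1 =~ prodE E l1 \c E (U :|: A).
  apply: prodE_comm => _ /mapP[W _ ->]; apply: (chain_comm EP); apply/orP; left.
  by apply: setUS; apply: subsetUl.
have c2 : E (U :|: A) \c prodE E l2 =~ prodE E l2 \c E (U :|: A).
  apply: prodE_comm => _ /mapP[W Wl ->]; apply: (chain_comm EP); apply/orP; right.
  by apply: setUS; apply: rcuts_sub.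
by rewrite (compA (E _)) c1 -(compA (prodE E l1)) c2.
Qed.

Lemma inv_top (al : lab X) x : good setT al -> @inv k R n set0 _ al x.
Proof.
move=> g; apply: inv_sbU; rewrite ?(good_img g) ?set0U ?(chain0 EP) ?(chainT EP) comp1m //.
Qed.

Lemma disjoint0 S : [disjoint (set0 : {set 'I_n}) & S].
Proof. by rewrite -setI_eq0 set0I. Qed.

Local Notation zT := (zlab [set: 'I_n]).
Let gzT : good setT zT := good_zlab setT.

(** In the row of the tautological label, the matrix of [x] is concentrated on the diagonal with
    entry [y]. Images of morphisms of Q_n have this form, while relabellings move the label
    ([Fop_gm]). *)
Definition acts (x : hom SB X X) (y : BB) :=
  forall w, Fop x set0 w zT =~ y \c w zT.

Lemma acts_comp x y x' y' : acts x y -> acts x' y' -> acts (x \c x') (y \c y').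
Proof.
move=> h h' w; rewrite -[Fop _ _ _ _]/(Fop x set0 (Fop x' set0 w) zT).
by rewrite h h' compA.
Qed.

Lemma acts_heq x x' y y' : x =~ x' -> y =~ y' -> acts x y -> acts x' y'.
Proof.
move=> xx' yy' h w; rewrite -yy' -h; apply: heq_sym.
by apply: (Fop_sound xx' gzT (disjoint0 _)) => al; apply: inv_top.
Qed.

Lemma acts_id : acts (idm X) (idm top).
Proof. by move=> w; rewrite comp1m; apply: heq_refl. Qed.

Lemma acts_Eh W : acts (Eh k setT W) (E W).
Proof.
have p : part W (setT :\: W) setT by apply: part_sub; apply: subsetT.
pose al : lab (us k W \ox us k (setT :\: W)) := labp (zlab W) (zlab (setT :\: W)).
have g : good setT al := good_labp (good_zlab _) (good_zlab _) p.
have rE : rcuts al = [:: W] by rewrite rcutsT labpl labpr /= (good_img (good_zlab W)).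
have e : Mlab k setT al \c Dlab k setT al =~ Eh k setT W.
  by rewrite (Mlab_Dlab k g) rE prodE1.
apply: (acts_heq e (heq_refl _)) => w.
rewrite -[Fop _ _ _ _]/(Fop (Mlab k setT al) set0 (Fop (Dlab k setT al) set0 w) zT).
have wP (be : lab X) : good setT be -> inv set0 be (w be) by exact: inv_top.
have dT : [disjoint (set0 : {set 'I_n}) & (1%g : 'S_n) @: setT] by exact: disjoint0.
have := Fop_Mlab (w := Fop (Dlab k setT al) set0 w) g dT; rewrite imset1g !plab1 => ->.
  by rewrite (Fop_Dlab g (disjoint0 _) wP) rE -[map _ _]/[:: set0 :|: W] prodE1 set0U.
by move=> be gbe; apply: Fop_inv gbe (disjoint0 _) wP.
Qed.

Lemma acts_prodE l : acts (prodE (t := X) (Eh k setT) l) (prodE E l).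
Proof.
elim: l => [|W l IH]; first exact: acts_id.
exact: acts_comp (acts_Eh W) IH.
Qed.

Lemma acts_ehat p : acts (ehat k p) (osp_idem k R p).
Proof.
apply: (acts_heq (heq_refl _) (heq_sym (osp_idem_cuts k R p))).
exact: acts_prodE.
Qed.

Definition totop p q (f : hom Q p q) : BB := incl k R q \c (f \c proj k R p).

Lemma totop_comp p q r (f : hom Q q r) (g : hom Q p q) :
  totop f \c totop g =~ totop (f \c g).
Proof.
rewrite /totop -(compA (incl _ _ r)) -(compA f) (compA (proj _ _ q)) projK.
by rewrite comp1m (compA f).
Qed.

Lemma totop_id p : totop (idm (p : Q)) =~ osp_idem k R p.
Proof. by rewrite /totop comp1m. Qed.

Lemma acts_Ghat p q (f : hom Q p q) : acts (Ghat f) (totop f).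
Proof.
elim: f => {p q} [p|p q r f IHf f' IHf'|p q|p q f IHf f' IHf'|p q x f IHf|
  p q h|q p h|p q h].
- apply: (acts_heq (heq_refl _) (heq_sym (totop_id p))); exact: acts_ehat.
- apply: (acts_heq (heq_refl _) (totop_comp f f')).
  exact: acts_comp IHf IHf'.
- move=> w; rewrite /totop comp0l comp0r comp0l; exact: heq_refl.
- move=> w; rewrite -[Fop _ _ _ _]/(hadd (Fop (Ghat f) set0 w zT) (Fop (Ghat f') set0 w zT)).
  by rewrite IHf IHf' -compDl /totop -compDr -compDl.
- move=> w; rewrite -[Fop _ _ _ _]/(hscale x (Fop (Ghat f) set0 w zT)).
  by rewrite IHf -compZl /totop -compZr -compZl.
- apply: (acts_heq (heq_refl _) (y := osp_idem k R p)); last exact: acts_ehat.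
  by rewrite /totop compA incl_Ind.
- apply: (acts_heq (heq_refl _) (y := osp_idem k R p)); last exact: acts_ehat.
  by rewrite /totop proj_Res.
(* The two inverses are not compared by formulas: the entry is fixed by the idempotent of [p], and
   the wall-crossing sends it to the expected value, which determines it. *)
- move=> w; have [hl hr ha hb] := htauP k h; have [yl yr ya yb] := tauV_inv k R h.
  set y := Fop _ _ _ _.
  have wP (v : lab X -> BB) al : good setT al -> inv set0 al (v al) by exact: inv_top.
  have e1 : osp_idem k R p \c y =~ y.
    rewrite -(acts_ehat p) -[Fop _ _ _ _]/(Fop (ehat k p \c htau k p q) set0 w zT).
    exact: (Fop_sound ha gzT (disjoint0 _) (wP w)).
  have e2 : osp_idem k R q \c (osp_idem k R p \c y) =~ osp_idem k R q \c w zT.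
    rewrite -(acts_ehat p) -(acts_ehat q) -(acts_ehat q w).
    rewrite -[Fop _ _ _ _]/(Fop ((ehat k q \c ehat k p) \c htau k p q) set0 w zT).
    exact: (Fop_sound hr gzT (disjoint0 _) (wP w)).
  rewrite -e1 -yl -(compA (totop _)) -(compA (osp_idem k R q)) e2.
  by rewrite compA yb.
Qed.

Lemma Fop_gm h th (w : lab X -> BB) :
  Fop (gm k h) set0 w (plab th zT) =~ w (plab (h * th)%g zT).
Proof.
have inj : injective (h \o @cz 'I_n [set: 'I_n]) by apply/perm_comp_inj/cz_inj.
have e : img (h \o @cz 'I_n [set: 'I_n]) = img (@cz 'I_n [set: 'I_n]).
  by rewrite img_perm img_cz -imset_permT.
have [s sP se] := same_img_bij inj (@cz_inj _ _) e.
have g : good setT (plab th zT) by have := good_plab th gzT; rewrite -imset_permT.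
have wP (al : lab X) : good setT al -> inv set0 al (w al) by exact: inv_top.
apply: (heq_trans (Fop_tr_gam sP (@cz_inj _ _) se g (disjoint0 _) wP)).
suff -> : labs s (plab th zT) = plab (h * th)%g zT by [].
by apply/ffunP => i; rewrite !ffunE se permM.
Qed.

(** [gm th] conjugates every multiplier to its permuted form, so rows at permuted labels are
    conjugate ([gm_Fop]). *)
Lemma relok_gm th : relok th set0 set0 setT
  (fun x y : BB => gm k th \c Ghat x =~ Ghat y \c gm k th).
Proof.
split.
- exact: (heq_trans (comp0r _ _) (heq_sym (comp0l _ _))).
- move=> x x' y y' xy xy'.
  rewrite -[Ghat (hadd x x')]/(hadd (Ghat x) (Ghat x')) -[Ghat (hadd y y')]/(hadd (Ghat y) (Ghat y')).
  by rewrite compDr compDl xy xy'.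
- move=> c x y xy.
  rewrite -[Ghat (hscale c x)]/(hscale c (Ghat x)) -[Ghat (hscale c y)]/(hscale c (Ghat y)).
  by rewrite compZr compZl xy.
- move=> W x y _ xy; rewrite (Ghat_comp (E _) x) (Ghat_comp (E _) y) !set0U !Ghat_qE compA.
  by rewrite -[gm k th \c Eh k setT W]/(gmap k th setT setT \c Eh k setT W) gmap_Eh -!compA xy.
- move=> W A B x y _ _ _ WA WB AB xy; rewrite (Ghat_comp (qh _ _ _ _ _) x) (Ghat_comp (qh _ _ _ _ _) y) !set0U compA.
  have dis V V' : [disjoint V & V'] -> [disjoint th @: V & th @: V'].
    move=> d; rewrite -setI_eq0 -imsetI ?(disjoint_setI0 d) ?imset0 // => i j _ _; exact: perm_inj.
  have -> : gm k th \c Ghat (qh k R W A B) =~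
      Ghat (qh k R (th @: W) (th @: A) (th @: B)) \c gm k th.
    apply: (swap_inv_intertwine (Ghat_qhP k R WA WB AB)
      (Ghat_qhP k R (dis _ _ WA) (dis _ _ WB) (dis _ _ AB))); rewrite -?imsetU; exact: gmap_Eh.
  by rewrite -!compA xy.
Qed.

Lemma gm_Fop a b (f : sbHom k a b) th w w' be : good setT be ->
  (forall al, good setT al -> gm k th \c Ghat (w al) =~ Ghat (w' (plab th al)) \c gm k th) ->
  gm k th \c Ghat (Fop f set0 w be) =~ Ghat (Fop f set0 w' (plab th be)) \c gm k th.
Proof. by move=> g h; apply: (Fop_rel f (relok_gm th) g h). Qed.

End OperatorsOfStructureMaps.

(** * The realization functor and its inverse on morphisms *)

Section Equivalence.
Variables (k : fieldType) (R : realType) (n : nat).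
Local Notation SB := (SB k).
Local Notation Q := (Q k R n).
Local Notation osp := (osp n).
Local Notation top := (osp_top n : Q).
Local Notation BB := (hom Q top top).
Local Notation X := (us k [set: 'I_n] : SB).
Local Notation lab := (lab 'I_n).
Local Notation E := (qE k R (n := n)).
Local Notation Fop := (@Fop k R n _ _).
Local Notation perms := (index_enum {perm 'I_n}).
Implicit Types (p q r : osp) (g h m : 'S_n).

Let EP : chain_idem (C := Q) (t := top) E := qE_chain k R n.
Let EhP : chain_idem (C := SB) (t := X) (Eh k setT) := Eh_chain k 'I_n.

#[local] Instance act_hom_proper g p q :
  Proper (@heq k Q p q ==> @heq k Q _ _) (@act_hom k R n g p q).
Proof. by move=> f f' ff'; apply: q_act_heq. Qed.

Definition onto p : hom SB X (osp_ob p) := Dlab k setT (osp_lab p).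
Definition into p : hom SB (osp_ob p) X := Mlab k setT (osp_lab p).

Lemma good_osp_lab p : good setT (osp_lab p).
Proof. by have /andP[] := osp_lab_matches p. Qed.

Lemma ontoK p : onto p \c into p =~ idm (osp_ob p : SB).
Proof. exact: Dlab_Mlab (good_osp_lab p). Qed.

Lemma into_onto p : into p \c onto p =~ ehat k p.
Proof.
by rewrite (Mlab_Dlab k (good_osp_lab p)) (prodE_matches EhP (osp_lab_matches p)).
Qed.

Lemma onto_abs p : onto p \c ehat k p =~ onto p.
Proof. by rewrite -into_onto compA ontoK comp1m. Qed.

Lemma into_abs p : ehat k p \c into p =~ into p.
Proof. by rewrite -into_onto -compA ontoK compm1. Qed.

Lemma Ghat_cast p q (e : p = q) : Ghat (qcast k R e) =~ ehat k q.
Proof. by case: _ / e. Qed.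

Lemma Ghat_castr p q r (f : hom Q q r) (e : p = q) : Ghat (f \c qcast k R e) =~ Ghat f.
Proof. by rewrite Ghat_comp Ghat_cast; case: (Ghat_abs f). Qed.

Lemma Ghat_hsum p q (T : Type) (s : seq T) (f : T -> hom Q p q) :
  Ghat (hsum s f) = hsum s (fun i => Ghat (f i)).
Proof.
rewrite /hsum; elim: s => [|i s IH]; first by rewrite !big_nil.
by rewrite !big_cons -IH.
Qed.

(** [phi g] starts at [osp_act g p], so the component at [g] first relabels by [gm g]. *)
Definition real_hom p q (phi : sd_hom k R p q) : hom SB (osp_ob p) (osp_ob q) :=
  hsum perms (fun g => onto q \c (Ghat (phi g) \c (gm k g \c into p))).

Lemma real_hom_heq p q (phi psi : sd_hom k R p q) :
  sd_heq phi psi -> real_hom phi =~ real_hom psi.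
Proof. by move=> e; apply: hsum_heq => g; rewrite (e g). Qed.

Lemma real_hom1 p : real_hom (sd_id k R p) =~ idm (osp_ob p : SB).
Proof.
rewrite /real_hom (hsum_single (i0 := 1%g)) ?index_enum_uniq ?mem_index_enum //.
  by rewrite /sd_id sd_in_eq Ghat_cast gm1 comp1m into_abs ontoK.
move=> g g1; rewrite /sd_id sd_in_neq //.
rewrite -[Ghat _]/(hzero X X) comp0l; exact: comp0r.
Qed.

Lemma real_homM p q r (phi : sd_hom k R q r) (psi : sd_hom k R p q) :
  real_hom (sd_comp phi psi) =~ real_hom phi \c real_hom psi.
Proof.
transitivity (hsum perms (fun g => hsum perms (fun h =>
    onto r \c (Ghat (phi g) \c (Ghat (act_hom g (psi h)) \c (gm k (h * g)%g \c into p)))))).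
  transitivity (hsum perms (fun m => hsum perms (fun g => onto r \c (Ghat (phi g) \c
      (Ghat (act_hom g (psi (m * g^-1)%g)) \c (gm k m \c into p)))))).
    apply: hsum_heq => m; rewrite sd_compE Ghat_hsum hsum_compl hsum_compr.
    apply: hsum_heq => g; rewrite Ghat_castr Ghat_comp.
    by rewrite -(compA (Ghat (phi g))).
  rewrite hsum_exchange; apply: hsum_heq => g.
  have pr : perm_eq perms (map (fun h => (h * g)%g) perms).
    apply: uniq_perm; first exact: index_enum_uniq.
      by rewrite map_inj_uniq ?index_enum_uniq //; apply: mulIg.
    move=> m; rewrite mem_index_enum; apply/esym/mapP.
    by exists (m * g^-1)%g; rewrite ?mem_index_enum ?mulgKV.
  rewrite (hsum_perm _ pr) hsum_map; apply: hsum_heq => h.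
  by rewrite mulgK.
rewrite /real_hom hsum_compl; apply: hsum_heq => g.
rewrite hsum_compr; apply: hsum_heq => h.
rewrite -!(compA (onto r)) -!(compA (Ghat (phi g))) -!(compA (gm k g)).
rewrite (compA (into q)) into_onto (compA (ehat k q)) (Ghat_abs (psi h)).1.
by rewrite (compA (gm k g) (Ghat _)) (gm_Ghat g (psi h)) -(compA _ (gm k g)) (compA (gm k g)) gmM.
Qed.

Lemma real_homD p q (phi psi : sd_hom k R p q) :
  real_hom (sd_add phi psi) =~ hadd (real_hom phi) (real_hom psi).
Proof.
rewrite /real_hom -hsumD; apply: hsum_heq => g.
rewrite -[Ghat _]/(hadd (Ghat (phi g)) (Ghat (psi g))).
by rewrite compDl compDr.
Qed.

Lemma real_homZ p q c (phi : sd_hom k R p q) :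
  real_hom (sd_scale c phi) =~ hscale c (real_hom phi).
Proof.
rewrite /real_hom -hsumZ; apply: hsum_heq => g.
rewrite -[Ghat _]/(hscale c (Ghat (phi g))).
by rewrite compZl compZr.
Qed.

(** The unit column at the label of [p] moved by [g]. Its entry is the idempotent instead of the
    identity in order to be invariant. *)
Definition column g p (al : lab (osp_ob p)) : BB :=
  if al == plab g (osp_lab p) then osp_idem k R (osp_act g p) else hzero top top.

Lemma column_inv g p (al : lab (osp_ob p)) : inv set0 al (@column g p al).
Proof.
rewrite /column; case: eqP => [->|_] V; last by rewrite comp0r.
rewrite set0U (osp_idem_cuts k R (osp_act g p)) !inE img_plab (good_img (good_osp_lab p)).
rewrite -imset_permT => /or3P[/eqP->|/eqP->|].
- by rewrite (chain0 EP) comp1m.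
- by rewrite (chainT EP) comp1m.
rewrite rcuts_plab => /mapP[W Wr ->].
have [sub _ _] := matches_cuts (osp_lab_matches p).
apply: (chain_absl EP (cuts_chain _)); rewrite cuts_act.
by apply: (map_f (fun W : {set 'I_n} => g @: W)); apply: sub.
Qed.

(** The matrix entry in the row of [q] and the column of [p] moved by [g], compressed to a morphism
    of Q_n. *)
Definition unreal p q (f : hom SB (osp_ob p) (osp_ob q)) : sd_hom k R p q := fun g =>
  proj k R q \c (Fop f set0 (@column g p) (osp_lab q) \c incl k R (osp_act g p)).

Lemma unreal_heq p q (f f' : hom SB (osp_ob p) (osp_ob q)) :
  f =~ f' -> sd_heq (unreal f) (unreal f').
Proof.
move=> ff' g; rewrite /unreal.
have e : Fop f set0 (@column g p) (osp_lab q) =~ Fop f' set0 (@column g p) (osp_lab q).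
  apply: (Fop_sound ff' (good_osp_lab q) (disjoint0 _)) => al _.
  exact: column_inv.
by rewrite e.
Qed.

Lemma good_permP a (al be : lab a) : good setT al -> good setT be ->
  exists th : 'S_n, be = plab th al.
Proof.
move=> /goodP[ia ea] /goodP[ib eb].
have [s sP se] := same_img_bij ib ia (etrans eb (esym ea)).
have ex x : exists i, x == al i.
  have : x \in img al by rewrite ea in_setT.
  by case/imgP => i ->; exists i.
pose t x := be (xchoose (ex x)).
have tE i : t (al i) = be i.
  by rewrite /t; congr (be _); apply: ia; rewrite -(eqP (xchooseP (ex (al i)))).
have t_inj : injective t.
  move=> x y; rewrite (eqP (xchooseP (ex x))) (eqP (xchooseP (ex y))) !tE.
  by move/ib->.
by exists (perm t_inj); apply/ffunP => i; rewrite ffunE permE tE.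
Qed.

Lemma plab_inj a (al : lab a) th th' : good setT al ->
  plab th al = plab th' al -> th = th'.
Proof.
case/goodP=> ia e /ffunP h; apply/permP => x.
have : x \in img al by rewrite e in_setT.
by case/imgP=> i ->; have := h i; rewrite !ffunE.
Qed.

Lemma gsum_perms (C : linCat k) (x y : C) a (al : lab a) (F : lab a -> hom C x y) :
  good setT al -> gsum setT F =~ hsum perms (fun h => F (plab h^-1%g al)).
Proof.
move=> g; have gp h : good setT (plab h al).
  by have := good_plab h g; rewrite -imset_permT.
have -> : gsum setT F =~ hsum [seq be <- enum {: lab a} | good setT be] F.
  rewrite /gsum; elim: (enum _) => [|be s IH]; first by rewrite /hsum !big_nil.
  rewrite {1}/hsum big_cons /=; case: ifP => _; last by rewrite hadd0.
  by rewrite [X in heq _ X]/hsum big_cons; apply: hadd_heq.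
rewrite -(hsum_map _ (fun h : 'S_n => plab h^-1%g al)); apply: hsum_perm.
apply: uniq_perm; first by rewrite filter_uniq ?enum_uniq.
  rewrite map_inj_uniq ?index_enum_uniq // => h h' /(plab_inj g).
  exact: invg_inj.
move=> be; rewrite mem_filter mem_enum andbT; apply/idP/mapP => [gb|[h _ ->]]; last exact: gp.
have [th ->] := good_permP g gb.
by exists (th^-1)%g; rewrite ?mem_index_enum ?invgK.
Qed.

Lemma column_gm h p (al : lab (osp_ob p)) :
  gm k h \c Ghat (@column 1%g p al) =~ Ghat (@column h p (plab h al)) \c gm k h.
Proof.
rewrite /column plab1 osp_act1.
have -> : (plab h al == plab h (osp_lab p)) = (al == osp_lab p).
  apply/eqP/eqP => [e|-> //].
  have e' c : plab h^-1%g (plab h c) = c :> lab (osp_ob p).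
    by rewrite plabM mulgV plab1.
  by rewrite -(e' al) e e'.
case: ifP => _; last by rewrite -[Ghat _]/(hzero X X) comp0r comp0l.
by rewrite !Ghat_osp_idem gm_ehat.
Qed.

Lemma Ghat_unreal p q (f : hom SB (osp_ob p) (osp_ob q)) h :
  Ghat (unreal f h) =~ ehat k q \c
    (Ghat (Fop f set0 (@column h p) (osp_lab q)) \c ehat k (osp_act h p)).
Proof. exact: heq_refl. Qed.

(** In the trivial context and for the unit column, [Fop_realizes] expands [f \c onto p] as a sum
    over the labellings of the target. These are the permutations of the label of [q], and
    relabelling by [h] brings each row back to the row of [q] read by [unreal]. *)
Lemma unrealK p q (f : hom SB (osp_ob p) (osp_ob q)) : real_hom (unreal f) =~ f.
Proof.
have main := @Fop_realizes k R n _ _ f (idFunctor SB) set0 setT (idm X) (@column 1%g p)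
  (@ctx_id k 'I_n) (disjoint0 _) (fun al _ => @column_inv 1%g p al).
have gp := good_osp_lab p; have gq := good_osp_lab q.
rewrite (gsum_single (al0 := osp_lab p) gp) in main; last first.
  move=> al ne; rewrite /column plab1 (negPf ne) -[Ghat _]/(hzero X X).
  by rewrite !comp0r.
have fE : f =~ f \c onto p \c (idm X \c Ghat (@column 1%g p (osp_lab p))) \c into p.
  rewrite /column plab1 eqxx osp_act1 Ghat_osp_idem comp1m -!compA into_abs ontoK.
  by rewrite compm1.
have {}main : f \c onto p \c (idm X \c Ghat (@column 1%g p (osp_lab p))) =~
    gsum setT (fun be => Dlab k setT be \c (idm X \c Ghat (Fop f set0 (@column 1%g p) be))) := main.
apply: heq_sym; rewrite {1}fE main (gsum_perms _ gq) hsum_compl; apply: hsum_heq => h.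
set be := plab h^-1%g (osp_lab q).
have eb : plab h be = osp_lab q by rewrite /be plabM mulVg plab1.
have gb : good setT be by have := good_plab h^-1%g gq; rewrite -imset_permT.
have <- : onto q \c gm k h =~ Dlab k setT be.
  apply: (@gmap_Dlab k _ h _ setT setT be (osp_lab q) gb (imset_permT h)).
  by rewrite -{1}eb; apply/ffunP => i; rewrite !ffunE.
apply: heq_sym; rewrite comp1m Ghat_unreal -!(compA (onto q)).
have -> : onto q \c ((ehat k q \c (Ghat (Fop f set0 (@column h p) (osp_lab q)) \c
    ehat k (osp_act h p))) \c (gm k h \c into p)) =~
    onto q \c (Ghat (Fop f set0 (@column h p) (osp_lab q)) \c (gm k h \c into p)).
  rewrite -!(compA (ehat k q)) (compA (onto q)) onto_abs -!(compA (Ghat _)).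
  by rewrite (compA (ehat k _)) -gm_ehat -(compA (gm k h)) into_abs.
have -> : gm k h \c Ghat (Fop f set0 (@column 1%g p) be) =~
    Ghat (Fop f set0 (@column h p) (osp_lab q)) \c gm k h.
  by rewrite -eb; apply: gm_Fop => // al _; apply: column_gm.
by rewrite -!(compA (Ghat _)).
Qed.

Lemma Fop_hsum a b (T : Type) (s : seq T) (f : T -> hom SB a b) U w be :
  Fop (hsum s f) U w be = hsum s (fun i => Fop (f i) U w be).
Proof.
rewrite /hsum; elim: s => [|i s IH]; first by rewrite !big_nil.
by rewrite !big_cons -IH.
Qed.

(** In the row of [q], [onto q] contributes the idempotent of [q], the image of [phi h] contributes
    [totop (phi h)], [gm h] moves the label and [into p] reads the column there. The column vanishes
    unless [h] is [g]. *)
Lemma real_homK p q (phi : sd_hom k R p q) : sd_heq (unreal (real_hom phi)) phi.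
Proof.
move=> g; rewrite /unreal /real_hom Fop_hsum.
have key h : Fop (onto q \c (Ghat (phi h) \c (gm k h \c into p))) set0 (@column g p) (osp_lab q) =~
    osp_idem k R q \c (totop (phi h) \c @column g p (plab h (osp_lab p))).
  pose v1 := Fop (into p) set0 (@column g p).
  pose v2 := Fop (gm k h) set0 v1.
  pose v3 := Fop (Ghat (phi h)) set0 v2.
  have h1 : Fop (onto q) set0 v3 (osp_lab q) =~
      prodE E [seq set0 :|: W | W <- rcuts (osp_lab q)] \c v3 (zlab setT).
    apply: (Fop_Dlab (good_osp_lab q) (disjoint0 _)) => al; exact: inv_top.
  have h2 : v3 (zlab setT) =~ totop (phi h) \c v2 (zlab setT) := acts_Ghat _ _.
  have h3 : v2 (zlab setT) =~ v1 (plab h (zlab setT)).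
    by have := Fop_gm h 1%g v1; rewrite mulg1 plab1.
  have h4 : v1 (plab h (zlab setT)) =~ @column g p (plab h (osp_lab p)).
    by apply: (Fop_Mlab (good_osp_lab p) (disjoint0 _)) => al _; apply: column_inv.
  have e : prodE E [seq set0 :|: W | W <- rcuts (osp_lab q)] =~ osp_idem k R q.
    rewrite (eq_map (g := id)) ?map_id => [|W]; last exact: set0U.
    by rewrite (prodE_matches EP (osp_lab_matches q)) -osp_idem_cuts.
  by rewrite -e -h4 -h3 -h2 -h1.
have -> : hsum perms (fun h => Fop (onto q \c (Ghat (phi h) \c (gm k h \c into p))) set0
    (@column g p) (osp_lab q)) =~ osp_idem k R q \c (totop (phi g) \c osp_idem k R (osp_act g p)).
  rewrite (hsum_heq _ key) (hsum_single (i0 := g)) ?index_enum_uniq ?mem_index_enum //.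
    by rewrite /column eqxx.
  move=> h hg; rewrite /column; case: eqP => [/(plab_inj (good_osp_lab p)) e|_].
    by rewrite e eqxx in hg.
  by rewrite !comp0r.
rewrite (compA (proj k R q)) (compA (proj k R q) (osp_idem k R q)) osp_idem_proj.
rewrite -(compA (proj k R q)) -(compA (totop _)) osp_idem_incl /totop.
rewrite -(compA (incl _ _ _)) (compA (proj k R q)) projK comp1m.
by rewrite -(compA (phi g)) projK compm1.
Qed.

Definition realization : linFunctor (semidirect k R n) (SBn k n).
Proof.
apply: (@LinFunctor k (semidirect k R n) (SBn k n)
  (fun p => exist (fun a => sb_deg a = n) (osp_ob p) (good_deg (good_osp_lab p)))
  (fun p q phi => real_hom phi)).
- exact: real_hom_heq.
- exact: real_hom1.
- exact: real_homM.
- exact: real_homD.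
- by move=> p q x phi; apply: real_homZ.
Defined.

(** Both objects split the idempotent [ehat k p] of [X], and two splittings of one idempotent are
    isomorphic. *)
Lemma matches_iso p a (al : lab a) : matches p al ->
  (Dlab k setT al \c into p) \c (onto p \c Mlab k setT al) =~ idm (a : SB) /\
  (onto p \c Mlab k setT al) \c (Dlab k setT al \c into p) =~ idm (osp_ob p : SB).
Proof.
move=> pm; have /andP[g _] := pm.
have e : Mlab k setT al \c Dlab k setT al =~ ehat k p.
  by rewrite (Mlab_Dlab k g) (prodE_matches EhP pm).
split.
  rewrite -(compA (Dlab k setT al)) (compA (into p)) into_onto -e.
  by rewrite -(compA (Mlab k setT al)) Dlab_Mlab // compm1 Dlab_Mlab.
rewrite -(compA (onto p)) (compA (Mlab k setT al)) e (compA (onto p)) onto_abs.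
exact: ontoK.
Qed.

Lemma SBn_equivalent : lin_equivalent (SBn k n) (semidirect k R n).
Proof.
pose P (b : SBn k n) := osp_of (good_deg_lab (svalP b)).
have iso (b : SBn k n) := matches_iso (osp_of_matches (good_deg_lab (svalP b))).
apply: (@lin_equivalent_of_ff k (SBn k n) (semidirect k R n) realization
  (fun p q f => unreal (p := p) (q := q) f)
  _ _ _ P (fun b => Dlab k setT (deg_lab (svalP b)) \c into (P b))
  (fun b => onto (P b) \c Mlab k setT (deg_lab (svalP b)))).
- by move=> p q f f'; apply: unreal_heq.
- by move=> p q f; apply: unrealK.
- by move=> p q f; apply: real_homK.
- by move=> b; case: (iso b).
- by move=> b; case: (iso b).
Qed.

End Equivalence.

Theorem theorem5p4p4 (k : fieldType) (hk : [pchar k] =i pred0)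
    (R : realType) (n : nat) :
  lin_equivalent (SBn k n) (semidirect k R n).
Proof. exact: SBn_equivalent. Qed.
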